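(* Let $n\ge 3$, let $\Omega\subset\mathbb{R}^n$ be a bounded domain with $C^\infty$ boundary, and let $\gamma\in C^\infty(\overline\Omega,\mathcal S_n)$ be a smooth conductivity. Let $\lambda_0\in\mathbb{R}$, $\lambda_0\neq 0$, be a number which does not belong to the Dirichlet spectrum of $L_\gamma=-\mathrm{div}(\gamma\nabla\,\cdot\,)$ on $\Omega$. Then for every integer $k\ge 1$ and every $\epsilon>0$ there exist two conductivities $\gamma_1,\gamma_2$ on $\overline\Omega$ of class $C^k$ such that: (i) $\gamma_1$ and $\gamma_2$ are not isometric, i.e. there is no $\Psi\in\mathrm{SDiff}(\overline\Omega)$ with $\gamma_2=\Psi_*\gamma_1$; (ii) $\gamma_1$ and $\gamma_2$ are $(\epsilon,k)$-close to $\gamma$, i.e. $\|\gamma_j-\gamma\|_{C^k(\overline\Omega,\mathcal S_n)}\le\epsilon$ for $j=1,2$; (iii) $\lambda_0$ does not belong to the Dirichlet spectrum of $L_{\gamma_1}$ or of $L_{\gamma_2}$, and the associated Dirichlet-to-Neumann maps at frequency $\lambda_0$ coincide: $\Lambda_{\gamma_1,\lambda_0}=\Lambda_{\gamma_2,\lambda_0}$.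
   Context: $\mathcal S_n$ denotes the set of real positive-definite symmetric $n\times n$ matrices. A conductivity on $\overline\Omega$ is a bounded measurable map $\gamma=(\gamma^{ij}):\overline\Omega\to\mathcal S_n$; it is smooth (resp. of class $C^k$) if its entries lie in $C^\infty(\overline\Omega)$ (resp. $C^k(\overline\Omega)$). Write $L_\gamma u=-\mathrm{div}(\gamma\nabla u)$. Dirichlet problem: for $\lambda\in\mathbb{R}$ and $f\in H^{1/2}(\partial\Omega)$, a weak solution of $L_\gamma u=\lambda u$ in $\Omega$, $u=f$ on $\partial\Omega$, is a function $u\in H^1(\Omega)$ with trace $f$ on $\partial\Omega$ and $\int_\Omega \gamma\nabla u\cdot\nabla v\,dx=\lambda\int_\Omega uv\,dx$ for all $v\in H^1_0(\Omega)$. If $\lambda$ does not belong to the Dirichlet spectrum of $L_\gamma$ (the spectrum of $L_\gamma$ with zero Dirichlet boundary condition), there is a unique weak solution for every $f\in H^{1/2}(\partial\Omega)$. Dirichlet-to-Neumann (DN) map: for $\lambda$ not in the Dirichlet spectrum of $L_\gamma$, $\Lambda_{\gamma,\lambda}:H^{1/2}(\partial\Omega)\to H^{-1/2}(\partial\Omega)$ is defined by $\langle\Lambda_{\gamma,\lambda}f\,|\,g\rangle=\int_\Omega\gamma\nabla u\cdot\nabla v\,dx-\lambda\int_\Omega uv\,dx$ for all $f,g\in H^{1/2}(\partial\Omega)$, where $u$ is the weak solution with boundary value $f$, $v\in H^1(\Omega)$ is any function with trace $g$, and $\langle\cdot|\cdot\rangle$ is the $L^2$ duality pairing between $H^{1/2}(\partial\Omega)$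 and its dual. $\mathrm{SDiff}(\overline\Omega)$ is the group of ($C^1$ up to the boundary) diffeomorphisms $\Psi:\overline\Omega\to\overline\Omega$ with $|\det D\Psi|=1$ on $\Omega$ and $\Psi|_{\partial\Omega}=\mathrm{Id}$. For a diffeomorphism $\Psi$ of $\overline\Omega$ and a conductivity $\gamma$, $\Psi_*\gamma=\left(\frac{D\Psi\cdot\gamma\cdot(D\Psi)^T}{|\det D\Psi|}\right)\circ\Psi^{-1}$. *)

(* Defs.v *)
From HB Require Import structures.
From mathcomp Require Import all_boot all_order all_algebra.
From mathcomp Require Import all_classical all_reals all_analysis.

Set Implicit Arguments.
Unset Strict Implicit.
Unset Printing Implicit Defensive.

Import Order.TTheory GRing.Theory Num.Theory.
Import numFieldNormedType.Exports.

Local Open Scope classical_set_scope.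
Local Open Scope ring_scope.

Section rV_measurable.
Variables (R : realType) (n : nat).

Let coors : 'I_n -> 'rV[R]_n -> measurableTypeR R := fun i x => x 0 i.

Let rV_set0 : g_sigma_preimage coors set0.
Proof. exact: sigma_algebra0. Qed.

Let rV_setC A : g_sigma_preimage coors A -> g_sigma_preimage coors (~` A).
Proof. exact: sigma_algebraC. Qed.

Let rV_bigcup (F : (set 'rV[R]_n)^nat) :
  (forall i, g_sigma_preimage coors (F i)) ->
  g_sigma_preimage coors (\bigcup_i (F i)).
Proof. exact: sigma_algebra_bigcup. Qed.

(* The Borel sigma-algebra of R^n, generated by the coordinate functions. *)
HB.instance Definition _ := @isMeasurable.Build default_measure_display
  'rV[R]_n (g_sigma_preimage coors) rV_set0 rV_setC rV_bigcup.

End rV_measurable.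

(* Lebesgue measure on R^(1+n), restricted to the Borel sets, is the image of
   lebesgue_measure times that of R^n under (a, x) |-> (a, x_1, ..., x_n);
   R^0 carries the Dirac measure. *)
Definition cons_rV (R : realType) (n : nat) (p : measurableTypeR R * 'rV[R]_n)
  : 'rV[R]_n.+1 := row_mx (p.1%:M : 'M[R]_1) p.2.

Lemma measurable_cons_rV (R : realType) (n : nat) :
  measurable_fun [set: (measurableTypeR R * 'rV[R]_n)%type] (@cons_rV R n).
Proof.
suff h : g_sigma_preimage (fun i (p : measurableTypeR R * 'rV[R]_n) =>
    cons_rV p 0 i : measurableTypeR R) `<=` measurable.
  move=> _ A mA; rewrite setTI; apply: h.
  rewrite (g_sigma_preimage_comp
    (fun i (x : 'rV[R]_n.+1) => x 0 i : measurableTypeR R) (@cons_rV R n)).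
  by exists A => //; rewrite setTI.
apply: smallest_sub; first exact: sigma_algebra_measurable.
rewrite -bigcup_mkord_ord; apply: bigcup_sub => k _ _ [B mB <-].
set i := inord k.
case: (unliftP ord0 i) => [j|] ->.
- suff : measurable_fun [set: (measurableTypeR R * 'rV[R]_n)%type]
      (fun p => p.2 0 j : measurableTypeR R).
    move=> /(_ measurableT B mB); congr (measurable (_ `&` _)).
    apply/funext => p /=; congr B; rewrite /cons_rV.
    have -> : lift ord0 j = rshift 1 j by apply: val_inj.
    by rewrite (row_mxEr p.1%:M p.2 0 j).
  apply: (@measurableT_comp _ _ _ _ _ _
    (fun x : 'rV[R]_n => x 0 j : measurableTypeR R)) => //.
  move=> _ C mC; rewrite setTI; apply: sub_sigma_algebra => /=.
  rewrite -bigcup_seq/=; exists j => /=; first by rewrite mem_index_enum.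
  by exists C => //; rewrite setTI.
- have := @measurable_fst _ _ (measurableTypeR R) 'rV[R]_n measurableT B mB.
  congr (measurable (_ `&` _)).
  apply/funext => p /=; congr B; rewrite /cons_rV.
  have -> : ord0 = lshift n (0 : 'I_1) by apply: val_inj.
  by rewrite (row_mxEl p.1%:M p.2 0 0) mxE eqxx mulr1n.
Qed.

Definition pushforward_cons_rV (R : realType) (n : nat)
    (mu : {measure set 'rV[R]_n -> \bar R}) :=
  pushforward (@lebesgue_measure R \x^ mu)%E (@cons_rV R n).

HB.instance Definition _ (R : realType) (n : nat)
    (mu : {measure set 'rV[R]_n -> \bar R}) :=
  Measure.copy (pushforward_cons_rV mu)
    (measure_function_pushforward__canonical__measure_function_Measure
      (@lebesgue_measure R \x^ mu)%E (@measurable_cons_rV R n)).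

Fixpoint lebesgue_rV (R : realType) (n : nat) :
    {measure set 'rV[R]_n -> \bar R} :=
  match n with
  | 0 => @dirac _ 'rV[R]_0 0 R
  | m.+1 => pushforward_cons_rV (lebesgue_rV R m)
  end.

Definition enorm (R : realType) (n : nat) (v : 'rV[R]_n) : R :=
  Num.sqrt (\sum_i (v 0 i) ^+ 2).

Section hausdorff.
Variables (R : realType) (n s : nat).
Local Open Scope ereal_scope.
Implicit Types A U : set 'rV[R]_n.

(* With s = 1 the Euclidean diameter of U and, for general s, its s-th power
   (0 if U is empty, including for s = 0). *)
Definition ediam_pow (s : nat) U : \bar R :=
  ereal_sup (0 |` [set ((enorm (x - y) ^+ s)%R)%:E | x in U & y in U]).

Definition hausdorff_gauge (delta : R) U : \bar R :=
  if ediam_pow 1 U <= delta%:E then ediam_pow s U else +oo.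

(* Infimum of \sum_k diam(U_k)^s over the countable covers of A by arbitrary
   sets U_k of diameter at most delta: mu_ext is taken with respect to the
   sigma-algebra in which every set is measurable. *)
Definition hausdorff_pre (delta : R) A : \bar R :=
  mu_ext (T := g_sigma_algebraType [set: set 'rV[R]_n])
    (hausdorff_gauge delta) A.

(* s-dimensional Hausdorff outer measure, up to the usual positive constant
   factor depending only on s. *)
Definition hausdorff A : \bar R :=
  ereal_sup [set hausdorff_pre delta A | delta in [set d : R | (0 < d)%R]].

Lemma ediam_pow_ge0 m U : 0 <= ediam_pow m U.
Proof. by apply: ereal_sup_ubound; left. Qed.

Lemma ediam_pow_set0 m : ediam_pow m set0 = 0.
Proof.
apply/eqP; rewrite eq_le ediam_pow_ge0 andbT.
by apply: ge_ereal_sup => _ [->//|[x []]].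
Qed.

Lemma hausdorff_gauge_ge0 delta U : 0 <= hausdorff_gauge delta U.
Proof. by rewrite /hausdorff_gauge; case: ifP => // _; exact: ediam_pow_ge0. Qed.

Lemma hausdorff_gauge_set0 delta : (0 < delta)%R -> hausdorff_gauge delta set0 = 0.
Proof.
by move=> d0; rewrite /hausdorff_gauge !ediam_pow_set0 lee_fin (ltW d0).
Qed.

Lemma hausdorff_pre_le delta A : (0 < delta)%R ->
  hausdorff_pre delta A <= hausdorff A.
Proof. by move=> d0; apply: ereal_sup_ubound; exists delta. Qed.

Lemma hausdorff_ge0 A : 0 <= hausdorff A.
Proof.
apply: le_trans (hausdorff_pre_le A ltr01).
exact/mu_ext_ge0/hausdorff_gauge_ge0.
Qed.

Lemma hausdorff0 : hausdorff set0 = 0.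
Proof.
apply/eqP; rewrite eq_le hausdorff_ge0 andbT.
apply: ge_ereal_sup => _ [d /= d0 <-].
rewrite /hausdorff_pre mu_ext0//; first exact: hausdorff_gauge_set0.
exact: hausdorff_gauge_ge0.
Qed.

Lemma le_hausdorff : {homo hausdorff : A B / A `<=` B >-> A <= B}.
Proof.
move=> A B AB; apply: ge_ereal_sup => _ [d /= d0 <-].
apply: le_trans (hausdorff_pre_le B d0); exact: le_mu_ext.
Qed.

Lemma hausdorff_sigma_subadditive : sigma_subadditive hausdorff.
Proof.
move=> F; apply: ge_ereal_sup => _ [d /= d0 <-].
apply: le_trans; first exact/mu_ext_sigma_subadditive/hausdorff_gauge_ge0.
apply: lee_nneseries => k _ *; first exact/mu_ext_ge0/hausdorff_gauge_ge0.
exact: hausdorff_pre_le.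
Qed.

HB.instance Definition _ := isOuterMeasure.Build R 'rV[R]_n hausdorff
  hausdorff0 hausdorff_ge0 le_hausdorff hausdorff_sigma_subadditive.

End hausdorff.

(* The (n-1)-dimensional Hausdorff measure, as a measure on the sets that are
   Caratheodory-measurable for the outer measure. *)
Definition restrict_caratheodory (R : realType) (T : pointedType)
    (mu : {outer_measure set T -> \bar R}) :
    {measure set (caratheodory_type mu) -> \bar R} :=
  mu : set (caratheodory_type mu) -> \bar R.

Definition surface_measure (R : realType) (n : nat) :=
  restrict_caratheodory (@hausdorff R n n.-1).

Section smoothness.
Variables (R : realType) (n : nat).
Implicit Types (U Omega : set 'rV[R]_n) (f : 'rV[R]_n -> R).

Definition pderiv (i : 'I_n) f : 'rV[R]_n -> R :=
  fun x => 'D_(delta_mx 0 i) f x.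

Definition iter_pderiv (s : seq 'I_n) f : 'rV[R]_n -> R := foldr pderiv f s.

(* C^k(U), for U open only *)
Definition class_C (k : nat) U f : Prop :=
  (forall s, (size s <= k)%N ->
    forall x, U x -> {for x, continuous (iter_pderiv s f)}) /\
  (forall s, (size s < k)%N ->
    forall i x, U x -> derivable (iter_pderiv s f) x (delta_mx 0 i)).

(* C^k of the closure of Omega, for Omega open: the partial derivatives of
   order at most k exist in Omega and extend continuously to the closure. *)
Definition class_C_bar (k : nat) Omega f : Prop :=
  [/\ {within closure Omega, continuous f},
      class_C k Omega f &
      forall s, (size s <= k)%N -> exists g : 'rV[R]_n -> R,
        {within closure Omega, continuous g} /\
        (forall x, Omega x -> g x = iter_pderiv s f x)].

Definition smooth_bar Omega f : Prop := forall k, class_C_bar k Omega f.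

Definition grad f (x : 'rV[R]_n) : 'rV[R]_n := \row_i pderiv i f x.

Definition test_function Omega f : Prop :=
  (forall k, class_C k setT f) /\
  (exists K, [/\ compact K, K `<=` Omega & forall x, ~ K x -> f x = 0]).

End smoothness.

Section L2.
Context d (T : measurableType d) (R : realType).
Variables (mu : {measure set T -> \bar R}) (D : set T).

Definition L2 (f : T -> R) : Prop :=
  measurable_fun D f /\ (\int[mu]_(x in D) ((f x) ^+ 2)%:E < +oo)%E.

Definition L2_cvg (f_ : nat -> T -> R) (f : T -> R) : Prop :=
  (\int[mu]_(x in D) ((f_ k x - f x) ^+ 2)%:E)%E @[k --> \oo] --> 0%E.

End L2.

Definition boundary (R : realType) (n : nat) (Omega : set 'rV[R]_n) :=
  closure Omega `\` interior Omega.

(* A Sobolev function is handled together with (a version of) its weak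
   gradient Du, a row vector field, which u determines almost everywhere. *)
Section sobolev.
Variables (R : realType) (n : nat) (Omega : set 'rV[R]_n).
Implicit Types (u v f : 'rV[R]_n -> R) (Du Dv : 'rV[R]_n -> 'rV[R]_n).

Notation leb := (lebesgue_rV R n).

Definition H1 u Du : Prop :=
  [/\ L2 leb Omega u,
      forall i, L2 leb Omega (fun x => Du x 0 i) &
      forall phi, test_function Omega phi -> forall i,
        \int[leb]_(x in Omega) (u x * pderiv i phi x) =
        - \int[leb]_(x in Omega) (Du x 0 i * phi x)].

Definition H1_cvg (phi_ : nat -> 'rV[R]_n -> R) u Du : Prop :=
  L2_cvg leb Omega phi_ u /\
  forall i, L2_cvg leb Omega (fun k => pderiv i (phi_ k)) (fun x => Du x 0 i).

(* H^1_0: the closure of the test functions in H^1 *)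
Definition H10 u Du : Prop :=
  H1 u Du /\
  exists phi_ : nat -> 'rV[R]_n -> R,
    (forall k, test_function Omega (phi_ k)) /\ H1_cvg phi_ u Du.

(* f, an element of L^2(boundary Omega), is the trace of u: the trace operator
   is the continuous extension to H^1 of the restriction to the boundary of
   functions that are smooth up to the boundary. *)
Definition trace u Du f : Prop :=
  [/\ H1 u Du,
      L2 (surface_measure R n) (boundary Omega) f &
      exists phi_ : nat -> 'rV[R]_n -> R,
        [/\ forall k, smooth_bar Omega (phi_ k),
            H1_cvg phi_ u Du &
            L2_cvg (surface_measure R n) (boundary Omega) phi_ f]].

(* H^{1/2}(boundary Omega), the range of the trace operator *)
Definition H_half f : Prop := exists u Du, trace u Du f.

End sobolev.

(* Near each boundary point, and up to permuting and reorienting the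
   coordinate axes, Omega lies above the graph of a smooth function h of the
   n - 1 coordinates other than the i-th one. *)
Definition smooth_boundary (R : realType) (n : nat) (Omega : set 'rV[R]_n) :=
  forall p, boundary Omega p ->
  exists (r : R) (i : 'I_n) (b : bool) (h : 'rV[R]_n.-1 -> R),
    [/\ 0 < r, forall k, class_C k setT h &
        forall x, ball p r x ->
          (Omega x <-> h (col' i x) < (-1) ^+ b * x 0 i)].

Definition smooth_bounded_domain (R : realType) (n : nat)
    (Omega : set 'rV[R]_n) : Prop :=
  [/\ Omega !=set0, open Omega, connected Omega, bounded_set Omega &
      smooth_boundary Omega].

Definition sym_posdef (R : realType) (n : nat) (A : 'M[R]_n) : Prop :=
  A^T = A /\ forall v : 'rV[R]_n, v != 0 -> 0 < (v *m A *m v^T) 0 0.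

Section conductivity.
Variables (R : realType) (n : nat) (Omega : set 'rV[R]_n).
Implicit Types (gamma : 'rV[R]_n -> 'M[R]_n) (lambda : R).
Implicit Types (u v f g F : 'rV[R]_n -> R) (Du Dv : 'rV[R]_n -> 'rV[R]_n).

Notation leb := (lebesgue_rV R n).

Definition conductivity gamma : Prop :=
  [/\ forall x, closure Omega x -> sym_posdef (gamma x),
      forall i j, measurable_fun (closure Omega) (fun x => gamma x i j) &
      exists M : R, forall x, closure Omega x -> `|gamma x| <= M].

Definition conductivity_C (k : nat) gamma : Prop :=
  conductivity gamma /\
  forall i j, class_C_bar k Omega (fun x => gamma x i j).

Definition conductivity_smooth gamma : Prop :=
  conductivity gamma /\
  forall i j, smooth_bar Omega (fun x => gamma x i j).

(* The C^k norm over the closure of Omega: by continuity, the derivatives have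
   the same supremum over Omega. *)
Definition C_norm (k : nat) gamma : \bar R :=
  ereal_sup [set z | exists (s : seq 'I_n) i j x,
    [/\ (size s <= k)%N, Omega x &
        z = `|iter_pderiv s (fun y => gamma y i j) x|%:E]].

Definition energy gamma Du Dv : R :=
  \int[leb]_(x in Omega) (Dv x *m (gamma x *m (Du x)^T)) 0 0.

Definition L2_inner u v : R := \int[leb]_(x in Omega) (u x * v x).

(* L_gamma u = F, where L_gamma is the unbounded operator on L^2(Omega)
   -div(gamma grad .) with zero Dirichlet boundary condition. *)
Definition dirichlet_operator gamma u Du F : Prop :=
  [/\ H10 Omega u Du, L2 leb Omega F &
      forall v Dv, H10 Omega v Dv -> energy gamma Du Dv = L2_inner F v].

(* L_gamma - lambda, from the domain of L_gamma to L^2(Omega), is bijective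
   with bounded inverse (its injectivity follows from the bound). *)
Definition dirichlet_resolvent gamma : set R := [set lambda |
  (forall F, L2 leb Omega F ->
    exists u Du, dirichlet_operator gamma u Du (fun x => F x + lambda * u x)) /\
  exists C : R, forall u Du F, L2 leb Omega F ->
    dirichlet_operator gamma u Du (fun x => F x + lambda * u x) ->
    L2_inner u u <= C * L2_inner F F].

Definition dirichlet_spectrum gamma : set R := ~` dirichlet_resolvent gamma.

Definition weak_solution gamma lambda f u Du : Prop :=
  trace Omega u Du f /\
  forall v Dv, H10 Omega v Dv ->
    energy gamma Du Dv = lambda * L2_inner u v.

(* DN_map gamma lambda f g is <Lambda_{gamma,lambda} f | g>, for f and g in
   H^{1/2}(boundary Omega).  If lambda is not in the Dirichlet spectrum of
   L_gamma, the set below has exactly one element; the default value 0 is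
   irrelevant. *)
Definition DN_map gamma lambda f g : R :=
  xget 0 [set c | exists u Du v Dv,
    [/\ weak_solution gamma lambda f u Du, trace Omega v Dv g &
        c = energy gamma Du Dv - lambda * L2_inner u v]].

Definition eq_DN_map gamma1 gamma2 lambda : Prop :=
  forall f g, H_half Omega f -> H_half Omega g ->
    DN_map gamma1 lambda f g = DN_map gamma2 lambda f g.

End conductivity.

Section diffeo.
Variables (R : realType) (n : nat) (Omega : set 'rV[R]_n).
Implicit Types (Psi : 'rV[R]_n -> 'rV[R]_n) (gamma : 'rV[R]_n -> 'M[R]_n).

(* Transposed with respect to the library's jacobian, which acts on row
   vectors. *)
Definition jac Psi (x : 'rV[R]_n) : 'M[R]_n :=
  \matrix_(i, j) pderiv j (fun y => Psi y 0 i) x.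

Definition inverse_bar Psi : 'rV[R]_n -> 'rV[R]_n :=
  'pinv_(fun=> 0) (closure Omega) Psi.

Definition diffeo_bar Psi : Prop :=
  [/\ set_bij (closure Omega) (closure Omega) Psi,
      forall i, class_C_bar 1 Omega (fun x => Psi x 0 i) &
      forall i, class_C_bar 1 Omega (fun x => inverse_bar Psi x 0 i)].

Definition SDiff Psi : Prop :=
  [/\ diffeo_bar Psi,
      forall x, Omega x -> `|\det (jac Psi x)| = 1 &
      forall x, boundary Omega x -> Psi x = x].

Definition push_conductivity Psi gamma (y : 'rV[R]_n) : 'M[R]_n :=
  let x := inverse_bar Psi y in
  `|\det (jac Psi x)|^-1 *: (jac Psi x *m gamma x *m (jac Psi x)^T).

(* Equality is tested in Omega only: for C^k conductivities and Psi of class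
   C^1 up to the boundary, it extends to the closure by continuity. *)
Definition isometric gamma1 gamma2 : Prop :=
  exists Psi, SDiff Psi /\
    forall y, Omega y -> gamma2 y = push_conductivity Psi gamma1 y.

End diffeo.

(* Main.v *)
(* Two operations on a pair (gamma, rho) preserve the Dirichlet-to-Neumann map
   of -div(gamma grad u) = lambda rho u: the substitution u = w u', with w = 1
   near the boundary, which leads to (w^2 gamma, rho') for an explicit rho',
   and the push-forward by a diffeomorphism equal to the identity near the
   boundary, which divides rho by the Jacobian determinant.  Take
   gamma_1 = gamma.  Apply the first operation to (gamma, 1), with w close to 1
   and one parameter adjusted so that the integral of rho' - 1 is 0; then bring
   rho' back to 1 by n shears, one in each coordinate direction, following
   Moser.  The result is (gamma_2, 1).  All these operations transport
   H^1_0, traces and the L^2 bounds, so lambda_0 stays out of the spectrum.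

   If gamma_1 and gamma_2 were isometric, then det gamma_2 would be
   (det gamma_1) o Theta with Theta volume-preserving, and the integral of
   det^(1/(n-2)) would not increase.  Since det gamma / rho^(n-2) is invariant
   under diffeomorphisms, this integral is for gamma_2 that of
   w^(2n/(n-2)) (det gamma)^(1/(n-2)).  If det gamma is not constant, w can be
   chosen such that it is larger than for w = 1.  If det gamma is constant,
   choose w equal to a constant different from 1 on some open set: there
   det gamma_2 is w^4 det gamma, so det gamma_2 is not constant. *)

(* Each diffeomorphism used to build gamma_2 is a product of shears, so that the change of variables
   reduces to a scalar equation on each line and to the fundamental theorem of calculus. Shears
   conserve the integral of the density, whence the condition on rho' - 1. The substitution creates
   a zeroth order term; divided by lambda_0, hence the hypothesis lambda_0 <> 0, it is absorbed in
   rho'.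

   The factor is w = 1 + tau (be + mu c), with be of integral 0 and c of integral 1. The integral of
   rho' - 1 is then tau (2 mu + O(tau)), so mu can be balanced against a small tau. Closeness in C^k
   only takes derivatives in x that are jointly continuous in the parameters and x, over a compact
   box.

   An isometry Psi is merely C^1; for it a one-sided inequality between integrals is proved with
   small cubes, on which Psi is nearly linear. As be has integral 0, the first order gain in the
   integral of det^(1/(n-2)), a multiple of the integral of be det(gamma)^(1/(n-2)), can be positive
   only if det gamma is not constant: this forces the case distinction. *)
Require Import Defs.
From HB Require Import structures.
From mathcomp Require Import all_boot all_order all_algebra.
From mathcomp Require Import all_classical all_reals all_analysis.
From mathcomp Require Import measurable_realfun perm ring lra.
Import Order.TTheory GRing.Theory Num.Theory.
Import numFieldNormedType.Exports.
Set Implicit Arguments.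
Unset Strict Implicit.
Unset Printing Implicit Defensive.
Local Open Scope classical_set_scope.
Local Open Scope ring_scope.

(** * Borel sets and Lebesgue measure on R^n *)

Section rV_measurability.
Variables (R : realType).

Lemma measurable_coord n (i : 'I_n) :
  measurable_fun [set: 'rV[R]_n] (fun x : 'rV[R]_n => x 0 i).
Proof.
move=> _ C mC; rewrite setTI; apply: sub_sigma_algebra => /=.
rewrite -bigcup_seq/=; exists i => /=; first by rewrite mem_index_enum.
by exists C => //; rewrite setTI.
Qed.

Lemma measurable_fun_rV d (T : measurableType d) n (D : set T)
    (f : T -> 'rV[R]_n) :
  measurable D -> (forall i, measurable_fun D (fun t => f t 0 i)) ->
  measurable_fun D f.
Proof.
move=> mD mf.
pose G := \big[setU/set0]_(i < n)
  preimage_set_system setT (fun x : 'rV[R]_n => x 0 i : measurableTypeR R) measurable.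
apply: (@measurability _ _ _ _ _ _ G) => //.
move=> _ [B + <-].
rewrite /G -bigcup_seq => -[i _ [C mC <-]].
by rewrite setTI; exact: mf.
Qed.

Lemma measurable_box n (A : 'I_n -> set R) : (forall i, measurable (A i)) ->
  measurable [set x : 'rV[R]_n | forall i, A i (x 0 i)].
Proof.
move=> mA; rewrite (_ : [set _ | _] =
  \big[setI/setT]_(i < n) ((fun x : 'rV[R]_n => x 0 i) @^-1` A i)).
  apply: bigsetI_measurable => i _.
  by rewrite -[X in measurable X]setTI; exact: measurable_coord.
apply/seteqP; split => x /=.
  by move=> h; rewrite -bigcap_seq => i _; exact: h.
by rewrite -bigcap_seq => h i; apply: h; rewrite /= mem_index_enum.
Qed.

Lemma rV_ballP n (x y : 'rV[R]_n) e :
  ball x e y <-> (0 < e /\ forall i, `|x 0 i - y 0 i| < e).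
Proof.
split=> [[e0 h]|[e0 h]].
  by split => // i; exact: (h 0 i).
by split => // i j; rewrite ord1; exact: (h j).
Qed.

(** Each point of U lies in a cube inside U with rational centre and radius 1/(k+1), and there are
    countably many such cubes. An index whose cube leaves U contributes the empty set. *)
Lemma open_measurable_rV n (U : set 'rV[R]_n) : open U -> measurable U.
Proof.
move=> oU.
pose B (p : 'rV[rat]_n * nat) := [set x : 'rV[R]_n | forall i, ball (ratr (p.1 0 i) : R) (p.2.+1%:R^-1) (x 0 i)].
rewrite (_ : U = \bigcup_p (if pselect (B p `<=` U) is left _ then B p else set0)).
  apply: countable_bigcupT_measurable; first exact: countableP.
  move=> p; case: pselect => // _.
  apply: (@measurable_box n (fun i => ball (ratr (p.1 0 i) : R) p.2.+1%:R^-1)) => i.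
  by apply: open_measurable; exact: ball_open.
apply/seteqP; split=> [x Ux|x [p _]]; last by case: pselect => // h; exact: h.
have /nbhs_ballP[e/= e0 xeU] : nbhs x U by exact: open_nbhs_nbhs.
have [k ke] : exists k : nat, k.+1%:R^-1 < e / 2.
  have e20 : 0 < e / 2 by rewrite divr_gt0.
  have [k _ hk] := near_infty_natSinv_lt (PosNum e20).
  by exists k; exact: (hk k (leqnn k)).
pose c := k.+1%:R^-1 : R.
have c0 : 0 < c by rewrite invr_gt0.
have hq i : {q : rat | `|ratr q - x 0 i| < c}.
  apply: cid; have [|q] := @rat_in_itvoo R (x 0 i - c) (x 0 i + c); first by lra.
  by rewrite in_itv/= => /andP[a b]; exists q; rewrite ltr_norml; apply/andP; split; lra.
pose q := \row_i sval (hq i).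
have Bx : B (q, k) x by move=> i; rewrite /ball/= mxE; exact: (svalP (hq i)).
exists (q, k) => //; case: pselect => // -[] y By.
apply: xeU; apply/rV_ballP; split => // i.
have := By i; have := Bx i; rewrite /ball/=.
set a := ratr _ => h1 h2.
rewrite (_ : _ - _ = (x 0 i - a) + (a - y 0 i)); last by ring.
rewrite (le_lt_trans (ler_normD _ _))//.
rewrite (distrC (x 0 i)); rewrite -/c in h1 h2 ke; clearbody c; lra.
Qed.

Lemma closed_measurable_rV n (U : set 'rV[R]_n) : closed U -> measurable U.
Proof.
by move=> cU; rewrite -[U]setCK; apply: measurableC; apply: open_measurable_rV; exact: closed_openC.
Qed.

Lemma continuous_measurable_rV n (D : set 'rV[R]_n) (f : 'rV[R]_n -> R) :
  open D -> (forall x, D x -> {for x, continuous f}) -> measurable_fun D f.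
Proof.
move=> oD cf mD.
apply: (@measurability _ _ _ _ _ _ _ (RGenOpens.measurableE R)) => //.
move=> _ [_ [a [b ->]] <-].
rewrite (_ : _ `&` _ = [set x | D x /\ (f @^-1` `]a, b[) x]) //.
apply: open_measurable_rV; rewrite openE => x [Dx fx]; apply: filterI; first exact: open_nbhs_nbhs.
apply: cf => //; apply: open_nbhs_nbhs; split => //; exact: interval_open.
Qed.

Lemma subspace_continuous_measurable_rV n (D : set 'rV[R]_n) (f : 'rV[R]_n -> R) :
  closed D -> {within D, continuous f} -> measurable_fun D f.
Proof.
move=> cD cf mD.
apply: (@measurability _ _ _ _ _ _ _ (RGenOpens.measurableE R)) => //.
move=> _ [_ [a [b ->]] <-].
have oab : open `]a, b[%classic by exact: interval_open.
have oS : open (f @^-1` `]a, b[%classic : set (subspace D)) := (proj1 (@continuousP _ _ _) cf) _ oab.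
have [U oU UV] := proj1 (open_subspaceP _ _) oS.
rewrite setIC -UV setIC; apply: measurableI => //; exact: open_measurable_rV.
Qed.

End rV_measurability.

Section lebesgue_rV_basic.
Variables (R : realType).

Lemma rV_coord_norm n (x : 'rV[R]_n) i : `|x 0 i| <= `|x|.
Proof.
by rewrite /Num.norm/= mx_normrE (le_bigmax _ (fun ij => `|x ij.1 ij.2|) (0, i)).
Qed.

Lemma cons_rV0 n (p : measurableTypeR R * 'rV[R]_n) : cons_rV p 0 ord0 = p.1.
Proof.
rewrite /cons_rV; have -> : ord0 = lshift n (0 : 'I_1) by apply: val_inj.
by rewrite (row_mxEl p.1%:M p.2 0 0) mxE eqxx mulr1n.
Qed.

Lemma cons_rVS n (p : measurableTypeR R * 'rV[R]_n) j :
  cons_rV p 0 (lift ord0 j) = p.2 0 j.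
Proof.
rewrite /cons_rV; have -> : lift ord0 j = rshift 1 j by apply: val_inj.
by rewrite (row_mxEr p.1%:M p.2 0 j).
Qed.

Lemma lebesgue_rV_box n (A : 'I_n -> set R) : (forall i, measurable (A i)) ->
  lebesgue_rV R n [set x : 'rV[R]_n | forall i, A i (x 0 i)] =
  (\prod_(i < n) lebesgue_measure (A i))%E.
Proof.
elim: n A => [|n IH] A mA.
  rewrite big_ord0 /= diracE mem_set//= => -[]//.
rewrite big_ord_recl /= /pushforward_cons_rV /pushforward.
rewrite (_ : _ @^-1` _ = A ord0 `*` [set x : 'rV[R]_n | forall i, A (lift ord0 i) (x 0 i)]).
  rewrite -IH; last by move=> i; exact: mA.
  apply: product_measure2E; first exact: mA.
  by apply: (@measurable_box R n (fun i => A (lift ord0 i))) => i; exact: mA.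
apply/seteqP; split => [[a x] /= h|[a x] /= [h1 h2] i].
  split; first by have := h ord0; rewrite cons_rV0.
  by move=> i; have := h (lift ord0 i); rewrite cons_rVS.
by case: (unliftP ord0 i) => [j|] ->; rewrite ?cons_rV0 ?cons_rVS//; exact: h2.
Qed.

Lemma sigma_finite_lebesgue_rV n : sigma_finite [set: 'rV[R]_n] (lebesgue_rV R n).
Proof.
exists (fun k => [set x : 'rV[R]_n | forall i, `[- k%:R, k%:R]%classic (x 0 i)]).
  apply/esym/seteqP; split => // x _.
  have [k hk] : exists k : nat, `|x| <= k%:R.
    by exists (Num.truncn `|x|).+1; rewrite ltW// truncnS_gt.
  exists k => // i /=; rewrite in_itv/= -ler_norml (le_trans _ hk)//.
  exact: rV_coord_norm.
move=> k; split; first by apply: (@measurable_box R n (fun=> `[- k%:R, k%:R]%classic)) => i.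
rewrite (@lebesgue_rV_box n (fun=> `[- k%:R, k%:R]%classic))//.
rewrite ltey_eq; apply/orP; left; elim/big_ind : _ => //.
- by move=> x y hx hy; rewrite fin_numM.
by move=> i _; rewrite lebesgue_measure_itv; case: ifP => _.
Qed.

(** The set function under a name of its own, to which the sigma-finite structure required by
    Tonelli's theorem is attached. *)
Definition lebesgue_fun n : set 'rV[R]_n -> \bar R := lebesgue_rV R n.

HB.instance Definition _ n := Measure.copy (@lebesgue_fun n) (lebesgue_rV R n).

HB.instance Definition _ n := Measure_isSigmaFinite.Build _ _ _ (@lebesgue_fun n)
  (sigma_finite_lebesgue_rV n).

Definition lebesgue_rV_sf n : {sigma_finite_measure set 'rV[R]_n -> \bar R} := @lebesgue_fun n.

Lemma ge0_integral_cons_rV n (f : 'rV[R]_n.+1 -> \bar R) :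
  measurable_fun setT f -> (forall x, 0 <= f x)%E ->
  (\int[lebesgue_rV R n.+1]_x f x =
   \int[lebesgue_rV R n]_y \int[lebesgue_measure]_a f (cons_rV (a, y)))%E.
Proof.
move=> mf f0.
rewrite ge0_integral_pushforward//=; last exact: measurable_cons_rV.
have mg : measurable_fun setT (f \o @cons_rV R n).
  by apply: measurableT_comp => //; exact: measurable_cons_rV.
rewrite preimage_setT.
have f0' x : (0 <= (f \o @cons_rV R n) x)%E by exact: f0.
rewrite -(fubini_tonelli2 (m1 := lebesgue_measure) (m2 := lebesgue_rV_sf n) (f \o @cons_rV R n) mg f0').
apply: eq_measure_integral => /= A mA _; apply/esym.
apply: (@product_measure_unique _ _ _ _ _ lebesgue_measure (lebesgue_rV_sf n)) => // B C mB mC.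
exact: product_measure2E.
Qed.

Lemma ge0_integral_cons_rV' n (f : 'rV[R]_n.+1 -> \bar R) :
  measurable_fun setT f -> (forall x, 0 <= f x)%E ->
  (\int[lebesgue_rV R n.+1]_x f x =
   \int[lebesgue_measure]_a \int[lebesgue_rV R n]_y f (cons_rV (a, y)))%E.
Proof.
move=> mf f0; rewrite ge0_integral_cons_rV//.
have mg : measurable_fun setT (f \o @cons_rV R n).
  by apply: measurableT_comp => //; exact: measurable_cons_rV.
have f0' x : (0 <= (f \o @cons_rV R n) x)%E by exact: f0.
exact/esym/(fubini_tonelli (m1 := lebesgue_measure) (m2 := lebesgue_rV_sf n) (f \o @cons_rV R n) mg f0').
Qed.

Definition upd n (j : 'I_n) (x : 'rV[R]_n) (s : R) : 'rV[R]_n :=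
  \row_i (if i == j then s else x 0 i).

Lemma measurable_upd n (j : 'I_n) (x : 'rV[R]_n) : measurable_fun setT (upd j x).
Proof.
apply: measurable_fun_rV => // i; under eq_fun do rewrite mxE.
by case: (i == j); [exact: measurable_id|exact: measurable_cst].
Qed.

(** Tonelli in the direction e_j, phrased as a comparison so that no integral over the other
    coordinates has to be written. By induction on n: the first coordinate is integrated innermost
    if it is the j-th one, outermost otherwise. *)
Lemma ge0_integral_line n (j : 'I_n) (f g : 'rV[R]_n -> \bar R) :
  measurable_fun setT f -> (forall x, 0 <= f x)%E ->
  measurable_fun setT g -> (forall x, 0 <= g x)%E ->
  (forall x, \int[lebesgue_measure]_s f (upd j x s) =
             \int[lebesgue_measure]_s g (upd j x s))%E ->
  (\int[lebesgue_rV R n]_x f x = \int[lebesgue_rV R n]_x g x)%E.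
Proof.
elim: n j f g => [[]//|n IH] j f g mf f0 mg g0 fg.
case: (unliftP ord0 j) fg => [j'|] -> fg.
  rewrite (ge0_integral_cons_rV' mf f0) (ge0_integral_cons_rV' mg g0).
  apply: eq_integral => a _.
  have mc h : measurable_fun [set: 'rV[R]_n.+1] h -> measurable_fun [set: 'rV[R]_n] (fun y => h (cons_rV (a, y)) : \bar R).
    move=> mh; apply: (measurableT_comp mh); apply: measurable_fun_rV => // i.
    case: (unliftP ord0 i) => [k|] ->.
      by under eq_fun do rewrite cons_rVS/=; exact: measurable_coord.
    by under eq_fun do rewrite cons_rV0/=; exact: measurable_cst.
  apply: (IH j') => //; [exact: mc|exact: mc|move=> y].
  have := fg (cons_rV (a, y)).
  have E s : upd (lift ord0 j') (cons_rV (a, y)) s = cons_rV (a, upd j' y s).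
    apply/rowP => i; rewrite mxE; case: (unliftP ord0 i) => [k|] ->.
      by rewrite !cons_rVS mxE (inj_eq lift_inj).
    by rewrite !cons_rV0.
  by under eq_integral do rewrite E; under [X in _ = X -> _]eq_integral do rewrite E.
rewrite (ge0_integral_cons_rV mf f0) (ge0_integral_cons_rV mg g0).
apply: eq_integral => y _.
have E s : cons_rV (s, y) = upd ord0 (cons_rV (0, y)) s.
  apply/rowP => i; rewrite [RHS]mxE; case: (unliftP ord0 i) => [k|] ->.
    by have -> : (lift ord0 k == ord0) = false by []; rewrite !cons_rVS.
  by rewrite !cons_rV0 eqxx.
by under eq_integral do rewrite E; under [RHS]eq_integral do rewrite E; exact: fg.
Qed.

End lebesgue_rV_basic.

(** * Partial derivatives *)

Lemma rV_norm_le (R : realType) n (x : 'rV[R]_n) (e : R) : 0 <= e ->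
  (forall i, `|x 0 i| <= e) -> `|x| <= e.
Proof.
move=> e0 h; rewrite /Num.norm/= mx_normrE; apply: bigmax_le => // -[i j] _ /=.
by rewrite ord1.
Qed.

Section upd.
Variables (R : realType) (n : nat).
Implicit Types (f : 'rV[R]_n -> R) (x y : 'rV[R]_n) (i j : 'I_n).

Lemma updE j x s : upd j x s = x + (s - x 0 j) *: delta_mx 0 j.
Proof.
by apply/rowP => i; rewrite !mxE/=; case: eqP => [->|_]; rewrite ?mulr1 ?mulr0 ?addr0// addrC subrK.
Qed.

Lemma upd_id j x : upd j x (x 0 j) = x.
Proof. by rewrite updE subrr scale0r addr0. Qed.

Lemma updK j x s r : upd j (upd j x s) r = upd j x r.
Proof. by apply/rowP => i; rewrite !mxE; case: eqP. Qed.

Lemma upd_eq j x s : upd j x s 0 j = s.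
Proof. by rewrite mxE eqxx. Qed.

Lemma upd_neq j x s i : i != j -> upd j x s 0 i = x 0 i.
Proof. by rewrite mxE => /negbTE ->. Qed.

(** The difference quotients along e_j are those of the restriction to a line, so partial
    derivatives inherit the one-variable theorems. *)
Lemma quot_upd f j x s :
  (fun h : R => h^-1 *: ((f \o shift (upd j x s)) (h *: delta_mx 0 j) - f (upd j x s))) =
  (fun h : R => h^-1 *: (((fun s => f (upd j x s)) \o shift s) (h *: 1) - f (upd j x s))).
Proof.
apply/funext => h /=; congr (_ *: (f _ - _)).
apply/rowP => i; rewrite !mxE/= /shift; case: eqP => _; rewrite ?mulr1 ?mulr0 ?add0r//.
by rewrite [in RHS]/GRing.scale/= mulr1.
Qed.

Lemma derivable_upd f j x s :
  derivable f (upd j x s) (delta_mx 0 j) = derivable (fun s => f (upd j x s)) s 1.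
Proof. by rewrite /derivable -quot_upd. Qed.

Lemma derive_upd f j x s :
  'D_(delta_mx 0 j) f (upd j x s) = 'D_1 (fun s => f (upd j x s)) s.
Proof. by rewrite /derive -quot_upd. Qed.

Lemma derivable_updx f j x :
  derivable f x (delta_mx 0 j) = derivable (fun s => f (upd j x s)) (x 0 j) 1.
Proof. by rewrite -derivable_upd upd_id. Qed.

Lemma derive_updx f j x :
  'D_(delta_mx 0 j) f x = 'D_1 (fun s => f (upd j x s)) (x 0 j).
Proof. by rewrite -derive_upd upd_id. Qed.

End upd.

Lemma is_deriveP_cvg (R : numFieldType) (V W : normedModType R) (f : V -> W) (x v : V) (d : W) :
  is_derive x v f d <->
  (h^-1 *: ((f \o shift x) (h *: v) - f x) @[h --> 0^'] --> d).
Proof.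
split=> [H|H].
  have dv := @ex_derive _ _ _ _ _ _ _ H.
  have E := @derive_val _ _ _ _ _ _ _ H.
  rewrite -E; exact: dv.
apply: DeriveDef; first by apply/cvg_ex; exists d.
exact: cvg_lim.
Qed.

(** By the mean value theorem the left-hand side is |g'(c) - L| |b - a|. The end points come in
    either order because they will be coordinates of two arbitrary points. *)
Lemma mvt_slope (R : realType) (g : R -> R) (a b L eta : R) :
  (forall s, Num.min a b <= s <= Num.max a b -> derivable g s 1 /\ `|'D_1 g s - L| <= eta) ->
  `|g b - g a - L * (b - a)| <= eta * `|b - a|.
Proof.
wlog ab : a b / a < b => [hw|].
  move=> H; have [ab|ba|->] := ltgtP a b; first exact: hw.
    rewrite -normrN (distrC b) [X in `|X| <= _](_ : _ = g a - g b - L * (a - b)); last by ring.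
    by apply: hw => //; rewrite minC maxC.
  by rewrite !subrr mulr0 subrr normr0 mulr0.
rewrite (min_idPl (ltW ab)) (max_idPr (ltW ab)) => H.
have Hd s : s \in `[a, b] -> derivable g s 1 by rewrite in_itv => /H[].
have [||c cab ->] := @MVT R g (fun s => 'D_1 g s) a b ab.
- move=> s sab; apply/derivableP/Hd; exact: subset_itv_oo_cc.
- apply: derivable_within_continuous => s; exact: Hd.
have : c \in `[a, b] by exact: subset_itv_oo_cc.
rewrite in_itv => /H[_ hc].
rewrite -mulrBl normrM ler_wpM2r//.
Qed.

Definition C1_at (R : realType) n (f : 'rV[R]_n -> R) (x : 'rV[R]_n) :=
  forall i, (\forall y \near x, derivable f y (delta_mx 0 i)) /\ {for x, continuous (pderiv i f)}.

(** Go from y to z one coordinate at a time, with the mean value theorem on each edge. Since both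
    points vary, this is strict differentiability, on which the chain rule and the volume estimate
    for small cubes rest. *)
Lemma C1_strict (R : realType) n (f : 'rV[R]_n -> R) (x : 'rV[R]_n) (e : R) :
  0 < e -> C1_at f x -> exists2 d, 0 < d & forall y z, ball x d y -> ball x d z ->
  `|f z - f y - \sum_i (z 0 i - y 0 i) * pderiv i f x| <= e * `|z - y|.
Proof.
move=> e0 C1.
(* Each of the n edges contributes at most [c * |z - y|]; n + 1 is nonzero also for n = 0. *)
pose c := e / n.+1%:R.
have c0 : 0 < c by rewrite divr_gt0.
have : \forall y \near x, forall i, derivable f y (delta_mx 0 i) /\ `|pderiv i f y - pderiv i f x| <= c.
  apply: (@filter_forall _ _ (fun (i : 'I_n) y => derivable f y (delta_mx 0 i) /\ `|pderiv i f y - pderiv i f x| <= c) (nbhs x) _) => i.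
  have [h1 h2] := C1 i.
  apply: filterI => //.
  move/cvgrPdist_le : h2 => /(_ _ c0); apply: filterS => y; by rewrite distrC.
move=> /nbhs_ballP[d /= d0 hd]; exists d => // y z xy xz.
(* The k-th corner of the path: the first k coordinates are those of z, the others those of y. *)
pose p k := \row_i (if (i < k)%N then z 0 i else y 0 i) : 'rV[R]_n.
have p0 : p 0 = y by apply/rowP => i; rewrite mxE.
have pn : p n = z by apply/rowP => i; rewrite mxE ltn_ord.
have -> : f z - f y = \sum_(0 <= k < n) (f (p k.+1) - f (p k)).
  by rewrite telescope_sumr// p0 pn.
rewrite big_mkord -sumrB.
apply: (@le_trans _ _ (\sum_(i < n) c * `|z - y|)).
  apply: (le_trans (ler_norm_sum _ _ _)); apply: ler_sum => i _.
  have pS : p i.+1 = upd i (p i) (z 0 i).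
    apply/rowP => k; rewrite !mxE ltnS leq_eqVlt -val_eqE/=.
    by case: eqP => //= /val_inj ->.
  have pI : p i = upd i (p i) (y 0 i).
    by apply/rowP => k; rewrite !mxE -val_eqE/=; case: eqP => // /val_inj ->; rewrite ltnn.
  rewrite pS [in X in _ - f X - _]pI mulrC.
  apply: (le_trans (@mvt_slope R (fun s => f (upd i (p i) s)) (y 0 i) (z 0 i) (pderiv i f x) c _)); last first.
    rewrite ler_wpM2l ?(ltW c0)//.
    by have := rV_coord_norm (z - y) i; rewrite !mxE.
  move=> s hs.
  have xp : ball x d (upd i (p i) s).
    apply/rV_ballP; split => // k; rewrite !mxE.
    have [_ /(_ k) h1] := proj1 (rV_ballP _ _ _) xy.
    have [_ /(_ k) h2] := proj1 (rV_ballP _ _ _) xz.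
    case: eqP => [ki|_]; last by case: ifP.
    subst k; move: hs h1 h2; rewrite !ltr_norml.
    by case: (leP (y 0 i) (z 0 i)) => ? /andP[? ?] /andP[? ?] /andP[? ?]; apply/andP; split; lra.
  have [h1 h2] := hd _ xp i; split; first by rewrite -derivable_upd.
  by rewrite -derive_upd.
rewrite sumr_const card_ord -[X in X <= _]mulr_natl mulrA ler_wpM2r//.
rewrite /c mulrCA ger_pMr// ler_pdivrMr ?ltr0n// mul1r ler_nat//.
Qed.

Lemma cvg_sum_fin (R : realType) (T : Type) (F : set_system T) (FF : Filter F) (I : finType)
    (f : I -> T -> R) (a : I -> R) :
  (forall i, f i x @[x --> F] --> a i) ->
  (\sum_i f i x) @[x --> F] --> \sum_i a i.
Proof.
move=> h; apply: (@cvg_big _ _ +%R 0 xpredT _ _ _ _ f) => //.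
exact: add_continuous.
Qed.

Lemma C1_chain (R : realType) n (f : 'rV[R]_n -> R) (c : R -> 'rV[R]_n) (s : R) d :
  C1_at f (c s) -> is_derive s 1 c d ->
  is_derive s 1 (f \o c) (\sum_i d 0 i * pderiv i f (c s)).
Proof.
move=> C1 /is_deriveP_cvg; set q := (fun h : R => _) => hq.
apply/is_deriveP_cvg.
have cc : {for s, continuous c}.
  apply: differentiable_continuous; apply/derivable1_diffP/cvg_ex; by exists d.
pose S (v : 'rV[R]_n) := \sum_i v 0 i * pderiv i f (c s).
have cS : continuous S.
  move=> v; apply: (@cvg_sum_fin R _ (nbhs v) _) => i; apply: cvgM; last exact: cvg_cst.
  exact: coord_continuous.
have hS : S (q h) @[h --> 0^'] --> S d.
  by apply: cvg_comp hq _; exact: cS.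
apply/cvgrPdist_le => e e0.
(* M bounds the quotients [q h] for small h, so an error of e/(2M) per unit of increment becomes e/2
   after division by h. *)
pose M := `|d| + 1.
have M0 : 0 < M by rewrite ltr_wpDl.
have eM : 0 < e / 2 / M by rewrite !divr_gt0.
have [r r0 hr] := C1_strict eM C1.
have hq1 : \forall h \near 0^', `|q h| <= M.
  move/cvgrPdist_le : (hq) => /(_ 1 ltr01); apply: filterS => h hh.
  by rewrite /M -[q h](subKr d) (le_trans (ler_normB _ _))// lerD2l.
have hc : \forall h \near 0^', ball (c s) r (c (h + s)).
  have : {for 0, continuous (c \o shift s)}.
    apply: continuous_comp; last by rewrite /shift add0r.
    by apply: cvgD; [exact: cvg_id|exact: cvg_cst].
  move=> /cvg_ballP /(_ _ r0); rewrite /= /shift add0r => H.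
  exact: cvg_within H.
move/cvgrPdist_le : hS => /(_ (e/2)); rewrite divr_gt0// => /(_ isT) hS.
have hne : \forall h \near (0:R)^', h != 0 by exact: nbhs_dnbhs_neq.
near=> h.
have h0 : h != 0 by near: h.
have B1 : `|S d - S (q h)| <= e / 2 by near: h.
have B2 : `|q h| <= M by near: h.
have B3 : ball (c s) r (c (h + s)) by near: h.
have := hr _ _ (ballxx _ r0) B3.
set Q := (X in `|S d - X|).
have E1 : h%:A = h :> R by rewrite /GRing.scale/= mulr1.
have Eq : q h = h^-1 *: (c (h + s) - c s) by rewrite /q /= /shift E1.
have EQ : Q - S (q h) = h^-1 * (f (c (h + s)) - f (c s) - \sum_i (c (h + s) 0 i - c s 0 i) * pderiv i f (c s)).
  rewrite /Q /S Eq mulrBr mulr_sumr; congr (_ - _).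
    by rewrite /= /shift E1.
  by apply: eq_bigr => i _; rewrite !mxE mulrA.
move=> H.
rewrite -[S d - _](subrKA (S (q h))) (le_trans (ler_normD _ _))//.
rewrite [leRHS](splitr e) lerD//.
rewrite distrC EQ normrM.
rewrite -(@ler_pM2l _ `|h|) ?normr_gt0// mulrA -normrM divff// normr1 mul1r.
apply: (le_trans H).
have -> : c (h + s) - c s = h *: q h by rewrite Eq scalerA divff// scale1r.
rewrite normrZ mulrCA ler_wpM2l// -ler_pdivlMl// invf_div.
by rewrite divfK// gt_eqF// divr_gt0.
Unshelve. all: by end_near. Qed.

(** * Families of smooth functions *)

Lemma continuous_pair (A B C : topologicalType) (f : A -> B) (g : A -> C) x :
  {for x, continuous f} -> {for x, continuous g} ->
  {for x, continuous (fun y => (f y, g y))}.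
Proof.
move=> hf hg P [[P1 P2] [/= h1 h2] hP].
change (nbhs x [set y | P (f y, g y)]).
have a1 : nbhs x (f @^-1` P1) by exact: hf.
have a2 : nbhs x (g @^-1` P2) by exact: hg.
apply: filterS (filterI a1 a2) => y [y1 y2].
exact: (hP (f y, g y)).
Qed.

Section pderiv_rules.
Variables (R : realType) (n : nat).
Implicit Types (f g : 'rV[R]_n -> R) (x : 'rV[R]_n) (i : 'I_n).
Local Notation "''e_' i" := (delta_mx 0 i) (at level 8, i at level 2).

Lemma pderivD i f g x : derivable f x 'e_i -> derivable g x 'e_i ->
  derivable (fun y => f y + g y) x 'e_i /\
  pderiv i (fun y => f y + g y) x = pderiv i f x + pderiv i g x.
Proof. by move=> df dg; split; [exact: derivableD|exact: deriveD]. Qed.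

Lemma pderivM i f g x : derivable f x 'e_i -> derivable g x 'e_i ->
  derivable (fun y => f y * g y) x 'e_i /\
  pderiv i (fun y => f y * g y) x = f x * pderiv i g x + g x * pderiv i f x.
Proof. move=> df dg; split; first exact: derivableM.
exact: (deriveM df dg). Qed.

Lemma pderivV i f x : f x != 0 -> derivable f x 'e_i ->
  derivable (fun y => (f y)^-1) x 'e_i /\
  pderiv i (fun y => (f y)^-1) x = - ((f x)^-1 * (f x)^-1 * pderiv i f x).
Proof.
move=> f0 df; split; first exact: derivableV.
by rewrite /pderiv deriveV// -exprVn expr2 /GRing.scale/= mulNr.
Qed.

Lemma pderiv_cst i (c : R) x : derivable (fun _ : 'rV[R]_n => c) x 'e_i /\ pderiv i (fun=> c) x = 0.
Proof. by split; [exact: derivable_cst|exact: derive_cst]. Qed.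

Lemma pderiv_congr i f g (U : set 'rV[R]_n) x : open U -> U x ->
  (forall y, U y -> f y = g y) ->
  (derivable f x 'e_i -> derivable g x 'e_i) /\ pderiv i f x = pderiv i g x.
Proof.
move=> oU Ux fg.
have H : {near x, f =1 g} by near=> y; apply: fg; near: y; exact: open_nbhs_nbhs.
by split; [exact: near_eq_derivable|exact: near_eq_derive].
Unshelve. all: by end_near. Qed.

Lemma pderiv_coord i j x : derivable (fun y : 'rV[R]_n => y 0 j) x 'e_i /\
  pderiv i (fun y : 'rV[R]_n => y 0 j) x = (i == j)%:R.
Proof.
suff H : is_derive x 'e_i (fun y : 'rV[R]_n => y 0 j) (i == j)%:R.
  by split; [exact: (@ex_derive _ _ _ _ _ _ _ H)|exact: (@derive_val _ _ _ _ _ _ _ H)].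
apply/is_deriveP_cvg; apply: cvg_near_cst; near=> h.
have h0 : h != 0 by near: h; exact: nbhs_dnbhs_neq.
rewrite /= /shift !mxE addrK eqxx/= /GRing.scale/= mulrA mulVf// mul1r eq_sym//.
Unshelve. all: by end_near. Qed.

End pderiv_rules.

Section fam.
Variables (R : realType) (T : topologicalType) (n : nat).
Implicit Types (W : set T) (U : set 'rV[R]_n) (F G : T -> 'rV[R]_n -> R).
Local Notation "''e_' i" := (delta_mx 0 i) (at level 8, i at level 2).

Definition jcont W U F := forall t x, W t -> U x ->
  {for (t, x), continuous (fun p : T * 'rV[R]_n => F p.1 p.2)}.

(* F t is C^k with derivatives jointly continuous in (t, x); no
   differentiability in t is required. *)
Fixpoint smk k W U F : Prop := jcont W U F /\
  match k with
  | 0 => True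
  | k'.+1 => (forall i t x, W t -> U x -> derivable (F t) x 'e_i) /\
             (forall i, smk k' W U (fun t => pderiv i (F t)))
  end.

Definition smf W U F := forall k, smk k W U F.

Lemma smk_jcont k W U F : smk k W U F -> jcont W U F.
Proof. by case: k => [|k] []. Qed.

Lemma smkW k W U F : smk k.+1 W U F -> smk k W U F.
Proof.
elim: k F => [|k IH] F /=; first by move=> [? _].
by move=> [? [? h]]; split => //; split => // i; exact: (IH _ (h i)).
Qed.

Lemma smk_sub k W U F W' U' : W' `<=` W -> U' `<=` U -> smk k W U F -> smk k W' U' F.
Proof.
move=> WW UU; elim: k F => [|k IH] F /= [h1 h2]; split => //.
- by move=> t x /WW ? /UU ?; exact: h1.
- by move=> t x /WW ? /UU ?; exact: h1.
case: h2 => h2 h3; split; first by move=> i t x /WW ? /UU ?; exact: h2.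
by move=> i; apply: IH.
Qed.

Lemma smf_sub W U F W' U' : W' `<=` W -> U' `<=` U -> smf W U F -> smf W' U' F.
Proof. by move=> WW UU h k; exact: (smk_sub WW UU). Qed.

Lemma smkU k W U1 U2 F : smk k W U1 F -> smk k W U2 F -> smk k W (U1 `|` U2) F.
Proof.
elim: k F => [|k IH] F /= [h1 h2] [g1 g2]; split.
- by move=> t x Wt [Ux|Ux]; [exact: h1|exact: g1].
- by [].
- by move=> t x Wt [Ux|Ux]; [exact: h1|exact: g1].
case: h2 g2 => h2 h3 [g2 g3]; split; last by move=> i; exact: IH.
by move=> i t x Wt [Ux|Ux]; [exact: h2|exact: g2].
Qed.

Lemma smfU W U1 U2 F : smf W U1 F -> smf W U2 F -> smf W (U1 `|` U2) F.
Proof. by move=> h1 h2 k; exact: smkU. Qed.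

Lemma jcont_congr W U F G : open W -> open U ->
  (forall t x, W t -> U x -> F t x = G t x) -> jcont W U F -> jcont W U G.
Proof.
move=> oW oU FG h t x Wt Ux; have := h _ _ Wt Ux.
rewrite /prop_for /continuous_at /= (FG t x)// => H.
apply: cvg_trans H; apply: near_eq_cvg.
have : nbhs (t, x) (W `*` U) by exists (W, U) => //; split; exact: open_nbhs_nbhs.
by apply: filterS => -[s y] /= [Ws Uy]; rewrite FG.
Qed.

Lemma smk_congr k W U F G : open W -> open U ->
  (forall t x, W t -> U x -> F t x = G t x) -> smk k W U F -> smk k W U G.
Proof.
move=> oW oU; elim: k F G => [|k IH] F G FG /= [h1 h2]; split => //; try exact: jcont_congr h1.
case: h2 => h2 h3.
have H i t x : W t -> U x -> (derivable (F t) x 'e_i -> derivable (G t) x 'e_i) /\ pderiv i (F t) x = pderiv i (G t) x.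
  by move=> Wt Ux; apply: (pderiv_congr _ oU) => // y Uy; exact: FG.
split; first by move=> i t x Wt Ux; apply: (proj1 (H i t x Wt Ux)); exact: h2.
by move=> i; apply: (IH (fun t => pderiv i (F t))) => // t x Wt Ux; exact: (proj2 (H i t x Wt Ux)).
Qed.

Lemma smf_congr W U F G : open W -> open U ->
  (forall t x, W t -> U x -> F t x = G t x) -> smf W U F -> smf W U G.
Proof. by move=> oW oU FG h k; exact: (smk_congr oW oU FG). Qed.

Lemma jcont_slice W U F t x : jcont W U F -> W t -> U x -> {for x, continuous (F t)}.
Proof.
move=> h Wt Ux.
apply: (@continuous_comp _ _ _ (fun y => (t, y)) (fun p => F p.1 p.2)); last exact: h.
by apply: continuous_pair; [exact: cst_continuous|exact: cvg_id].
Qed.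

Lemma smf_jcont W U F : smf W U F -> jcont W U F.
Proof. by move=> /(_ 0%N)/smk_jcont. Qed.

Lemma smf_continuous W U F t x : smf W U F -> W t -> U x -> {for x, continuous (F t)}.
Proof. by move=> /smf_jcont; exact: jcont_slice. Qed.

Lemma smf_derivable W U F i t x : smf W U F -> W t -> U x -> derivable (F t) x 'e_i.
Proof. by move=> /(_ 1%N)[_ [h _]]; exact: h. Qed.

Lemma smf_pderiv W U F i : smf W U F -> smf W U (fun t => pderiv i (F t)).
Proof. by move=> h k; have [_ [_]] := h k.+1; exact. Qed.

Lemma smk_C1 k W U F t x : open U -> smk k.+1 W U F -> W t -> U x -> C1_at (F t) x.
Proof.
move=> oU [_ [h1 h2]] Wt Ux i; split.
  near=> y; apply: h1 => //; near: y; exact: open_nbhs_nbhs.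
exact: (jcont_slice (smk_jcont (h2 i))).
Unshelve. all: by end_near. Qed.

Lemma smf_iter W U F s : smf W U F -> smf W U (fun t => iter_pderiv s (F t)).
Proof. by move=> h; elim: s => //= i s IH; exact: smf_pderiv. Qed.

Lemma smf_class_C W U F t k : smf W U F -> W t -> class_C k U (F t).
Proof.
move=> h Wt; split => [s _ x Ux|s _ i x Ux].
  exact: (smf_continuous (smf_iter s h)).
exact: (smf_derivable (smf_iter s h) Wt Ux).
Qed.

(** [class_C] adds a derivative on the outside and [smk] peels one off on the inside; this identity
    mediates between them. *)
Lemma iter_pderiv_rcons (s : seq 'I_n) i (f : 'rV[R]_n -> R) : iter_pderiv (rcons s i) f = iter_pderiv s (pderiv i f).
Proof. by rewrite /iter_pderiv foldr_rcons. Qed.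

Lemma class_C_smf W U f : (forall k, class_C k U f) -> smf W U (fun=> f).
Proof.
move=> h k; have := h k; move: (f); elim: k {h} => [|k IH] g [h1 h2] /=.
  split=> // t x Wt Ux; apply: (@continuous_comp _ _ _ snd g); first exact: cvg_snd.
  exact: (h1 [::]).
split.
  move=> t x Wt Ux; apply: (@continuous_comp _ _ _ snd g); first exact: cvg_snd.
  exact: (h1 [::]).
split; first by move=> i t x _ Ux; exact: (h2 [::]).
move=> i; apply: IH; split.
  by move=> s hs x Ux; rewrite -iter_pderiv_rcons; apply: h1 => //; rewrite size_rcons.
by move=> s hs j x Ux; rewrite -iter_pderiv_rcons; apply: h2 => //; rewrite size_rcons.
Qed.

Lemma smf_cst W U (c : T -> R) : (forall t, W t -> {for t, continuous c}) ->
  smf W U (fun t _ => c t).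
Proof.
move=> hc [|k] /=.
  split => // t x Wt Ux; apply: (@continuous_comp _ _ _ fst c); first exact: cvg_fst.
  exact: hc.
split.
  move=> t x Wt Ux; apply: (@continuous_comp _ _ _ fst c); first exact: cvg_fst.
  exact: hc.
have E i t : pderiv i (fun _ : 'rV[R]_n => c t) = fun=> 0 by apply/funext => x; exact: (proj2 (pderiv_cst _ _ _)).
split; first by move=> i t x _ _; exact: (proj1 (pderiv_cst _ _ _)).
move=> i; have -> : (fun t => pderiv i (fun=> c t)) = fun _ _ => 0 by apply/funext => t; rewrite E.
have Z j : pderiv j (fun _ : 'rV[R]_n => 0) = fun=> 0 by apply/funext => x; exact: (proj2 (pderiv_cst _ _ _)).
elim: k => [|k IH] /=; split => //; try (by move=> t x _ _; exact: cvg_cst).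
split; first by move=> j t x _ _; exact: (proj1 (pderiv_cst _ _ _)).
by move=> j; have -> : (fun _ : T => pderiv j (fun _ : 'rV[R]_n => 0)) = fun _ _ => 0 by apply/funext => t; rewrite Z.
Qed.

Lemma smf_const W U (c : R) : smf W U (fun _ _ => c).
Proof. by apply: (@smf_cst _ _ (fun=> c)) => t _; exact: cvg_cst. Qed.

Lemma smf_coord W U i : smf W U (fun _ x => x 0 i).
Proof.
have C : jcont W U (fun _ x => x 0 i).
  move=> t x _ _; apply: (@continuous_comp _ _ _ snd (fun x : 'rV[R]_n => x 0 i)); first exact: cvg_snd.
  exact: coord_continuous.
move=> [|k] //=; split => //; split; first by move=> j t x _ _; exact: (proj1 (pderiv_coord _ _ _)).
move=> j; have -> : (fun _ : T => pderiv j (fun x : 'rV[R]_n => x 0 i)) = fun _ _ => (j == i)%:R.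
  by apply/funext => t; apply/funext => x; exact: (proj2 (pderiv_coord _ _ _)).
exact: smf_const.
Qed.

Section ops.
Variables (W : set T) (U : set 'rV[R]_n).
Hypotheses (oW : open W) (oU : open U).

Lemma smkD k F G : smk k W U F -> smk k W U G -> smk k W U (fun t x => F t x + G t x).
Proof.
elim: k F G => [|k IH] F G /= [h1 h2] [g1 g2].
  by split => // t x Wt Ux; apply: cvgD; [exact: h1|exact: g1].
split; first by move=> t x Wt Ux; apply: cvgD; [exact: h1|exact: g1].
case: h2 g2 => h2 h3 [g2 g3].
have D i t x Wt Ux := pderivD (h2 i t x Wt Ux) (g2 i t x Wt Ux).
split; first by move=> i t x Wt Ux; exact: (proj1 (D i t x Wt Ux)).
move=> i; apply: (smk_congr oW oU _ (IH _ _ (h3 i) (g3 i))) => t x Wt Ux.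
by rewrite (proj2 (D i t x Wt Ux)).
Qed.

Lemma smkM k F G : smk k W U F -> smk k W U G -> smk k W U (fun t x => F t x * G t x).
Proof.
elim: k F G => [|k IH] F G hF hG.
  by case: hF hG => [h1 _] [g1 _]; split => // t x Wt Ux; apply: cvgM; [exact: h1|exact: g1].
have [hF' hG'] := (smkW hF, smkW hG).
case: hF hG => h1 [h2 h3] [g1 [g2 g3]].
split; first by move=> t x Wt Ux; apply: cvgM; [exact: h1|exact: g1].
have D i t x Wt Ux := pderivM (h2 i t x Wt Ux) (g2 i t x Wt Ux).
split; first by move=> i t x Wt Ux; exact: (proj1 (D i t x Wt Ux)).
move=> i; apply: (smk_congr oW oU _ (smkD (IH _ _ hF' (g3 i)) (IH _ _ hG' (h3 i)))) => t x Wt Ux.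
by rewrite (proj2 (D i t x Wt Ux)).
Qed.

Lemma smkN k F : smk k W U F -> smk k W U (fun t x => - F t x).
Proof.
move=> hF; apply: (smk_congr oW oU _ (smkM (smf_const W U (-1) k) hF)) => t x _ _.
by rewrite mulN1r.
Qed.

Lemma smkV k F : (forall t x, W t -> U x -> F t x != 0) ->
  smk k W U F -> smk k W U (fun t x => (F t x)^-1).
Proof.
move=> F0; elim: k F F0 => [|k IH] F F0 hF.
  by case: hF => [h1 _]; split => // t x Wt Ux; apply: cvgV; [exact: F0|exact: h1].
have hF' := smkW hF; case: hF => h1 [h2 h3].
split; first by move=> t x Wt Ux; apply: cvgV; [exact: F0|exact: h1].
have D i t x Wt Ux := pderivV (F0 t x Wt Ux) (h2 i t x Wt Ux).
split; first by move=> i t x Wt Ux; exact: (proj1 (D i t x Wt Ux)).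
move=> i; have hV := IH _ F0 hF'.
apply: (smk_congr oW oU _ (smkN (smkM (smkM hV hV) (h3 i)))) => t x Wt Ux.
by rewrite (proj2 (D i t x Wt Ux)).
Qed.

Lemma smfD F G : smf W U F -> smf W U G -> smf W U (fun t x => F t x + G t x).
Proof. by move=> h g k; exact: smkD. Qed.

Lemma smfM F G : smf W U F -> smf W U G -> smf W U (fun t x => F t x * G t x).
Proof. by move=> h g k; exact: smkM. Qed.

Lemma smfN F : smf W U F -> smf W U (fun t x => - F t x).
Proof. by move=> h k; exact: smkN. Qed.

Lemma smfB F G : smf W U F -> smf W U G -> smf W U (fun t x => F t x - G t x).
Proof. by move=> h g; apply: smfD => //; exact: smfN. Qed.

Lemma smfV F : (forall t x, W t -> U x -> F t x != 0) ->
  smf W U F -> smf W U (fun t x => (F t x)^-1).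
Proof. by move=> F0 h k; exact: smkV. Qed.

Lemma smfX F m : smf W U F -> smf W U (fun t x => F t x ^+ m).
Proof.
move=> h; elim: m => [|m IH]; first exact: smf_const.
by apply: (smf_congr oW oU _ (smfM h IH)) => t x _ _; rewrite exprS.
Qed.

Lemma smf_sum (I : Type) (r : seq I) (P : pred I) (F : I -> T -> 'rV[R]_n -> R) : (forall i, smf W U (F i)) ->
  smf W U (fun t x => \sum_(i <- r | P i) F i t x).
Proof.
move=> h; elim: r => [|i r IH].
  by apply: (smf_congr oW oU _ (smf_const W U 0)) => t x _ _; rewrite big_nil.
have [Pi|Pi] := boolP (P i).
  by apply: (smf_congr oW oU _ (smfD (h i) IH)) => t x _ _; rewrite big_cons Pi.
by apply: (smf_congr oW oU _ IH) => t x _ _; rewrite big_cons (negbTE Pi).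
Qed.

Lemma smf_prod (I : Type) (r : seq I) (P : pred I) (F : I -> T -> 'rV[R]_n -> R) : (forall i, smf W U (F i)) ->
  smf W U (fun t x => \prod_(i <- r | P i) F i t x).
Proof.
move=> h; elim: r => [|i r IH].
  by apply: (smf_congr oW oU _ (smf_const W U 1)) => t x _ _; rewrite big_nil.
have [Pi|Pi] := boolP (P i).
  by apply: (smf_congr oW oU _ (smfM (h i) IH)) => t x _ _; rewrite big_cons Pi.
by apply: (smf_congr oW oU _ IH) => t x _ _; rewrite big_cons (negbTE Pi).
Qed.

End ops.

(** The shear maps the line through x in the direction e_i to this curve, to which the chain rule
    [C1_chain] will be applied. *)
Lemma is_derive_shear j (theta : 'rV[R]_n -> R) x i :
  derivable theta x 'e_i ->
  is_derive (0 : R) 1 (fun h : R => (h *: 'e_i + x) + theta (h *: 'e_i + x) *: 'e_j)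
    ('e_i + pderiv i theta x *: 'e_j : 'rV[R]_n).
Proof.
move=> dt; apply/is_deriveP_cvg.
have H : h^-1 *: (theta (h *: 'e_i + x) - theta x) @[h --> (0:R)^'] --> pderiv i theta x by exact: dt.
have K : ('e_i + (h^-1 *: (theta (h *: 'e_i + x) - theta x)) *: 'e_j : 'rV[R]_n) @[h --> (0:R)^'] --> ('e_i + pderiv i theta x *: 'e_j : 'rV[R]_n).
  by apply: cvgD; [exact: cvg_cst|apply: cvgZ; [exact: H|exact: cvg_cst]].
apply: cvg_trans K; apply: near_eq_cvg; near=> h.
have h0 : h != 0 by near: h; exact: nbhs_dnbhs_neq.
have E : (h%:A + 0 : R) = h by rewrite addr0 /GRing.scale/= mulr1.
rewrite /comp /shift E scale0r add0r.
by apply/rowP => k; rewrite !mxE /GRing.scale/=; field.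
Unshelve. all: by end_near. Qed.

Lemma pderiv_shear (H theta : 'rV[R]_n -> R) j x i :
  C1_at H (x + theta x *: 'e_j) -> derivable theta x 'e_i ->
  derivable (fun x => H (x + theta x *: 'e_j)) x 'e_i /\
  pderiv i (fun x => H (x + theta x *: 'e_j)) x =
    pderiv i H (x + theta x *: 'e_j) + pderiv j H (x + theta x *: 'e_j) * pderiv i theta x.
Proof.
move=> HC dt.
have D := is_derive_shear j dt.
have HC' : C1_at H ((fun h : R => (h *: 'e_i + x) + theta (h *: 'e_i + x) *: 'e_j) 0).
  by rewrite scale0r add0r.
have := C1_chain HC' D.
rewrite scale0r add0r.
set S := (X in is_derive _ _ _ X) => K.
have ES : S = pderiv i H (x + theta x *: 'e_j) + pderiv j H (x + theta x *: 'e_j) * pderiv i theta x.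
  have D1 (l : 'I_n) (a : 'I_n -> R) : \sum_k (k == l)%:R * a k = a l.
    by rewrite (bigD1 l)//= eqxx mul1r big1 ?addr0// => k /negbTE ->; rewrite mul0r.
  rewrite /S; under eq_bigr do rewrite !mxE eqxx/= mulrDl -mulrA.
  by rewrite big_split/= D1 -mulr_sumr D1 mulrC.
have K' : is_derive x 'e_i (fun x => H (x + theta x *: 'e_j)) S.
  apply/is_deriveP_cvg; move/is_deriveP_cvg : K.
  apply: cvg_trans; apply: near_eq_cvg; near=> h.
  by rewrite /= /shift scale0r add0r addr0 /GRing.scale/= mulr1.
split; first exact: (@ex_derive _ _ _ _ _ _ _ K').
by rewrite -ES; exact: (@derive_val _ _ _ _ _ _ _ K').
Unshelve. all: by end_near. Qed.

Lemma jcont_shear W U V H (theta : T -> 'rV[R]_n -> R) j :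
  jcont W V H -> jcont W U theta ->
  (forall t x, W t -> U x -> V (x + theta t x *: 'e_j)) ->
  jcont W U (fun t x => H t (x + theta t x *: 'e_j)).
Proof.
move=> hH ht hV t x Wt Ux.
apply: (@continuous_comp _ _ _ (fun p : T * 'rV[R]_n => (p.1, p.2 + theta p.1 p.2 *: 'e_j)) (fun p => H p.1 p.2)).
  apply: continuous_pair; first exact: cvg_fst.
  apply: cvgD; first exact: cvg_snd.
  by apply: cvgZ; [exact: ht|exact: cvg_cst].
by apply: hH => //; exact: hV.
Qed.

(** [theta] is assumed only as smooth as the conclusion: [transport_smooth] gains one order at a
    time by applying this to the very function whose smoothness it proves. *)
Lemma smk_shear k W U V H (theta : T -> 'rV[R]_n -> R) j : open W -> open U -> open V ->
  smf W V H -> smk k W U theta ->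
  (forall t x, W t -> U x -> V (x + theta t x *: 'e_j)) ->
  smk k W U (fun t x => H t (x + theta t x *: 'e_j)).
Proof.
move=> oW oU oV + + hV; elim: k H => [|k IH] H hH ht.
  by split => //; apply: jcont_shear hV; [exact: smf_jcont|exact: smk_jcont ht].
have ht' := smkW ht; have [t1 [t2 t3]] := ht.
split; first by apply: jcont_shear hV => //; exact: smf_jcont.
have D i t x (Wt : W t) (Ux : U x) := pderiv_shear (smk_C1 oV (hH 1%N) Wt (hV _ _ Wt Ux)) (t2 i t x Wt Ux).
split; first by move=> i t x Wt Ux; exact: (proj1 (D i t x Wt Ux)).
move=> i; apply: (smk_congr oW oU _ (smkD oW oU (IH _ (smf_pderiv i hH) ht') (smkM oW oU (IH _ (smf_pderiv j hH) ht') (t3 i)))).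
by move=> t x Wt Ux; rewrite (proj2 (D i t x Wt Ux)).
Qed.

Lemma smf_shear W U V H (theta : T -> 'rV[R]_n -> R) j : open W -> open U -> open V ->
  smf W V H -> smf W U theta ->
  (forall t x, W t -> U x -> V (x + theta t x *: 'e_j)) ->
  smf W U (fun t x => H t (x + theta t x *: 'e_j)).
Proof. by move=> oW oU oV hH ht hV k; exact: (smk_shear oW oU oV). Qed.

(** U and the complement of K form an open cover, and on the latter the family is 0. *)
Lemma smf_extend W U K F : open W -> closed K -> K `<=` U -> smf W U F ->
  (forall t x, W t -> ~ K x -> F t x = 0) -> smf W setT F.
Proof.
move=> oW cK KU hF F0.
have -> : [set: 'rV[R]_n] = U `|` ~` K.
  by apply/seteqP; split => // x _; have [Kx|] := pselect (K x); [left; exact: KU|right].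
apply: smfU => //; apply: (@smf_congr _ _ (fun _ _ => 0)) => //.
- exact: closed_openC.
- by move=> t x Wt nK; rewrite F0.
exact: smf_const.
Qed.

End fam.

(** * Change of variables along a line *)

Section density.
Context d (T : measurableType d) (R : realType).
Variables (mu : {measure set T -> \bar R}) (g : T -> \bar R).
Hypotheses (mg : measurable_fun setT g) (g0 : forall x, (0 <= g x)%E).
Hypothesis gfin : forall x, g x \is a fin_num.
Local Open Scope ereal_scope.

(* The two proofs are arguments so that the measure structure of dens mg g0 can
   be inferred. *)
Definition dens (_ : measurable_fun setT g) (_ : forall x, (0 <= g x)%E) (A : set T) : \bar R :=
  \int[mu]_(x in A) g x.

Let dens0 : dens mg g0 set0 = 0. Proof. by rewrite /dens integral_set0. Qed.

Let dens_ge0 A : 0 <= dens mg g0 A.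
Proof. by apply: integral_ge0 => x _. Qed.

Let dens_sigma_additive : semi_sigma_additive (dens mg g0).
Proof. exact: semi_sigma_additive_nng_induced. Qed.

HB.instance Definition _ := isMeasure.Build _ _ _ (dens mg g0)
  dens0 dens_ge0 dens_sigma_additive.

Import HBNNSimple.

(** For simple functions this is linearity and the definition of [dens]; monotone convergence on
    both sides does the rest. *)
Lemma ge0_integral_dens (f : T -> \bar R) : measurable_fun setT f -> (forall x, 0 <= f x) ->
  \int[dens mg g0]_x f x = \int[mu]_x (f x * g x).
Proof.
move=> mf f0.
pose h := nnsfun_approx measurableT mf.
have -> : \int[dens mg g0]_x f x = lim (\int[dens mg g0]_x (EFin \o h n) x @[n --> \oo]).
  rewrite -monotone_convergence//.
  - by apply: eq_integral => x _; apply/esym/cvg_lim => //; exact: cvg_nnsfun_approx.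
  - by move=> n; exact/measurable_EFinP.
  - by move=> n x _; rewrite lee_fin.
  - by move=> x _ a b ab; rewrite lee_fin; exact/lefP/nd_nnsfun_approx.
have -> : \int[mu]_x (f x * g x) = lim (\int[mu]_x ((EFin \o h n) x * g x) @[n --> \oo]).
  rewrite -monotone_convergence//.
  - apply: eq_integral => x _; apply/esym/cvg_lim => //.
    by apply: cvgeZr => //; exact: cvg_nnsfun_approx.
  - by move=> n; apply: emeasurable_funM => //; exact/measurable_EFinP.
  - by move=> n x _; rewrite mule_ge0// lee_fin.
  - move=> x _ a b ab; rewrite lee_wpmul2r// lee_fin; exact/lefP/nd_nnsfun_approx.
suff -> : (fun n => \int[dens mg g0]_x (EFin \o h n) x) = (fun n => \int[mu]_x ((EFin \o h n) x * g x)) by [].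
apply/funext => n.
transitivity (\int[dens mg g0]_x (\sum_(y \in range (h n)) (y * \1_(h n @^-1` [set y]) x)%:E)).
  by apply: eq_integral => t _; rewrite /= fimfunE -fsumEFin.
rewrite ge0_integral_fsum//; last 2 first.
- by move=> r; apply/measurable_EFinP; apply: measurable_funM.
- by move=> r x _; exact: nnfun_muleindic_ge0.
transitivity (\int[mu]_x (\sum_(y \in range (h n)) (y * \1_(h n @^-1` [set y]) x)%:E * g x)); last first.
  apply: eq_integral => x _.
  rewrite -ge0_mule_fsuml => [|y]; last exact: nnfun_muleindic_ge0.
  by rewrite fsumEFin // -(fimfunE _ x).
rewrite ge0_integral_fsum//; last 2 first.
- by move=> y; apply: emeasurable_funM => //; apply/measurable_EFinP; apply: measurable_funM.
- by move=> r x _; rewrite mule_ge0//; exact: nnfun_muleindic_ge0.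
apply: eq_fsbigr => r rhn.
under eq_integral do rewrite EFinM.
rewrite integralZl_indic_nnsfun//.
rewrite integral_indic// setIT.
under [RHS]eq_integral do rewrite EFinM -muleA.
rewrite ge0_integralZl//; last 3 first.
- by apply: emeasurable_funM => //; exact/measurable_EFinP.
- by move=> x _; rewrite mule_ge0// lee_fin.
- by case: (set_mem rhn) => x _ <-; rewrite lee_fin.
congr (_ * _).
transitivity (\int[mu]_(x in h n @^-1` [set r]) g x) => //.
rewrite integral_mkcond; apply: eq_integral => x _.
by rewrite patchE indicE; case: ifP; rewrite ?mul1e ?mul0e.
Qed.

End density.

Lemma continuous_cstD (R : realType) (T : topologicalType) (f : T -> R) c x :
  {for x, continuous f} -> {for x, continuous (fun y => c + f y)}.
Proof.
by move=> cf; apply: (@cvgD _ _ _ _ _ (fun=> c) f); [exact: cvg_cst|exact: cf].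
Qed.

Lemma continuousT_measurable_rV (R : realType) n (f : 'rV[R]_n -> R) :
  continuous f -> measurable_fun setT f.
Proof. by move=> cf; exact: (continuous_measurable_rV (@openT _) (fun x _ => cf x)). Qed.

Section subst1d.
Variable R : realType.
Notation mu := (@lebesgue_measure R).

(** By the fundamental theorem of calculus, the image under psi of the measure with density dpsi
    gives each half-open interval its length, and this characterises Lebesgue measure. *)
Lemma ge0_integral_subst (psi dpsi psi' : R -> R) (f : R -> \bar R) :
  (forall s : R, is_derive s 1 psi (dpsi s)) -> continuous dpsi ->
  (forall s, 0 < dpsi s) -> cancel psi psi' -> cancel psi' psi ->
  measurable_fun setT f -> (forall s, 0 <= f s)%E ->
  (\int[mu]_s (f (psi s) * (dpsi s)%:E) = \int[mu]_s f s)%E.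
Proof.
move=> dp cdp dp0 K K' mf f0.
have md : measurable_fun setT (EFin \o dpsi).
  by apply/measurable_EFinP; exact: continuous_measurable_fun.
have d0 s : (0 <= (EFin \o dpsi) s)%E by rewrite /= lee_fin ltW.
have der s : derivable psi s 1 by exact: (@ex_derive _ _ _ _ _ _ _ (dp s)).
have cpsi : continuous psi.
  by move=> s; apply: differentiable_continuous; exact/derivable1_diffP.
have mpsi : measurable_fun setT (psi : measurableTypeR R -> measurableTypeR R).
  exact: continuous_measurable_fun.
have incr : {mono psi : x y / x < y}.
  apply: leW_mono; apply: le_mono => x y xy.
  have [c _ E] := @MVT R psi dpsi x y xy (fun s _ => dp s) (continuous_subspaceT cpsi).
  by rewrite -subr_gt0 E mulr_gt0// subr_gt0.
have E A : measurable A -> mu A = pushforward (dens mu md d0) (psi : measurableTypeR R -> measurableTypeR R) A.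
  move=> mA.
  apply: (@lebesgue_measure_unique R (pushforward (dens mu md d0) (psi : measurableTypeR R -> measurableTypeR R))) => //.
  move=> _ [[a b] _ <-] /=; rewrite /pushforward /dens.
  have i1 x y : (psi' x < y) = (x < psi y) by rewrite -incr K'.
  have i2 x y : (y <= psi' x) = (psi y <= x) by rewrite !leNgt i1.
  have -> : psi @^-1` `]a, b] = `]psi' a, psi' b]%classic.
    by apply/seteqP; split => s /=; rewrite !in_itv/= i1 i2.
  have [ab|ab] := ltP a b; last first.
    rewrite set_itv_ge -?leNgt ?bnd_simp// ?measure0 ?set_itv_ge ?integral_set0// ?bnd_simp -leNgt.
    by rewrite leNgt -incr !K' -leNgt.
  have ab' : psi' a < psi' b by rewrite -incr !K'.
  rewrite lebesgue_measure_itv/= lte_fin ab.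
  rewrite integral_itv_obnd_cbnd//; last exact: measurable_funTS.
  rewrite (@continuous_FTC2 _ dpsi psi)//.
  - by rewrite !K' -EFinB.
  - exact: continuous_subspaceT.
  - split; first by move=> s _; exact: der.
    + by apply: cvg_at_right_filter; exact: cpsi.
    + by apply: cvg_at_left_filter; exact: cpsi.
  - by move=> s _; rewrite derive1E; exact: derive_val.
rewrite -(@ge0_integral_dens _ _ _ mu _ md d0 _ (f \o psi)); last 3 first.
- by [].
- by apply: measurableT_comp mf _; exact: mpsi.
- by move=> s; exact: f0.
rewrite -(ge0_integral_pushforward (phi := psi : measurableTypeR R -> measurableTypeR R) mpsi (dens mu md d0) (D := setT) (f := f))//.
by apply: eq_measure_integral => A mA _; exact/esym/E.
Qed.

End subst1d.

(** * Integrals under shears, and integrals of partial derivatives *)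

Section shear_integral.
Variables (R : realType) (n : nat).
Local Notation leb := (lebesgue_rV R n).
Local Notation "''e_' i" := (delta_mx 0 i) (at level 8, i at level 2).

Lemma upd_shear (j : 'I_n) (x : 'rV[R]_n) s (t : R) :
  upd j x s + t *: 'e_j = upd j x (s + t).
Proof.
by apply/rowP => i; rewrite !mxE/=; case: eqP => _; rewrite ?mulr1 ?mulr0 ?addr0.
Qed.

Lemma continuous_upd (j : 'I_n) (x : 'rV[R]_n) : continuous (upd j x).
Proof.
move=> s; rewrite (_ : upd j x = fun s => x + (s - x 0 j) *: 'e_j); last by apply/funext => r; exact: updE.
apply: cvgD; first exact: cvg_cst.
by apply: cvgZ; [apply: cvgB; [exact: cvg_id|exact: cvg_cst]|exact: cvg_cst].
Qed.

Lemma measurable_shear (j : 'I_n) (theta : 'rV[R]_n -> R) : continuous theta ->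
  measurable_fun setT (fun x : 'rV[R]_n => x + theta x *: 'e_j).
Proof.
move=> ct; apply: measurable_fun_rV => // i.
under eq_fun do rewrite !mxE.
apply: measurable_funD; first exact: measurable_coord.
apply: measurable_funM; last exact: measurable_cst.
exact: continuousT_measurable_rV.
Qed.

(** A shear maps each line parallel to e_j to itself with derivative 1 + d_j theta, so the
    one-variable substitution on these lines is enough. *)
Lemma ge0_integral_shear (j : 'I_n) (theta theta' : 'rV[R]_n -> R) (f : 'rV[R]_n -> \bar R) :
  continuous theta -> (forall x, derivable theta x 'e_j) -> continuous (pderiv j theta) ->
  (forall x, 0 < 1 + pderiv j theta x) ->
  cancel (fun x => x + theta x *: 'e_j) (fun x => x + theta' x *: 'e_j) ->
  cancel (fun x => x + theta' x *: 'e_j) (fun x => x + theta x *: 'e_j) ->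
  measurable_fun setT f -> (forall x, 0 <= f x)%E ->
  (\int[leb]_x (f (x + theta x *: 'e_j)%R * (1 + pderiv j theta x)%:E) = \int[leb]_x f x)%E.
Proof.
move=> ct dt cdt dt0 K K' mf f0.
have cdt1 x : {for x, continuous (fun x => 1 + pderiv j theta x)}.
  by apply: continuous_cstD; exact: cdt.
apply: (@ge0_integral_line R n j) => //.
- apply: emeasurable_funM.
    by apply: measurableT_comp mf _; exact: measurable_shear.
  by apply/measurable_EFinP; exact: continuousT_measurable_rV.
- by move=> x; rewrite mule_ge0// lee_fin ltW.
move=> x.
under eq_integral do rewrite upd_shear.
apply: (@ge0_integral_subst R (fun s => s + theta (upd j x s)) (fun s => 1 + pderiv j theta (upd j x s)) (fun s => s + theta' (upd j x s)) (fun s => f (upd j x s))) => //.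
- move=> s; apply: is_deriveD; apply: DeriveDef; first by rewrite -derivable_upd; exact: dt.
  by rewrite -derive_upd.
- by move=> s; apply: (@continuous_comp _ _ _ (upd j x) (fun y => 1 + pderiv j theta y)); [exact: continuous_upd|exact: cdt1].
- by move=> s; have := K (upd j x s); rewrite /= !upd_shear => /rowP/(_ j); rewrite !upd_eq.
- by move=> s; have := K' (upd j x s); rewrite /= !upd_shear => /rowP/(_ j); rewrite !upd_eq.
- by apply: measurableT_comp mf _; exact: measurable_upd.
Qed.

Definition boxN (N : R) : set 'rV[R]_n := [set x | forall i, `|x 0 i| <= N].

Lemma bounded_supp_integrable (G : 'rV[R]_n -> R) (N M : R) :
  measurable_fun setT G -> (forall x, `|G x| <= M) -> (forall x, ~ boxN N x -> G x = 0) ->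
  leb.-integrable setT (EFin \o G).
Proof.
move=> mG GM G0.
have mB : measurable (boxN N).
  apply: (@measurable_box R n (fun=> [set r : R | `|r| <= N])) => i.
  rewrite (_ : [set r | _] = `[- N, N]%classic) => [|]; first exact: measurable_itv.
  by apply/seteqP; split => r /=; rewrite in_itv/= ler_norml.
have fB : (leb (boxN N) < +oo)%E.
  rewrite (_ : boxN N = [set x : 'rV[R]_n | forall i, `[- N, N]%classic (x 0 i)]); last first.
    by apply/seteqP; split => x /= h i; have := h i; rewrite in_itv/= ler_norml.
  rewrite (@lebesgue_rV_box R n (fun=> `[- N, N]%classic))//.
  rewrite ltey_eq; apply/orP; left; elim/big_ind : _ => //.
  - by move=> x y hx hy; rewrite fin_numM.
  by move=> i _; rewrite lebesgue_measure_itv; case: ifP => _.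
apply: (@le_integrable _ _ _ leb _ measurableT _ (fun x => (M * \1_(boxN N) x)%:E)).
- exact/measurable_EFinP.
- move=> x _ /=; rewrite lee_fin indicE.
  have M0 : 0 <= M by apply: le_trans (GM x).
  have [xB|xB] := boolP (x \in boxN N).
    by rewrite mulr1 (ger0_norm M0).
  by rewrite G0 ?normr0// => /mem_set; exact/negP.
- have -> : (fun x => (M * \1_(boxN N) x)%:E) = (fun x => (M%:E * (EFin \o \1_(boxN N)) x)%E) by [].
  apply: integrableZl => //; apply/integrableP; split; first exact/measurable_EFinP/measurable_indic.
  under eq_integral do rewrite /= ger0_norm//.
  by rewrite integral_indic// setIT.
Qed.

Lemma sub0_eq (p q : \bar R) : p \is a fin_num -> q \is a fin_num -> (p - q = 0)%E -> p = q.
Proof.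
by case: p => // p; case: q => // q _ _; rewrite -EFinB => -[/eqP]; rewrite subr_eq0 => /eqP ->.
Qed.

(** On every line the positive and negative parts of G have the same finite integral, so
    [ge0_integral_line] applies to these two parts. *)
Lemma integral_line0 (j : 'I_n) (G : 'rV[R]_n -> R) (N M : R) :
  continuous G -> (forall x, `|G x| <= M) -> (forall x, ~ boxN N x -> G x = 0) ->
  (forall x, (\int[lebesgue_measure]_s (G (upd j x s))%:E = 0)%E) ->
  (\int[leb]_x (G x)%:E = 0)%E.
Proof.
move=> cG GM G0 Gline.
have mG : measurable_fun setT G by exact: continuousT_measurable_rV.
have iG := bounded_supp_integrable mG GM G0.
rewrite integralE.
have -> : (\int[leb]_x ((EFin \o G)^\+ x) = \int[leb]_x ((EFin \o G)^\- x))%E.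
  apply: (@ge0_integral_line R n j) => //.
  - by apply: measurable_funepos; exact/measurable_EFinP.
  - by apply: measurable_funeneg; exact/measurable_EFinP.
  move=> x.
  pose f s := (G (upd j x s))%:E.
  have ab : (\int[lebesgue_measure]_s f^\+ s - \int[lebesgue_measure]_s f^\- s = 0)%E.
    by rewrite -integralE; exact: Gline.
  have ml : measurable_fun setT (fun s => G (upd j x s)).
    by apply: (measurableT_comp mG); exact: measurable_upd.
  have il : lebesgue_measure.-integrable setT (EFin \o (fun s => G (upd j x s))).
    apply: (@le_integrable _ _ _ lebesgue_measure _ measurableT _ (fun s => (M * \1_(`[- N, N]%classic) s)%:E)).
    - exact/measurable_EFinP.
    - move=> s _ /=; rewrite lee_fin indicE.
      have M0 : 0 <= M by apply: le_trans (GM x).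
      have [xB|xB] := boolP (s \in `[- N, N]%classic).
        by rewrite mulr1 (ger0_norm M0).
      rewrite G0 ?normr0// => /(_ j); rewrite upd_eq => sN.
      by move/negP: xB; apply; rewrite inE/= in_itv/= -ler_norml.
    - pose I : set R := `[- N, N]%classic; rewrite -/I.
      have -> : (fun s => (M * \1_I s)%:E) = (fun s => (M%:E * (EFin \o \1_I) s)%E) by [].
      have mI : measurable I by exact: measurable_itv.
      have fI : (lebesgue_measure I < +oo)%E by rewrite /I lebesgue_measure_itv; case: ifP => _; rewrite ?ltry.
      apply: integrableZl => //; apply/integrableP; split; first exact/measurable_EFinP/measurable_indic.
      under eq_integral do rewrite /= ger0_norm//.
      by rewrite integral_indic// setIT.
  have fa : (\int[lebesgue_measure]_s f^\+ s)%E \is a fin_num by exact: integral_fune_fin_num (integrable_funepos _ il).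
  have fb : (\int[lebesgue_measure]_s f^\- s)%E \is a fin_num by exact: integral_fune_fin_num (integrable_funeneg _ il).
  have E1 s : ((EFin \o G)^\+ (upd j x s) = f^\+ s)%E by rewrite !funeposE.
  have E2 s : ((EFin \o G)^\- (upd j x s) = f^\- s)%E by rewrite !funenegE.
  under eq_integral do rewrite E1.
  under [RHS]eq_integral do rewrite E2.
  exact: (sub0_eq fa fb ab).
rewrite subee//.
exact: integral_fune_fin_num (integrable_funeneg _ iG).
Qed.

(** A line either misses the box, and F vanishes on it, or the fundamental theorem of calculus
    applies between two points where F is 0. *)
Lemma integral_pderiv0 (j : 'I_n) (F : 'rV[R]_n -> R) (N M : R) :
  0 < N -> (forall x, derivable F x 'e_j) -> continuous (pderiv j F) ->
  (forall x, `|pderiv j F x| <= M) -> (forall x, ~ boxN N x -> F x = 0) ->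
  (\int[leb]_x (pderiv j F x)%:E = 0)%E.
Proof.
move=> N0 dF cdF bdF F0.
have cB : closed (boxN N).
  rewrite (_ : boxN N = \bigcap_i [set x : 'rV[R]_n | `|x 0 i| <= N]); last first.
    by apply/seteqP; split => x /= h i => [_|]; [exact: h|exact: (h i Logic.I)].
  apply: closed_bigI => i _.
  apply: (@closed_comp _ _ (fun x : 'rV[R]_n => `|x 0 i|) [set r | r <= N]); last exact: closed_le.
  by move=> x _; apply: continuous_comp; [exact: coord_continuous|exact: norm_continuous].
have dF0 x : ~ boxN N x -> pderiv j F x = 0.
  move=> nB; rewrite -(proj2 (pderiv_cst j 0 x)).
  by have [_] := @pderiv_congr R n j F (fun=> 0) (~` boxN N) x (closed_openC cB) nB F0.
apply: (@integral_line0 j (pderiv j F) N M) => // x.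
have [Bx|nBx] := pselect (forall i, i != j -> `|x 0 i| <= N); last first.
  rewrite integral0_eq// => s _; rewrite dF0// => h; apply: nBx => i ij.
  by have := h i; rewrite upd_neq.
pose phi s := F (upd j x s).
have dphi (s : R) : is_derive s 1 phi (pderiv j F (upd j x s)).
  by apply: DeriveDef; [rewrite -derivable_upd; exact: dF|rewrite -derive_upd].
have cphi : continuous phi.
  move=> s; apply: differentiable_continuous; apply/derivable1_diffP.
  exact: (@ex_derive _ _ _ _ _ _ _ (dphi s)).
have z s : N < `|s| -> phi s = 0.
  by move=> sN; apply: F0 => /(_ j); rewrite upd_eq leNgt sN.
(* The extra 1 puts the end points strictly outside the box, where F vanishes. *)
pose J : set R := `[- (N + 1), N + 1]%classic.
transitivity (\int[lebesgue_measure]_(s in J) (pderiv j F (upd j x s))%:E)%E.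
  rewrite [RHS]integral_mkcond; apply: eq_integral => s _; rewrite patchE.
  case: ifPn => // sN; congr (_%:E); apply: dF0 => /(_ j); rewrite upd_eq => h.
  move/negP: sN; apply; rewrite inE /J /= in_itv/= -ler_norml (le_trans h)//.
  by rewrite lerDl.
rewrite (@continuous_FTC2 _ (fun s => pderiv j F (upd j x s)) phi).
- rewrite !z ?subee//.
  + by rewrite normrN gtr0_norm ?ltrDl ?addr_gt0.
  + by rewrite gtr0_norm ?ltrDl ?addr_gt0.
- by rewrite (@lt_trans _ _ 0)// ?oppr_lt0 addr_gt0.
- apply: continuous_subspaceT => s.
  by apply: continuous_comp; [exact: continuous_upd|exact: cdF].
- split; first by move=> s _; exact: (@ex_derive _ _ _ _ _ _ _ (dphi s)).
  + by apply: cvg_at_right_filter; exact: cphi.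
  + by apply: cvg_at_left_filter; exact: cphi.
- by move=> s _; rewrite derive1E; exact: (@derive_val _ _ _ _ _ _ _ (dphi s)).
Qed.

End shear_integral.

(** * Transport of densities by shears *)

Section transport.
Variables (R : realType) (T : topologicalType) (n : nat).
(* The solution theta of theta + g'(x + theta e_j) = g(x) defines a shear
   x + theta e_j that transports the density 1 + d_j g to 1 + d_j g'. *)
Variables (W : set T) (j : 'I_n) (g g' : T -> 'rV[R]_n -> R).
Hypotheses (oW : open W) (sg : smf W setT g) (sg' : smf W setT g').
Hypothesis slope : forall t x, W t -> - 2^-1 <= pderiv j (g' t) x.
Local Notation "''e_' i" := (delta_mx 0 i) (at level 8, i at level 2).

Let E t x r := r + g' t (x + r *: 'e_j).

Let line_derive t x r : W t ->
  is_derive (r : R) 1 (fun r => g' t (x + r *: 'e_j)) (pderiv j (g' t) (x + r *: 'e_j)).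
Proof.
move=> Wt; apply/is_deriveP_cvg.
have : derivable (g' t) (x + r *: 'e_j) 'e_j by exact: (smf_derivable sg').
rewrite /derivable /pderiv /derive => H.
apply: cvg_trans H; apply: near_eq_cvg; near=> h.
by rewrite /= /shift scalerDl addrCA -scalerA scale1r.
Unshelve. all: by end_near. Qed.

Let line_mvt t x r1 r2 : W t -> exists2 c, Num.min r1 r2 <= c <= Num.max r1 r2 &
  g' t (x + r2 *: 'e_j) - g' t (x + r1 *: 'e_j) = pderiv j (g' t) (x + c *: 'e_j) * (r2 - r1).
Proof.
move=> Wt.
wlog lt12 : r1 r2 / r1 < r2 => [hw|].
  case: (boolP (r1 < r2)) => [|]; first exact: hw.
  rewrite -leNgt le_eqVlt => /orP[/eqP->|gt12]; last first.
    have [c hc e] := hw _ _ gt12; exists c; first by rewrite minC maxC.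
    by rewrite -opprB e -mulrN opprB.
  by exists r1; [rewrite minxx maxxx lexx|rewrite !subrr mulr0].
have D r := line_derive x r Wt.
have [|c cI ->] := @MVT R (fun r => g' t (x + r *: 'e_j)) (fun r => pderiv j (g' t) (x + r *: 'e_j)) r1 r2 lt12.
  apply: derivable_within_continuous => r _; exact: (@ex_derive _ _ _ _ _ _ _ (D r)).
exists c => //; rewrite (min_idPl (ltW lt12)) (max_idPr (ltW lt12)).
by move: cI; rewrite in_itv/= => /andP[/ltW -> /ltW ->].
Qed.

(** In r the function [E] has slope 1 + d_j g' >= 1/2, hence the factor 2. Uniqueness of the root
    and its continuity in (t, x) both come from this inequality. *)
Let E_slope t x r1 r2 : W t -> `|r1 - r2| <= 2 * `|E t x r1 - E t x r2|.
Proof.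
move=> Wt; have [c _ e] := line_mvt x r2 r1 Wt.
rewrite /E [X in 2 * `|X|](_ : _ - _ = (1 + pderiv j (g' t) (x + c *: 'e_j)) * (r1 - r2)); last by rewrite mulrDl mul1r -e; ring.
rewrite normrM mulrA; apply: ler_peMl => //.
have := slope (x + c *: 'e_j) Wt; set d := pderiv _ _ _ => hd.
rewrite ger0_norm; lra.
Qed.

Let E_cont t x : W t -> continuous (E t x).
Proof.
move=> Wt r; apply: cvgD; first exact: cvg_id.
apply: differentiable_continuous; apply/derivable1_diffP.
exact: (@ex_derive _ _ _ _ _ _ _ (line_derive x r Wt)).
Qed.

Let E_incr t x r1 r2 : W t -> r1 <= r2 -> (r2 - r1) / 2 <= E t x r2 - E t x r1.
Proof.
move=> Wt r12; have [c _ e] := line_mvt x r1 r2 Wt.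
have := slope (x + c *: 'e_j) Wt; move: e; rewrite /E.
set d := pderiv _ _ _; set u := g' _ _; set v := g' _ _ => e hd.
have -> : r2 + u - (r1 + v) = (1 + d) * (r2 - r1) by rewrite mulrDl mul1r -e; ring.
rewrite mulrC ler_wpM2r ?subr_ge0//; lra.
Qed.

Let E_surj t x c : W t -> exists r, E t x r = c.
Proof.
(* As the slope is at least 1/2, a move by r0 changes [E] by at least |c - E(0)|, so c is reached
   between -r0 and r0. *)
move=> Wt; pose r0 := 2 * `|c - E t x 0|.
have r00 : 0 <= r0 by rewrite mulr_ge0.
have h1 := E_incr x Wt r00.
have h2 : (0 - (- r0)) / 2 <= E t x 0 - E t x (- r0) by apply: E_incr => //; rewrite oppr_le0.
have h3 : `|c - E t x 0| = r0 / 2 by rewrite /r0; lra.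
have h4 : E t x (- r0) <= c <= E t x r0.
  have := ler_norm (c - E t x 0); have := ler_norm (- (c - E t x 0)); rewrite normrN h3.
  by move=> h5 h6; apply/andP; split; lra.
have h5 : E t x (- r0) <= E t x r0 by case/andP: h4 => ? ?; apply: (@le_trans _ _ c).
have [|||r _ <-] := @IVT R (E t x) (- r0) r0 c; last by exists r.
- lra.
- by apply: continuous_subspaceT; exact: E_cont.
- by rewrite (min_idPl h5) (max_idPr h5).
Qed.

(** Identifies the root: a value that solves the equation is the root. In this way the shears are
    seen to be trivial off the box and inverse to each other. *)
Lemma transport_unique t x r1 r2 : W t ->
  r1 + g' t (x + r1 *: 'e_j) = r2 + g' t (x + r2 *: 'e_j) -> r1 = r2.
Proof.
move=> Wt e; have := E_slope x r1 r2 Wt; rewrite /E e subrr normr0 mulr0.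
by rewrite normr_le0 subr_eq0 => /eqP.
Qed.

Section root.
Variable theta : T -> 'rV[R]_n -> R.
Hypothesis thetaE : forall t x, W t -> theta t x + g' t (x + theta t x *: 'e_j) = g t x.

Let theta_jcont : jcont W setT theta.
Proof.
move=> t x Wt _.
pose r := theta t x.
(* By [E_slope], N bounds the distance of [theta] at p from r; it is continuous and vanishes at (t,
   x). *)
pose N (p : T * 'rV[R]_n) := 2 * `|g p.1 p.2 - (r + g' p.1 (p.2 + r *: 'e_j))|.
have cN : {for (t, x), continuous N}.
  apply: (@cvgM _ _ _ _ (fun=> 2)); first exact: cvg_cst.
  have c1 : {for (t, x), continuous (fun p : T * 'rV[R]_n => g' p.1 (p.2 + r *: 'e_j))}; last first.
    apply: cvg_norm; apply: cvgB; first exact: (smf_jcont sg).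
    by apply: (@cvgD _ _ _ _ _ (fun=> r)); [exact: cvg_cst|exact: c1].
  apply: (@continuous_comp _ _ _ (fun p : T * 'rV[R]_n => (p.1, p.2 + r *: 'e_j)) (fun p => g' p.1 p.2)).
    apply: continuous_pair; first exact: cvg_fst.
    by apply: cvgD; [exact: cvg_snd|exact: cvg_cst].
  exact: (smf_jcont sg').
have N0 : N (t, x) = 0 by rewrite /N /= thetaE// subrr normr0 mulr0.
apply/cvgrPdist_le => e e0.
have WN : \forall p \near (t, x), W p.1.
  exists (W, setT); first by split; [exact: open_nbhs_nbhs|exact: filterT].
  by move=> p [].
move/cvgrPdist_le : cN => /(_ e e0); rewrite N0; apply: filterS2 WN => -[s y] /= Ws.
rewrite sub0r normrN => hN; rewrite distrC.
apply: le_trans hN; apply: (le_trans (E_slope y _ _ Ws)).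
by rewrite /N [leRHS]ger0_norm ?mulr_ge0//= /E thetaE.
Qed.

Let theta_derive i t x : W t -> is_derive x 'e_i (theta t)
  ((pderiv i (g t) x - pderiv i (g' t) (x + theta t x *: 'e_j)) / (1 + pderiv j (g' t) (x + theta t x *: 'e_j))).
Proof.
move=> Wt; apply/is_deriveP_cvg.
set r := theta t x; set y := x + r *: 'e_j.
(* Implicit differentiation: with the intermediate point rho(h) of the mean value theorem in the
   direction e_j, the difference quotient of [theta] is exactly the claimed formula taken at rho(h)
   instead of r. *)
have /choice[rho hrho] : forall h : R, exists c, Num.min r (theta t (h *: 'e_i + x)) <= c <= Num.max r (theta t (h *: 'e_i + x)) /\
   g' t ((h *: 'e_i + x) + theta t (h *: 'e_i + x) *: 'e_j) - g' t ((h *: 'e_i + x) + r *: 'e_j) =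
   pderiv j (g' t) ((h *: 'e_i + x) + c *: 'e_j) * (theta t (h *: 'e_i + x) - r).
  by move=> h; have [c h1 h2] := line_mvt (h *: 'e_i + x) r (theta t (h *: 'e_i + x)) Wt; exists c.
have cx : (h *: 'e_i + x : 'rV[R]_n) @[h --> (0:R)^'] --> x.
  have : (h *: 'e_i + x : 'rV[R]_n) @[h --> (0:R)^'] --> (0 : R) *: ('e_i : 'rV[R]_n) + x.
    apply: cvgD; last exact: cvg_cst.
    by apply: cvgZ; [exact: cvg_within|exact: cvg_cst].
  by rewrite scale0r add0r.
have ct : theta t (h *: 'e_i + x) @[h --> (0:R)^'] --> r.
  by apply: cvg_comp cx _; exact: (jcont_slice theta_jcont).
have crho : rho h @[h --> (0:R)^'] --> r.
  apply/cvgrPdist_le => e e0; move/cvgrPdist_le : ct => /(_ e e0).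
  apply: filterS => h; have [hh _] := hrho h; apply: le_trans.
  move: hh; case: (leP r (theta t (h *: 'e_i + x))) => c /andP[c1 c2].
    by rewrite distrC ger0_norm ?subr_ge0// distrC ger0_norm ?subr_ge0// lerB.
  by rewrite ger0_norm ?subr_ge0// ger0_norm ?subr_ge0 ?(ltW c)// lerB.
have cd : 1 + pderiv j (g' t) ((h *: 'e_i + x) + rho h *: 'e_j) @[h --> (0:R)^'] --> 1 + pderiv j (g' t) y.
  apply: cvgD; first exact: cvg_cst.
  have cy : ((h *: 'e_i + x) + rho h *: 'e_j : 'rV[R]_n) @[h --> (0:R)^'] --> y.
    by apply: cvgD => //; apply: cvgZ => //; exact: cvg_cst.
  by apply: cvg_comp cy _; exact: (smf_continuous (smf_pderiv j sg')).
have pos z : 0 < 1 + pderiv j (g' t) z by have := slope z Wt; lra.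
have D1 : h^-1 *: (g t (h *: 'e_i + x) - g t x) @[h --> (0:R)^'] --> pderiv i (g t) x.
  exact: (smf_derivable sg).
have D2 : h^-1 *: (g' t (h *: 'e_i + y) - g' t y) @[h --> (0:R)^'] --> pderiv i (g' t) y.
  exact: (smf_derivable sg').
have K : (h^-1 *: (g t (h *: 'e_i + x) - g t x) - h^-1 *: (g' t (h *: 'e_i + y) - g' t y)) *
    (1 + pderiv j (g' t) ((h *: 'e_i + x) + rho h *: 'e_j))^-1 @[h --> (0:R)^'] -->
    (pderiv i (g t) x - pderiv i (g' t) y) / (1 + pderiv j (g' t) y).
  apply: cvgM; first exact: cvgB.
  by apply: cvgV => //; exact: lt0r_neq0.
apply: cvg_trans K; apply: near_eq_cvg; near=> h.
have [_ H] := hrho h.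
have e1 := thetaE (h *: 'e_i + x) Wt; have e2 := thetaE x Wt.
rewrite -/r -/y in e2.
rewrite /= /shift -/r.
have ey : h *: 'e_i + x + r *: 'e_j = h *: 'e_i + y by rewrite addrA.
rewrite ey in H.
have := pos (h *: 'e_i + x + rho h *: 'e_j).
move: H e1 e2; rewrite /GRing.scale/=.
set th := theta t _; set pd := pderiv j _ _; set A := g' t _; set B := g' t _; set C := g' t _; set G := g t _.
move=> H e1 e2 p0; apply: (mulIf (lt0r_neq0 p0)); rewrite mulfVK ?lt0r_neq0// -mulrBr -mulrA; congr (_ * _).
by move: H e1 e2; lra.
Unshelve. all: by end_near. Qed.

(** Bootstrap: by the formula of [theta_derive] the first derivatives of [theta] are smooth
    expressions in x and [theta], so order k yields order k + 1. *)
Lemma transport_smooth : smf W setT theta.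
Proof.
have oT : open [set: 'rV[R]_n] by exact: openT.
move=> k; elim: k => [|k IH]; first by split.
have D i t x (Wt : W t) := theta_derive i x Wt.
split; first exact: theta_jcont.
split; first by move=> i t x Wt _; exact: (@ex_derive _ _ _ _ _ _ _ (D i t x Wt)).
move=> i.
have hV t (x : 'rV[R]_n) : W t -> setT x -> [set: 'rV[R]_n] (x + theta t x *: 'e_j) by [].
have S1 := smk_shear oW oT oT (smf_pderiv i sg') IH hV.
have S2 := smk_shear oW oT oT (smf_pderiv j sg') IH hV.
have S3 := smkD oW oT (smf_pderiv i sg k) (smkN oW oT S1).
have S4 := smkD oW oT (smf_const W setT 1 k) S2.
have S5 : smk k W setT (fun t x => (1 + pderiv j (g' t) (x + theta t x *: 'e_j))^-1).
  apply: smkV => // t x Wt _; have := slope (x + theta t x *: 'e_j) Wt => h.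
  by apply: lt0r_neq0; lra.
apply: (smk_congr oW oT _ (smkM oW oT S3 S5)) => t x Wt _.
by rewrite /pderiv (@derive_val _ _ _ _ _ _ _ (D i t x Wt)).
Qed.

End root.

Lemma transport_exists : exists theta : T -> 'rV[R]_n -> R,
  smf W setT theta /\ forall t x, W t -> theta t x + g' t (x + theta t x *: 'e_j) = g t x.
Proof.
have /choice[th hth] : forall p : T * 'rV[R]_n, exists r, W p.1 -> E p.1 p.2 r = g p.1 p.2.
  move=> [t x] /=; have [Wt|nW] := pselect (W t); last by exists 0.
  by have [r hr] := E_surj x (g t x) Wt; exists r.
exists (fun t x => th (t, x)).
have h t x : W t -> th (t, x) + g' t (x + th (t, x) *: 'e_j) = g t x by move=> Wt; exact: (hth (t, x)).
by split => //; exact: (@transport_smooth (fun t x => th (t, x)) h).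
Qed.

End transport.

(** * Partial primitives *)

Section prim.
Variable R : realType.
Notation mu := (@lebesgue_measure R).

Definition prim (f : R -> R) (r : R) : R := \int[mu]_(s in `]-oo, r]) f s.

Variables (a b : R).
Definition supp_in (f : R -> R) := forall s, ~~ (a <= s <= b) -> f s = 0.

Lemma supp_integrable (f : R -> R) D : continuous f -> supp_in f -> measurable D ->
  mu.-integrable D (EFin \o f).
Proof.
move=> cf f0 mD.
suff : mu.-integrable setT (EFin \o f) by apply: integrableS.
pose J : set (measurableTypeR R) := `[a, b]%classic.
have h : mu.-integrable J (EFin \o f).
  apply: continuous_compact_integrable; first exact: segment_compact.
  exact: continuous_subspaceT.
have mI : measurable J by exact: measurable_itv.
move: h; rewrite integrable_mkcond// => H; rewrite (_ : EFin \o f = ((EFin \o f) \_ J)%E)//; apply/funext => s; rewrite patchE; case: ifPn => //= sI.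
by rewrite f0//; apply: contra sI => h; rewrite /J inE/= in_itv.
Qed.

Lemma prim_derive f r : continuous f -> supp_in f -> is_derive (r : R) 1 (prim f) (f r).
Proof.
move=> cf f0.
have r1 : r < r + 1 by rewrite ltrDl.
have fi : mu.-integrable [set` Interval -oo%O (BRight (r + 1))] (EFin \o f).
  by apply: supp_integrable => //; exact: measurable_itv.
have [|d1 d2] := continuous_FTC1 r1 fi _ (cf r).
  by rewrite ltNye_eq. 
by apply: DeriveDef; [exact: d1|rewrite -derive1E].
Qed.

Lemma primB f g r : continuous f -> supp_in f -> continuous g -> supp_in g ->
  prim (fun s => f s - g s) r = prim f r - prim g r.
Proof.
move=> cf f0 cg g0; rewrite /prim RintegralB//; try exact: supp_integrable.
Qed.

Lemma primZ (c : R) f r : continuous f -> supp_in f -> prim (fun s => c * f s) r = c * prim f r.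
Proof. by move=> cf f0; rewrite /prim RintegralZl//; exact: supp_integrable. Qed.

Lemma prim_bound f e r : continuous f -> supp_in f -> a <= b -> (forall s, `|f s| <= e) ->
  `|prim f r| <= e * (b - a).
Proof.
move=> cf f0 ab fe.
have e0 : 0 <= e by apply: le_trans (fe 0).
have mD : measurable (`]-oo, r] : set R) by exact: measurable_itv.
pose I : set R := `[a, b]%classic.
have mI : measurable I by exact: measurable_itv.
have fI : mu I = (b - a)%:E.
  rewrite /I lebesgue_measure_itv/= lte_fin; move: ab; rewrite le_eqVlt => /orP[/eqP ->|->//].
  by rewrite ltxx subrr.
have fIoo : (lebesgue_measure I < +oo)%E by rewrite /I lebesgue_measure_itv; case: ifP => _; rewrite ?ltry.
apply: (le_trans (@le_normr_Rintegral _ _ _ mu _ f mD (supp_integrable cf f0 mD))).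
apply: (@le_trans _ _ (\int[mu]_(s in `]-oo, r]) (e * \1_I s))).
  apply: le_Rintegral => //.
  - have := supp_integrable (f := fun s => `|f s|) _ _ mD; apply.
      by move=> s; apply: cvg_norm; exact: cf.
    by move=> s /f0 ->; rewrite normr0.
  - have -> : EFin \o (fun s => e * \1_I s) = (fun s => (e%:E * (EFin \o \1_I) s)%E) by [].
    apply: integrableZl => //; apply: (@integrableS _ _ _ mu setT) => //.
    apply/integrableP; split; first exact/measurable_EFinP/measurable_indic.
    under eq_integral do rewrite /= ger0_norm//.
    by rewrite integral_indic// setIT.
  move=> s _; rewrite indicE; have [sI|sI] := boolP (s \in I); first by rewrite mulr1.
  by rewrite f0 ?normr0 ?mulr0//; apply: contra sI => h; rewrite /I inE/= in_itv.
rewrite RintegralZl//; last first.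
  apply: (@integrableS _ _ _ mu setT) => //.
  apply/integrableP; split; first exact/measurable_EFinP/measurable_indic.
  under eq_integral do rewrite /= ger0_norm//.
  by rewrite integral_indic// setIT.
rewrite ler_wpM2l// /Rintegral integral_indic//.
rewrite -lee_fin fineK.
  by rewrite -fI; apply: le_measure; rewrite ?inE//; exact: measurableI.
rewrite ge0_fin_numE//; apply: (@le_lt_trans _ _ (mu I)); last by rewrite fI ltry.
by apply: le_measure; rewrite ?inE//; exact: measurableI.
Qed.

Lemma eq_prim f g r : f =1 g -> prim f r = prim g r.
Proof. by move=> fg; apply: eq_Rintegral => s _; exact: fg. Qed.

Lemma prim0 f r : (forall s, s <= r -> f s = 0) -> prim f r = 0.
Proof.
move=> f0; rewrite /prim.
transitivity (\int[mu]_(s in `]-oo, r]) (0 : R)).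
  by apply: eq_Rintegral => s /set_mem; rewrite /= in_itv/= => /f0.
by rewrite Rintegral_cst ?mul0r//; exact: measurable_itv.
Qed.

Lemma prim_ge f r : supp_in f -> b <= r -> prim f r = prim f b.
Proof.
move=> f0 br; rewrite /prim Rintegral_mkcond [RHS]Rintegral_mkcond.
apply: eq_Rintegral => s _; rewrite !patchE.
have E u : (s \in `]-oo, u]%classic) = (s <= u).
  by apply/idP/idP => [/set_mem|h]; [|apply/mem_set]; rewrite /= in_itv.
rewrite !E; case: (leP s b) => [sb|bs]; first by rewrite (le_trans sb br).
by case: ifP => // _; apply: f0; rewrite negb_and -!ltNge bs orbT.
Qed.

End prim.

Section partial_primitive.
Variables (R : realType) (T : topologicalType) (n : nat) (j : 'I_n) (a b : R).
Hypothesis ab : a <= b.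
Implicit Types (W : set T) (F : T -> 'rV[R]_n -> R).
Local Notation "''e_' i" := (delta_mx 0 i) (at level 8, i at level 2).

Definition supp_j W F := forall t (x : 'rV[R]_n), W t -> ~~ (a <= x 0 j <= b) -> F t x = 0.

Definition PI F (t : T) (x : 'rV[R]_n) : R := prim (fun s => F t (upd j x s)) (x 0 j).

Lemma jcont_line W F t x : jcont W setT F -> W t -> continuous (fun s => F t (upd j x s)).
Proof.
move=> cF Wt s; apply: (@continuous_comp _ _ _ (upd j x) (F t)); first exact: continuous_upd.
exact: (jcont_slice cF).
Qed.

Lemma supp_line W F t x : supp_j W F -> W t -> supp_in a b (fun s => F t (upd j x s)).
Proof. by move=> h Wt s hs; apply: h => //; rewrite upd_eq. Qed.

(** Uniformity in s comes from compactness of the segment, by a tube argument. *)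
Lemma unif_line W F t0 x0 e : jcont W setT F -> W t0 -> 0 < e ->
  \forall p \near (t0, x0), forall s, a <= s <= b -> `|F p.1 (upd j p.2 s) - F t0 (upd j x0 s)| <= e.
Proof.
move=> cF Wt e0.
have /compact_near_coveringP/(_ _ (nbhs (t0, x0)) (fun p s => `|F p.1 (upd j p.2 s) - F t0 (upd j x0 s)| <= e)) := @segment_compact R a b.
move=> H.
have {}H : \forall p \near (t0, x0), `[a, b] `<=` (fun s => `|F p.1 (upd j p.2 s) - F t0 (upd j x0 s)| <= e).
  apply: H => s _.
  have c1 : {for (s, (t0, x0)), continuous (fun q : R * (T * 'rV[R]_n) => F q.2.1 (upd j q.2.2 q.1) - F t0 (upd j x0 q.1))}.
    have cu : {for (s, (t0, x0)), continuous (fun q : R * (T * 'rV[R]_n) => upd j q.2.2 q.1)}.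
      rewrite (_ : (fun q => _) = (fun q : R * (T * 'rV[R]_n) => q.2.2 + (q.1 - q.2.2 0 j) *: 'e_j)); last by apply/funext => q; exact: updE.
      have c22 : {for (s, (t0, x0)), continuous (fun q : R * (T * 'rV[R]_n) => q.2.2)}.
        by apply: (@continuous_comp _ _ _ (fun q : R * (T * 'rV[R]_n) => q.2) snd); exact: cvg_snd.
      apply: cvgD; first exact: c22.
      apply: cvgZ; last exact: cvg_cst.
      apply: cvgB; first exact: cvg_fst.
      by apply: (@continuous_comp _ _ _ (fun q : R * (T * 'rV[R]_n) => q.2.2) (fun x : 'rV[R]_n => x 0 j)); [exact: c22|exact: coord_continuous].
    apply: cvgB.
      apply: (@continuous_comp _ _ _ (fun q : R * (T * 'rV[R]_n) => (q.2.1, upd j q.2.2 q.1)) (fun p => F p.1 p.2)); last exact: cF.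
      apply: continuous_pair => //.
      by apply: (@continuous_comp _ _ _ (fun q : R * (T * 'rV[R]_n) => q.2) fst); [exact: cvg_snd|exact: cvg_fst].
    apply: (@continuous_comp _ _ _ (fun q : R * (T * 'rV[R]_n) => q.1) (fun s => F t0 (upd j x0 s))); first exact: cvg_fst.
    exact: (jcont_line cF).
  move/cvgrPdist_le : c1 => /(_ e e0); rewrite /= subrr.
  move=> [[A B] /= [hA hB] hAB]; exists (A, B) => // -[s' p] /= [As Bp].
  by have := hAB (s', p) (conj As Bp); rewrite /= sub0r normrN.
by apply: filterS H => p hp s hs; apply: hp; rewrite /= in_itv.
Qed.

Lemma PI_jcont W F : open W -> jcont W setT F -> supp_j W F -> jcont W setT (PI F).
Proof.
move=> oW cF sF t0 x0 Wt _; apply/cvgrPdist_le => e e0.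
(* Half of e is for the change of the integrand, over a support of length b - a, and half for the
   moving end point. The added 1 covers a = b. *)
pose c := e / 2 / (b - a + 1).
have ba : 0 < b - a + 1 by rewrite ltr_wpDl// subr_ge0.
have c0 : 0 < c by rewrite !divr_gt0.
have H1 := unif_line x0 cF Wt c0.
have H2 : \forall p \near (t0, x0), `|prim (fun s => F t0 (upd j x0 s)) (x0 0 j) - prim (fun s => F t0 (upd j x0 s)) ((p.2 : 'rV[R]_n) 0 j)| <= e / 2.
  have e20 : 0 < e / 2 by rewrite divr_gt0.
  have : {for (t0, x0), continuous (fun p : T * 'rV[R]_n => prim (fun s => F t0 (upd j x0 s)) (p.2 0 j))}.
    apply: (@continuous_comp _ _ _ (fun p : T * 'rV[R]_n => p.2 0 j) (prim (fun s => F t0 (upd j x0 s)))).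
      apply: (@continuous_comp _ _ _ (fun p : T * 'rV[R]_n => p.2) (fun x : 'rV[R]_n => x 0 j)); first exact: cvg_snd.
      exact: coord_continuous.
    apply: differentiable_continuous; apply/derivable1_diffP.
    have := prim_derive (x0 0 j) (@jcont_line _ _ _ x0 cF Wt) (@supp_line _ _ _ x0 sF Wt).
    by move=> D; exact: (@ex_derive _ _ _ _ _ _ _ D).
  by move/cvgrPdist_le => /(_ _ e20).
have H3 : \forall p \near (t0, x0), W p.1.
  by exists (W, setT); [split; [exact: open_nbhs_nbhs|exact: filterT]|move=> p []].
near=> p.
have Wp : W p.1 by near: p.
have h1 : forall s, a <= s <= b -> `|F p.1 (upd j p.2 s) - F t0 (upd j x0 s)| <= c by near: p.
have h2 : `|prim (fun s => F t0 (upd j x0 s)) (x0 0 j) - prim (fun s => F t0 (upd j x0 s)) (p.2 0 j)| <= e / 2 by near: p.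
rewrite /PI /= -[X in `|X|](subrKA (prim (fun s => F t0 (upd j x0 s)) (p.2 0 j))).
rewrite (le_trans (ler_normD _ _))// [leRHS]splitr lerD// distrC -(@primB _ a b); last 4 first.
- exact: (jcont_line cF).
- exact: (supp_line _ sF Wp).
- exact: (jcont_line cF).
- exact: (supp_line _ sF Wt).
apply: (le_trans (@prim_bound _ a b _ c _ _ _ ab _)).
- by move=> s; apply: cvgB; exact: (jcont_line cF).
- by move=> s hs; rewrite (supp_line _ sF Wp hs) (supp_line _ sF Wt hs) subrr.
- move=> s; have [hs|hs] := boolP (a <= s <= b); first exact: h1.
  by rewrite (supp_line _ sF Wp hs) (supp_line _ sF Wt hs) subrr normr0 ltW.
- apply: (@le_trans _ _ (c * (b - a + 1))); first by rewrite ler_wpM2l ?(ltW c0)// lerDl.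
  by rewrite /c divfK// gt_eqF.
Unshelve. all: by end_near. Qed.

Lemma PI_derive_j W F t x : jcont W setT F -> supp_j W F -> W t ->
  is_derive x 'e_j (PI F t) (F t x).
Proof.
move=> cF sF Wt.
suff H : is_derive (x 0 j) 1 (fun s => PI F t (upd j x s)) (F t x).
  apply: DeriveDef; first by rewrite derivable_updx; exact: (@ex_derive _ _ _ _ _ _ _ H).
  by rewrite derive_updx; exact: (@derive_val _ _ _ _ _ _ _ H).
have -> : (fun s => PI F t (upd j x s)) = prim (fun s => F t (upd j x s)).
  by apply/funext => s; rewrite /PI upd_eq; apply: eq_prim => r; rewrite updK.
rewrite -[X in F t X](upd_id j); apply: (@prim_derive _ a b); [exact: (jcont_line cF)|exact: (supp_line _ sF Wt)].
Qed.

Lemma upd_shift i x s (h : R) : i != j -> upd j (h *: 'e_i + x) s = h *: 'e_i + upd j x s.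
Proof.
move=> ij; apply/rowP => k; rewrite !mxE; case: eqP => // ->.
by rewrite eqxx/= eq_sym (negbTE ij) mulr0 add0r.
Qed.

(** Differentiation under the integral sign: the difference quotient of F tends to its derivative
    uniformly on the support, by the mean value inequality and [unif_line]. *)
Lemma PI_derive_i W F t x i : i != j -> open W -> smf W setT F -> supp_j W F -> W t ->
  is_derive x 'e_i (PI F t) (PI (fun t => pderiv i (F t)) t x).
Proof.
move=> ij oW sF spF Wt; apply/is_deriveP_cvg; apply/cvgrPdist_le => e e0.
pose c := e / (b - a + 1).
have ba : 0 < b - a + 1 by rewrite ltr_wpDl// subr_ge0.
have c0 : 0 < c by rewrite !divr_gt0.
have cF := smf_jcont sF; have cdF := smf_jcont (smf_pderiv i sF).
have spdF : supp_j W (fun t => pderiv i (F t)).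
  move=> s y Ws hy; rewrite /pderiv.
  have E : (fun r : R => r^-1 *: ((F s \o shift y) (r *: 'e_i) - F s y)) = cst 0.
    apply/funext => r /=; rewrite !spF ?subrr ?scaler0//= /shift !mxE.
    by rewrite eqxx/= eq_sym (negbTE ij) mulr0 add0r.
  by rewrite /derive E; apply: lim_cst.
have := unif_line x cdF Wt c0 => -[[A B] /= [hA hB] hAB].
have /nbhs_ballP[d /= d0 hd] := hB.
have At : A t by exact: nbhs_singleton.
near=> h.
have h0 : h != 0 by near: h; exact: nbhs_dnbhs_neq.
have hd' : `|h| < d.
  by near: h; apply: dnbhs0_lt.
rewrite /PI /= /shift.
have -> : (h *: 'e_i + x) 0 j = x 0 j by rewrite !mxE eqxx/= eq_sym (negbTE ij) mulr0 add0r.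
have E1 : prim (fun s => F t (upd j (h *: 'e_i + x) s)) (x 0 j) - prim (fun s => F t (upd j x s)) (x 0 j) = prim (fun s => F t (upd j (h *: 'e_i + x) s) - F t (upd j x s)) (x 0 j).
  by rewrite (@primB _ a b)//; first [exact: (jcont_line cF)|exact: (supp_line _ spF Wt)].
rewrite E1 /GRing.scale/= -(@primZ _ a b); last 2 first.
- by move=> s; apply: cvgB; exact: (jcont_line cF).
- by move=> s hs; rewrite !(supp_line _ spF Wt hs) subrr.
rewrite -(@primB _ a b); last 4 first.
- exact: (jcont_line cdF).
- exact: (supp_line _ spdF Wt).
- move=> s; apply: cvgM; first exact: cvg_cst.
  by apply: cvgB; exact: (jcont_line cF).
- by move=> s hs; rewrite !(supp_line _ spF Wt hs) subrr mulr0.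
apply: (le_trans (@prim_bound _ a b _ c _ _ _ ab _)); last first.
- by rewrite /c -mulrA ler_piMr ?(ltW e0)// mulrC ler_pdivrMr// mul1r lerDl.
- move=> s; have [hs|hs] := boolP (a <= s <= b); last first.
    by rewrite (supp_line _ spdF Wt hs) !(supp_line _ spF Wt hs) subrr mulr0 subrr normr0 ltW.
  rewrite upd_shift// distrC -(@ler_pM2l _ `|h|) ?normr_gt0// -normrM mulrBr mulrA divff// mul1r.
  have := @mvt_slope R (fun r => F t (r *: 'e_i + upd j x s)) 0 h (pderiv i (F t) (upd j x s)) c.
  rewrite scale0r add0r subr0 [X in _ -> `|_ - X| <= _]mulrC [X in _ -> _ <= X]mulrC; apply => r hr.
  have rh : `|r| <= `|h|.
    move: hr; case: (leP 0 h) => h' /andP[r1 r2].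
      by rewrite !ger0_norm.
    by rewrite !ler0_norm ?lerN2// ltW.
  have D : is_derive (r : R) 1 (fun r => F t (r *: 'e_i + upd j x s)) (pderiv i (F t) (r *: 'e_i + upd j x s)).
    apply/is_deriveP_cvg.
    have : derivable (F t) (r *: 'e_i + upd j x s) 'e_i by exact: (smf_derivable sF).
    rewrite /derivable /pderiv /derive; apply: cvg_trans; apply: near_eq_cvg; near=> k.
    by rewrite /= /shift/= (_ : k%:A = k) ?scalerDl ?addrA//; exact: mulr1.
  split; first exact: (@ex_derive _ _ _ _ _ _ _ D).
  rewrite (@derive_val _ _ _ _ _ _ _ D) -upd_shift//.
  apply: (hAB (t, r *: 'e_i + x)) => //; split => //=.
  apply: hd; rewrite -ball_normE /= opprD addrCA subrr addr0 normrN normrZ.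
  apply: le_lt_trans hd'; apply: (@le_trans _ _ (`|r| * 1)); last by rewrite mulr1.
  rewrite ler_wpM2l// rV_norm_le// => k; rewrite mxE eqxx/=.
  by case: (k == i); rewrite ?normr1 ?normr0.
- by move=> s hs; rewrite (supp_line _ spdF Wt hs) !(supp_line _ spF Wt hs) subrr mulr0 subrr.
- by move=> s; apply: cvgB; [exact: (jcont_line cdF)|apply: cvgM; [exact: cvg_cst|apply: cvgB; exact: (jcont_line cF)]].
Unshelve. all: by end_near. Qed.

Lemma supp_pderiv W F i : smf W setT F -> supp_j W F -> supp_j W (fun t => pderiv i (F t)).
Proof.
move=> sF spF t y Wt hy.
have oU : open [set x : 'rV[R]_n | ~~ (a <= x 0 j <= b)].
  rewrite (_ : [set x | _] = ~` ((fun x : 'rV[R]_n => x 0 j) @^-1` `[a, b])); last first.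
    by apply/seteqP; split => x /=; rewrite in_itv/= => /negP.
  apply: closed_openC; apply: closed_comp; last exact: interval_closed.
  by move=> x _; exact: coord_continuous.
rewrite -(proj2 (pderiv_cst i 0 y)).
by have [_] := @pderiv_congr R n i (F t) (fun=> 0) _ y oU hy (fun x => spF t x Wt).
Qed.

(** Induction on the order: d_j turns the primitive of F back into F, and any other d_i gives the
    primitive of d_i F, which has its support in the same slab. *)
Lemma smf_PI W F : open W -> smf W setT F -> supp_j W F -> smf W setT (PI F).
Proof.
move=> oW + + k; elim: k F => [|k IH] F sF spF.
  by split => //; apply: PI_jcont => //; exact: smf_jcont.
have oT : open [set: 'rV[R]_n] by exact: openT.
split; first by apply: PI_jcont => //; exact: smf_jcont.
split.
  move=> i t x Wt _; have [->|ij] := eqVneq i j.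
    by have D := PI_derive_j x (smf_jcont sF) spF Wt; exact: (@ex_derive _ _ _ _ _ _ _ D).
  by have D := PI_derive_i x ij oW sF spF Wt; exact: (@ex_derive _ _ _ _ _ _ _ D).
move=> i; have [->|ij] := eqVneq i j.
  apply: (smk_congr oW oT _ (sF k)) => t x Wt _.
  by have D := PI_derive_j x (smf_jcont sF) spF Wt; rewrite /pderiv (@derive_val _ _ _ _ _ _ _ D).
have P := IH _ (smf_pderiv i sF) (@supp_pderiv _ _ i sF spF).
apply: (smk_congr oW oT _ P) => t x Wt _.
by have D := PI_derive_i x ij oW sF spF Wt; rewrite /pderiv (@derive_val _ _ _ _ _ _ _ D).
Qed.

End partial_primitive.

(** * Bump functions *)

(** Carrying the whole sequence of derivatives lets an induction on the order pass from one member
    of the sequence to the next. *)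
Definition smooth1 (R : realType) (s : R -> R) := exists D : nat -> R -> R,
  D 0 = s /\ forall k (r : R), is_derive r 1 (D k) (D k.+1 r).

Section smooth1.
Variable R : realType.

Lemma smooth1_affine (s : R -> R) c d : smooth1 s -> smooth1 (fun r => s (c * r + d)).
Proof.
move=> [D [D0 hD]]; exists (fun k r => c ^+ k * D k (c * r + d)); split.
  by apply/funext => r; rewrite expr0 mul1r D0.
move=> k r.
have A : is_derive r 1 (fun r => c * r + d) c.
  have -> : (fun r : R => c * r + d) = (c \*: (@id R) + cst d)%R by apply/funext.
  have h1 := is_deriveZ c (is_derive_id r (1 : R)).
  have := is_deriveD h1 (is_derive_cst d r (1 : R)).
  by rewrite addr0 /GRing.scale/= mulr1.
have B := is_derive1_comp (g := fun r => c * r + d) (hD k (c * r + d)) A.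
have C : is_derive r 1 (c ^+ k \*: (D k \o (fun r => c * r + d)))%R (c ^+ k *: (D k.+1 (c * r + d) * c)).
  exact: is_deriveZ.
by rewrite exprSr -mulrA [c * _]mulrC; exact: C.
Qed.

Lemma smf_comp_coord (T : topologicalType) n (W : set T) (U : set 'rV[R]_n) (s : R -> R) i :
  smooth1 s -> smf W U (fun _ x => s (x 0 i)).
Proof.
move=> [D [<- hD]].
have cD k : continuous (D k).
  move=> r; apply: differentiable_continuous; apply/derivable1_diffP.
  exact: (@ex_derive _ _ _ _ _ _ _ (hD k r)).
have C m : jcont W U (fun _ x => D m (x 0 i)).
  move=> t x _ _; apply: (@continuous_comp _ _ _ (fun p : T * 'rV[R]_n => p.2 0 i) (D m)); last exact: cD.
  apply: (@continuous_comp _ _ _ snd (fun x : 'rV[R]_n => x 0 i)); first exact: cvg_snd.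
  exact: coord_continuous.
have P m l (x : 'rV[R]_n) : derivable (fun x : 'rV[R]_n => D m (x 0 i)) x (delta_mx 0 l) /\
    pderiv l (fun x : 'rV[R]_n => D m (x 0 i)) x = (l == i)%:R * D m.+1 (x 0 i).
  suff H : is_derive (x 0 l) 1 (fun s => D m (upd l x s 0 i)) ((l == i)%:R * D m.+1 (x 0 i)).
    rewrite /pderiv derivable_updx derive_updx; split; first exact: (@ex_derive _ _ _ _ _ _ _ H).
    exact: (@derive_val _ _ _ _ _ _ _ H).
  have [->|li] := eqVneq l i.
    by rewrite mul1r; under eq_fun do rewrite upd_eq.
  rewrite mul0r; under eq_fun do rewrite upd_neq 1?eq_sym//.
  exact: is_derive_cst.
move=> k; suff H : forall k m, smk k W U (fun _ x => D m (x 0 i)) by exact: H.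
move=> {}k; elim: k => [|k IH] m; first by split.
split => //; split; first by move=> l t x _ _; exact: (proj1 (P m l x)).
move=> l; have -> : (fun _ : T => pderiv l (fun x : 'rV[R]_n => D m (x 0 i))) = fun _ x => (l == i)%:R * D m.+1 (x 0 i).
  by apply/funext => t; apply/funext => x; exact: (proj2 (P m l x)).
have [_|_] := eqVneq l i.
  by have -> : (fun (_ : T) (x : 'rV[R]_n) => true%:R * D m.+1 (x 0 i)) = fun _ x => D m.+1 (x 0 i) by apply/funext => t; apply/funext => x; rewrite mul1r.
have -> : (fun (_ : T) (x : 'rV[R]_n) => false%:R * D m.+1 (x 0 i)) = fun _ _ => 0 by apply/funext => t; apply/funext => x; rewrite mul0r.
exact: smf_const.
Qed.

(* This class of functions is closed under derivation. *)
Definition flat (p : {poly R}) (s : R) : R := if 0 < s then p.[s^-1] * expR (- s^-1) else 0.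

(** With y = 1/s >= 1, |p(y)| <= A y^m, while the term of order m + 2 of the exponential series
    gives exp(-y) <= (m+2)! / y^(m+2). The surplus y^(-2) is s^2, enough for a zero derivative at
    0. *)
Lemma flat_bound (p : {poly R}) : exists2 C, 0 <= C & forall s, 0 < s -> s <= 1 ->
  `|flat p s| <= C * s ^+ 2.
Proof.
pose m := size p; pose A := \sum_(i < m) `|p`_i|.
have A0 : 0 <= A by apply: sumr_ge0.
exists (A * (m.+2)`!%:R); first by rewrite mulr_ge0.
move=> s s0 s1; rewrite /flat s0 normrM (ger0_norm (expR_ge0 _)).
pose y := s^-1; rewrite -/y.
have y0 : 0 < y by rewrite invr_gt0.
have y1 : 1 <= y by rewrite invr_ge1 ?unitf_gt0.
have h1 : `|p.[y]| <= A * y ^+ m.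
  rewrite horner_coef mulr_suml; apply: (le_trans (ler_norm_sum _ _ _)); apply: ler_sum => i _.
  rewrite normrM normrX (gtr0_norm y0) ler_wpM2l// ler_weXn2l//.
  exact: ltnW.
have h2 : y ^+ m.+2 / (m.+2)`!%:R <= expR y.
  by apply: le_trans (expR_ge1Dxn m.+1 (ltW y0)); rewrite lerDr.
rewrite expRN.
have f0 : 0 < (m.+2)`!%:R :> R by rewrite ltr0n fact_gt0.
have h3 : (expR y)^-1 <= (m.+2)`!%:R / y ^+ m.+2.
  rewrite -[leRHS]invf_div lef_pV2 ?posrE ?expR_gt0//.
  by rewrite divr_gt0// exprn_gt0.
apply: (@le_trans _ _ (A * y ^+ m * ((m.+2)`!%:R / y ^+ m.+2))).
  by apply: ler_pM => //; rewrite invr_ge0 expR_ge0.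
rewrite le_eqVlt; apply/orP; left; apply/eqP.
have ys : s = y^-1 by rewrite /y invrK.
move: y0; rewrite ys => y0; clearbody y.
rewrite exprVn -addn2 exprD; have : y ^+ m != 0 by rewrite expf_neq0// gt_eqF.
have : y != 0 by exact: lt0r_neq0.
set z := y ^+ m; set w := _%:R; clearbody w z => yn zn; field.
by rewrite yn zn.
Qed.

(** For s > 0 the chain rule yields (p - p')(1/s) s^(-2) exp(-1/s); at 0 the quadratic bound
    [flat_bound] makes the difference quotient tend to 0. *)
Lemma flat_derive (p : {poly R}) (s : R) :
  is_derive s 1 (flat p) (flat ('X^2 * (p - p^`())) s).
Proof.
have [s0|s0|->] := ltgtP s 0.
- have -> : flat ('X^2 * (p - p^`())) s = (0 : R) by rewrite /flat ltNge (ltW s0).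
  have hc : is_derive (s : R) (1 : R) (fun _ : R => 0 : R) 0 by exact: is_derive_cst.
  apply: (near_eq_is_derive _ hc).
  near=> r; rewrite /flat ltNge (_ : r <= 0)//.
  by apply: ltW; near: r; exact: lt_nbhsl.
- have sn : s != 0 by rewrite gt_eqF.
  have iv : is_derive (s : R) (1 : R) (fun r : R => r^-1) (- s ^- 2).
    apply: DeriveDef; first by apply: derivableV => //; exact: derivable_id.
    by rewrite deriveV// derive_id /GRing.scale/= mulr1.
  have h1 : is_derive (s : R) (1 : R) (horner p \o (fun r : R => r^-1)) (p^`().[s^-1] * (- s ^- 2)).
    exact: is_derive1_comp.
  have h2 : is_derive (s : R) (1 : R) (fun r : R => - r^-1) (s ^- 2).
    by rewrite -[X in is_derive _ _ _ X]opprK; exact: is_deriveN.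
  have h3 : is_derive (s : R) (1 : R) (expR \o (fun r : R => - r^-1)) (expR (- s^-1) * s ^- 2).
    exact: is_derive1_comp.
  have h4 := is_deriveM h1 h3.
  have E : \forall r \near s, ((horner p \o (fun r : R => r^-1)) * (expR \o (fun r : R => - r^-1)))%R r = flat p r.
    near=> r; rewrite /flat (_ : 0 < r)//.
    by near: r; exact: lt_nbhsr.
  have := near_eq_is_derive E h4.
  set L := (X in is_derive _ _ _ X -> _); set RR := (X in _ -> is_derive _ _ _ X).
  suff -> : L = RR by [].
  have alg (P P' e y : R) : P * (e * y) + e * (P' * - y) = (y * (P - P')) * e by ring.
  rewrite /L /RR /flat s0 hornerM hornerXn hornerD hornerN -alg exprVn //.
have f0 (q : {poly R}) : flat q 0 = 0 by rewrite /flat ltxx.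
rewrite f0; apply/is_deriveP_cvg.
have [C C0 hC] := flat_bound p.
apply/cvgrPdist_le => e e0.
have C1 : 0 < C + 1 by rewrite ltr_wpDl.
near=> h.
have h0 : h != 0 by near: h; exact: nbhs_dnbhs_neq.
rewrite f0 subr0 sub0r normrN /= /shift addr0 /GRing.scale/= mulr1.
have [hp|hn] := ltP 0 h; last by rewrite /flat ltNge hn/= mulr0 normr0 ltW.
have h1 : `|h| < Num.min 1 (e / (C + 1)).
  by near: h; apply: dnbhs0_lt; rewrite lt_min ltr01 divr_gt0.
move: h1; rewrite gtr0_norm// lt_min => /andP[h1 h2].
rewrite normrM normfV (gtr0_norm hp) ler_pdivrMl// (le_trans (hC _ hp (ltW h1)))//.
rewrite expr2 mulrA mulrC ler_wpM2l ?ltW//.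
move: h2; rewrite ltr_pdivlMr// => h2.
by apply: le_lt_trans h2; rewrite mulrC ler_wpM2l ?(ltW hp)// lerDl.
Unshelve. all: by end_near. Qed.

Definition bump0 := flat 1.

Lemma bump0_smooth : smooth1 bump0.
Proof.
pose P := fix P (k : nat) : {poly R} := if k is k'.+1 then 'X^2 * (P k' - (P k')^`()) else 1.
exists (fun k => flat (P k)); split => // k r; exact: flat_derive.
Qed.

Lemma bump0_gt0 s : (0 < bump0 s) = (0 < s).
Proof.
rewrite /bump0 /flat; case: ifP => s0; last by rewrite ltxx.
by rewrite hornerC mul1r expR_gt0.
Qed.

Lemma bump0_ge0 s : 0 <= bump0 s.
Proof. by rewrite /bump0 /flat; case: ifP => s0 //; rewrite hornerC mul1r expR_ge0. Qed.

Lemma bump0_eq0 s : s <= 0 -> bump0 s = 0.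
Proof. by rewrite /bump0 /flat ltNge => ->. Qed.

Lemma smooth1_continuous (s : R -> R) : smooth1 s -> continuous s.
Proof.
move=> [D [<- hD]] r; apply: differentiable_continuous; apply/derivable1_diffP.
exact: (@ex_derive _ _ _ _ _ _ _ (hD 0%N r)).
Qed.

Definition hat (a b s : R) := bump0 (s - a) * bump0 (b - s).

Lemma hat_ge0 a b s : 0 <= hat a b s.
Proof. by rewrite mulr_ge0// bump0_ge0. Qed.

Lemma hat_gt0 a b s : a < s < b -> 0 < hat a b s.
Proof. by move=> /andP[h1 h2]; rewrite mulr_gt0// bump0_gt0 subr_gt0. Qed.

Lemma hat_eq0 a b s : ~~ (a < s < b) -> hat a b s = 0.
Proof.
rewrite negb_and -!leNgt /hat => /orP[h|h].
  by rewrite bump0_eq0 ?mul0r// subr_le0.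
by rewrite [X in _ * X]bump0_eq0 ?mulr0// subr_le0.
Qed.

Lemma smf_hat (T : topologicalType) n (W : set T) (U : set 'rV[R]_n) a b i : open W -> open U ->
  smf W U (fun _ x => hat a b (x 0 i)).
Proof.
move=> oW oU; apply: (smfM oW oU).
  have h := smooth1_affine 1 (- a) bump0_smooth.
  have := smf_comp_coord W U i h.
  by apply: (smf_congr oW oU) => t x _ _; rewrite mul1r.
have h := smooth1_affine (-1) b bump0_smooth.
have := smf_comp_coord W U i h.
by apply: (smf_congr oW oU) => t x _ _; rewrite mulN1r addrC.
Qed.

Lemma continuous_hat a b : continuous (hat a b).
Proof.
have c := smooth1_continuous bump0_smooth.
move=> s; apply: cvgM.
  apply: (@continuous_comp _ _ _ (fun s => s - a) bump0); last exact: c.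
  by apply: cvgB; [exact: cvg_id|exact: cvg_cst].
apply: (@continuous_comp _ _ _ (fun s => b - s) bump0); last exact: c.
by apply: cvgB; [exact: cvg_cst|exact: cvg_id].
Qed.

Definition step (s : R) := bump0 s / (bump0 s + bump0 (1 - s)).

Lemma step_den s : 0 < bump0 s + bump0 (1 - s).
Proof.
have [s0|s0] := ltP 0 s; first by rewrite ltr_pwDl ?bump0_gt0// bump0_ge0.
by rewrite ltr_pwDr ?bump0_ge0// bump0_gt0; lra.
Qed.

Lemma step_eq1 s : 1 <= s -> step s = 1.
Proof.
move=> s1; rewrite /step [X in _ + X]bump0_eq0; last by rewrite subr_le0.
by rewrite addr0 divff// gt_eqF// bump0_gt0; lra.
Qed.

Lemma step_eq0 s : s <= 0 -> step s = 0.
Proof. by move=> s0; rewrite /step bump0_eq0 ?mul0r. Qed.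

Lemma step_ge0 s : 0 <= step s.
Proof. by rewrite divr_ge0 ?bump0_ge0// ltW ?step_den. Qed.

Lemma smf_step (T : topologicalType) n (W : set T) (U : set 'rV[R]_n) c d i : open W -> open U ->
  smf W U (fun _ x => step (c * x 0 i + d)).
Proof.
move=> oW oU.
have h1 := smf_comp_coord W U i (smooth1_affine c d bump0_smooth).
have h2 : smf W U (fun _ x => bump0 (1 - (c * x 0 i + d))).
  have := smf_comp_coord W U i (smooth1_affine (- c) (1 - d) bump0_smooth).
  apply: (smf_congr oW oU) => t x _ _; congr bump0; ring.
apply: (smfM oW oU h1); apply: (smfV oW oU); last exact: smfD.
by move=> t x _ _; rewrite gt_eqF// step_den.
Qed.

End smooth1.

(** * Moser's averaging in one direction *)

Section pos.
Variables (R : realType) (n : nat).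
Notation leb := (lebesgue_rV R n).

(** By continuity f is at least f(p)/2 on a cube around p, which has positive volume. *)
Lemma integral_pos (f : 'rV[R]_n -> R) p : measurable_fun setT f -> {for p, continuous f} ->
  (forall x, 0 <= f x) -> 0 < f p -> (0 < \int[leb]_x (f x)%:E)%E.
Proof.
move=> mf cf f0 fp.
have [e /= e0 he] : exists2 e, 0 < e & forall y, ball p e y -> f p / 2 <= f y.
  have := cf; rewrite /prop_for /continuous_at => /cvgrPdist_le /(_ (f p / 2)) H.
  have /nbhs_ballP[e e0 h] := H (divr_gt0 fp (ltr0Sn _ 1)).
  exists e => // y /h /=; rewrite ler_distl => /andP[_ h2]; lra.
pose I i : set R := `]p 0 i - e, p 0 i + e[%classic.
have mI i : measurable (I i) by exact: measurable_itv.
pose B := [set x : 'rV[R]_n | forall i, I i (x 0 i)].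
have mB : measurable B by exact: (@measurable_box R n I).
have lB : (0 < leb B)%E.
  rewrite (@lebesgue_rV_box R n I)//.
  have -> : (\prod_(i < n) lebesgue_measure (I i) = (\prod_(i < n) (e + e))%:E)%E.
    rewrite (big_morph EFin (@EFinM R) (erefl _)); apply: eq_bigr => i _; rewrite /I lebesgue_measure_itv/= lte_fin.
    have -> : p 0 i - e < p 0 i + e by lra.
    by rewrite -EFinB; congr (_%:E); lra.
  by rewrite lte_fin prodr_gt0// => i _; rewrite addr_gt0.
apply: (@lt_le_trans _ _ (\int[leb]_x ((f p / 2)%:E * (\1_B x)%:E))%E).
  rewrite ge0_integralZl//; first by rewrite integral_indic// setIT mule_gt0// lte_fin divr_gt0.
  - exact/measurable_EFinP/measurable_indic.
  - by rewrite lee_fin divr_ge0// ltW.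
apply: ge0_le_integral => //.
- by move=> x _; rewrite -EFinM lee_fin mulr_ge0// divr_ge0// ltW.
- by apply/measurable_EFinP; apply: measurable_funM => //; exact: measurable_indic.
- exact/measurable_EFinP.
move=> x _; rewrite -EFinM lee_fin indicE; have [xB|xB] := boolP (x \in B); last by rewrite mulr0.
rewrite mulr1; apply: he; apply/rV_ballP; split => // i.
have := set_mem xB => /(_ i); rewrite /I /= in_itv/= => /andP[h1 h2].
by rewrite ltr_norml; apply/andP; split; lra.
Qed.

End pos.

Section moser.
Variables (R : realType) (T : topologicalType) (n : nat) (a b : 'I_n -> R).
Hypothesis ab : forall i, a i < b i.
Local Notation "''e_' i" := (delta_mx 0 i) (at level 8, i at level 2).
Notation leb := (lebesgue_rV R n).
Implicit Types (W : set T) (F : T -> 'rV[R]_n -> R).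

Definition cbox : set 'rV[R]_n := [set x | forall i, a i <= x 0 i <= b i].

Lemma closed_cbox : closed cbox.
Proof.
rewrite (_ : cbox = \bigcap_i [set x : 'rV[R]_n | `[a i, b i]%classic (x 0 i)]); last first.
  by apply/seteqP; split => x /= h i => [_|]; [exact: h|exact: (h i Logic.I)].
apply: closed_bigI => i _.
apply: (@closed_comp _ _ (fun x : 'rV[R]_n => x 0 i)); last exact: interval_closed.
by move=> x _; exact: coord_continuous.
Qed.

Definition cbox_bound : R := \sum_i (`|a i| + `|b i|).

Lemma cbox_boundP x : cbox x -> boxN cbox_bound x.
Proof.
move=> Kx i; have /andP[h1 h2] := Kx i.
rewrite /cbox_bound (bigD1 i)//= (@le_trans _ _ (`|a i| + `|b i|))//; last first.
  by rewrite lerDl sumr_ge0// => k _; rewrite addr_ge0.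
rewrite ler_norml; apply/andP; split.
  rewrite (le_trans _ h1)// lerNl.
  by rewrite (le_trans (ler_norm _))// normrN lerDl.
by rewrite (le_trans h2)// (le_trans (ler_norm _))// lerDr.
Qed.

Lemma compact_cbox : compact cbox.
Proof.
apply: bounded_closed_compact; last exact: closed_cbox.
exists cbox_bound; split; first exact: num_real.
move=> M hM x /cbox_boundP h; apply: rV_norm_le; last by move=> i; rewrite (le_trans (h i))// ltW.
by rewrite (le_trans _ (ltW hM))// sumr_ge0// => i _; rewrite addr_ge0.
Qed.

(** The total integral of the hat function, which vanishes beyond b_j; dividing by it normalises
    [eta] to integral 1. *)
Definition eta0 j : R := prim (hat (a j) (b j)) (b j).

Lemma eta0_gt0 j : 0 < eta0 j.
Proof.
have sB : supp_in (a j) (b j) (hat (a j) (b j)).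
  by move=> s hs; rewrite hat_eq0//; apply: contra hs => /andP[h1 h2]; rewrite !ltW.
have D r := @prim_derive R (a j) (b j) (hat (a j) (b j)) r (@continuous_hat R _ _) sB.
have [c cI E] := @MVT R (prim (hat (a j) (b j))) (hat (a j) (b j)) (a j) (b j) (ab j) (fun x _ => D x)
  (continuous_subspaceT (fun x => differentiable_continuous (iffLR (derivable1_diffP _ _) (@ex_derive _ _ _ _ _ _ _ (D x))))).
move: E; rewrite [X in _ - X]prim0; last first.
  by move=> s sa; rewrite hat_eq0// negb_and -leNgt sa.
rewrite subr0 /eta0 => ->; rewrite mulr_gt0 ?subr_gt0//.
by apply: hat_gt0; move: cI; rewrite in_itv.
Qed.

Definition eta j (s : R) := hat (a j) (b j) s / eta0 j.

Lemma eta_ge0 j s : 0 <= eta j s.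
Proof. by rewrite divr_ge0 ?hat_ge0// ltW// eta0_gt0. Qed.

Lemma eta_supp j : supp_in (a j) (b j) (eta j).
Proof.
by move=> s hs; rewrite /eta hat_eq0 ?mul0r//; apply: contra hs => /andP[h1 h2]; rewrite !ltW.
Qed.

Lemma eta_continuous j : continuous (eta j).
Proof. by move=> s; apply: cvgM; [exact: continuous_hat|exact: cvg_cst]. Qed.

Lemma prim_eta j : prim (eta j) (b j) = 1.
Proof.
rewrite (@eq_prim _ _ (fun s => (eta0 j)^-1 * hat (a j) (b j) s)); last by move=> s; rewrite mulrC.
rewrite (@primZ _ (a j) (b j)).
- by rewrite -/(eta0 j) mulVf// gt_eqF// eta0_gt0.
- exact: continuous_hat.
- by move=> s hs; rewrite hat_eq0//; apply: contra hs => /andP[h1 h2]; rewrite !ltW.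
Qed.

Lemma smf_eta W (U : set 'rV[R]_n) j : open W -> open U -> smf W U (fun _ x => eta j (x 0 j)).
Proof. by move=> oW oU; apply: (smfM oW oU); [exact: smf_hat|exact: smf_const]. Qed.

(** The integral of F over the whole line through x parallel to e_j, for F supported in the box:
    there the primitive is constant beyond b_j. *)
Definition lint j F (t : T) (x : 'rV[R]_n) : R := PI j F t (upd j x (b j)).

Lemma lintE j F t x : lint j F t x = prim (fun s => F t (upd j x s)) (b j).
Proof. by rewrite /lint /PI upd_eq; apply: eq_prim => s; rewrite updK. Qed.

(* Replaces the dependence of F on x_j by the fixed profile eta_j and keeps the
   integral over every line parallel to e_j. *)
Definition moser j F (t : T) (x : 'rV[R]_n) : R := eta j (x 0 j) * lint j F t x.

Definition suppK W F := forall t x, W t -> ~ cbox x -> F t x = 0.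

Lemma suppK_j W F j : suppK W F -> supp_j j (a j) (b j) W F.
Proof. by move=> h t x Wt hx; apply: h => // /(_ j) h2; rewrite h2 in hx. Qed.

Lemma smf_lint W F j : open W -> smf W setT F -> suppK W F -> smf W setT (lint j F).
Proof.
move=> oW sF spF.
have oT : open [set: 'rV[R]_n] by exact: openT.
have H1 := smf_PI (ltW (ab j)) oW sF (suppK_j (j := j) spF).
have H2 : smf W [set: 'rV[R]_n] (fun _ x => b j - x 0 j).
  by apply: (smfB oW oT); [exact: smf_const|exact: smf_coord].
have := smf_shear (j := j) oW oT oT H1 H2 (fun _ _ _ _ => I).
by apply: (smf_congr oW oT) => t x _ _; rewrite /lint updE.
Qed.

Lemma smf_moser W F j : open W -> smf W setT F -> suppK W F -> smf W setT (moser j F).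
Proof.
move=> oW sF spF; apply: (smfM oW (@openT _)); last exact: smf_lint.
by apply: smf_eta => //; exact: openT.
Qed.

Lemma lint0 W F j t (x : 'rV[R]_n) : suppK W F -> W t -> (exists2 i, i != j & ~~ (a i <= x 0 i <= b i)) -> lint j F t x = 0.
Proof.
move=> spF Wt [i ij hi]; rewrite lintE prim0// => s _; apply: spF => // /(_ i).
by rewrite upd_neq// => h; rewrite h in hi.
Qed.

Lemma not_cbox x j : ~ cbox x -> ~~ (a j <= x 0 j <= b j) \/ exists2 i, i != j & ~~ (a i <= x 0 i <= b i).
Proof.
move=> nK; have [h|h] := boolP (a j <= x 0 j <= b j); last by left.
right; apply: contrapT => H; apply: nK => i; apply: contrapT => /negP hi; apply: H.
by exists i => //; apply: contra hi => /eqP ->.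
Qed.

Lemma suppK_moser W F j : suppK W F -> suppK W (moser j F).
Proof.
move=> spF t x Wt /(@not_cbox _ j)[h|h]; rewrite /moser; first by rewrite (eta_supp h) mul0r.
by rewrite (lint0 spF Wt h) mulr0.
Qed.

Lemma moser0 F j t : (forall x, F t x = 0) -> forall x, moser j F t x = 0.
Proof. by move=> F0 x; rewrite /moser lintE prim0 ?mulr0. Qed.

Lemma moser_upd F j t x s : moser j F t (upd j x s) = lint j F t x * eta j s.
Proof.
rewrite /moser upd_eq mulrC; congr (_ * _); rewrite !lintE.
by apply: eq_prim => r; rewrite updK.
Qed.

Lemma lint_moser W F j t x : open W -> smf W setT F -> suppK W F -> W t ->
  lint j (moser j F) t x = lint j F t x.
Proof.
move=> oW sF spF Wt; rewrite [LHS]lintE.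
rewrite (@eq_prim _ _ (fun s => lint j F t x * eta j s)); last by move=> s; exact: moser_upd.
by rewrite (@primZ _ (a j) (b j)) ?prim_eta ?mulr1//; [exact: eta_continuous|exact: eta_supp].
Qed.

Lemma compact_bound (K : set 'rV[R]_n) (f : 'rV[R]_n -> R) : compact K -> continuous f ->
  (forall x, ~ K x -> f x = 0) -> exists M, forall x, `|f x| <= M.
Proof.
move=> cK cf f0.
have [M [_ HM]] : bounded_set (f @` K).
  by apply: compact_bounded; apply: continuous_compact => //; exact: continuous_subspaceT.
exists (Num.max 0 (M + 1)) => x; rewrite le_max.
have [Kx|nK] := pselect (K x); last by rewrite f0// normr0 lexx.
by apply/orP; right; apply: HM; [rewrite ltrDl|exists x].
Qed.

Lemma smfT_continuous W F t : smf W setT F -> W t -> continuous (F t).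
Proof. by move=> sF Wt x; exact: (smf_continuous sF). Qed.

Lemma suppK_integrable W F t : smf W setT F -> suppK W F -> W t -> leb.-integrable setT (EFin \o F t).
Proof.
move=> sF spF Wt.
have [M HM] := compact_bound compact_cbox (smfT_continuous sF Wt) (fun x => spF t x Wt).
apply: (@bounded_supp_integrable R n (F t) cbox_bound M) => //.
  by apply: continuousT_measurable_rV; exact: (smfT_continuous sF).
by move=> x nB; apply: spF => // Kx; apply: nB; exact: cbox_boundP.
Qed.

Lemma integral_prim (f : R -> R) (c d : R) : continuous f -> supp_in c d f ->
  (\int[lebesgue_measure]_s (f s)%:E = (prim f d)%:E)%E.
Proof.
move=> cf f0.
have mD : measurable (`]-oo, d]%classic : set (measurableTypeR R)) by exact: measurable_itv.
rewrite /prim /Rintegral fineK; last first.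
  exact: integrable_fin_num (supp_integrable cf f0 mD).
rewrite [RHS]integral_mkcond; apply: eq_integral => s _; rewrite patchE.
case: ifPn => // sN; rewrite f0//; apply: contra sN => /andP[_ h].
by apply/mem_set; rewrite /= in_itv.
Qed.

(** The difference of the two functions has integral 0 on every line parallel to e_j, so
    [integral_line0] applies. *)
Lemma integral_moser W F j t : open W -> smf W setT F -> suppK W F -> W t ->
  (\int[leb]_x (moser j F t x)%:E = \int[leb]_x (F t x)%:E)%E.
Proof.
move=> oW sF spF Wt.
have sM := smf_moser j oW sF spF.
have spM := suppK_moser j spF.
have iF := suppK_integrable sF spF Wt.
have iM := suppK_integrable sM spM Wt.
have oT : open [set: 'rV[R]_n] by exact: openT.
have sG : smf W setT (fun t x => moser j F t x - F t x) by exact: (smfB oW oT).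
have spG : suppK W (fun t x => moser j F t x - F t x).
  by move=> t' x Wt' nK; rewrite spM// spF// subrr.
have [M HM] := compact_bound compact_cbox (smfT_continuous sG Wt) (fun x => spG t x Wt).
have := @integral_line0 R n j (fun x => moser j F t x - F t x) cbox_bound M.
move=> /(_ (smfT_continuous sG Wt) HM).
have H1 x : ~ boxN cbox_bound x -> moser j F t x - F t x = 0.
  by move=> nB; apply: spG => // Kx; apply: nB; exact: cbox_boundP.
move=> /(_ H1) H; have {}H := H _.
have : (\int[leb]_x (moser j F t x - F t x)%:E = 0)%E.
  apply: H => x.
  have cl : continuous (fun s => F t (upd j x s)) by exact: (jcont_line (smf_jcont sF)).
  have cl' : continuous (fun s => moser j F t (upd j x s)) by exact: (jcont_line (smf_jcont sM)).
  have sl := supp_line x (suppK_j (j := j) spF) Wt.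
  have sl' := supp_line x (suppK_j (j := j) spM) Wt.
  rewrite (@integral_prim _ (a j) (b j)).
  - by rewrite (@primB _ (a j) (b j))// -!lintE (@lint_moser W F j t x oW sF spF Wt) subrr.
  - by move=> s; apply: cvgB; [exact: cl'|exact: cl].
  - by move=> s hs; rewrite sl// sl'// subrr.
under eq_integral do rewrite EFinB.
rewrite integralB_EFin// => /sub0_eq; apply.
- exact: integrable_fin_num iM.
- exact: integrable_fin_num iF.
Qed.

(** Since this is a right fold, the last direction of s is treated first, and the intermediate
    stages are the suffixes of s. *)
Definition mosers h s := foldr moser h s.

Lemma mosers_spec W h s : open W -> smf W setT h -> suppK W h ->
  [/\ smf W setT (mosers h s), suppK W (mosers h s) &
  forall t, W t -> (\int[leb]_x (mosers h s t x)%:E = \int[leb]_x (h t x)%:E)%E].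
Proof.
move=> oW sh sph; elim: s => [|j s [IH1 IH2 IH3]]; first by split.
split => [||t Wt] /=; [exact: smf_moser|exact: suppK_moser|].
by rewrite (integral_moser _ oW IH1 IH2 Wt) IH3.
Qed.

Lemma mosers0 h s t : (forall x, h t x = 0) -> forall x, mosers h s t x = 0.
Proof. by move=> h0; elim: s => // j s IH; exact: moser0. Qed.

(** Says, without division, that the result is proportional to eta_i in x_i once direction i has
    been treated. Averaging later in another direction j keeps this, as the factor in x_i passes
    through the integral over x_j. *)
Lemma mosers_prop W h s i t x r : open W -> smf W setT h -> suppK W h -> W t -> i \in s ->
  mosers h s t (upd i x r) * eta i (x 0 i) = mosers h s t x * eta i r.
Proof.
move=> oW sh sph Wt; elim: s x r => //= j s IH x r.
have [->|ij] := eqVneq i j => [_|].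
  by rewrite moser_upd /moser mulrAC [X in X * _]mulrC.
rewrite inE (negbTE ij)/= => si.
have [s1 s2 _] := mosers_spec s oW sh sph.
rewrite /moser upd_neq 1?eq_sym// -[LHS]mulrA -[RHS]mulrA; congr (_ * _).
rewrite !lintE ![_ * eta i _]mulrC -(@primZ _ (a j) (b j)).
rewrite -(@primZ _ (a j) (b j)).
- apply: eq_prim => q; have := IH (upd j x q) r si; rewrite upd_neq// => E.
  rewrite mulrC [RHS]mulrC -E; congr (mosers _ _ _ _ * _).
  apply/rowP => k; rewrite !mxE; have [->|kj] := eqVneq k j; last by [].
  by rewrite eq_sym (negbTE ij).
- exact: (jcont_line (smf_jcont s1)).
- exact: (supp_line _ (suppK_j (j := j) s2)).
- exact: (jcont_line (smf_jcont s1)).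
- exact: (supp_line _ (suppK_j (j := j) s2)).
Qed.

(* Once all directions have been treated, h is a multiple of the product of the
   eta_i. *)
Lemma mosers_enum0 W h t : open W -> smf W setT h -> suppK W h -> W t ->
  (\int[leb]_x (h t x)%:E = 0)%E -> forall x, mosers h (enum 'I_n) t x = 0.
Proof.
move=> oW sh sph Wt h0.
set F := mosers h (enum 'I_n) t.
have [s1 s2 /(_ t Wt)] := mosers_spec (enum 'I_n) oW sh sph; rewrite h0 -/F => F0.
pose p : 'rV[R]_n := \row_i ((a i + b i) / 2).
have ep i : 0 < eta i (p 0 i).
  rewrite divr_gt0 ?eta0_gt0// hat_gt0// mxE; have := ab i => ?.
  by apply/andP; split; lra.
pose E (x : 'rV[R]_n) := \prod_i eta i (x 0 i).
have E0 x : 0 <= E x by apply: prodr_ge0 => i _; exact: eta_ge0.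
have FE x : F x * E p = F p * E x.
  (* The coordinates of x with index in s are replaced by those of p; [mosers_prop] compares F
     before and after each single replacement. *)
  pose U (s : seq 'I_n) := foldr (fun i y => upd i y (p 0 i)) x s.
  have Un s i : i \notin s -> U s 0 i = x 0 i.
    elim: s => //= k s IH; rewrite inE negb_or => /andP[ik /IH <-].
    by rewrite upd_neq.
  have Uy s i : i \in s -> U s 0 i = p 0 i.
    elim: s => //= k s IH; rewrite inE.
    by have [->|ik] := eqVneq i k => [_|/= /IH <-]; [rewrite upd_eq|rewrite upd_neq].
  have H s : uniq s -> F x * \prod_(i <- s) eta i (p 0 i) = F (U s) * \prod_(i <- s) eta i (x 0 i).
    elim: s => [_|i s IH /= /andP[is_ /IH {}IH]]; first by rewrite !big_nil.
    rewrite !big_cons mulrCA IH [RHS]mulrA.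
    have := mosers_prop (U s) (p 0 i) oW sh sph Wt (mem_enum 'I_n i).
    by rewrite -/F (Un _ _ is_) => ->; rewrite mulrCA mulrA.
  have := H (enum 'I_n) (enum_uniq _); have En f : \prod_(i <- enum 'I_n) f i = \prod_i f i :> R by rewrite big_enum.
  rewrite !En.
  suff -> : U (enum 'I_n) = p by [].
  by apply/rowP => i; rewrite Uy// mem_enum.
have Ep : 0 < E p by apply: prodr_gt0 => i _; exact: ep.
have cE : continuous E.
  have sE : smf W [set: 'rV[R]_n] (fun _ => E).
    by apply: (smf_prod oW (@openT _)) => i; apply: smf_eta => //; exact: openT.
  exact: (smfT_continuous sE Wt).
have pE : (0 < \int[leb]_x (E x)%:E)%E.
  by apply: (@integral_pos _ _ _ p) => //; [exact: continuousT_measurable_rV|exact: cE].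
suff Fp : F p = 0 by move=> x; apply: (mulIf (lt0r_neq0 Ep)); rewrite FE Fp !mul0r.
(* If F(p) were nonzero, E would be a multiple of F, whose integral is 0, whereas E has positive
   integral. *)
apply: contrapT => /eqP nF.
pose c := F p / E p.
have c0 : c != 0 by rewrite mulf_neq0// invr_neq0// gt_eqF.
have EF x : E x = c^-1 * F x.
  by rewrite /c invfM invrK -mulrA [E p * _]mulrC FE mulrA mulVf// mul1r.
move: pE; under eq_integral do rewrite EF EFinM.
by rewrite integralZl// ?F0 ?mule0 ?ltxx//; exact: suppK_integrable s1 s2 Wt.
Qed.

End moser.

(** * L^2 and H^1 *)

Section L2theory.
Context d (T : measurableType d) (R : realType).
Variables (mu : {measure set T -> \bar R}) (D : set T).
Hypothesis mD : measurable D.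
Implicit Types f g a : T -> R.

Definition sqn f : \bar R := (\int[mu]_(x in D) ((f x) ^+ 2)%:E)%E.

Lemma sqn_ge0 f : (0 <= sqn f)%E.
Proof. by apply: integral_ge0 => x _; rewrite lee_fin sqr_ge0. Qed.

Lemma measurable_sq f : measurable_fun D f -> measurable_fun D (fun x => ((f x) ^+ 2)%:E).
Proof. by move=> mf; apply/measurable_EFinP; exact: measurable_funX. Qed.

Lemma L2_sq f : L2 mu D f -> mu.-integrable D (fun x => ((f x) ^+ 2)%:E).
Proof.
move=> [mf ff]; apply/integrableP; split; first exact: measurable_sq.
by under eq_integral do rewrite /= ger0_norm ?sqr_ge0//.
Qed.

Lemma L2_sqn f : L2 mu D f -> sqn f \is a fin_num.
Proof. by move=> /L2_sq; exact: integrable_fin_num. Qed.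

(** Because |f g| <= f^2 + g^2. *)
Lemma L2_mul f g : L2 mu D f -> L2 mu D g -> mu.-integrable D (EFin \o (fun x => f x * g x)).
Proof.
move=> hf hg.
apply: (@le_integrable _ _ _ mu _ mD _ (fun x => ((f x) ^+ 2)%:E + ((g x) ^+ 2)%:E)%E).
- by apply/measurable_EFinP; apply: measurable_funM; [exact: hf.1|exact: hg.1].
- move=> x _ /=; rewrite lee_fin normrM [leRHS]ger0_norm ?addr_ge0 ?sqr_ge0//.
  have := sqr_ge0 (`|f x| - `|g x|); have := sqr_ge0 (`|f x| + `|g x|).
  have e1 : f x ^+ 2 = `|f x| ^+ 2 by rewrite real_normK// num_real.
  have e2 : g x ^+ 2 = `|g x| ^+ 2 by rewrite real_normK// num_real.
  rewrite e1 e2; nra.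
- by apply: integrableD => //; exact: L2_sq.
Qed.

Lemma L2D f g : L2 mu D f -> L2 mu D g -> L2 mu D (fun x => f x + g x).
Proof.
move=> hf hg; split; first by apply: measurable_funD; [exact: hf.1|exact: hg.1].
have := integrableD mD (integrableZl mD 2%R (L2_sq hf)) (integrableZl mD 2%R (L2_sq hg)).
move/integrableP => [_]; apply: le_lt_trans.
apply: ge0_le_integral => //.
- by move=> x _; rewrite lee_fin sqr_ge0.
- by apply: measurable_sq; apply: measurable_funD; [exact: hf.1|exact: hg.1].
- apply: measurableT_comp => //; apply: emeasurable_funD; apply: emeasurable_funM => //; apply: measurable_sq.
    exact: hf.1.
  exact: hg.1.
move=> x _ /=; rewrite lee_fin [leRHS]ger0_norm; last by rewrite addr_ge0// mulr_ge0// sqr_ge0.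
have := sqr_ge0 (f x - g x); nra.
Qed.

Lemma sqn_bounded (a : T -> R) f (C : R) : 0 <= C -> measurable_fun D a -> measurable_fun D f ->
  (forall x, D x -> `|a x| <= C) -> (sqn (fun x => (a x * f x)%R) <= (C ^+ 2)%:E * sqn f)%E.
Proof.
move=> C0 ma mf aC; rewrite /sqn -ge0_integralZl//; last 3 first.
- exact: measurable_sq.
- by move=> x _; rewrite lee_fin sqr_ge0.
- by rewrite lee_fin sqr_ge0.
apply: ge0_le_integral => //.
- by move=> x _; rewrite lee_fin sqr_ge0.
- by apply: measurable_sq; exact: measurable_funM.
- by apply: emeasurable_funM => //; exact: measurable_sq.
move=> x Dx; rewrite -EFinM lee_fin exprMn ler_wpM2r ?sqr_ge0//.
rewrite -[a x ^+ 2]real_normK ?num_real// ler_pXn2r ?nnegrE//; exact: aC.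
Qed.

Lemma L2M (a : T -> R) f (C : R) : 0 <= C -> measurable_fun D a -> (forall x, D x -> `|a x| <= C) ->
  L2 mu D f -> L2 mu D (fun x => a x * f x).
Proof.
move=> C0 ma aC hf; split; first by apply: measurable_funM => //; exact: hf.1.
apply: le_lt_trans (sqn_bounded C0 ma hf.1 aC) _.
by rewrite -ge0_fin_numE ?fin_numM ?L2_sqn// mule_ge0 ?sqn_ge0// lee_fin sqr_ge0.
Qed.

Lemma L2Z (c : R) f : L2 mu D f -> L2 mu D (fun x => c * f x).
Proof. by apply: (@L2M (fun=> c) f `|c|). Qed.

Lemma L2_0 : L2 mu D (fun=> 0).
Proof.
split; first exact: measurable_cst.
by under eq_integral do rewrite expr0n/=; rewrite integral0 ltry.
Qed.

Definition L2c (f_ : nat -> T -> R) f := [/\ forall k, L2 mu D (f_ k), L2 mu D f & L2_cvg mu D f_ f].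

Lemma sqe_cvg (f_ : nat -> T -> R) f (b : nat -> \bar R) :
  (forall k, (sqn (fun x => (f_ k x - f x)%R) <= b k)%E) -> b @ \oo --> 0%E -> L2_cvg mu D f_ f.
Proof.
move=> h hb; apply: (@squeeze_cvge _ _ _ _ (fun=> 0%E) _ b) => //.
  by near=> k; rewrite h andbT; exact: sqn_ge0.
exact: cvg_cst.
Unshelve. all: by end_near. Qed.

Lemma cvgeZ0 (c : R) (b : nat -> \bar R) : b @ \oo --> 0%E -> (fun k => c%:E * b k)%E @ \oo --> 0%E.
Proof. by move=> h; rewrite -[X in _ --> X](mule0 c%:E); apply: cvgeZl. Qed.

Lemma L2cM (a : T -> R) (f_ : nat -> T -> R) f (C : R) : 0 <= C -> measurable_fun D a ->
  (forall x, D x -> `|a x| <= C) -> L2c f_ f -> L2c (fun k x => a x * f_ k x) (fun x => a x * f x).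
Proof.
move=> C0 ma aC [h1 h2 h3]; split => [k||]; try exact: (@L2M _ _ C).
apply: sqe_cvg (cvgeZ0 (C ^+ 2) h3) => k.
have := @sqn_bounded a (fun x => f_ k x - f x) C C0 ma _ aC.
have -> : (fun x => a x * (f_ k x - f x)) = (fun x => a x * f_ k x - a x * f x).
  by apply/funext => x; rewrite mulrBr.
by apply; apply: measurable_funB; [exact: (h1 k).1|exact: h2.1].
Qed.

Lemma L2N f : L2 mu D f -> L2 mu D (fun x => - f x).
Proof. by move=> /(L2Z (-1)); under eq_fun do rewrite mulN1r. Qed.

Lemma L2B f g : L2 mu D f -> L2 mu D g -> L2 mu D (fun x => f x - g x).
Proof. by move=> hf hg; apply: L2D => //; exact: L2N. Qed.

Lemma sqnD f g : L2 mu D f -> L2 mu D g ->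
  (sqn (fun x => (f x + g x)%R) <= 2%:E * (sqn f + sqn g))%E.
Proof.
move=> hf hg; rewrite /sqn -ge0_integralD//; last 4 first.
- by move=> x _; rewrite lee_fin sqr_ge0.
- by apply: measurable_sq; exact: hf.1.
- by move=> x _; rewrite lee_fin sqr_ge0.
- by apply: measurable_sq; exact: hg.1.
rewrite -ge0_integralZl//; last 2 first.
- by apply: emeasurable_funD; apply: measurable_sq; [exact: hf.1|exact: hg.1].
- by move=> x _; rewrite -EFinD lee_fin addr_ge0 ?sqr_ge0.
apply: ge0_le_integral => //.
- by move=> x _; rewrite lee_fin sqr_ge0.
- by apply: measurable_sq; apply: measurable_funD; [exact: hf.1|exact: hg.1].
- apply: emeasurable_funM => //.
  by apply: emeasurable_funD; apply: measurable_sq; [exact: hf.1|exact: hg.1].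
move=> x _; rewrite -EFinD -EFinM lee_fin.
have := sqr_ge0 (f x - g x); nra.
Qed.

Lemma L2cD (f_ : nat -> T -> R) f (g_ : nat -> T -> R) g : L2c f_ f -> L2c g_ g -> L2c (fun k x => f_ k x + g_ k x) (fun x => f x + g x).
Proof.
move=> [f1 f2 f3] [g1 g2 g3]; split => [k||]; try exact: L2D.
have h : (fun k => 2%:E * (sqn (fun x => (f_ k x - f x)%R) + sqn (fun x => (g_ k x - g x)%R)))%E @ \oo --> 0%E.
  by apply: cvgeZ0; rewrite -[X in _ --> X](adde0 0%E); apply: cvgeD.
apply: sqe_cvg h => k.
have := sqnD (L2B (f1 k) f2) (L2B (g1 k) g2).
by under eq_fun do rewrite addrACA -opprD.
Qed.

Lemma L2c0 : L2c (fun _ _ => 0) (fun=> 0).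
Proof.
split => [k||]; try exact: L2_0.
apply: (@sqe_cvg _ _ (fun=> 0%E)); last exact: cvg_cst.
by move=> k; rewrite /sqn; under eq_integral do rewrite subrr expr0n/=; rewrite integral0.
Qed.

Lemma L2c_sum (I : Type) (r : seq I) (f_ : I -> nat -> T -> R) (f : I -> T -> R) :
  (forall i, L2c (f_ i) (f i)) ->
  L2c (fun k x => \sum_(i <- r) f_ i k x) (fun x => \sum_(i <- r) f i x).
Proof.
move=> h; elim: r => [|i r IH].
  by under eq_fun do under eq_fun do rewrite big_nil; under [X in L2c _ X]eq_fun do rewrite big_nil; exact: L2c0.
under eq_fun do under eq_fun do rewrite big_cons.
by under [X in L2c _ X]eq_fun do rewrite big_cons; exact: L2cD.
Qed.

(** Weighted Young inequality: for every del > 0 the difference of the integrals is at most del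
    |a|^2 + |f_k - f|^2 / del in L^2 norms. *)
Lemma L2c_cvg_inner (a : T -> R) (f_ : nat -> T -> R) f : L2 mu D a -> L2c f_ f ->
  (\int[mu]_(x in D) (a x * f_ k x)) @[k --> \oo] --> \int[mu]_(x in D) (a x * f x).
Proof.
move=> ha [f1 f2 f3].
pose A := fine (sqn a).
have A0 : 0 <= A by rewrite fine_ge0// sqn_ge0.
have key k (del : R) : 0 < del ->
    `|\int[mu]_(x in D) (a x * f_ k x) - \int[mu]_(x in D) (a x * f x)| <=
    del * A + del^-1 * fine (sqn (fun x => f_ k x - f x)).
  move=> d0; rewrite -RintegralB//; try exact: L2_mul.
  have hk := L2B (f1 k) f2.
  have i0 : mu.-integrable D (EFin \o (fun x => a x * f_ k x - a x * f x)).
    by have := L2_mul ha hk; under eq_fun do rewrite mulrBr.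
  have i1 := integrableZl mD del (L2_sq ha); have i2 := integrableZl mD del^-1 (L2_sq hk).
  apply: (le_trans (le_normr_Rintegral mD i0)).
  apply: (@le_trans _ _ (\int[mu]_(x in D) (del * (a x) ^+ 2 + del^-1 * (f_ k x - f x) ^+ 2))).
    apply: le_Rintegral => //.
    - exact: integrable_norm.
    - by have := integrableD mD i1 i2.
    move=> x _; rewrite -mulrBr normrM.
    set p := a x; set q := f_ k x - f x.
    have e1 : p ^+ 2 = `|p| ^+ 2 by rewrite real_normK// num_real.
    have e2 : q ^+ 2 = `|q| ^+ 2 by rewrite real_normK// num_real.
    rewrite e1 e2; have := sqr_ge0 (del * `|p| - `|q|).
    have := mulr_ge0 (normr_ge0 p) (normr_ge0 q).
    move=> h1 h2; rewrite -(ler_pM2l d0) mulrDr [del * (del^-1 * _)]mulrA divff ?gt_eqF// mul1r.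
    nra.
  by rewrite RintegralD// !RintegralZl//; exact: L2_sq.
apply/cvgrPdist_le => e e0.
(* This del makes the first term at most e/2 for all k; the second is at most e/2 once |f_k - f|^2
   <= del e / 2. *)
pose del := e / 2 / (A + 1).
have A1 : 0 < A + 1 by rewrite ltr_wpDl.
have d0 : 0 < del by rewrite !divr_gt0.
have /fine_cvgP[_ /cvgrPdist_le H] := f3.
have de : 0 < del * (e / 2) by rewrite mulr_gt0// divr_gt0.
have {}H := H _ de.
near=> k; rewrite distrC; apply: (le_trans (key k del d0)).
have h : `|0 - fine (sqn (fun x => f_ k x - f x))| <= del * (e / 2) by near: k.
move: h; rewrite sub0r normrN ger0_norm ?fine_ge0 ?sqn_ge0// => h.
rewrite [leRHS]splitr lerD//.
  apply: (@le_trans _ _ (del * (A + 1))); first by rewrite ler_wpM2l ?(ltW d0)// lerDl.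
  by rewrite /del divfK// gt_eqF.
by rewrite mulrC ler_pdivrMr// mulrC.
Unshelve. all: by end_near. Qed.

End L2theory.

Lemma near_continuous (T U : topologicalType) (f g : T -> U) x :
  (\forall y \near x, f y = g y) -> {for x, continuous f} -> {for x, continuous g}.
Proof.
move=> e c A hA; have fx := nbhs_singleton e; rewrite -fx in hA.
have h : nbhs x (f @^-1` A) := c A hA.
by apply: filterS2 e h => y /= ->.
Qed.

(** * Functions smooth up to the boundary, and gluing *)

Section smooth.
Variables (R : realType) (n : nat).
Implicit Types (U Omega K : set 'rV[R]_n) (f g : 'rV[R]_n -> R).
Notation leb := (lebesgue_rV R n).

Definition sm U f := forall k, class_C k U f.

Lemma sm_smf U f : sm U f -> smf [set: R] U (fun=> f).
Proof. exact: class_C_smf. Qed.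

Lemma smf_sm U f : smf [set: R] U (fun=> f) -> sm U f.
Proof. by move=> h k; exact: (@smf_class_C _ _ _ _ _ _ (0 : R) k h I). Qed.

Lemma sm_sub U V f : V `<=` U -> sm U f -> sm V f.
Proof. by move=> VU /sm_smf h; apply: smf_sm; apply: smf_sub h. Qed.

Lemma sm_pderiv U f i : sm U f -> sm U (pderiv i f).
Proof. by move=> /sm_smf h; apply: smf_sm; exact: smf_pderiv. Qed.

Lemma sm_continuous U f x : sm U f -> U x -> {for x, continuous f}.
Proof. by move=> /(_ 0%N)[h _]; exact: (h [::]). Qed.

Lemma sm_derivable U f i x : sm U f -> U x -> derivable f x (delta_mx 0 i).
Proof. by move=> /(_ 1%N)[_ h]; exact: (h [::]). Qed.

Lemma sm_C1 U f x : open U -> sm U f -> U x -> C1_at f x.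
Proof. by move=> oU /sm_smf h Ux; exact: (@smk_C1 _ _ _ 0 [set: R] U _ (0 : R) x oU (h 1%N)). Qed.

Lemma sm_congr U f g : open U -> (forall x, U x -> f x = g x) -> sm U f -> sm U g.
Proof.
move=> oU fg /sm_smf h; apply: smf_sm.
by apply: (smf_congr _ oU _ h) => [|t x _]; [exact: openT|exact: fg].
Qed.

Lemma smM U f g : open U -> sm U f -> sm U g -> sm U (fun x => f x * g x).
Proof. by move=> oU /sm_smf hf /sm_smf hg; apply: smf_sm; apply: smfM => //; exact: openT. Qed.

Lemma smD U f g : open U -> sm U f -> sm U g -> sm U (fun x => f x + g x).
Proof. by move=> oU /sm_smf hf /sm_smf hg; apply: smf_sm; apply: smfD => //; exact: openT. Qed.

Lemma smV U f : open U -> (forall x, U x -> f x != 0) -> sm U f -> sm U (fun x => (f x)^-1).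
Proof. by move=> oU f0 /sm_smf hf; apply: smf_sm; apply: smfV => //; [exact: openT|move=> _ x _; exact: f0]. Qed.

Lemma sm_extend U K f : closed K -> K `<=` U -> sm U f -> (forall x, ~ K x -> f x = 0) -> sm setT f.
Proof.
move=> cK KU /sm_smf h f0; apply: smf_sm.
by apply: (smf_extend (@openT _) cK KU h) => _ x _; exact: f0.
Qed.

Lemma iter_pderiv_congr U f g s x : open U -> (forall y, U y -> f y = g y) -> U x ->
  iter_pderiv s f x = iter_pderiv s g x.
Proof.
move=> oU fg; elim: s x => [|i s IH] x Ux /=; first exact: fg.
by have [_] := @pderiv_congr R n i _ _ U x oU Ux (fun y Uy => IH y Uy).
Qed.

Lemma glue_within Omega K f g : open Omega -> closed K -> K `<=` Omega ->
  {within closure Omega, continuous f} -> (forall x, Omega x -> {for x, continuous g}) ->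
  (forall x, closure Omega x -> ~ K x -> g x = f x) -> {within closure Omega, continuous g}.
Proof.
move=> oO cK KO /subspace_continuousP cf cg gf; apply/subspace_continuousP => x Ox.
have [xO|nO] := pselect (Omega x).
  by apply: cvg_within_filter; exact: cg.
have nK : ~ K x by move=> /KO.
change (g y @[y --> within (closure Omega) (nbhs x)] --> g x).
have c : f y @[y --> within (closure Omega) (nbhs x)] --> f x := cf x Ox.
rewrite (gf _ Ox nK); apply: cvg_trans c; apply: near_eq_cvg.
have nbK : nbhs x (~` K) by apply: open_nbhs_nbhs; split => //; exact: closed_openC.
rewrite /within/=; apply: filterS nbK => y nKy Oy.
by first [exact: gf | apply/esym/gf].
Qed.

(** Changing f only on a closed set K inside Omega leaves it untouched near the boundary, where the
    continuous extensions of the derivatives of f still serve. *)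
Lemma glue_class_C_bar k Omega K f g : open Omega -> closed K -> K `<=` Omega ->
  class_C_bar k Omega f -> class_C k Omega g -> (forall x, ~ K x -> g x = f x) ->
  class_C_bar k Omega g.
Proof.
move=> oO cK KO [f1 f2 f3] hg gf; split => //.
  apply: (glue_within oO cK KO f1) => [x Ox|x _]; last exact: gf.
  exact: (hg.1 [::]).
move=> s sk; have [h [h1 h2]] := f3 s sk.
(* Off K, the two branches agree in Omega, so the extension of the derivative of f continues that of
   g to the boundary. *)
exists (fun x => if x \in Omega then iter_pderiv s g x else h x).
split; last by move=> x Ox; rewrite mem_set.
apply: (glue_within oO cK KO h1) => [x Ox|x Ox nK].
  have /= c := hg.1 s sk x Ox.
  apply: near_continuous c; have : nbhs x Omega by exact: open_nbhs_nbhs.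
  by apply: filterS => y Oy; rewrite mem_set.
case: ifPn => // /set_mem xO; rewrite (h2 _ xO).
apply: (@iter_pderiv_congr (~` K)) => //; exact: closed_openC.
Unshelve. all: by end_near. Qed.

Lemma glue_smooth_bar Omega K f g : open Omega -> closed K -> K `<=` Omega ->
  smooth_bar Omega f -> sm Omega g -> (forall x, ~ K x -> g x = f x) -> smooth_bar Omega g.
Proof. by move=> oO cK KO hf hg gf k; exact: (glue_class_C_bar oO cK KO (hf k) (hg k) gf). Qed.

Lemma smooth_bar_sm Omega f : smooth_bar Omega f -> sm Omega f.
Proof. by move=> h k; have [] := h k. Qed.

Lemma smT_smooth_bar Omega f : sm setT f -> smooth_bar Omega f.
Proof.
move=> hf k; have c s : continuous (iter_pderiv s f).
  by move=> x; exact: ((hf (size s)).1 s (leqnn _) x I).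
split; first exact: continuous_subspaceT (c [::]).
  by exact: (sm_sub (fun _ _ => I) hf).
by move=> s _; exists (iter_pderiv s f); split => //; exact: continuous_subspaceT.
Qed.

Lemma test_smooth_bar Omega f : test_function Omega f -> smooth_bar Omega f.
Proof. by move=> [h _]; exact: smT_smooth_bar. Qed.

Lemma sm_test Omega K f : closed K -> compact K -> K `<=` Omega -> sm Omega f ->
  (forall x, ~ K x -> f x = 0) -> test_function Omega f.
Proof. by move=> cK kK KO hf f0; split; [exact: (sm_extend cK KO hf)|exists K]. Qed.

End smooth.

(** * Sobolev functions on a bounded open set *)

Section H1theory.
Variables (R : realType) (n : nat) (Omega : set 'rV[R]_n).
Hypotheses (oO : open Omega) (bO : bounded_set Omega).
Notation leb := (lebesgue_rV R n).
Implicit Types (u v f g : 'rV[R]_n -> R) (Du Dv : 'rV[R]_n -> 'rV[R]_n).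

Lemma mO : measurable Omega.
Proof. exact: open_measurable_rV. Qed.

Lemma boundN : exists2 N, 0 < N & forall x, closure Omega x -> `|x| <= N.
Proof.
have [M [_ HM]] := bO; pose N := Num.max 1 (M + 1).
have N1 : 0 < N by rewrite /N lt_max ltr01.
exists N => // x; have cN : closed [set x : 'rV[R]_n | `|x| <= N].
  apply: (@closed_comp _ _ (fun x : 'rV[R]_n => `|x|) [set r | r <= N]); last exact: closed_le.
  by move=> y _; exact: norm_continuous.
move=> Ox; suff : [set y : 'rV[R]_n | `|y| <= N] x by [].
rewrite [X in X x]((closure_id _).1 cN); apply: closure_subset Ox => y Oy /=.
by apply: HM => //; rewrite /N lt_max ltrDl ltr01 orbT.
Qed.

Lemma compact_closure : compact (closure Omega).
Proof.
have [N N0 hN] := boundN.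
apply: bounded_closed_compact; last exact: closed_closure.
exists N; split; first exact: num_real.
by move=> M NM x Ox /=; rewrite (le_trans (hN x Ox))// ltW.
Qed.

Lemma compact_boxN (K : set 'rV[R]_n) : compact K -> exists2 N, 0 < N & K `<=` @boxN R n N.
Proof.
move=> /compact_bounded[M [_ HM]]; exists (Num.max 1 (M + 1)); first by rewrite lt_max ltr01.
move=> x Kx i; rewrite (le_trans (rV_coord_norm x i))//.
by apply: HM => //; rewrite lt_max ltrDl ltr01 orbT.
Qed.

Lemma leb_finite : (leb Omega < +oo)%E.
Proof.
have [N N0 hN] := boundN.
have /integrableP[_] : leb.-integrable setT (EFin \o \1_Omega).
  apply: (@bounded_supp_integrable R n (\1_Omega) N 1).
- exact: measurable_indic mO.
- by move=> x; rewrite indicE; case: (x \in _); rewrite ?normr1 ?normr0.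
- move=> x nB; rewrite indicE memNset// => /subset_closure/hN h; apply: nB => i.
  exact: le_trans (rV_coord_norm x i) h.
under eq_integral do rewrite /= ger0_norm//.
by rewrite integral_indic ?setIT//; exact: mO.
Qed.

Lemma bounded_L2 f (M : R) : measurable_fun Omega f -> (forall x, Omega x -> `|f x| <= M) -> L2 leb Omega f.
Proof.
move=> mf fM; split => //.
apply: (@le_lt_trans _ _ (\int[leb]_(x in Omega) (M ^+ 2)%:E)%E).
  apply: ge0_le_integral => //; [exact: mO|by move=> x _; rewrite lee_fin sqr_ge0|exact: measurable_sq|].
  move=> x Ox; rewrite lee_fin -[f x ^+ 2]real_normK ?num_real//.
  by rewrite ler_pXn2r ?nnegrE ?fM// (le_trans _ (fM x Ox)).
by rewrite integral_cst ?lte_mul_pinfty ?leb_finite ?lee_fin ?sqr_ge0//; exact: mO.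
Qed.

Lemma within_bounded g : {within closure Omega, continuous g} ->
  exists2 M, 0 <= M & forall x, closure Omega x -> `|g x| <= M.
Proof.
move=> cg; have [M [_ HM]] : bounded_set (g @` closure Omega).
  by apply: compact_bounded; apply: continuous_compact => //; exact: compact_closure.
exists (Num.max 0 (M + 1)); first by rewrite le_max lexx.
move=> x Ox; rewrite le_max; apply/orP; right; apply: HM; [by rewrite ltrDl|by exists x].
Qed.

Lemma sm_measurable f : sm Omega f -> measurable_fun Omega f.
Proof. by move=> hf; apply: continuous_measurable_rV => // x; exact: sm_continuous. Qed.

Lemma smooth_bar_bounded f s : smooth_bar Omega f ->
  exists2 M, 0 <= M & forall x, Omega x -> `|iter_pderiv s f x| <= M.
Proof.
move=> /(_ (size s))[_ _ /(_ s (leqnn _))[g [cg gE]]].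
have [M M0 HM] := within_bounded cg; exists M => // x Ox.
by rewrite -gE//; apply: HM; exact: subset_closure.
Qed.

Lemma smooth_bar_L2 f : smooth_bar Omega f ->
  L2 leb Omega f /\ forall i, L2 leb Omega (pderiv i f).
Proof.
move=> hf; have sf := smooth_bar_sm hf; split.
  have [M _ hM] := smooth_bar_bounded [::] hf.
  by apply: (@bounded_L2 _ M) => //; exact: sm_measurable.
move=> i; have [M _ hM] := smooth_bar_bounded [:: i] hf.
by apply: (@bounded_L2 _ M) => //; apply: sm_measurable; exact: sm_pderiv.
Qed.

Lemma int_pderiv0 (K : set 'rV[R]_n) F i : compact K -> closed K -> K `<=` Omega -> sm Omega F ->
  (forall x, ~ K x -> F x = 0) -> \int[leb]_(x in Omega) pderiv i F x = 0.
Proof.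
move=> kK cK KO sF F0; have sT := sm_extend cK KO sF F0.
have [N N0 KN] := compact_boxN kK.
have P0 x : ~ K x -> pderiv i F x = 0.
  move=> nK; rewrite -(proj2 (pderiv_cst i 0 x)).
  by have [_] := @pderiv_congr R n i F (fun=> 0) (~` K) x (closed_openC cK) nK F0.
have cP : continuous (pderiv i F) by move=> x; exact: (sm_continuous (sm_pderiv i sT)).
have [M HM] := compact_bound kK cP P0.
rewrite /Rintegral integral_mkcond.
rewrite (_ : (_ \_ _) = EFin \o pderiv i F) => [|].
  rewrite (@integral_pderiv0 R n i F N M)//.
  - by move=> x; exact: (sm_derivable sT I).
  - by move=> x nB; apply: F0 => /KN.
apply/funext => x; rewrite patchE; case: ifPn => //= xO.
by rewrite P0// => /KO /mem_set; exact/negP.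
Qed.

Lemma pderiv_mul f g i x : sm Omega f -> sm Omega g -> Omega x ->
  pderiv i (fun y => f y * g y) x = f x * pderiv i g x + g x * pderiv i f x.
Proof.
move=> sf sg Ox; by have [_ ->] := @pderivM R n i f g x (sm_derivable sf Ox) (sm_derivable sg Ox).
Qed.

(** The product [f * phi] has compact support in Omega, so the integral of its derivative is 0. *)
Lemma smooth_bar_weak f phi i : smooth_bar Omega f -> test_function Omega phi ->
  \int[leb]_(x in Omega) (f x * pderiv i phi x) = - \int[leb]_(x in Omega) (pderiv i f x * phi x).
Proof.
move=> hf hphi; have [K [kK KO phi0]] := hphi.2.
have cK : closed K by apply: compact_closed => //; exact: norm_hausdorff.
have hpb := test_smooth_bar hphi.
have [sf sphi] := (smooth_bar_sm hf, smooth_bar_sm hpb).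
have [f1 f2] := smooth_bar_L2 hf; have [p1 p2] := smooth_bar_L2 hpb.
have := @int_pderiv0 K (fun x => f x * phi x) i kK cK KO (smM oO sf sphi).
move=> /(_ _)/wrap[|H]; first by move=> x nK; rewrite phi0// mulr0.
apply/eqP; rewrite -addr_eq0 -RintegralD; first last.
- exact: (L2_mul mO).
- exact: (L2_mul mO).
- exact: mO.
rewrite -H; apply/eqP; apply: eq_Rintegral => x /set_mem Ox.
by rewrite pderiv_mul// [phi x * _]mulrC.
Qed.

(** Integration by parts holds for functions smooth up to the boundary and survives L^2 limits. This
    is how transformed functions are shown to lie in H^1. *)
Lemma H1_of_cvg phi_ u Du : L2 leb Omega u -> (forall i, L2 leb Omega (fun x => Du x 0 i)) ->
  (forall k, smooth_bar Omega (phi_ k)) -> H1_cvg Omega phi_ u Du -> H1 Omega u Du.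
Proof.
move=> hu hDu sp [c1 c2]; split => // phi hphi i.
have [p1 p2] := smooth_bar_L2 (test_smooth_bar hphi).
have L1 : L2c leb Omega phi_ u by split => // k; exact: (smooth_bar_L2 (sp k)).1.
have L2' : L2c leb Omega (fun k => pderiv i (phi_ k)) (fun x => Du x 0 i).
  by split => // k; exact: (smooth_bar_L2 (sp k)).2.
have C1 := L2c_cvg_inner mO (p2 i) L1.
have C2 := L2c_cvg_inner mO p1 L2'.
have E1 : \int[leb]_(x in Omega) (u x * pderiv i phi x) = \int[leb]_(x in Omega) (pderiv i phi x * u x).
  by apply: eq_Rintegral => x _; rewrite mulrC.
have E2 : \int[leb]_(x in Omega) (Du x 0 i * phi x) = \int[leb]_(x in Omega) (phi x * Du x 0 i).
  by apply: eq_Rintegral => x _; rewrite mulrC.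
rewrite E1 E2 -(cvg_lim (@norm_hausdorff _ R) C1); apply: (cvg_lim (@norm_hausdorff _ R)).
apply: cvg_trans (cvgN C2); apply: near_eq_cvg; near=> k.
have := smooth_bar_weak i (sp k) hphi.
rewrite (_ : \int[leb]_(x in Omega) (phi_ k x * _) = \int[leb]_(x in Omega) (pderiv i phi x * phi_ k x)); last first.
  by apply: eq_Rintegral => x _; rewrite mulrC.
move=> ->; rewrite /= (_ : \int[leb]_(x in Omega) (pderiv i (phi_ k) x * _) = \int[leb]_(x in Omega) (phi x * pderiv i (phi_ k) x))//.
by apply: eq_Rintegral => x _; rewrite mulrC.
Unshelve. all: by end_near. Qed.

(* The limits in H^1 of functions smooth up to the boundary: nothing else is
   used of the elements of H^1_0 and of the functions with a trace. *)
Definition HA u Du := H1 Omega u Du /\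
  exists phi_ : nat -> 'rV[R]_n -> R, (forall k, smooth_bar Omega (phi_ k)) /\ H1_cvg Omega phi_ u Du.

Lemma H10_HA u Du : H10 Omega u Du -> HA u Du.
Proof. by move=> [h [phi_ [h1 h2]]]; split => //; exists phi_; split => // k; exact: test_smooth_bar. Qed.

Lemma trace_HA u Du f : trace Omega u Du f -> HA u Du.
Proof. by move=> [h _ [phi_ [h1 h2 _]]]; split => //; exists phi_. Qed.

(** Formally the integral of d_i (zeta u v), where neither u nor v vanishes at the boundary. The
    weak derivative of u is tested against zeta phi_k, with phi_k smooth and tending to v. *)
Lemma H1_ibp zeta u Du v Dv i : test_function Omega zeta -> H1 Omega u Du -> HA v Dv ->
  \int[leb]_(x in Omega) (u x * zeta x * Dv x 0 i) + \int[leb]_(x in Omega) (u x * pderiv i zeta x * v x)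
  + \int[leb]_(x in Omega) (Du x 0 i * zeta x * v x) = 0.
Proof.
move=> hz [u1 u2 u3] [[v1 v2 _] [phi_ [sp [c1 c2]]]].
have hzb := test_smooth_bar hz; have sz := smooth_bar_sm hzb.
have [K [kK KO z0]] := hz.2.
have cK : closed K by apply: compact_closed => //; exact: norm_hausdorff.
have [M M0 hM] := smooth_bar_bounded [::] hzb; have [M' M'0 hM'] := smooth_bar_bounded [:: i] hzb.
have mz := sm_measurable sz; have mdz := sm_measurable (sm_pderiv i sz).
have bnd (a b : 'rV[R]_n -> R) C : 0 <= C -> measurable_fun Omega b -> (forall x, Omega x -> `|b x| <= C) ->
    L2 leb Omega a -> L2 leb Omega (fun x => a x * b x).
  move=> C0 mb bC ha; have := L2M mO C0 mb bC ha.
  by under eq_fun do rewrite mulrC.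
have L1 : L2c leb Omega phi_ v by split => // k; exact: (smooth_bar_L2 (sp k)).1.
have L2' : L2c leb Omega (fun k => pderiv i (phi_ k)) (fun x => Dv x 0 i).
  by split => // k; exact: (smooth_bar_L2 (sp k)).2.
have A1 := bnd _ _ _ M0 mz hM u1.
have A2 := bnd _ _ _ M'0 mdz hM' u1.
have A3 := bnd _ _ _ M0 mz hM (u2 i).
have C1 := L2c_cvg_inner mO A1 L2'.
have C2 := L2c_cvg_inner mO A2 L1.
have C3 := L2c_cvg_inner mO A3 L1.
have E k : \int[leb]_(x in Omega) (u x * zeta x * pderiv i (phi_ k) x) +
    \int[leb]_(x in Omega) (u x * pderiv i zeta x * phi_ k x) +
    \int[leb]_(x in Omega) (Du x 0 i * zeta x * phi_ k x) = 0.
  have [q1 q2] := smooth_bar_L2 (sp k).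
  have sk := smooth_bar_sm (sp k).
  have ht : test_function Omega (fun x => zeta x * phi_ k x).
    by apply: (sm_test cK kK KO); [exact: smM|move=> x nK; rewrite z0// mul0r].
  have := u3 _ ht i.
  rewrite (_ : \int[leb]_(x in Omega) (u x * _) = \int[leb]_(x in Omega) (u x * zeta x * pderiv i (phi_ k) x + u x * pderiv i zeta x * phi_ k x)); last first.
    by apply: eq_Rintegral => x /set_mem Ox; rewrite pderiv_mul//; ring.
  rewrite RintegralD; [|exact: mO|exact: (L2_mul mO)|exact: (L2_mul mO)].
  rewrite /= => ->; rewrite (_ : \int[leb]_(x in Omega) (Du x 0 i * (zeta x * _)) = \int[leb]_(x in Omega) (Du x 0 i * zeta x * phi_ k x)) ?addNr//.
  by apply: eq_Rintegral => x _; rewrite mulrA.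
have C := cvgD (cvgD C1 C2) C3.
rewrite -(cvg_lim (@norm_hausdorff _ R) (C _ _)); apply: (cvg_lim (@norm_hausdorff _ R)).
rewrite (_ : (_ + _ + _)%R = fun=> 0); first exact: cvg_cst.
by apply/funext => k; exact: E.
Qed.

End H1theory.

(** * Gauge transformations *)

Section step.
Variables (R : realType) (n : nat) (Omega K : set 'rV[R]_n).
Hypotheses (oO : open Omega) (bO : bounded_set Omega).
Hypotheses (cK : closed K) (kK : compact K) (KO : K `<=` Omega).
Notation leb := (lebesgue_rV R n).
Implicit Types (u v f g : 'rV[R]_n -> R) (Du Dv : 'rV[R]_n -> 'rV[R]_n).
Variables (Th : 'rV[R]_n -> 'rV[R]_n) (al : 'rV[R]_n -> R) (M : 'rV[R]_n -> 'M[R]_n)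
  (be : 'rV[R]_n -> 'rV[R]_n) (C : R).

(* stepD u Du is the gradient of stepT u if Du is that of u. *)
Definition stepT u y := al y * u (Th y).
Definition stepD u Du y := Du (Th y) *m M y + u (Th y) *: be y.

(** Covers both operations, multiplication by a function ([Th] the identity) and composition with a
    shear ([al] equal to 1). C bounds all coefficients and, in [step_dens], the distortion of
    volume; [step_off] is what preserves boundary values. *)
Record step_ok : Prop := {
  step_mTh : measurable_fun Omega Th;
  step_Th : forall y, Omega y -> Omega (Th y);
  step_C : 0 <= C;
  step_mal : measurable_fun Omega al;
  step_mM : forall i j, measurable_fun Omega (fun y => M y i j);
  step_mbe : forall i, measurable_fun Omega (fun y => be y 0 i);
  step_al : forall y, Omega y -> `|al y| <= C;
  step_M : forall y i j, Omega y -> `|M y i j| <= C;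
  step_be : forall y i, Omega y -> `|be y 0 i| <= C;
  step_dens : forall f : 'rV[R]_n -> \bar R, measurable_fun Omega f -> (forall x, (0 <= f x)%E) ->
    (\int[leb]_(y in Omega) f (Th y) <= C%:E * \int[leb]_(x in Omega) f x)%E;
  step_sm : forall f, sm Omega f -> sm Omega (stepT f) /\
    forall y i, Omega y -> pderiv i (stepT f) y = stepD f (grad f) y 0 i;
  step_off : forall y, ~ K y -> Th y = y /\ al y = 1 }.

Hypothesis ok : step_ok.
Let mOm : measurable Omega := mO oO.

Lemma measurable_Th u : measurable_fun Omega u -> measurable_fun Omega (fun y => u (Th y)).
Proof.
move=> mu; apply: (@measurable_comp _ _ _ _ _ _ Omega) => //; last exact: step_mTh.
by move=> _ [y Oy <-]; exact: step_Th.
Qed.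

Lemma sqn_Th u : measurable_fun Omega u ->
  (sqn leb Omega (fun y => u (Th y)) <= C%:E * sqn leb Omega u)%E.
Proof.
move=> mu; have := @step_dens ok (fun x => ((u x) ^+ 2)%:E); apply.
  exact: measurable_sq.
by move=> x; rewrite lee_fin sqr_ge0.
Qed.

Lemma L2_Th u : L2 leb Omega u -> L2 leb Omega (fun y => u (Th y)).
Proof.
move=> hu; split; first exact: measurable_Th hu.1.
apply: le_lt_trans (sqn_Th hu.1) _.
rewrite -ge0_fin_numE ?fin_numM ?(L2_sqn mOm)//.
by rewrite mule_ge0 ?sqn_ge0// lee_fin (step_C ok).
Qed.

Lemma L2c_Th (u_ : nat -> 'rV[R]_n -> R) u : L2c leb Omega u_ u -> L2c leb Omega (fun k y => u_ k (Th y)) (fun y => u (Th y)).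
Proof.
move=> [h1 h2 h3]; split => [k||]; try exact: L2_Th.
apply: sqe_cvg (cvgeZ0 C h3) => k.
by apply: (@sqn_Th (fun x => u_ k x - u x)); apply: measurable_funB; [exact: (h1 k).1|exact: h2.1].
Qed.

Lemma stepDE u Du i : (fun y => stepD u Du y 0 i) =
  (fun y => \sum_j M y j i * Du (Th y) 0 j + be y 0 i * u (Th y)).
Proof.
apply/funext => y; rewrite /stepD !mxE mulrC; congr (_ + _).
by apply: eq_bigr => j _; rewrite mulrC.
Qed.

Lemma L2c_stepT (u_ : nat -> 'rV[R]_n -> R) u : L2c leb Omega u_ u -> L2c leb Omega (fun k => stepT (u_ k)) (stepT u).
Proof.
move=> /L2c_Th h.
by have := L2cM mOm (step_C ok) (step_mal ok) (step_al ok) h.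
Qed.

Lemma L2c_stepD (u_ : nat -> 'rV[R]_n -> R) u (D_ : nat -> 'rV[R]_n -> 'rV[R]_n) Du i : L2c leb Omega u_ u ->
  (forall j, L2c leb Omega (fun k x => D_ k x 0 j) (fun x => Du x 0 j)) ->
  L2c leb Omega (fun k y => stepD (u_ k) (D_ k) y 0 i) (fun y => stepD u Du y 0 i).
Proof.
move=> hu hD; rewrite stepDE; under eq_fun do rewrite stepDE.
apply: (L2cD mOm); last first.
  exact: (L2cM mOm (step_C ok) (step_mbe ok i) (fun y Oy => step_be ok i Oy) (L2c_Th hu)).
apply: (L2c_sum mOm) => j.
exact: (L2cM mOm (step_C ok) (step_mM ok j i) (fun y Oy => step_M ok j i Oy) (L2c_Th (hD j))).
Qed.

(** With constant sequences, membership in L^2 after a step is read off from the convergence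
    lemmas. *)
Lemma L2c_const u : L2 leb Omega u -> L2c leb Omega (fun=> u) u.
Proof.
move=> hu; split => //; apply: (@sqe_cvg _ _ _ _ _ _ _ (fun=> 0%E)); last exact: cvg_cst.
by move=> k; rewrite /sqn; under eq_integral do rewrite subrr expr0n/=; rewrite integral0.
Qed.

Lemma L2_stepT u : L2 leb Omega u -> L2 leb Omega (stepT u).
Proof. by move=> /L2c_const/L2c_stepT[]. Qed.

Lemma sqn_stepT u : L2 leb Omega u -> (sqn leb Omega (stepT u) <= (C ^+ 3)%:E * sqn leb Omega u)%E.
Proof.
move=> hu; apply: (le_trans (@sqn_bounded _ _ _ leb Omega mOm al (fun y => u (Th y)) C (step_C ok) (step_mal ok) (measurable_Th hu.1) (step_al ok))).
have -> : ((C ^+ 3)%:E = (C ^+ 2)%:E * C%:E)%E by rewrite -EFinM -exprSr.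
rewrite -muleA; apply: lee_wpmul2l; first by rewrite lee_fin sqr_ge0.
exact: sqn_Th hu.1.
Qed.

Lemma smooth_bar_stepT f : smooth_bar Omega f -> smooth_bar Omega (stepT f).
Proof.
move=> hf; apply: (glue_smooth_bar oO cK KO hf).
  exact: (step_sm ok (smooth_bar_sm hf)).1.
by move=> x nK; rewrite /stepT; have [-> ->] := step_off ok nK; rewrite mul1r.
Qed.

Lemma test_stepT f : test_function Omega f -> test_function Omega (stepT f).
Proof.
move=> hf; have [K' [kK' K'O f0]] := hf.2.
have cK' : closed K' by apply: compact_closed => //; exact: norm_hausdorff.
apply: (@sm_test R n Omega (K `|` K')).
- exact: closedU.
- exact: compactU.
- by move=> x [/KO|/K'O].
- exact: (step_sm ok (smooth_bar_sm (test_smooth_bar hf))).1.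
move=> x nKK; rewrite /stepT; have [-> ->] := step_off ok (fun Kx => nKK (or_introl Kx)).
by rewrite f0 ?mulr0// => K'x; apply: nKK; right.
Qed.

Lemma H1_cvg_step phi_ u Du : L2 leb Omega u -> (forall i, L2 leb Omega (fun x => Du x 0 i)) ->
  (forall k, smooth_bar Omega (phi_ k)) -> H1_cvg Omega phi_ u Du ->
  H1_cvg Omega (fun k => stepT (phi_ k)) (stepT u) (stepD u Du).
Proof.
move=> hu hDu sp [c1 c2].
have L1 : L2c leb Omega phi_ u by split => // k; exact: (smooth_bar_L2 oO bO (sp k)).1.
have L2' j : L2c leb Omega (fun k x => grad (phi_ k) x 0 j) (fun x => Du x 0 j).
  have -> : (fun k x => grad (phi_ k) x 0 j) = (fun k => pderiv j (phi_ k)).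
    by apply/funext => k; apply/funext => x; rewrite mxE.
  by split => // k; exact: (smooth_bar_L2 oO bO (sp k)).2.
split; first by have [] := L2c_stepT L1.
move=> i; have [_ _] := @L2c_stepD phi_ u (fun k => grad (phi_ k)) Du i L1 L2'.
apply: cvg_trans; apply: near_eq_cvg; near=> k.
apply: eq_integral => y /set_mem Oy.
by rewrite ((step_sm ok (smooth_bar_sm (sp k))).2 y i Oy).
Unshelve. all: by end_near. Qed.

Lemma H1_step phi_ u Du : L2 leb Omega u -> (forall i, L2 leb Omega (fun x => Du x 0 i)) ->
  (forall k, smooth_bar Omega (phi_ k)) -> H1_cvg Omega phi_ u Du ->
  H1 Omega (stepT u) (stepD u Du).
Proof.
move=> hu hDu sp c; have c' := H1_cvg_step hu hDu sp c.
apply: (H1_of_cvg oO bO _ _ (fun k => smooth_bar_stepT (sp k)) c'); first exact: L2_stepT.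
move=> i; by have [_] := @L2c_stepD (fun=> u) u (fun=> Du) Du i (L2c_const hu) (fun j => L2c_const (hDu j)).
Qed.

Lemma HA_step u Du : HA Omega u Du -> HA Omega (stepT u) (stepD u Du).
Proof.
move=> [[u1 u2 _] [phi_ [sp c]]]; split; first exact: H1_step sp c.
by exists (fun k => stepT (phi_ k)); split; [move=> k; exact: smooth_bar_stepT|exact: H1_cvg_step].
Qed.

Lemma H10_step u Du : H10 Omega u Du -> H10 Omega (stepT u) (stepD u Du).
Proof.
move=> [[u1 u2 _] [phi_ [sp c]]]; have sb k := test_smooth_bar (sp k).
split; first exact: H1_step sb c.
by exists (fun k => stepT (phi_ k)); split; [move=> k; exact: test_stepT|exact: H1_cvg_step].
Qed.

Lemma trace_step u Du f : trace Omega u Du f -> trace Omega (stepT u) (stepD u Du) f.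
Proof.
move=> [[u1 u2 _] hf [phi_ [sp c cb]]]; split => //; first exact: H1_step sp c.
exists (fun k => stepT (phi_ k)); split; [move=> k; exact: smooth_bar_stepT|exact: H1_cvg_step|].
apply: cvg_trans cb; apply: near_eq_cvg; near=> k.
apply: eq_integral => y /set_mem[_ nO].
(* Boundary points lie outside the open set Omega, hence outside K, where the step changes
   nothing. *)
have nK : ~ K y by move=> /KO; rewrite -((interior_id Omega).1 oO).
by rewrite /stepT; have [-> ->] := step_off ok nK; rewrite mul1r.
Unshelve. all: by end_near. Qed.

End step.

(** * Dirichlet-to-Neumann map and resolvent set under abstract gauge maps *)

Section gauge.
Variables (R : realType) (n : nat) (Omega : set 'rV[R]_n) (lambda : R).
Hypotheses (oO : open Omega) (bO : bounded_set Omega).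
Notation leb := (lebesgue_rV R n).
Implicit Types (u v f g F : 'rV[R]_n -> R) (Du Dv : 'rV[R]_n -> 'rV[R]_n).
Implicit Types (ga : 'rV[R]_n -> 'M[R]_n) (rho : 'rV[R]_n -> R).

Definition form ga rho u Du v Dv : R :=
  energy Omega ga Du Dv - lambda * \int[leb]_(x in Omega) (rho x * (u x * v x)).

Notation fld := ('rV[R]_n -> R).
Notation vfld := ('rV[R]_n -> 'rV[R]_n).

(* T maps solutions to solutions (TD acts on their gradients), S is a right
   inverse of T, and P the adjoint of T in L^2. *)
Record gauge_maps ga1 rho1 ga2 rho2 (T : fld -> fld) (TD : fld -> vfld -> vfld)
    (S : fld -> fld) (SD : fld -> vfld -> vfld) (P : fld -> fld) (C : R) : Prop := {
  gT : forall u, T (S u) = u;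
  gTD : forall u Du, TD (S u) (SD u Du) = Du;
  gHA : forall u Du, HA Omega u Du -> HA Omega (T u) (TD u Du);
  gH10 : forall u Du, H10 Omega u Du -> H10 Omega (T u) (TD u Du);
  gtr : forall u Du f, trace Omega u Du f -> trace Omega (T u) (TD u Du) f;
  gH10S : forall u Du, H10 Omega u Du -> H10 Omega (S u) (SD u Du);
  gtrS : forall u Du f, trace Omega u Du f -> trace Omega (S u) (SD u Du) f;
  gform : forall u Du v Dv, HA Omega u Du -> HA Omega v Dv ->
    form ga2 rho2 (T u) (TD u Du) (T v) (TD v Dv) = form ga1 rho1 u Du v Dv;
  gTL2 : forall u, L2 leb Omega u -> L2 leb Omega (T u);
  gPL2 : forall u, L2 leb Omega u -> L2 leb Omega (P u);
  gP : forall F v, L2 leb Omega F -> L2 leb Omega v ->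
    L2_inner Omega (P F) v = L2_inner Omega F (T v);
  gC : 0 <= C;
  gTb : forall u, L2 leb Omega u -> L2_inner Omega (T u) (T u) <= C * L2_inner Omega u u;
  gPb : forall u, L2 leb Omega u -> L2_inner Omega (P u) (P u) <= C * L2_inner Omega u u }.

Definition gauge ga1 rho1 ga2 rho2 :=
  exists T TD S SD P C, gauge_maps ga1 rho1 ga2 rho2 T TD S SD P C.

Lemma gauge_trans ga1 rho1 ga2 rho2 ga3 rho3 :
  gauge ga1 rho1 ga2 rho2 -> gauge ga2 rho2 ga3 rho3 -> gauge ga1 rho1 ga3 rho3.
Proof.
move=> [T [TD [S [SD [P [C h]]]]]] [T' [TD' [S' [SD' [P' [C' h']]]]]].
exists (T' \o T), (fun u Du => TD' (T u) (TD u Du)), (S \o S'),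
  (fun u Du => SD (S' u) (SD' u Du)), (P \o P'), (C' * C); split => /=.
- by move=> u; rewrite (gT h) (gT h').
- by move=> u Du; rewrite (gT h) (gTD h) (gTD h').
- by move=> u Du /(gHA h)/(gHA h').
- by move=> u Du /(gH10 h)/(gH10 h').
- by move=> u Du f /(gtr h)/(gtr h').
- by move=> u Du /(gH10S h')/(gH10S h).
- by move=> u Du f /(gtrS h')/(gtrS h).
- by move=> u Du v Dv hu hv; rewrite (gform h') ?(gform h)//; exact: (gHA h).
- by move=> u /(gTL2 h)/(gTL2 h').
- by move=> u /(gPL2 h')/(gPL2 h).
- by move=> F v hF hv; rewrite (gP h)//; [rewrite (gP h')//; exact: (gTL2 h)|exact: (gPL2 h')].
- by rewrite mulr_ge0 ?(gC h) ?(gC h').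
- move=> u hu; rewrite (le_trans (gTb h' (gTL2 h hu)))// -mulrA ler_wpM2l ?(gC h')//.
  exact: (gTb h).
- move=> u hu; rewrite (le_trans (gPb h (gPL2 h' hu)))// [C' * C]mulrC -mulrA ler_wpM2l ?(gC h)//.
  exact: (gPb h').
Qed.

Lemma form1 ga u Du v Dv :
  form ga (fun=> 1) u Du v Dv = energy Omega ga Du Dv - lambda * L2_inner Omega u v.
Proof.
by rewrite /form /L2_inner; congr (_ - _ * _); apply: eq_Rintegral => x _; rewrite mul1r.
Qed.

(** The two sets of candidate values coincide: T carries solutions and extensions for ga1 to ones
    for ga2 with the same value of the form, and S carries them back. A test function w is written T
    (S w) so that [gform] applies. *)
Lemma gauge_DN ga1 ga2 f g : gauge ga1 (fun=> 1) ga2 (fun=> 1) ->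
  DN_map Omega ga1 lambda f g = DN_map Omega ga2 lambda f g.
Proof.
move=> [T [TD [S [SD [P [C h]]]]]]; rewrite /DN_map; congr (xget 0 _).
apply/seteqP; split => c [u [Du [v [Dv [[tu wu] tv ->]]]]].
  exists (T u), (TD u Du), (T v), (TD v Dv); split.
  - split; first exact: (gtr h).
    move=> w Dw hw; apply/eqP; rewrite -subr_eq0 -form1 -(gT h w) -(gTD h w Dw).
    have hS := gH10S h hw.
    rewrite (gform h); [|exact: trace_HA tu|exact: H10_HA hS].
    by rewrite form1 subr_eq0; apply/eqP/wu.
  - exact: (gtr h).
  - by rewrite -!form1 (gform h)//; [exact: trace_HA tu|exact: trace_HA tv].
have tSu := gtrS h tu; have tSv := gtrS h tv.
exists (S u), (SD u Du), (S v), (SD v Dv); split => //.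
- split => // w Dw hw; apply/eqP; rewrite -subr_eq0 -form1.
  rewrite -(gform h); [|exact: trace_HA tSu|exact: H10_HA hw].
  by rewrite (gT h) (gTD h) form1 subr_eq0; apply/eqP/wu; exact: (gH10 h).
- rewrite -!form1 -(gform h); [|exact: trace_HA tSu|exact: trace_HA tSv].
  by rewrite !(gT h) !(gTD h).
Qed.

Lemma inner_op F u v : L2 leb Omega F -> L2 leb Omega u -> L2 leb Omega v ->
  L2_inner Omega (fun x => F x + lambda * u x) v =
  L2_inner Omega F v + lambda * L2_inner Omega u v.
Proof.
move=> hF hu hv; have mOm := mO oO; rewrite /L2_inner.
rewrite -RintegralZl//; last exact: (L2_mul mOm).
rewrite -RintegralD//; first by apply: eq_Rintegral => x _; rewrite mulrDl mulrA.
  exact: (L2_mul mOm).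
have := L2_mul mOm (L2Z mOm lambda hu) hv.
by under eq_fun do rewrite -mulrA.
Qed.

Lemma dirichlet_operatorE ga u Du F : H10 Omega u Du -> L2 leb Omega F ->
  dirichlet_operator Omega ga u Du (fun x => F x + lambda * u x) <->
  forall v Dv, H10 Omega v Dv -> form ga (fun=> 1) u Du v Dv = L2_inner Omega F v.
Proof.
move=> hu hF; have mOm := mO oO.
have Lu : L2 leb Omega u by have [[]] := hu.
split=> [[_ _ H] v Dv hv|H].
  rewrite form1 (H v Dv hv) inner_op//; first by rewrite addrK.
  by have [[]] := hv.
split => //; first by apply: (L2D mOm) => //; exact: (L2Z mOm).
move=> v Dv hv; have Lv : L2 leb Omega v by have [[]] := hv.
by rewrite inner_op// -(H v Dv hv) form1 subrK.
Qed.

(** To solve with source F for ga2, solve with source P F for ga1 and apply T. The three factors of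
    the new constant come from T, from the old resolvent bound and from P. *)
Lemma gauge_resolvent ga1 ga2 : gauge ga1 (fun=> 1) ga2 (fun=> 1) ->
  dirichlet_resolvent Omega ga1 lambda -> dirichlet_resolvent Omega ga2 lambda.
Proof.
move=> [T [TD [S [SD [P [C h]]]]]] [ex [D bd]]; split.
  move=> F hF; have [u [Du hu]] := ex _ (gPL2 h hF).
  have hu0 : H10 Omega u Du by have [] := hu.
  exists (T u), (TD u Du); apply/(dirichlet_operatorE _ (gH10 h hu0) hF) => v Dv hv.
  have hS := gH10S h hv.
  rewrite -{1}(gT h v) -(gTD h v Dv) (gform h); [|exact: H10_HA|exact: H10_HA].
  have /(dirichlet_operatorE _ hu0 (gPL2 h hF))/(_ _ _ hS) -> := hu.
  by rewrite (gP h) ?(gT h)//; have [[]] := hS.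
(* D may be negative; its positive part keeps the estimates monotone. *)
exists (C * (Num.max 0 D * C)) => u Du F hF hu.
have hu0 : H10 Omega u Du by have [] := hu.
have hS := gH10S h hu0; have LS : L2 leb Omega (S u) by have [[]] := hS.
have hSu : dirichlet_operator Omega ga1 (S u) (SD u Du) (fun x => P F x + lambda * S u x).
  apply/(dirichlet_operatorE _ hS (gPL2 h hF)) => v Dv hv.
  rewrite -(gform h); [|exact: H10_HA|exact: H10_HA].
  rewrite (gT h) (gTD h); have /(dirichlet_operatorE _ hu0 hF)/(_ _ _ (gH10 h hv)) -> := hu.
  by rewrite (gP h)//; have [[]] := hv.
have H1 := bd _ _ _ (gPL2 h hF) hSu.
have H2 := gTb h LS; rewrite (gT h) in H2.
have H3 := gPb h hF.
have in0 w : 0 <= L2_inner Omega w w.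
  by apply: Rintegral_ge0 => x _; rewrite -expr2 sqr_ge0.
apply: (le_trans H2); rewrite -mulrA ler_wpM2l ?(gC h)//.
apply: (le_trans H1); apply: (@le_trans _ _ (Num.max 0 D * L2_inner Omega (P F) (P F))).
  by rewrite ler_wpM2r// le_max lexx orbT.
by rewrite -mulrA ler_wpM2l// le_max lexx.
Qed.

End gauge.

(** * Multiplication by a function *)

Section bil.
Variables (R : realType) (n : nat).
Implicit Types (a b : 'rV[R]_n) (G : 'M[R]_n).

Definition bil G a b : R := (a *m (G *m b^T)) 0 0.

Lemma bilE G a b : bil G a b = \sum_i \sum_j a 0 i * G i j * b 0 j.
Proof.
rewrite /bil mxE; apply: eq_bigr => i _; rewrite mxE mulr_sumr; apply: eq_bigr => j _.
by rewrite mxE mulrA.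
Qed.

Lemma bilDl G a a' b : bil G (a + a') b = bil G a b + bil G a' b.
Proof. by rewrite /bil mulmxDl mxE. Qed.

Lemma bilDr G a b b' : bil G a (b + b') = bil G a b + bil G a b'.
Proof. by rewrite /bil linearD /= mulmxDr mulmxDr mxE. Qed.

Lemma bilZl G c a b : bil G (c *: a) b = c * bil G a b.
Proof. by rewrite /bil -scalemxAl mxE. Qed.

Lemma bilZr G c a b : bil G a (c *: b) = c * bil G a b.
Proof. by rewrite /bil linearZ /= -!scalemxAr mxE. Qed.

Lemma bilZm G c a b : bil (c *: G) a b = c * bil G a b.
Proof. by rewrite /bil -scalemxAl -scalemxAr mxE. Qed.

Lemma bilC G a b : G^T = G -> bil G a b = bil G b a.
Proof.
move=> sG; rewrite /bil -[LHS]mulr1 -[RHS]mulr1 !mulr1.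
have -> : (a *m (G *m b^T)) 0 0 = ((a *m (G *m b^T))^T) 0 0 by rewrite [RHS]mxE.
by rewrite !trmx_mul trmxK sG mulmxA.
Qed.

Lemma bil_congr G M a b : bil G (a *m M) (b *m M) = bil (M *m G *m M^T) a b.
Proof. by rewrite /bil trmx_mul !mulmxA. Qed.

Lemma measurable_bil (D : set 'rV[R]_n) (G : 'rV[R]_n -> 'M[R]_n) (a b : 'rV[R]_n -> 'rV[R]_n) :
  (forall i j, measurable_fun D (fun x => G x i j)) ->
  (forall i, measurable_fun D (fun x => a x 0 i)) -> (forall i, measurable_fun D (fun x => b x 0 i)) ->
  measurable_fun D (fun x => bil (G x) (a x) (b x)).
Proof.
move=> mG ma mb; under eq_fun do rewrite bilE.
apply: measurable_sum => i; apply: measurable_sum => j.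
by apply: measurable_funM => //; exact: measurable_funM.
Qed.

End bil.

Section wstep.
Variables (R : realType) (n : nat) (Omega K : set 'rV[R]_n).
Hypotheses (oO : open Omega) (bO : bounded_set Omega).
Hypotheses (cK : closed K) (kK : compact K) (KO : K `<=` Omega).
Notation leb := (lebesgue_rV R n).
Implicit Types (u v f g : 'rV[R]_n -> R) (Du Dv : 'rV[R]_n -> 'rV[R]_n).
Let mOm : measurable Omega := mO oO.

Definition intg f := leb.-integrable Omega (EFin \o f).

Lemma intg_mul f g : L2 leb Omega f -> L2 leb Omega g -> intg (fun x => f x * g x).
Proof. exact: (L2_mul mOm). Qed.

Lemma intg_sum (I : Type) (r : seq I) (f : I -> 'rV[R]_n -> R) :
  (forall i, intg (f i)) -> intg (fun x => \sum_(i <- r) f i x).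
Proof.
move=> h; rewrite /intg (_ : EFin \o _ = (fun x => \sum_(i <- r) (f i x)%:E)%E); last first.
  by apply/funext => x /=; rewrite sumEFin.
by apply: integrable_sum => // i _; exact: h.
Qed.

Lemma Rint_sum (I : Type) (r : seq I) (f : I -> 'rV[R]_n -> R) :
  (forall i, intg (f i)) ->
  \int[leb]_(x in Omega) (\sum_(i <- r) f i x) = \sum_(i <- r) \int[leb]_(x in Omega) f i x.
Proof.
move=> h; elim: r => [|i r IH].
  under eq_Rintegral do rewrite big_nil; rewrite big_nil Rintegral_cst ?mul0r//.
rewrite big_cons -IH -RintegralD//; [|exact: h|exact: intg_sum].
by apply: eq_Rintegral => x _; rewrite big_cons.
Qed.

Lemma intg_bil (G : 'rV[R]_n -> 'M[R]_n) (a b : 'rV[R]_n -> 'rV[R]_n) C : 0 <= C ->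
  (forall i j, measurable_fun Omega (fun x => G x i j)) ->
  (forall x i j, Omega x -> `|G x i j| <= C) ->
  (forall i, L2 leb Omega (fun x => a x 0 i)) -> (forall i, L2 leb Omega (fun x => b x 0 i)) ->
  intg (fun x => bil (G x) (a x) (b x)).
Proof.
move=> C0 mG GC ha hb; rewrite /intg; under eq_fun do rewrite bilE.
apply: intg_sum => i; apply: intg_sum => j.
have := L2M mOm C0 (mG i j) (fun x Ox => GC x i j Ox) (ha i).
move=> /intg_mul/(_ (hb j)).
rewrite /intg (_ : EFin \o _ = EFin \o (fun x => a x 0 i * G x i j * b x 0 j))//.
by apply/funext => x /=; rewrite [G x i j * _]mulrC.
Qed.

Lemma le_integral_scale (C : R) (f : 'rV[R]_n -> \bar R) : 1 <= C -> (forall x, (0 <= f x)%E) ->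
  (\int[leb]_(y in Omega) f y <= C%:E * \int[leb]_(x in Omega) f x)%E.
Proof.
move=> C1 f0; have I0 : (0 <= \int[leb]_(x in Omega) f x)%E by exact: integral_ge0.
by rewrite -[leLHS]mul1e lee_wpmul2r// lee_fin.
Qed.

Lemma cst1_off (f : 'rV[R]_n -> R) i x : (forall y, ~ K y -> f y = 1) -> ~ K x -> pderiv i f x = 0.
Proof.
move=> f1 nK; rewrite -(proj2 (pderiv_cst i 1 x)).
by have [_] := @pderiv_congr R n i f (fun=> 1) (~` K) x (closed_openC cK) nK f1.
Qed.

Lemma sm_bounded f : sm setT f -> exists2 M, 0 <= M & forall x, Omega x -> `|f x| <= M.
Proof. by move=> /(@smT_smooth_bar R n Omega)/(smooth_bar_bounded bO [::]). Qed.

Lemma mul_step_ok (a : 'rV[R]_n -> R) : sm setT a -> (forall x, ~ K x -> a x = 1) ->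
  exists C, step_ok Omega K id a (fun y => (a y)%:M) (grad a) C.
Proof.
move=> sa a1.
have sd i : sm setT (pderiv i a) by exact: sm_pderiv.
have [A A0 hA] := sm_bounded sa.
have /choice[B hB] i : exists B, 0 <= B /\ forall x, Omega x -> `|pderiv i a x| <= B.
  by have [B B0 h] := sm_bounded (sd i); exists B.
pose C := 1 + A + \sum_i B i.
have SB : 0 <= \sum_i B i by apply: sumr_ge0 => i _; exact: (hB i).1.
have saO : sm Omega a by exact: (sm_sub (fun _ _ => I) sa).
have CA : A <= C by rewrite /C; lra.
have C1 : 1 <= C by rewrite /C; lra.
have C0 : 0 <= C by lra.
have CB i : B i <= C.
  have BS : B i <= \sum_i B i by rewrite (bigD1 i)//= lerDl sumr_ge0// => k _; exact: (hB k).1.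
  by rewrite /C; lra.
exists C; split.
- exact: measurable_id.
- by [].
- exact: C0.
- exact: sm_measurable.
- move=> i j; under eq_fun do rewrite mxE.
  case: (i == j) => /=; last exact: measurable_cst.
  by under eq_fun do rewrite mulr1n; exact: sm_measurable.
- move=> i; under eq_fun do rewrite mxE.
  by apply: sm_measurable => //; exact: (sm_sub (fun _ _ => I) (sd i)).
- by move=> y Oy; exact: le_trans (hA y Oy) CA.
- move=> y i j Oy; rewrite mxE; case: (i == j) => /=; last by rewrite mulr0n normr0.
  by rewrite mulr1n; exact: le_trans (hA y Oy) CA.
- move=> y i Oy; rewrite mxE; exact: le_trans ((hB i).2 y Oy) (CB i).
- by move=> f _ f0; apply: le_integral_scale.
- move=> f sf; split; first exact: smM.
  move=> y i Oy; have := @pderiv_mul R n Omega a f i y saO sf Oy.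
  by rewrite /stepT /stepD /= => ->; rewrite mul_mx_scalar !mxE.
- by move=> y nK; rewrite a1.
Qed.

Variables (w : 'rV[R]_n -> R) (lambda : R).
Variables (ga ga2 : 'rV[R]_n -> 'M[R]_n) (rho2 : 'rV[R]_n -> R).
Hypotheses (sw : sm setT w) (w1 : forall x, ~ K x -> w x = 1) (w0 : forall x, 0 < w x).
Hypothesis sga : forall i j, smooth_bar Omega (fun x => ga x i j).
Hypothesis tga : forall x, Omega x -> (ga x)^T = ga x.
Hypothesis l0 : lambda != 0.

(** The vector field ga grad (log w). *)
Definition zeta i x : R := (\sum_j ga x i j * pderiv j w x) / w x.

Hypothesis ga2E : forall x, Omega x -> ga2 x = w x ^+ 2 *: ga x.
(** By the product rule the right-hand side is w^2 + w div(ga grad w) / lambda. It is expanded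
    through [zeta] because that is the field used in the integration by parts. *)
Hypothesis rho2E : forall x, Omega x -> rho2 x =
  w x ^+ 2 + (w x ^+ 2 * (\sum_i pderiv i (zeta i) x) + bil (ga x) (grad w x) (grad w x)) / lambda.
Hypothesis mrho2 : measurable_fun Omega rho2.
Hypothesis brho2 : exists M, forall x, Omega x -> `|rho2 x| <= M.

Let swV : sm setT (fun x => (w x)^-1).
Proof. by apply: smV => //; [exact: openT|move=> x _; rewrite gt_eqF]. Qed.

Let wV1 x : ~ K x -> (w x)^-1 = 1.
Proof. by move=> /w1 ->; rewrite invr1. Qed.

Let test_zeta i : test_function Omega (zeta i).
Proof.
apply: (@sm_test R n Omega K) => //; last first.
  move=> x nK; rewrite /zeta big1 ?mul0r// => j _.
  by rewrite (cst1_off j w1 nK) mulr0.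
apply: smM => //; last exact: (sm_sub (fun _ _ => I) swV).
apply: smf_sm; apply: (smf_sum (@openT _) oO) => j.
apply: smfM => //; first exact: openT.
  by apply: sm_smf; apply: smooth_bar_sm; exact: sga.
by apply: sm_smf; exact: (sm_sub (fun _ _ => I) (@sm_pderiv R n setT w j sw)).
Qed.

Let gradV x : grad (fun x => (w x)^-1) x = - (w x ^- 2) *: grad w x.
Proof.
apply/rowP => i; rewrite !mxE.
have [|_ ->] := @pderivV R n i w x _ (sm_derivable sw I); first by rewrite gt_eqF.
by rewrite -expr2 exprVn mulNr.
Qed.

Let CT := projT1 (cid (mul_step_ok swV wV1)).
Let okT := projT2 (cid (mul_step_ok swV wV1)).
Let okS := projT2 (cid (mul_step_ok sw w1)).

(** In the substitution u = w u' the new unknown is u' = T u, so T multiplies by 1/w and S by w. *)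
Let T := stepT id (fun x => (w x)^-1).
Let TD := stepD id (fun y => ((w y)^-1)%:M) (grad (fun x => (w x)^-1)).
Let S := stepT id w.
Let SD := stepD id (fun y => (w y)%:M) (grad w).

Let TDE u Du x : TD u Du x = (w x)^-1 *: Du x + (- (w x ^- 2) * u x) *: grad w x.
Proof. by rewrite /TD /stepD mul_mx_scalar gradV scalerA [u x * _]mulrC. Qed.

(** Pointwise the two integrands differ by the divergence of u v zeta, whose integral is 0 by
    [H1_ibp]. *)
Let w_form u Du v Dv : HA Omega u Du -> HA Omega v Dv ->
  form Omega lambda ga2 rho2 (T u) (TD u Du) (T v) (TD v Dv) =
  form Omega lambda ga (fun=> 1) u Du v Dv.
Proof.
move=> hu hv.
have [[u1 u2 _] _] := hu; have [[v1 v2 _] _] := hv.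
have hTu := HA_step oO bO cK KO okT hu; have hTv := HA_step oO bO cK KO okT hv.
have [[Tu1 Tu2 _] _] := hTu; have [[Tv1 Tv2 _] _] := hTv.
have mga i j : measurable_fun Omega (fun x => ga x i j).
  by apply: sm_measurable => //; apply: smooth_bar_sm; exact: sga.
have [M M0 gaM] : exists2 M, 0 <= M & forall x i j, Omega x -> `|ga x i j| <= M.
  have /choice[B hB] (p : 'I_n * 'I_n) : exists B, 0 <= B /\ forall x, Omega x -> `|ga x p.1 p.2| <= B.
    by have [B B0 h] := smooth_bar_bounded bO [::] (sga p.1 p.2); exists B.
  exists (\sum_p B p); first by apply: sumr_ge0 => p _; exact: (hB p).1.
  move=> x i j Ox; rewrite (bigD1 (i, j))//= (le_trans ((hB (i, j)).2 x Ox))//= lerDl.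
  by apply: sumr_ge0 => p _; exact: (hB p).1.
have swO : sm Omega w by exact: (sm_sub (fun _ _ => I) sw).
have [W W0 hW] := sm_bounded sw.
have [Q hQ] := brho2.
have ie1 : intg (fun x => bil (ga x) (Dv x) (Du x)) by exact: (intg_bil M0 mga gaM v2 u2).
have ie2 : intg (fun x => bil (w x ^+ 2 *: ga x) (TD v Dv x) (TD u Du x)).
  apply: (@intg_bil _ _ _ (W ^+ 2 * M)) => //; first by rewrite mulr_ge0// sqr_ge0.
  - move=> i j; under eq_fun do rewrite mxE.
    by apply: measurable_funM => //; apply: measurable_funX; exact: sm_measurable.
  - move=> x i j Ox; rewrite mxE normrM ler_pM// ?gaM// normrX ler_pXn2r ?nnegrE// hW//.
have iuv : intg (fun x => 1 * (u x * v x)).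
  by have := intg_mul u1 v1; rewrite /intg; under [X in _ -> is_true (integrable _ _ X)]eq_fun do rewrite /= mul1r.
have iTuv : intg (fun x => rho2 x * (T u x * T v x)).
  have Q0 : 0 <= Num.max 0 Q by rewrite le_max lexx.
  have := L2M mOm Q0 mrho2 _ Tu1; move=> /(_ _)/wrap[x Ox|].
    by rewrite le_max hQ// orbT.
  move=> /intg_mul/(_ Tv1); rewrite /intg (_ : EFin \o _ = EFin \o (fun x => rho2 x * (T u x * T v x)))//.
  by apply/funext => x /=; rewrite mulrA.
have E2 : energy Omega ga2 (TD u Du) (TD v Dv) =
    \int[leb]_(x in Omega) bil (w x ^+ 2 *: ga x) (TD v Dv x) (TD u Du x).
  by apply: eq_Rintegral => x /set_mem Ox; rewrite ga2E.
(* Formally d_i (u v zeta_i), expanded with weak gradients. *)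
pose Z i x := u x * zeta i x * Dv x 0 i + u x * pderiv i (zeta i) x * v x + Du x 0 i * zeta i x * v x.
have iZ i : [/\ intg (fun x => u x * zeta i x * Dv x 0 i), intg (fun x => u x * pderiv i (zeta i) x * v x) &
    intg (fun x => Du x 0 i * zeta i x * v x)].
  have zb := test_smooth_bar (test_zeta i).
  have sz := smooth_bar_sm zb.
  have [Y Y0 hY] := smooth_bar_bounded bO [::] zb.
  have [Y' Y'0 hY'] := smooth_bar_bounded bO [:: i] zb.
  have mz := sm_measurable oO sz; have mdz := sm_measurable oO (sm_pderiv i sz).
  have bnd (a b c : 'rV[R]_n -> R) D : 0 <= D -> measurable_fun Omega b -> (forall x, Omega x -> `|b x| <= D) ->
      L2 leb Omega a -> L2 leb Omega c -> intg (fun x => a x * b x * c x).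
    move=> D0 mb bD ha hc; have := intg_mul (L2M mOm D0 mb bD ha) hc.
    by rewrite /intg; under eq_fun do rewrite [b _ * _]mulrC.
  split; [exact: (bnd _ _ _ _ Y0 mz hY u1 (v2 i))|exact: (bnd _ _ _ _ Y'0 mdz hY' u1 v1)|exact: (bnd _ _ _ _ Y0 mz hY (u2 i) v1)].
have Z0 i : \int[leb]_(x in Omega) Z i x = 0.
  have [i1 i2 i3] := iZ i.
  rewrite /Z RintegralD// ?RintegralD//; last first.
    by have := integrableD mOm i1 i2.
  by apply: (H1_ibp oO bO i (test_zeta i)) => //; exact: hu.1.
have iZZ i : intg (Z i).
  have [i1 i2 i3] := iZ i; have := integrableD mOm (integrableD mOm i1 i2) i3.
  by [].
apply/eqP; rewrite -subr_eq0; apply/eqP.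
rewrite /form E2.
rewrite (_ : energy Omega ga Du Dv = \int[leb]_(x in Omega) bil (ga x) (Dv x) (Du x)) => [|//].
rewrite -!RintegralZl// -!RintegralB//; first last.
- by have := integrableZl mOm lambda iTuv.
- by have := integrableZl mOm lambda iuv.
- by have := integrableB mOm ie1 (integrableZl mOm lambda iuv).
- by have := integrableB mOm ie2 (integrableZl mOm lambda iTuv).
rewrite (_ : \int[leb]_(x in Omega) _ = \int[leb]_(x in Omega) (-1 * \sum_i Z i x)); last first.
  apply: eq_Rintegral => x /set_mem Ox.
  have wx : w x != 0 by rewrite gt_eqF.
  rewrite !TDE !bilZm !bilDl !bilDr !bilZl !bilZr rho2E// /T /stepT /=.
  have S1 : \sum_i Z i x = u x * (bil (ga x) (Dv x) (grad w x) / w x) +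
      u x * v x * (\sum_i pderiv i (zeta i) x) + v x * (bil (ga x) (Du x) (grad w x) / w x).
    rewrite /Z !big_split /=; congr (_ + _ + _).
    - rewrite bilE mulr_suml mulr_sumr; apply: eq_bigr => i _.
      rewrite /zeta -mulrA; congr (_ * _); rewrite mulrC mulrA mulr_sumr; congr (_ / _).
      by apply: eq_bigr => j _; rewrite mxE mulrA.
    - by rewrite mulr_sumr; apply: eq_bigr => i _; rewrite mulrAC.
    - rewrite bilE mulr_suml mulr_sumr; apply: eq_bigr => i _.
      rewrite /zeta mulrC; congr (_ * _); rewrite mulrA mulr_sumr; congr (_ / _).
      by apply: eq_bigr => j _; rewrite mxE mulrA.
  rewrite S1 (bilC (grad w x) (Du x) (tga Ox)).
  set a1 := bil _ (Dv x) (Du x); set a2 := bil _ (Dv x) _; set a3 := bil _ (Du x) _; set a4 := bil _ _ _.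
  set dv := \sum_i _; move: wx (u x) (v x); clearbody a1 a2 a3 a4 dv.
  move: (w x) => y y0 p q; field.
  by rewrite l0 y0.
by rewrite RintegralZl// ?Rint_sum ?big1 ?mulr0//; exact: intg_sum.
Qed.

Lemma L2_innerE u : L2 leb Omega u -> (L2_inner Omega u u)%:E = sqn leb Omega u.
Proof.
move=> hu; rewrite /L2_inner /Rintegral -[RHS]fineK ?(L2_sqn mOm)//.
Qed.

Lemma step_bound Th al M be C u : step_ok Omega K Th al M be C -> L2 leb Omega u ->
  L2_inner Omega (stepT Th al u) (stepT Th al u) <= C ^+ 3 * L2_inner Omega u u.
Proof.
move=> ok hu; rewrite -lee_fin EFinM !L2_innerE//; last exact: (L2_stepT oO ok).
exact: (sqn_stepT oO ok).
Qed.

(** Multiplication by 1/w is its own adjoint, so P is T. *)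
Lemma w_gauge : gauge Omega lambda ga (fun=> 1) ga2 rho2.
Proof.
exists T, TD, S, SD, T, (CT ^+ 3); split.
- by move=> u; apply/funext => x; rewrite /T /S /stepT mulKf// gt_eqF.
- move=> u Du; apply/funext => x; rewrite TDE /SD /S /stepD /stepT mul_mx_scalar.
  have wx : w x != 0 by rewrite gt_eqF.
  rewrite scalerDr !scalerA mulVf// scale1r -addrA -scalerDl.
  have -> : (w x)^-1 * u x + - w x ^- 2 * (w x * u x) = 0 by field; exact: wx.
  by rewrite scale0r addr0.
- exact: (HA_step oO bO cK KO okT).
- exact: (H10_step oO bO cK kK KO okT).
- exact: (trace_step oO bO cK KO okT).
- exact: (H10_step oO bO cK kK KO okS).
- exact: (trace_step oO bO cK KO okS).
- exact: w_form.
- exact: (L2_stepT oO okT).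
- exact: (L2_stepT oO okT).
- move=> F v _ _; apply: eq_Rintegral => x _; rewrite /T /stepT /=.
  by rewrite [_ * F x]mulrC mulrA.
- by rewrite exprn_ge0// (step_C okT).
- by move=> u; exact: (step_bound okT).
- by move=> u; exact: (step_bound okT).
Qed.

End wstep.

(** * Shears *)

Section shear_step.
Variables (R : realType) (n : nat) (Omega K : set 'rV[R]_n) (j : 'I_n).
Hypotheses (oO : open Omega) (bO : bounded_set Omega).
Hypotheses (cK : closed K) (kK : compact K) (KO : K `<=` Omega).
Notation leb := (lebesgue_rV R n).
Local Notation "''e_' i" := (delta_mx 0 i) (at level 8, i at level 2).
Let mOm : measurable Omega := mO oO.

Definition shear (th : 'rV[R]_n -> R) (x : 'rV[R]_n) := x + th x *: 'e_j : 'rV[R]_n.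

(** The Jacobian matrix of [shear th]; gradients are row vectors and are multiplied by it from the
    left. *)
Definition shear_mx (th : 'rV[R]_n -> R) (x : 'rV[R]_n) : 'M[R]_n :=
  1%:M + (delta_mx j 0 : 'cV_n) *m grad th x.

Lemma mul_shear_mx v th x : v *m shear_mx th x = v + v 0 j *: grad th x.
Proof.
rewrite mulmxDr mulmx1 mulmxA; congr (_ + _).
rewrite -mul_scalar_mx; congr (_ *m _).
by rewrite -colE [LHS]mx11_scalar mxE.
Qed.

Section oneway.
Variables th th' : 'rV[R]_n -> R.
Hypotheses (sth : sm setT th) (sth' : sm setT th').
Hypotheses (th0 : forall x, ~ K x -> th x = 0) (th'0 : forall x, ~ K x -> th' x = 0).
Hypotheses (k1 : cancel (shear th) (shear th')) (k2 : cancel (shear th') (shear th)).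
Hypothesis dpos : forall x, 0 < 1 + pderiv j th x.

Lemma shear_K x : K x -> K (shear th x).
Proof.
move=> Kx; apply: contrapT => nK.
have E : shear th' (shear th x) = shear th x by rewrite {1}/shear th'0// scale0r addr0.
by apply: nK; rewrite -E k1.
Qed.

Lemma shear_off x : ~ K x -> shear th x = x.
Proof. by move=> nK; rewrite /shear th0// scale0r addr0. Qed.

Lemma shear_Omega x : Omega x -> Omega (shear th x).
Proof.
by have [/shear_K/KO//|/shear_off->] := pselect (K x).
Qed.

Lemma shear_inv x : th' (shear th x) = - th x.
Proof.
have := k1 x; rewrite {1}/shear {2}/shear -addrA -scalerDl => /eqP.
rewrite -subr_eq0 addrAC subrr add0r scaler_eq0 => /orP[|/eqP/rowP/(_ j)].
  by rewrite addrC addr_eq0 => /eqP.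
by rewrite !mxE !eqxx => /eqP; rewrite oner_eq0.
Qed.

(** The chain rule applied to the identity [shear_inv]. It makes the two Jacobian matrices inverse
    to each other and the second determinant positive. *)
Lemma shear_pderiv i x :
  pderiv i th' (shear th x) + pderiv j th' (shear th x) * pderiv i th x = - pderiv i th x.
Proof.
have oT : open [set: 'rV[R]_n] by exact: openT.
have [_ <-] := @pderiv_shear R n th' th j x i (sm_C1 oT sth' I) (sm_derivable sth I).
have -> : (fun y => th' (y + th y *: 'e_j)) = (fun y => - th y) by apply/funext => y; exact: shear_inv.
by rewrite /pderiv deriveN//; exact: (sm_derivable sth I).
Qed.

Lemma shear_mxK x : shear_mx th' (shear th x) *m shear_mx th x = 1%:M.
Proof.
apply/row_matrixP => i; rewrite !rowE mulmxA !mul_shear_mx mulmx1.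
apply/rowP => k; rewrite !mxE.
have := shear_pderiv k x; set a := pderiv k th' _; set b := pderiv k th x; set aj := pderiv j th' _ => H.
have -> : a = - b - aj * b by rewrite -H addrK.
ring.
Qed.

Lemma shear_dpos x : 0 < 1 + pderiv j th' (shear th x).
Proof.
have H := shear_pderiv j x; have d := dpos x.
set a := pderiv j th' _ in H *; set b := pderiv j th x in H d.
have E : (1 + a) * (1 + b) = 1 by transitivity (1 + b + (a + a * b)); [ring|rewrite H; ring].
by rewrite -(pmulr_lgt0 _ d) E ltr01.
Qed.

Lemma ge0_int_shear (f : 'rV[R]_n -> \bar R) : measurable_fun Omega f -> (forall x, Omega x -> 0 <= f x)%E ->
  (\int[leb]_(x in Omega) (f (shear th x) * (1 + pderiv j th x)%:E) = \int[leb]_(x in Omega) f x)%E.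
Proof.
move=> mf f0; rewrite [RHS]integral_mkcond [LHS]integral_mkcond.
rewrite -(@ge0_integral_shear R n j th th' (f \_ Omega)%E).
- apply: eq_integral => x _; rewrite !patchE.
  have -> : (shear th x \in Omega) = (x \in Omega).
    apply/idP/idP => /set_mem h; apply/mem_set; last exact: shear_Omega.
    by have [/KO//|/shear_off <-] := pselect (K x).
  by case: ifP => // _; rewrite mul0e.
- by move=> x; exact: (sm_continuous sth).
- by move=> x; exact: (sm_derivable sth).
- by move=> x; exact: (sm_continuous (@sm_pderiv R n setT th j sth) I).
- exact: dpos.
- exact: k1.
- exact: k2.
- by apply/(measurable_restrictT _ _).1.
- by move=> x; rewrite patchE; case: ifP => // /set_mem; exact: f0.
Qed.

Lemma Rint_shear (f : 'rV[R]_n -> R) : measurable_fun Omega f ->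
  \int[leb]_(x in Omega) (f (shear th x) * (1 + pderiv j th x)) = \int[leb]_(x in Omega) f x.
Proof.
move=> mf; have mEf : measurable_fun Omega (EFin \o f) by exact/measurable_EFinP.
rewrite /Rintegral; congr fine; rewrite [LHS]integralE [RHS]integralE.
rewrite -[in RHS](@ge0_int_shear (fun x => (EFin \o f)^\+ x)%E); last 2 first.
- exact: measurable_funepos.
- by move=> x _; exact: funepos_ge0.
rewrite -[X in (_ = _ - X)%E](@ge0_int_shear (fun x => (EFin \o f)^\- x)%E); last 2 first.
- exact: measurable_funeneg.
- by move=> x _; exact: funeneg_ge0.
congr (_ - _)%E; apply: eq_integral => x _.
- by rewrite !funeposE /= EFinM maxe_pMl ?mul0e// lee_fin ltW.
- by rewrite !funenegE /= -mulNr EFinM maxe_pMl ?mul0e// lee_fin ltW.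
Qed.

(** Pushing forward by [shear th] composes functions with the inverse map, hence the step is the one
    of [th']. The volume bound comes from the determinant 1 + d_j th. *)
Lemma shear_step_ok : exists C, step_ok Omega K (shear th') (fun=> 1) (shear_mx th') (fun=> 0) C.
Proof.
have /choice[B hB] i : exists B, 0 <= B /\ forall x, Omega x -> `|pderiv i th' x| <= B.
  by have [B B0 h] := sm_bounded bO (@sm_pderiv R n setT th' i sth'); exists B.
have [A A0 hA] := sm_bounded bO (@sm_pderiv R n setT th j sth).
pose C := 1 + A + \sum_i B i.
have sO y : Omega y -> Omega (shear th' y).
  move=> Oy; have [Ky|nK] := pselect (K y); last by rewrite /shear th'0// scale0r addr0.
  apply: KO; apply: contrapT => nK'; have E' : shear th (shear th' y) = shear th' y by rewrite shear_off.
  by apply: nK'; rewrite -E' k2.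
have SB : 0 <= \sum_i B i by apply: sumr_ge0 => i _; exact: (hB i).1.
have C0 : 0 <= C by rewrite /C; lra.
have C1 : 1 <= C by rewrite /C; lra.
have CB i : 1 + B i <= C.
  have BS : B i <= \sum_i B i by rewrite (bigD1 i)//= lerDl sumr_ge0// => k _; exact: (hB k).1.
  by rewrite /C; lra.
have CA : 1 + A <= C by rewrite /C; lra.
have smM' i : sm Omega (pderiv i th') by exact: (sm_sub (fun _ _ => I) (@sm_pderiv R n setT th' i sth')).
have E i k y : shear_mx th' y i k = (i == k)%:R + (i == j)%:R * pderiv k th' y.
  by rewrite !mxE big_ord1 !mxE eqxx andbT.
exists C; split => //.
- apply: measurable_funTS; apply: measurable_shear => x; exact: (sm_continuous sth').
- move=> i k; under eq_fun do rewrite E.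
  apply: measurable_funD; first exact: measurable_cst.
  by apply: measurable_funM; [exact: measurable_cst|exact: sm_measurable].
- by move=> y _; rewrite normr1.
- move=> y i k Oy; rewrite E (le_trans _ (CB k))// (le_trans (ler_normD _ _))// lerD//.
    by case: (i == k); rewrite ?normr1 ?normr0.
  rewrite normrM; case: (i == j); rewrite ?normr1 ?normr0 ?mul1r ?mul0r; first exact: (hB k).2.
  exact: (hB k).1.
- by move=> y i _; rewrite mxE normr0.
- move=> f mf f0.
  rewrite -(@ge0_int_shear (fun y => f (shear th' y))); last 2 first.
  - apply: (@measurable_comp _ _ _ _ _ _ Omega) => //.
      by move=> _ [y Oy <-]; exact: sO.
    by apply: measurable_funTS; apply: measurable_shear => x; exact: (sm_continuous sth').
  - by move=> x _; exact: f0.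
  rewrite -ge0_integralZl//; apply: ge0_le_integral => //.
  - by move=> x _; rewrite mule_ge0// lee_fin ltW.
  - apply: emeasurable_funM; first by under eq_fun do rewrite k1.
    apply/measurable_EFinP/measurable_funD; first exact: measurable_cst.
    by apply: sm_measurable => //; exact: (sm_sub (fun _ _ => I) (@sm_pderiv R n setT th j sth)).
  - by apply: emeasurable_funM => //; exact: measurable_cst.
  move=> x Ox; rewrite k1 muleC; apply: lee_wpmul2r => //; rewrite lee_fin (le_trans _ CA)// lerD2l.
  by rewrite (le_trans (ler_norm _))// hA.
- move=> f sf; have oT : open [set: R] by exact: openT.
  split.
    have H := @smf_shear R R n setT Omega Omega (fun=> f) (fun=> th') j oT oO oO (sm_smf sf)
      (sm_smf (sm_sub (fun _ _ => I) sth')) (fun _ y _ => sO y).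
    by apply: sm_congr (smf_sm H) => // x _; rewrite /stepT mul1r.
  move=> y i Oy; rewrite /stepT /stepD scaler0 addr0 mul_shear_mx !mxE.
  have [_] := @pderiv_shear R n f th' j y i (sm_C1 oO sf (sO y Oy)) (sm_derivable sth' I).
  by under eq_fun do rewrite -[f _]mul1r; rewrite mulrC.
by move=> y nK; rewrite /shear th'0// scale0r addr0.
Qed.

End oneway.

Variables (th th' : 'rV[R]_n -> R) (lambda : R).
Hypotheses (sth : sm setT th) (sth' : sm setT th').
Hypotheses (th0 : forall x, ~ K x -> th x = 0) (th'0 : forall x, ~ K x -> th' x = 0).
Hypotheses (k1 : cancel (shear th) (shear th')) (k2 : cancel (shear th') (shear th)).
Hypothesis dpos : forall x, 0 < 1 + pderiv j th x.

Let dpos' y : 0 < 1 + pderiv j th' y.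
Proof. by rewrite -(k2 y); exact: (shear_dpos sth sth' k1 dpos). Qed.

Variables (ga ga2 : 'rV[R]_n -> 'M[R]_n) (rho rho2 : 'rV[R]_n -> R).
Hypotheses (mga2 : forall i k, measurable_fun Omega (fun x => ga2 x i k)) (mrho2 : measurable_fun Omega rho2).
Hypothesis ga2E : forall x, Omega x -> ga2 (shear th x) =
  (1 + pderiv j th x)^-1 *: (shear_mx th x *m ga x *m (shear_mx th x)^T).
Hypothesis rho2E : forall x, Omega x -> rho2 (shear th x) = rho x / (1 + pderiv j th x).

Let okT := projT2 (cid (shear_step_ok sth sth' th0 th'0 k1 k2 dpos)).
Let okS := projT2 (cid (shear_step_ok sth' sth th'0 th0 k2 k1 dpos')).
Let T := stepT (shear th') (fun=> 1).
Let TD := stepD (shear th') (shear_mx th') (fun=> 0).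
Let S := stepT (shear th) (fun=> 1).
Let SD := stepD (shear th) (shear_mx th) (fun=> 0).
(** The adjoint of composition with [shear th']: composition with [shear th] times the Jacobian
    determinant. *)
Let P (F : 'rV[R]_n -> R) x := (1 + pderiv j th x) * F (shear th x).

(** After the change of variables by [shear th], the determinant cancels the one in [ga2E] and
    [rho2E], and the Jacobian matrices cancel those in TD. *)
Let shear_form u Du v Dv : HA Omega u Du -> HA Omega v Dv ->
  form Omega lambda ga2 rho2 (T u) (TD u Du) (T v) (TD v Dv) =
  form Omega lambda ga rho u Du v Dv.
Proof.
move=> hu hv.
have [[u1 u2 _] _] := hu; have [[v1 v2 _] _] := hv.
have [[Tu1 Tu2 _] _] := HA_step oO bO cK KO okT hu; have [[Tv1 Tv2 _] _] := HA_step oO bO cK KO okT hv.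
rewrite /form; congr (_ - _ * _).
  rewrite (_ : energy _ _ _ _ = \int[leb]_(x in Omega) bil (ga2 x) (TD v Dv x) (TD u Du x))//.
  rewrite -(Rint_shear sth th0 th'0 k1 k2 dpos); last first.
    by apply: measurable_bil => // i; [exact: (Tv2 i).1|exact: (Tu2 i).1].
  apply: eq_Rintegral => x /set_mem Ox.
  have E w Dw : TD w Dw (shear th x) = Dw x *m shear_mx th' (shear th x).
    by rewrite /TD /stepD k1 scaler0 addr0.
  rewrite ga2E// !E bilZm -bil_congr -!mulmxA shear_mxK// !mulmx1 mulrAC mulVf ?mul1r//.
  by rewrite gt_eqF.
rewrite -(Rint_shear sth th0 th'0 k1 k2 dpos); last first.
  by apply: measurable_funM => //; apply: measurable_funM; [exact: Tu1.1|exact: Tv1.1].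
apply: eq_Rintegral => x /set_mem Ox; rewrite rho2E// /T /stepT k1 !mul1r.
by rewrite mulrAC -[RHS]mulr1 divfK ?mulr1// gt_eqF.
Qed.

Let P_ok : exists C, 0 <= C /\ forall u, L2 leb Omega u -> L2 leb Omega (P u) /\
  L2_inner Omega (P u) (P u) <= C * L2_inner Omega u u.
Proof.
have [A A0 hA] := sm_bounded bO (@sm_pderiv R n setT th j sth).
set CS := projT1 (cid (shear_step_ok sth' sth th'0 th0 k2 k1 dpos')) .
have CS0 : 0 <= CS by exact: step_C okS.
have md : measurable_fun Omega (fun x => 1 + pderiv j th x).
  apply: measurable_funD; first exact: measurable_cst.
  by apply: sm_measurable => //; exact: (sm_sub (fun _ _ => I) (@sm_pderiv R n setT th j sth)).
have bd x : Omega x -> `|1 + pderiv j th x| <= 1 + A.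
  by move=> Ox; rewrite (le_trans (ler_normD _ _))// normr1 lerD2l hA.
have A1 : 0 <= 1 + A by rewrite addr_ge0.
exists ((1 + A) ^+ 2 * CS); split; first by rewrite mulr_ge0// sqr_ge0.
move=> u hu; have hS := L2_Th oO okS hu.
have LP : L2 leb Omega (P u) by exact: (L2M mOm A1 md bd hS).
split => //; rewrite -lee_fin EFinM !(L2_innerE oO)//.
apply: (le_trans (@sqn_bounded _ _ _ leb Omega mOm _ _ _ A1 md hS.1 bd)).
rewrite [X in (_ <= X * _)%E]EFinM -muleA; apply: lee_wpmul2l; first by rewrite lee_fin sqr_ge0.
exact: (sqn_Th okS hu.1).
Qed.

Lemma shear_gauge : gauge Omega lambda ga rho ga2 rho2.
Proof.
have [C [C0 hP]] := P_ok.
set CT := projT1 (cid (shear_step_ok sth sth' th0 th'0 k1 k2 dpos)) .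
have CT0 : 0 <= CT ^+ 3 by rewrite exprn_ge0//; exact: step_C okT.
have in0 w : 0 <= L2_inner Omega w w.
  by apply: Rintegral_ge0 => x _; rewrite -expr2 sqr_ge0.
exists T, TD, S, SD, P, (CT ^+ 3 + C); split.
- by move=> u; apply/funext => x; rewrite /T /S /stepT !mul1r k2.
- move=> u Du; apply/funext => x.
  rewrite /TD /SD /stepD !scaler0 !addr0 k2 -mulmxA.
  have := shear_mxK sth' sth k2 x.
  by move=> ->; rewrite mulmx1.
- exact: (HA_step oO bO cK KO okT).
- exact: (H10_step oO bO cK kK KO okT).
- exact: (trace_step oO bO cK KO okT).
- exact: (H10_step oO bO cK kK KO okS).
- exact: (trace_step oO bO cK KO okS).
- exact: shear_form.
- exact: (L2_stepT oO okT).
- by move=> u /hP[].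
- move=> F v hF hv; rewrite /L2_inner -[RHS](Rint_shear sth th0 th'0 k1 k2 dpos); last first.
    by apply: measurable_funM; [exact: hF.1|exact: (L2_stepT oO okT hv).1].
  apply: eq_Rintegral => x _; rewrite /P /T /stepT k1 mul1r.
  by rewrite -mulrA mulrC.
- by rewrite addr_ge0.
- move=> u hu; rewrite (le_trans (step_bound oO okT hu))// ler_wpM2r// lerDl//.
- by move=> u hu; rewrite (le_trans (hP u hu).2)// ler_wpM2r// lerDr.
Qed.

End shear_step.

(** * Smooth families of gauge transformations *)

(** Two block triangularisations: the determinants of X Y and Y X agree, and each product is block
    triangular with one side of the identity as its determinant. *)
Lemma det_rank1 (R : comUnitRingType) n (u : 'cV[R]_n) (v : 'rV[R]_n) :
  \det (1%:M + u *m v) = 1 + (v *m u) 0 0.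
Proof.
pose X := block_mx (1%:M : 'M[R]_n) u (- v) (1%:M : 'M[R]_1).
pose Y := block_mx (1%:M : 'M[R]_n) 0 v (1%:M : 'M[R]_1).
have dY : \det Y = 1 by rewrite det_lblock !det1 mulr1.
have E1 : \det (X *m Y) = \det (1%:M + u *m v).
  have -> : X *m Y = block_mx (1%:M + u *m v) u 0 1%:M.
    by rewrite mulmx_block !mulmx1 !mul1mx !mulmx0 !add0r addNr.
  by rewrite det_ublock det1 mulr1.
have E2 : \det (Y *m X) = 1 + (v *m u) 0 0.
  have -> : Y *m X = block_mx 1%:M u 0 (v *m u + 1%:M).
    by rewrite mulmx_block !mulmx1 !mul1mx !mul0mx !addr0 subrr.
  by rewrite det_ublock det1 mul1r det_mx11 mxE [X in _ + X]mxE eqxx addrC.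
by rewrite -E1 -E2 !det_mulmx dY mulr1 mul1r.
Qed.

Section chain.
Variables (R : realType) (T : topologicalType) (n : nat) (a b : 'I_n -> R).
Hypothesis ab : forall i, a i < b i.
Local Notation "''e_' i" := (delta_mx 0 i) (at level 8, i at level 2).
Notation leb := (lebesgue_rV R n).
Implicit Types (W : set T) (h : T -> 'rV[R]_n -> R).
Let K := @cbox R n a b.
Let cK : closed K := @closed_cbox R n a b.
Let kK : compact K := @compact_cbox R n a b.

(** F t0 vanishes on the compact box, so by a tube argument F t is uniformly small there for t near
    t0. *)
Lemma near_small W (U : set 'rV[R]_n) (F : T -> 'rV[R]_n -> R) t0 e : K `<=` U -> W t0 -> jcont W U F ->
  (forall x, K x -> F t0 x = 0) -> 0 < e ->
  \forall t \near t0, forall x, K x -> `|F t x| <= e.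
Proof.
move=> KU Wt cF F0 e0.
have /compact_near_coveringP/(_ _ (nbhs t0) (fun t x => `|F t x| <= e)) := kK.
apply => x Kx; have := cF t0 x Wt (KU x Kx).
move/cvgrPdist_le => /(_ e e0); rewrite /= F0//.
move=> [[A B] /= [hA hB] hAB]; exists (B, A) => // -[y t] /= [By At].
by have := hAB (t, y) (conj At By); rewrite /= sub0r normrN.
Qed.

Lemma smf_det W (U : set 'rV[R]_n) (g : T -> 'rV[R]_n -> 'M[R]_n) : open W -> open U ->
  (forall i k, smf W U (fun t x => g t x i k)) -> smf W U (fun t x => \det (g t x)).
Proof.
move=> oW oU sg; apply: (smf_sum oW oU) => s; apply: smfM => //; first exact: smf_const.
by apply: (smf_prod oW oU) => i; exact: sg.
Qed.

Lemma smf_slice W (U : set 'rV[R]_n) F t : smf W U F -> W t -> sm U (F t).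
Proof. by move=> sF Wt k; exact: (@smf_class_C _ _ _ _ _ _ t k sF Wt). Qed.

(* Invariant under push-forwards, which multiply det gamma by d^(2-n) and rho by
   1/d, where d is the Jacobian determinant. *)
Definition iota (A : 'M[R]_n) (r : R) := \det A / r ^+ (n - 2).

Variables (Omega : set 'rV[R]_n) (lambda : R) (ga : 'rV[R]_n -> 'M[R]_n).
Hypotheses (oO : open Omega) (bO : bounded_set Omega) (KO : K `<=` Omega).
Variables (W : set T) (t0 : T).
Hypotheses (oW : open W) (Wt0 : W t0).
Variables (g0 : T -> 'rV[R]_n -> 'M[R]_n) (h0 : T -> 'rV[R]_n -> R).
Hypothesis n2 : (2 <= n)%N.

Record chain h (g : T -> 'rV[R]_n -> 'M[R]_n) : Prop := {
  c_sm : forall i k, smf W Omega (fun t x => g t x i k);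
  c_off : forall t x, W t -> ~ K x -> g t x = ga x;
  c_t0 : forall x, Omega x -> g t0 x = ga x;
  c_pos : forall t x, W t -> Omega x -> sym_posdef (g t x);
  c_gauge : forall t, W t -> gauge Omega lambda ga (fun=> 1) (g t) (fun x => 1 + h t x);
  c_range : forall t y, W t -> Omega y ->
    exists2 x, Omega x & iota (g t x) (1 + h t x) = iota (g0 t y) (1 + h0 t y);
  c_int : forall t (F : R -> R), W t -> measurable_fun setT F -> (forall r, 0 <= F r) ->
    (\int[leb]_(x in Omega) (F (iota (g t x) (1 + h t x)) * (1 + h t x))%:E =
     \int[leb]_(x in Omega) (F (iota (g0 t x) (1 + h0 t x)) * (1 + h0 t x))%:E)%E }.

(** Let G and G' be the primitives in x_j of h and of its average h'. The shear solving th + G'(x +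
    th e_j) = G(x) carries the density 1 + h to 1 + h'. The bound 1/2 gives the slope condition for
    solvability and positive densities. *)
Lemma chain_step h g j : smf W setT h -> suppK a b W h -> (forall x, h t0 x = 0) ->
  (forall t x, W t -> `|h t x| <= 2^-1) -> (forall t x, W t -> `|moser a b j h t x| <= 2^-1) ->
  chain h g -> exists g', chain (moser a b j h) g'.
Proof.
move=> sh sph h00 hb hb' cg.
set h' := moser a b j h.
have oT : open [set: 'rV[R]_n] by exact: openT.
have smO f : smf W [set: 'rV[R]_n] f -> smf W Omega f.
  by move=> sf k; apply: (smk_sub _ _ (sf k)).
have sh' : smf W setT h' by exact: smf_moser.
have sph' : suppK a b W h' by exact: suppK_moser.
have sj := suppK_j (j := j) sph; have sj' := suppK_j (j := j) sph'.
have abj := ltW (ab j).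
pose G := PI j h; pose G' := PI j h'.
have sG : smf W setT G := smf_PI abj oW sh sj.
have sG' : smf W setT G' := smf_PI abj oW sh' sj'.
have dG t x : W t -> pderiv j (G t) x = h t x.
  by move=> Wt; have D := PI_derive_j x (smf_jcont sh) sj Wt; exact: (@derive_val _ _ _ _ _ _ _ D).
have dG' t x : W t -> pderiv j (G' t) x = h' t x.
  by move=> Wt; have D := PI_derive_j x (smf_jcont sh') sj' Wt; exact: (@derive_val _ _ _ _ _ _ _ D).
have lb t x : W t -> - 2^-1 <= h t x by move=> /(hb t x); rewrite ler_norml => /andP[].
have lb' t x : W t -> - 2^-1 <= h' t x by move=> /(hb' t x); rewrite ler_norml => /andP[].
have sl t x : W t -> - 2^-1 <= pderiv j (G t) x by move=> Wt; rewrite dG//; exact: lb.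
have sl' t x : W t -> - 2^-1 <= pderiv j (G' t) x by move=> Wt; rewrite dG'//; exact: lb'.
have [th [sth thE]] := transport_exists oW sG sG' sl'.
have [th' [sth' th'E]] := transport_exists oW sG' sG sl.
(* Off the box the line through x misses it, and both primitives are 0, or x_j < a_j, and they are 0
   again, or x_j > b_j, and they are the full line integrals, which averaging preserves. *)
have GG t x : W t -> ~ K x -> G t x = G' t x.
  move=> Wt nK; have z f (c : continuous (fun s => f t (upd j x s))) : suppK a b W f ->
      (exists2 i, i != j & ~~ (a i <= x 0 i <= b i)) -> PI j f t x = 0.
    move=> sf [i ij hi]; apply: prim0 => s _; apply: sf => // /(_ i).
    by rewrite upd_neq// => H; rewrite H in hi.
  have cl f : smf W setT f -> continuous (fun s => f t (upd j x s)).
    by move=> sf; exact: (jcont_line (smf_jcont sf)).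
  have [|H] := not_cbox j nK; last by rewrite /G /G' !z//; exact: cl.
  rewrite negb_and -!ltNge => /orP[xa|xb].
    rewrite /G /G' /PI !prim0// => s sx.
      by apply: sj' => //; rewrite upd_eq negb_and -ltNge (le_lt_trans sx xa).
    by apply: sj => //; rewrite upd_eq negb_and -ltNge (le_lt_trans sx xa).
  rewrite /G /G' /PI (prim_ge (supp_line x sj Wt) (ltW xb)) (prim_ge (supp_line x sj' Wt) (ltW xb)).
  by have := @lint_moser R T n a b ab W h j t x oW sh sph Wt; rewrite !lintE => ->.
(* Where G = G', the value 0 solves the equation. *)
have th0 t x : W t -> ~ K x -> th t x = 0.
  move=> Wt nK; apply: (transport_unique (x := x) sG' sl' Wt).
  by rewrite thE// scale0r addr0 add0r GG.
have th'0 t x : W t -> ~ K x -> th' t x = 0.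
  move=> Wt nK; apply: (transport_unique (x := x) sG sl Wt).
  by rewrite th'E// scale0r addr0 add0r GG.
(* The equation for [th'] is that for [th] with G and G' exchanged, so - th solves it at the image
   point. *)
have inv t x : W t -> th' t (shear j (th t) x) = - th t x.
  move=> Wt; apply: (transport_unique (x := shear j (th t) x) sG sl Wt).
  rewrite th'E// /shear -addrA -scalerDl subrr scale0r addr0 -thE//.
  by rewrite addKr.
have inv' t x : W t -> th t (shear j (th' t) x) = - th' t x.
  move=> Wt; apply: (transport_unique (x := shear j (th' t) x) sG' sl' Wt).
  rewrite thE// /shear -addrA -scalerDl subrr scale0r addr0 -th'E//.
  by rewrite addKr.
have k1 t : W t -> cancel (shear j (th t)) (shear j (th' t)).
  by move=> Wt x; rewrite {1}/shear inv// /shear -addrA -scalerDl subrr scale0r addr0.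
have k2 t : W t -> cancel (shear j (th' t)) (shear j (th t)).
  by move=> Wt x; rewrite {1}/shear inv'// /shear -addrA -scalerDl subrr scale0r addr0.
have sth_ t : W t -> sm setT (th t) := smf_slice sth.
have sth'_ t : W t -> sm setT (th' t) := smf_slice sth'.
(* Derivative in x_j of the equation defining [th]. *)
have dE t x : W t -> (1 + h' t (shear j (th t) x)) * (1 + pderiv j (th t) x) = 1 + h t x.
  move=> Wt.
  have C1 : C1_at (G' t) (x + th t x *: 'e_j) by apply: (sm_C1 oT) => //; exact: smf_slice sG' Wt.
  have dth : derivable (th t) x 'e_j by exact: (sm_derivable (sth_ t Wt) I).
  have [d1 d2] := pderiv_shear C1 dth.
  have : pderiv j (fun y => th t y + G' t (y + th t y *: 'e_j)) x = h t x.
    rewrite -(dG t x Wt); congr (pderiv j _ x); apply/funext => y; exact: thE.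
  have [_ ->] := pderivD dth d1.
  rewrite d2 dG'// -/(shear j (th t) x) => <-; ring.
have dpos t x : W t -> 0 < 1 + pderiv j (th t) x.
  move=> Wt; have := dE t x Wt; have := lb t x Wt; have := lb' t (shear j (th t) x) Wt.
  set p := 1 + pderiv _ _ _; set q := h' t _; set r := h t x => A1 A2 A3.
  have q1 : 0 < 1 + q by lra.
  by rewrite -(pmulr_rgt0 _ q1) A3; lra.
have sO t x : W t -> Omega x -> Omega (shear j (th t) x).
  by move=> Wt; exact: (shear_Omega KO (fun y => th0 t y Wt) (fun y => th'0 t y Wt) (k1 t Wt)).
have sO' t x : W t -> Omega x -> Omega (shear j (th' t) x).
  by move=> Wt; exact: (shear_Omega KO (fun y => th'0 t y Wt) (fun y => th0 t y Wt) (k2 t Wt)).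
pose N t x := shear_mx j (th t) x.
(* The pushed-forward conductivity, as a function of the source point x. *)
pose H t x := (1 + pderiv j (th t) x)^-1 *: (N t x *m g t x *m (N t x)^T).
exists (fun t y => H t (shear j (th' t) y)).
have HE t x : W t -> H t (shear j (th' t) (shear j (th t) x)) = H t x by move=> Wt; rewrite k1.
have detN t x : \det (N t x) = 1 + pderiv j (th t) x.
  by rewrite /N /shear_mx det_rank1 mxE (bigD1 j)//= !mxE !eqxx mulr1 big1 ?addr0// => i ij; rewrite !mxE (negbTE ij) mulr0.
have rE t x : W t -> 1 + h' t (shear j (th t) x) = (1 + h t x) / (1 + pderiv j (th t) x).
  by move=> Wt; rewrite -dE// mulfK// gt_eqF// dpos.
have iE t x : W t -> iota (H t x) (1 + h' t (shear j (th t) x)) = iota (g t x) (1 + h t x).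
  move=> Wt; rewrite /iota rE// /H detZ !det_mulmx det_tr detN.
  have := dpos t x Wt; move: (1 + pderiv j _ _) => d d0.
  rewrite expr_div_n invf_div.
  have r0 : (1 + h t x) ^+ (n - 2) != 0.
    by rewrite expf_neq0// gt_eqF//; have := lb t x Wt; lra.
  (* The scalar factor contributes d^(-n) to the determinant and the two Jacobian matrices
     contribute d^2, which leaves d^(2-n). *)
  have dn : d^-1 ^+ n = d ^- 2 / d ^+ (n - 2).
    by rewrite -[in LHS](subnKC n2) exprD !exprVn.
  have e0 : d ^+ (n - 2) != 0 by rewrite expf_neq0// gt_eqF.
  rewrite dn; move: (d ^+ (n - 2)) e0 (_ ^+ (n - 2)) r0 (\det _) => e e0 r r0 dg.
  have dd : d != 0 by rewrite gt_eqF.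
  field; by rewrite r0 e0 dd.
have sd : smf W Omega (fun t x => (1 + pderiv j (th t) x)^-1).
  apply: smfV => //; first by move=> t x Wt _; rewrite gt_eqF// dpos.
  apply: smfD => //; first exact: smf_const.
  exact: smO (smf_pderiv j sth).
have sN i k : smf W Omega (fun t x => N t x i k).
  have E t x : (i == k)%:R + (i == j)%:R * pderiv k (th t) x = N t x i k.
    by rewrite /N !mxE big_ord1 !mxE eqxx andbT.
  apply: (smf_congr oW oO (fun t x _ _ => E t x)).
  apply: smfD => //; first exact: smf_const.
  apply: smfM => //; first exact: smf_const.
  exact: smO (smf_pderiv k sth).
have sH i k : smf W Omega (fun t x => H t x i k).
  have E t x : (1 + pderiv j (th t) x)^-1 * \sum_l (\sum_m N t x i m * g t x m l) * N t x k l = H t x i k.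
    rewrite /H !mxE; congr (_ * _); apply: eq_bigr => l _; rewrite !mxE; congr (_ * _).
  apply: (smf_congr oW oO (fun t x _ _ => E t x)).
  apply: smfM => //; apply: smf_sum => // l; apply: smfM => //.
  by apply: smf_sum => // m; apply: smfM => //; exact: (c_sm cg).
have sg' i k : smf W Omega (fun t y => H t (shear j (th' t) y) i k).
  apply: (smf_shear (V := Omega) oW oO oO (sH i k)); last exact: sO'.
  exact: smO sth'.
have dth0 t x i : W t -> ~ K x -> pderiv i (th t) x = 0.
  move=> Wt nK; rewrite -(proj2 (pderiv_cst i 0 x)).
  by have [_] := @pderiv_congr R n i (th t) (fun=> 0) (~` K) x (closed_openC cK) nK (fun y => th0 t y Wt).
have N1 t x : (forall i, pderiv i (th t) x = 0) -> N t x = 1%:M.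
  move=> d0; rewrite /N /shear_mx (_ : grad _ _ = 0) ?mulmx0 ?addr0//.
  by apply/rowP => i; rewrite !mxE.
have H1 t x : (forall i, pderiv i (th t) x = 0) -> H t x = g t x.
  by move=> d0; rewrite /H N1// d0 addr0 invr1 scale1r trmx1 mulmx1 mul1mx.
have mom : measurable Omega := mO oO.
split => //.
- move=> t y Wt nK.
  have -> : shear j (th' t) y = y by rewrite /shear th'0// scale0r addr0.
  by rewrite H1; [exact: (c_off cg)|move=> i; exact: dth0].
- move=> x Ox.
  (* At t0 both densities are 1, both primitives vanish and the shear is the identity. *)
  have G0 y : G t0 y = 0 by apply: prim0 => s _; exact: h00.
  have G'0 y : G' t0 y = 0 by apply: prim0 => s _; exact: moser0.
  have t00 y : th t0 y = 0.
    by apply: (transport_unique (x := y) sG' sl' Wt0); rewrite thE// add0r G0 G'0.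
  have t0'0 y : th' t0 y = 0.
    by apply: (transport_unique (x := y) sG sl Wt0); rewrite th'E// add0r G0 G'0.
  have -> : shear j (th' t0) x = x by rewrite /shear t0'0 scale0r addr0.
  rewrite H1; first exact: (c_t0 cg).
  move=> i; rewrite (_ : th t0 = fun=> 0); first exact: (proj2 (pderiv_cst i 0 x)).
  by apply/funext => y; exact: t00.
- move=> t y Wt Oy; have Ox := sO' t y Wt Oy.
  set x := shear j (th' t) y in Ox *.
  have [gT gp] := c_pos cg Wt Ox.
  have d0 := dpos t x Wt.
  split.
    by rewrite /H linearZ/= !trmx_mul trmxK gT mulmxA.
  move=> v v0; rewrite /H -scalemxAr -scalemxAl mxE mulr_gt0 ?invr_gt0//.
  have -> : v *m (N t x *m g t x *m (N t x)^T) *m v^T = (v *m N t x) *m g t x *m (v *m N t x)^T.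
    by rewrite trmx_mul !mulmxA.
  apply: gp; apply: contra v0 => /eqP vN.
  have MN := shear_mxK (sth_ t Wt) (sth'_ t Wt) (k1 t Wt) x.
  by rewrite -[v]mulmx1 -(mulmx1C MN) mulmxA vN mul0mx.
- move=> t Wt; apply: gauge_trans (c_gauge cg Wt) _.
  have mh (f : T -> 'rV[R]_n -> R) : smf W setT f -> measurable_fun Omega (fun x => 1 + f t x).
    move=> sf; apply: measurable_funD; first exact: measurable_cst.
    by apply: (sm_measurable oO); exact: (sm_sub (fun _ _ => I) (smf_slice sf Wt)).
  apply: (shear_gauge oO bO cK kK KO lambda (sth_ t Wt) (sth'_ t Wt) (fun y => th0 t y Wt)
    (fun y => th'0 t y Wt) (k1 t Wt) (k2 t Wt) (fun x => dpos t x Wt)).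
  + by move=> i k; apply: (sm_measurable oO); exact: (smf_slice (sg' i k) Wt).
  + exact: mh.
  + by move=> x Ox; rewrite k1.
  + by move=> x Ox; rewrite rE.
- move=> t y Wt Oy; have [x Ox <-] := c_range cg Wt Oy.
  by exists (shear j (th t) x); [exact: sO|rewrite HE// iE].
move=> t F Wt mF F0; rewrite -(c_int cg Wt mF F0).
have l0 x : 0 <= 1 + h t x by have := lb t x Wt; lra.
have l0' x : 0 <= 1 + h' t x by have := lb' t x Wt; lra.
rewrite -(@ge0_int_shear R n Omega K j oO KO (th t) (th' t) (sth_ t Wt) (fun y => th0 t y Wt)
  (fun y => th'0 t y Wt) (k1 t Wt) (k2 t Wt) (fun x => dpos t x Wt)).
- apply: eq_integral => x _; rewrite HE// iE// rE// -EFinM -mulrA divfK// gt_eqF//.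
  exact: dpos.
- apply/measurable_EFinP; apply: measurable_funM.
    apply: (measurableT_comp mF).
    apply: (sm_measurable oO); apply: (@smf_slice W Omega (fun t y => iota (H t (shear j (th' t) y)) (1 + h' t y)) t) => //.
    apply: smfM => //; first exact: smf_det.
    apply: smfV => //.
      by move=> s x Ws _; rewrite expf_neq0// gt_eqF//; have := lb' s x Ws; lra.
    apply: smfX => //; apply: smfD => //; first exact: smf_const.
    exact: smO sh'.
  apply: measurable_funD; first exact: measurable_cst.
  by apply: (sm_measurable oO); exact: (sm_sub (fun _ _ => I) (smf_slice sh' Wt)).
- by move=> x _; rewrite lee_fin mulr_ge0.
Qed.

(** The densities met on the way belong to the suffixes [drop m s], so these are what must be
    bounded by 1/2. *)
Lemma chain_all h g s : smf W setT h -> suppK a b W h -> (forall x, h t0 x = 0) ->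
  (forall m t x, W t -> `|mosers a b h (drop m s) t x| <= 2^-1) ->
  chain h g -> exists g', chain (mosers a b h s) g'.
Proof.
move=> sh sph h00 + cg; elim: s => [|j s IHs] hb; first by exists g.
have [|g' IH] := IHs _; first by move=> m; exact: (hb m.+1).
have [s1 s2 _] := mosers_spec ab s oW sh sph.
apply: (chain_step s1 s2 _ _ _ IH).
- exact: mosers0.
- by move=> t x; have := hb 1%N t x; rewrite /= drop0.
- exact: (hb 0%N).
Qed.

End chain.

(** * The deformation *)

(** The equation is linear in tau: fix mu = -e and solve. This gives tau > 0 if j0 > 0 and e is
    small; changing the sign of mu covers j0 < 0, and mu = 0 works if j0 = 0. *)
Lemma solve_constraint (R : realType) (j0 j1 j2 del : R) : 0 < del ->
  exists tau mu, [/\ 0 < tau, tau < del, `|mu| < del & 2 * mu + tau * (j0 + mu * j1 + mu ^+ 2 * j2) = 0].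
Proof.
move=> d0.
wlog : j0 j1 j2 / 0 <= j0 => [hw|].
  have [j|j] := leP 0 j0; first exact: hw.
  have [|tau [mu [h1 h2 h3 h4]]] := hw (- j0) j1 (- j2); first by rewrite oppr_ge0 ltW.
  exists tau, (- mu); split; rewrite ?normrN//; nra.
rewrite le_eqVlt => /orP[/eqP <-|j].
  by exists (del / 2), 0; split; rewrite ?normr0//; lra.
pose A := `|j1| + `|j2| + 1.
have A0 : 0 < A by rewrite /A ltr_wpDl// addr_ge0.
(* The bound with A keeps the bracket J at least j0/2; then tau = 2e/J <= 4e/j0, and the last bound
   makes this at most del/2. *)
pose e := Num.min 1 (Num.min (del / 2) (Num.min (j0 / (2 * A)) (del * j0 / 8))).
have e0 : 0 < e by rewrite /e !lt_min ltr01 !divr_gt0 ?mulr_gt0.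
have [e1 e2 e3 e4] : [/\ e <= 1, e <= del / 2, e * A <= j0 / 2 & e <= del * j0 / 8].
  split; rewrite /e; try by rewrite !ge_min lexx ?orbT.
  have : e <= j0 / (2 * A) by rewrite /e !ge_min lexx ?orbT.
  by rewrite ler_pdivlMr ?mulr_gt0// /e; lra.
pose J := j0 + (- e) * j1 + (- e) ^+ 2 * j2.
have Jb : j0 / 2 <= J.
  have h1 : e * j1 <= e * `|j1| by rewrite ler_wpM2l ?(ltW e0)// ler_norm.
  have h2 : - (e ^+ 2 * j2) <= e * `|j2|.
    have h3 : - j2 <= `|j2| by rewrite -normrN ler_norm.
    apply: (@le_trans _ _ (e ^+ 2 * `|j2|)); first by rewrite -mulrN ler_wpM2l ?sqr_ge0.
    by rewrite expr2 ler_wpM2r// ler_piMr// ltW.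
  move: e3; rewrite /A !mulrDr mulr1 /J sqrrN => e3; lra.
have J0 : 0 < J by apply: lt_le_trans Jb; rewrite divr_gt0.
exists (2 * e / J), (- e); split.
- by rewrite divr_gt0// mulr_gt0.
- rewrite ltr_pdivrMr//; apply: (@lt_le_trans _ _ (del * (j0 / 2))); first nra.
  by rewrite ler_wpM2l// ltW.
- by rewrite normrN gtr0_norm//; lra.
- by rewrite -/J divfK ?gt_eqF//; lra.
Qed.

Lemma near_forall (I : finType) (T : topologicalType) (t0 : T) (P : I -> T -> Prop) :
  (forall i, \forall t \near t0, P i t) -> \forall t \near t0, forall i, P i t.
Proof.
move=> h; have H (s : seq I) : \forall t \near t0, forall i, i \in s -> P i t.
  elim: s => [|i s IH]; first by apply: nearW.
  by apply: filterS2 (h i) IH => t hi hs k; rewrite inE => /orP[/eqP ->|/hs].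
by apply: filterS (H (enum I)) => t ht i; apply: ht; rewrite mem_enum.
Qed.

Section init.
Variables (R : realType) (n : nat) (a b : 'I_n -> R).
Hypothesis ab : forall i, a i < b i.
Local Notation "''e_' i" := (delta_mx 0 i) (at level 8, i at level 2).
Notation leb := (lebesgue_rV R n).
Notation T := (R * R)%type.
Let K := @cbox R n a b.
Let cK : closed K := @closed_cbox R n a b.
Let kK : compact K := @compact_cbox R n a b.
Variables (Omega : set 'rV[R]_n) (lambda : R) (ga : 'rV[R]_n -> 'M[R]_n).
Hypotheses (oO : open Omega) (bO : bounded_set Omega) (KO : K `<=` Omega).
Hypotheses (n2 : (2 <= n)%N) (l0 : lambda != 0).
Hypothesis sga : forall i j, smooth_bar Omega (fun x => ga x i j).
Hypothesis pga : forall x, closure Omega x -> sym_posdef (ga x).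
Variables (be c : 'rV[R]_n -> R).
Hypotheses (sbe : sm setT be) (sc : sm setT c).
Hypotheses (be0 : forall x, ~ K x -> be x = 0) (c0 : forall x, ~ K x -> c x = 0).
Let oT : open [set: 'rV[R]_n] := @openT _.
Let oTT : open [set: T] := @openT _.

(* be is the perturbation proper; the multiple t.2 of c is adjusted to make the
   integral of hfun vanish. *)
Definition bump_dir (t : T) x : R := be x + t.2 * c x.
Definition wfun (t : T) x : R := 1 + t.1 * bump_dir t x.
(** The field w ga grad w. Since w div(ga grad w) is its divergence minus [qfun], second derivatives
    of w drop out of the integral of [hfun]. *)
Definition zfun i (t : T) x : R := \sum_k wfun t x * ga x i k * pderiv k (wfun t) x.
Definition qfun (t : T) x : R := bil (ga x) (grad (wfun t) x) (grad (wfun t) x).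
(* (w^2 gamma, 1 + hfun) is obtained from (gamma, 1) by the substitution
   u = w u': the first order terms are removed by an integration by parts. *)
Definition hfun (t : T) x : R :=
  wfun t x ^+ 2 - 1 + (\sum_i pderiv i (zfun i t) x - qfun t x) / lambda.

Lemma sm_smfW (T' : topologicalType) (W : set T') (U : set 'rV[R]_n) (f : 'rV[R]_n -> R) : sm U f -> smf W U (fun=> f).
Proof. exact: class_C_smf. Qed.

Lemma smf_bump_dir W : smf W setT bump_dir.
Proof.
have oW : open [set: T] := oTT.
suff H : smf [set: T] [set: 'rV[R]_n] bump_dir by move=> k; exact: (smk_sub (fun _ _ => I) _ (H k)).
apply: smfD => //; first exact: sm_smfW.
apply: smfM => //; last exact: sm_smfW.
by apply: (@smf_cst _ _ _ _ _ (fun t : T => t.2)) => t _; exact: cvg_snd.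
Qed.

Lemma smf_wfun W : smf W setT wfun.
Proof.
suff H : smf [set: T] [set: 'rV[R]_n] wfun by move=> k; exact: (smk_sub (fun _ _ => I) _ (H k)).
apply: smfD => //; first exact: smf_const.
apply: smfM => //; last exact: smf_bump_dir.
by apply: (@smf_cst _ _ _ _ _ (fun t : T => t.1)) => t _; exact: cvg_fst.
Qed.

Lemma wfun_off t x : ~ K x -> wfun t x = 1.
Proof. by move=> nK; rewrite /wfun /bump_dir be0// c0// mulr0 addr0 mulr0 addr0. Qed.

Lemma pderiv_off (f g : 'rV[R]_n -> R) i x : (forall y, ~ K y -> f y = g y) -> ~ K x ->
  pderiv i f x = pderiv i g x.
Proof. by move=> fg nK; have [_] := @pderiv_congr R n i f g (~` K) x (closed_openC cK) nK fg. Qed.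

Lemma dw_off t i x : ~ K x -> pderiv i (wfun t) x = 0.
Proof.
move=> nK; rewrite (@pderiv_off _ (fun=> 1) i x _ nK); first exact: (proj2 (pderiv_cst i 1 x)).
exact: wfun_off.
Qed.

Lemma zfun_off i t x : ~ K x -> zfun i t x = 0.
Proof. by move=> nK; rewrite /zfun big1// => k _; rewrite dw_off// mulr0. Qed.

Lemma qfun_off t x : ~ K x -> qfun t x = 0.
Proof.
move=> nK; rewrite /qfun (_ : grad _ _ = 0); first by rewrite /bil mul0mx mxE.
by apply/rowP => i; rewrite !mxE dw_off.
Qed.

Lemma hfun_off t x : ~ K x -> hfun t x = 0.
Proof.
move=> nK; rewrite /hfun wfun_off// expr1n subrr add0r qfun_off// subr0 big1 ?mul0r// => i _.
rewrite (@pderiv_off _ (fun=> 0) i x _ nK); first exact: (proj2 (pderiv_cst i 0 x)).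
by move=> y; exact: zfun_off.
Qed.

Lemma smf_ga W i k : smf W Omega (fun (_ : T) x => ga x i k).
Proof. by apply: sm_smfW; apply: smooth_bar_sm; exact: sga. Qed.

Lemma smf_wO W : smf W Omega wfun.
Proof. by move=> k; exact: (smk_sub (fun _ h => h) (fun _ _ => I) (smf_wfun W k)). Qed.

Lemma smf_zfun W i : open W -> smf W Omega (zfun i).
Proof.
move=> oW; apply: (smf_sum oW oO) => k; apply: smfM => //.
  by apply: smfM => //; [exact: smf_wO|exact: smf_ga].
by apply: smf_pderiv; exact: smf_wO.
Qed.

Lemma smf_hfun W : open W -> smf W setT hfun.
Proof.
move=> oW; apply: (smf_extend oW cK KO); last by move=> t x _; exact: hfun_off.
apply: smfD => //.
  apply: smfB => //; last exact: smf_const.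
  by apply: smfX => //; exact: smf_wO.
apply: smfM => //; last exact: smf_const.
apply: smfB => //.
  by apply: smf_sum => // i; apply: smf_pderiv; exact: smf_zfun.
have E t x : \sum_i \sum_k pderiv i (wfun t) x * ga x i k * pderiv k (wfun t) x = qfun t x.
  by rewrite /qfun bilE; apply: eq_bigr => i _; apply: eq_bigr => k _; rewrite !mxE.
apply: (smf_congr oW oO (fun t x _ _ => E t x)).
apply: smf_sum => // i; apply: smf_sum => // k; apply: smfM => //; last by apply: smf_pderiv; exact: smf_wO.
by apply: smfM => //; [apply: smf_pderiv; exact: smf_wO|exact: smf_ga].
Qed.

Lemma suppK_hfun W : suppK a b W hfun.
Proof. by move=> t x _; exact: hfun_off. Qed.

Lemma wfun0 : wfun (0, 0) = fun=> 1.
Proof. by apply/funext => x; rewrite /wfun mul0r addr0. Qed.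

(** On an open set where w is constant all derivatives drop out, and rho' is w^2. *)
Lemma hfun_flat t x (U : set 'rV[R]_n) w0 : open U -> U x -> (forall y, U y -> wfun t y = w0) ->
  hfun t x = w0 ^+ 2 - 1.
Proof.
move=> oU Ux wU.
have dw i y : U y -> pderiv i (wfun t) y = 0.
  move=> Uy; have [_ ->] := @pderiv_congr R n i (wfun t) (fun=> w0) U y oU Uy wU.
  exact: (proj2 (pderiv_cst i w0 y)).
have z0 i y : U y -> zfun i t y = 0 by move=> Uy; rewrite /zfun big1// => k _; rewrite dw// mulr0.
have q0 : qfun t x = 0.
  rewrite /qfun (_ : grad _ _ = 0); first by rewrite /bil mul0mx mxE.
  by apply/rowP => i; rewrite !mxE dw.
rewrite /hfun wU// q0 subr0 big1 ?mul0r ?addr0// => i _.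
have [_ ->] := @pderiv_congr R n i (zfun i t) (fun=> 0) U x oU Ux (z0 i).
exact: (proj2 (pderiv_cst i 0 x)).
Qed.

Lemma hfun0 x : hfun (0, 0) x = 0.
Proof.
rewrite (@hfun_flat (0, 0) x setT 1)//; first by rewrite expr1n subrr.
by move=> y _; rewrite wfun0.
Qed.

Definition g0fun (t : T) x : 'M[R]_n := wfun t x ^+ 2 *: ga x.

(** Reconciles [hfun] with the density of [w_gauge]: zfun = w^2 zeta, and its divergence exceeds w^2
    div zeta by 2 qfun. *)
Lemma hfun_gauge t : (forall x, 0 < wfun t x) ->
  gauge Omega lambda ga (fun=> 1) (g0fun t) (fun x => 1 + hfun t x).
Proof.
move=> w0.
have sw : sm setT (wfun t) by exact: (smf_slice (smf_wfun setT) I).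
have swO : sm Omega (wfun t) by exact: (sm_sub (fun _ _ => I) sw).
have sh : sm setT (hfun t) by exact: (smf_slice (smf_hfun oTT) I).
apply: (@w_gauge R n Omega K oO bO cK kK KO (wfun t) lambda ga (g0fun t) _ sw (@wfun_off t) w0 sga _ l0) => //.
- by move=> x Ox; have [] := pga (subset_closure Ox).
- move=> x Ox; rewrite /hfun.
  have sz i : sm Omega (zeta (wfun t) ga i).
    have wn y : Omega y -> wfun t y != 0 by rewrite gt_eqF.
    apply: (smM oO _ (smV oO wn swO)).
    apply: smf_sm; apply: (smf_sum (@openT R) oO) => k; apply: smfM => //; first exact: openT.
      by apply: sm_smf; apply: smooth_bar_sm; exact: sga.
    by apply: sm_smf; exact: sm_pderiv.
  have Ez i : zfun i t = fun y => wfun t y ^+ 2 * zeta (wfun t) ga i y.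
    apply/funext => y; rewrite /zfun /zeta.
    have -> : \sum_k wfun t y * ga y i k * pderiv k (wfun t) y = wfun t y * \sum_k ga y i k * pderiv k (wfun t) y.
      by rewrite mulr_sumr; apply: eq_bigr => k _; rewrite mulrA.
    have wy : wfun t y != 0 by rewrite gt_eqF.
    by move: (\sum_k _) (wfun t y) wy => S v v0; field.
  have dz i : pderiv i (zfun i t) x = wfun t x ^+ 2 * pderiv i (zeta (wfun t) ga i) x +
      2 * (wfun t x * zeta (wfun t) ga i x * pderiv i (wfun t) x).
    have sw2 : sm Omega (fun y => wfun t y * wfun t y) by exact: smM.
    have -> : zfun i t = fun y => (wfun t y * wfun t y) * zeta (wfun t) ga i y.
      by rewrite Ez; apply/funext => y; rewrite expr2.
    rewrite (@pderiv_mul R n Omega _ _ i x sw2 (sz i) Ox) (@pderiv_mul R n Omega _ _ i x swO swO Ox).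
    by rewrite expr2; ring.
  have Eq : \sum_i wfun t x * zeta (wfun t) ga i x * pderiv i (wfun t) x = qfun t x.
    rewrite /qfun bilE; apply: eq_bigr => i _; rewrite /zeta [wfun t x * (_ / _)]mulrC divfK ?gt_eqF// mulr_suml.
    by apply: eq_bigr => k _; rewrite !mxE mulrC mulrA.
  rewrite (eq_bigr _ (fun i _ => dz i)) big_split/= -!mulr_sumr Eq -/(qfun t x).
  by rewrite addrA [1 + _]addrC subrK; congr (_ + _ / _); ring.
- apply: measurable_funD; first exact: measurable_cst.
  by apply: (sm_measurable oO); exact: (sm_sub (fun _ _ => I) sh).
have [M HM] := compact_bound kK (fun x => sm_continuous sh I) (fun x => @hfun_off t x).
exists (1 + M) => x _; rewrite (le_trans (ler_normD _ _))// normr1 lerD2l; exact: HM.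
Qed.

Lemma posdef_scale (A : 'M[R]_n) s : 0 < s -> sym_posdef A -> sym_posdef (s *: A).
Proof.
move=> s0 [AT Ap]; split; first by rewrite linearZ/= AT.
by move=> v v0; rewrite -scalemxAr -scalemxAl mxE mulr_gt0// Ap.
Qed.

Lemma chain_init (W : set T) : open W -> (forall t x, W t -> 0 < wfun t x) ->
  @chain R T n a b Omega lambda ga W (0, 0) g0fun hfun hfun g0fun.
Proof.
move=> oW w0; split => //.
- move=> i k; have E t x : wfun t x ^+ 2 * ga x i k = g0fun t x i k by rewrite /g0fun mxE.
  apply: (smf_congr oW oO (fun t x _ _ => E t x)).
  by apply: smfM => //; [apply: smfX => //; exact: smf_wO|exact: smf_ga].
- by move=> t x _ nK; rewrite /g0fun wfun_off// expr1n scale1r.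
- by move=> x _; rewrite /g0fun wfun0 expr1n scale1r.
- move=> t x Wt Ox; apply: posdef_scale; first by rewrite exprn_gt0// w0.
  exact: (pga (subset_closure Ox)).
- by move=> t Wt; apply: hfun_gauge => x; exact: w0.
- by move=> t y _ Oy; exists y.
Qed.

Lemma suppO_intg f : sm Omega f -> (forall x, ~ K x -> f x = 0) -> intg Omega f.
Proof.
move=> sf f0; have sT := sm_extend cK KO sf f0.
have := @suppK_integrable R R n a b setT (fun=> f) 0 (sm_smfW setT sT) (fun _ x _ => f0 x) I.
by apply: integrableS => //; exact: mO.
Qed.

Lemma suppO_integral f : sm setT f -> (forall x, ~ K x -> f x = 0) ->
  (\int[leb]_x (f x)%:E = (\int[leb]_(x in Omega) f x)%:E)%E.
Proof.
move=> sf f0; have iO := suppO_intg (sm_sub (fun _ _ => I) sf) f0.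
rewrite /Rintegral fineK; last by apply: integrable_fin_num => //; exact: mO.
rewrite [RHS]integral_mkcond; apply: eq_integral => x _; rewrite patchE.
by case: ifPn => // xO; rewrite f0// => /KO /mem_set; exact/negP.
Qed.

Hypotheses (ibe : \int[leb]_(x in Omega) be x = 0) (ic : \int[leb]_(x in Omega) c x = 1).

(** The divergence integrates to 0, and be and c have integrals 0 and 1, so 2 tau mu is the only
    term without a factor tau^2. The expansion is exact, [hfun] being quadratic in w apart from
    constants. *)
Lemma hfun_integral : exists j0 j1 j2, forall t : T, \int[leb]_(x in Omega) hfun t x =
  t.1 * (2 * t.2 + t.1 * (j0 + t.2 * j1 + t.2 ^+ 2 * j2)).
Proof.
have mom : measurable Omega := mO oO.
have sbO := sm_sub (V := Omega) (fun _ _ => I) sbe.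
have scO := sm_sub (V := Omega) (fun _ _ => I) sc.
have dbe i x : ~ K x -> pderiv i be x = 0.
  by move=> nK; rewrite (@pderiv_off _ (fun=> 0) i x be0 nK); exact: (proj2 (pderiv_cst i 0 x)).
have dc i x : ~ K x -> pderiv i c x = 0.
  by move=> nK; rewrite (@pderiv_off _ (fun=> 0) i x c0 nK); exact: (proj2 (pderiv_cst i 0 x)).
have gbe x : ~ K x -> grad be x = 0 by move=> nK; apply/rowP => i; rewrite !mxE dbe.
have gc x : ~ K x -> grad c x = 0 by move=> nK; apply/rowP => i; rewrite !mxE dc.
pose B f g x := bil (ga x) (grad f x) (grad g x).
have sB f g : sm Omega f -> sm Omega g -> sm Omega (B f g).
  move=> sf sg; have E x : \sum_i \sum_k pderiv i f x * ga x i k * pderiv k g x = B f g x.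
    by rewrite /B bilE; apply: eq_bigr => i _; apply: eq_bigr => k _; rewrite !mxE.
  apply: (sm_congr oO (fun x _ => E x)); apply: smf_sm.
  apply: (smf_sum (@openT R) oO) => i; apply: (smf_sum (@openT R) oO) => k.
  apply: sm_smf.
  exact: (smM oO (smM oO (@sm_pderiv R n Omega f i sf) (smooth_bar_sm (sga i k))) (@sm_pderiv R n Omega g k sg)).
(* The coefficients of tau^2, tau^2 mu and tau^2 mu^2 in [hfun], without its divergence. *)
pose f0 x := be x * be x - B be be x / lambda.
pose f1 x := 2 * (be x * c x) - (B be c x + B c be x) / lambda.
pose f2 x := c x * c x - B c c x / lambda.
have B0l f g x : grad f x = 0 -> B f g x = 0 by move=> h; rewrite /B h /bil mul0mx mxE.
have smC r : sm Omega (fun=> r) by apply: smf_sm; exact: smf_const.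
have smB f g : sm Omega f -> sm Omega g -> sm Omega (fun x => f x - g x).
  by move=> /sm_smf hf /sm_smf hg; apply: smf_sm; apply: smfB => //; exact: openT.
have i0 : intg Omega f0.
  apply: suppO_intg => [|x nK]; last by rewrite /f0 be0// B0l ?gbe// mul0r mul0r subr0.
  exact: (smB _ _ (smM oO sbO sbO) (smM oO (sB _ _ sbO sbO) (smC _))).
have i1 : intg Omega f1.
  apply: suppO_intg => [|x nK]; last by rewrite /f1 be0// !B0l ?gbe ?gc// mul0r mulr0 addr0 mul0r subr0.
  exact: (smB _ _ (smM oO (smC _) (smM oO sbO scO)) (smM oO (smD oO (sB _ _ sbO scO) (sB _ _ scO sbO)) (smC _))).
have i2 : intg Omega f2.
  apply: suppO_intg => [|x nK]; last by rewrite /f2 c0// B0l ?gc// mul0r mul0r subr0.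
  exact: (smB _ _ (smM oO scO scO) (smM oO (sB _ _ scO scO) (smC _))).
have ib : intg Omega be by exact: suppO_intg.
have icc : intg Omega c by exact: suppO_intg.
exists (\int[leb]_(x in Omega) f0 x), (\int[leb]_(x in Omega) f1 x), (\int[leb]_(x in Omega) f2 x).
move=> t; case: t => tau mu /=; set t := (tau, mu).
have sz i : sm Omega (zfun i t) by exact: (smf_slice (smf_zfun i oTT) I).
have iz i : intg Omega (pderiv i (zfun i t)).
  apply: (suppO_intg (@sm_pderiv R n Omega (zfun i t) i (sz i))).
  move=> x nK; rewrite (@pderiv_off _ (fun=> 0) i x _ nK); first exact: (proj2 (pderiv_cst i 0 x)).
  by move=> y; exact: zfun_off.
have gw x : grad (wfun t) x = tau *: (grad be x + mu *: grad c x).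
  apply/rowP => i; rewrite !mxE.
  have db := @sm_derivable R n setT be i x sbe I; have dcc := @sm_derivable R n setT c i x sc I.
  have [k1 k2] := pderivM (proj1 (pderiv_cst i mu x)) dcc.
  have [k3 k4] := pderivD db k1.
  have [k5 k6] := pderivM (proj1 (pderiv_cst i tau x)) k3.
  have [_ k8] := pderivD (proj1 (pderiv_cst i 1 x)) k5.
  rewrite k8 k6 k4 k2 (proj2 (pderiv_cst i 1 x)) (proj2 (pderiv_cst i tau x)) (proj2 (pderiv_cst i mu x)).
  by rewrite !mulr0 !addr0 add0r.
have E x : hfun t x = (2 * tau) * be x + (2 * tau * mu) * c x + tau ^+ 2 * f0 x +
    (tau ^+ 2 * mu) * f1 x + (tau ^+ 2 * mu ^+ 2) * f2 x + lambda^-1 * \sum_i pderiv i (zfun i t) x.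
  rewrite /hfun /qfun gw bilZl bilZr !bilDl !bilDr !bilZl !bilZr /f0 /f1 /f2 -!/(B _ _ x).
  rewrite /wfun /bump_dir /=; set S := \sum_i _; move: l0; set la := lambda => l0'.
  move: (be x) (c x) (B be be x) (B be c x) (B c be x) (B c c x) S => y0 y1 y2 y3 y4 y5 S.
  by field.
have iE (r : R) f : intg Omega f -> intg Omega (fun x => r * f x).
  by move=> h; have := integrableZl mom r h.
have iA f g : intg Omega f -> intg Omega g -> intg Omega (fun x => f x + g x).
  by move=> h1 h2; have := integrableD mom h1 h2.
have iS : intg Omega (fun x => \sum_i pderiv i (zfun i t) x) by exact: intg_sum.
under eq_Rintegral do rewrite E.
have e1 : intg Omega (fun x => 2 * tau * be x) by exact: iE.
have e2 : intg Omega (fun x => 2 * tau * mu * c x) by exact: iE.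
have e3 : intg Omega (fun x => tau ^+ 2 * f0 x) by exact: iE.
have e4 : intg Omega (fun x => tau ^+ 2 * mu * f1 x) by exact: iE.
have e5 : intg Omega (fun x => tau ^+ 2 * mu ^+ 2 * f2 x) by exact: iE.
have e6 : intg Omega (fun x => lambda^-1 * \sum_i pderiv i (zfun i t) x) by exact: iE.
have a2 := iA _ _ e1 e2; have a3 := iA _ _ a2 e3; have a4 := iA _ _ a3 e4; have a5 := iA _ _ a4 e5.
rewrite (RintegralD mom a5 e6) (RintegralD mom a4 e5) (RintegralD mom a3 e4) (RintegralD mom a2 e3) (RintegralD mom e1 e2).
have z6 : \int[leb]_(x in Omega) (\sum_i pderiv i (zfun i t) x) = 0.
  rewrite Rint_sum// big1// => i _.
  by apply: (int_pderiv0 i kK cK KO (sz i)) => x nK; exact: zfun_off.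
have z r f : intg Omega f -> \int[leb]_(x in Omega) (r * f x) = r * \int[leb]_(x in Omega) f x.
  by move=> hf; exact: RintegralZl.
rewrite (z _ _ ib) (z _ _ icc) (z _ _ i0) (z _ _ i1) (z _ _ i2) (z _ _ iS) ibe ic z6.
move: (Rintegral _ _ f0) (Rintegral _ _ f1) (Rintegral _ _ f2) => x0 x1 x2.
ring.
Qed.

Lemma iter_pderiv0 s (x : 'rV[R]_n) : iter_pderiv s (fun=> 0 : R) x = 0.
Proof.
elim: s x => // i s IH x /=; rewrite (_ : iter_pderiv s _ = fun=> 0); last exact/funext.
exact: (proj2 (pderiv_cst i 0 x)).
Qed.

Lemma conductivity_C_glue k (g2 : 'rV[R]_n -> 'M[R]_n) :
  (forall i j, sm Omega (fun x => g2 x i j)) -> (forall x, ~ K x -> g2 x = ga x) ->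
  (forall x, Omega x -> sym_posdef (g2 x)) -> conductivity_C Omega k g2.
Proof.
move=> sg off pos.
have cb i j : class_C_bar k Omega (fun x => g2 x i j).
  by apply: (glue_class_C_bar oO cK KO (sga i j k) (sg i j k)) => x nK; rewrite off.
split; last exact: cb.
have cc : closed (closure Omega) by exact: closed_closure.
split.
- move=> x Ox; have [|nO] := pselect (Omega x); first exact: pos.
  by rewrite off; [exact: pga|move=> /KO].
- by move=> i j; apply: subspace_continuous_measurable_rV => //; have [] := cb i j.
have /choice[B hB] (p : 'I_n * 'I_n) : exists B, 0 <= B /\ forall x, closure Omega x -> `|g2 x p.1 p.2| <= B.
  have [c1 _ _] := cb p.1 p.2.
  by have [B B0 h] := within_bounded bO c1; exists B.
exists (\sum_p B p) => x Ox; rewrite /Num.norm/= mx_normrE; apply: bigmax_le.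
  by apply: sumr_ge0 => p _; exact: (hB p).1.
move=> p _; rewrite (le_trans ((hB p).2 x Ox))// (bigD1 p)//= lerDl.
by apply: sumr_ge0 => q _; exact: (hB q).1.
Qed.

Lemma deform k eps del : 0 < eps -> 0 < del -> exists (tau mu : R) (g2 : 'rV[R]_n -> 'M[R]_n),
  let w := wfun (tau, mu) in let h := hfun (tau, mu) in
  [/\ [/\ 0 < tau, `|mu| < del & forall x, 2^-1 <= w x],
      [/\ conductivity_C Omega k g2, (C_norm Omega k (fun x => g2 x - ga x)%R <= eps%:E)%E &
        gauge Omega lambda ga (fun=> 1) g2 (fun=> 1)],
      forall x, 2^-1 <= 1 + h x,
      forall y, Omega y -> exists2 x, Omega x & \det (g2 x) = iota (w y ^+ 2 *: ga y) (1 + h y) &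
      forall F : R -> R, measurable_fun setT F -> (forall r, 0 <= F r) ->
        (\int[leb]_(x in Omega) (F (\det (g2 x)))%:E =
         \int[leb]_(x in Omega) (F (iota (w x ^+ 2 *: ga x) (1 + h x)) * (1 + h x))%:E)%E].
Proof.
move=> eps0 del0; pose t0 : T := (0, 0); pose E := enum 'I_n.
have half : 0 < 2^-1 :> R by rewrite invr_gt0.
have sh : smf setT setT hfun := smf_hfun oTT.
have sph : suppK a b setT hfun := @suppK_hfun setT.
have mo m := mosers_spec ab (drop m E) oTT sh sph.
have P1 : \forall t \near t0, forall x, K x -> `|wfun t x - 1| <= 2^-1.
  apply: (@near_small R T n a b setT setT (fun t x => wfun t x - 1)) => //.
    apply: (@smf_jcont R T n setT setT (fun t x => wfun t x - 1)).
    by apply: smfB => //; [exact: smf_wfun|exact: smf_const].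
  by move=> x _; rewrite wfun0 subrr.
have P2 : \forall t \near t0, forall m : 'I_n.+1, forall x, K x -> `|mosers a b hfun (drop m E) t x| <= 2^-1.
  apply: near_forall => m; have [s1 _ _] := mo m.
  apply: (@near_small R T n a b setT setT _ t0) => //; first exact: smf_jcont s1.
  by move=> x _; apply: mosers0 => y; exact: hfun0.
(* [drop m E] gives the density perturbation after n - m of the shears; m = 0, ..., n are all
   stages. *)
pose W0 := [set t : T | (forall x, K x -> `|wfun t x - 1| <= 2^-1) /\
  forall m : 'I_n.+1, forall x, K x -> `|mosers a b hfun (drop m E) t x| <= 2^-1].
have nW0 : nbhs t0 W0 by apply: filterS2 P1 P2 => t h1 h2; split.
pose W := interior W0.
have oW : open W by exact: open_interior.
have Wt0 : W t0 by [].
have WW0 t : W t -> W0 t by exact: interior_subset.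
have wb t x : W t -> 2^-1 <= wfun t x.
  move=> /WW0[h _]; have [Kx|nK] := pselect (K x); last by rewrite wfun_off//; lra.
  by have := h x Kx; rewrite ler_norml => /andP[h1 _]; lra.
have mb m t x : W t -> `|mosers a b hfun (drop m E) t x| <= 2^-1.
  move=> /WW0[_ h].
  have [Kx|nK] := pselect (K x); last by have [_ s2 _] := mo m; rewrite s2// normr0 ltW.
  have [mn|nm] := ltnP m n.+1; first exact: (h (Ordinal mn) x Kx).
  have := h ord_max x Kx; rewrite /E !drop_oversize ?size_enum_ord//.
  by rewrite ltnW.
have shW : smf W setT hfun by move=> i; exact: (smk_sub (fun _ _ => I) (fun _ h => h) (sh i)).
have sphW : suppK a b W hfun := @suppK_hfun W.
have w0 t x : W t -> 0 < wfun t x by move=> Wt; apply: lt_le_trans (wb t x Wt).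
have [g cg] : exists g, @chain R T n a b Omega lambda ga W t0 g0fun hfun (mosers a b hfun E) g.
  apply: (@chain_all R T n a b ab Omega lambda ga oO bO KO W t0 oW Wt0 g0fun hfun n2 hfun g0fun) => //.
  - by move=> x; exact: hfun0.
  - exact: chain_init.
(* There are finitely many sequences of at most k derivatives and finitely many entries, so finitely
   many neighbourhoods are intersected. *)
have P3 : \forall t \near t0, forall q : {bseq k of 'I_n} * 'I_n * 'I_n, forall x, K x ->
    `|iter_pderiv q.1.1 (fun y => g t y q.1.2 q.2 - ga y q.1.2 q.2) x| <= eps.
  apply: near_forall => -[[s i] j] /=.
  have sF : smf W Omega (fun t y => g t y i j - ga y i j).
    by apply: smfB => //; [exact: (c_sm cg)|exact: smf_ga].
  apply: (@near_small R T n a b W Omega _ t0) => //; first exact: smf_jcont (smf_iter s sF).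
  move=> x Kx; rewrite -(iter_pderiv0 s x).
  apply: (iter_pderiv_congr (U := Omega)) => //; last exact: KO.
  by move=> y Oy; rewrite (c_t0 cg)// subrr.
have nW : nbhs t0 W by exact: open_nbhs_nbhs.
have [[A B] /= [hA hB] hAB] : nbhs t0 (W `&` [set t | forall q : {bseq k of 'I_n} * 'I_n * 'I_n, forall x, K x ->
    `|iter_pderiv q.1.1 (fun y => g t y q.1.2 q.2 - ga y q.1.2 q.2) x| <= eps]) by exact: filterI.
have /nbhs_ballP[d1 /= d10 hd1] := hA; have /nbhs_ballP[d2 /= d20 hd2] := hB.
have [j0 [j1 [j2 hJ]]] := hfun_integral.
pose d := Num.min del (Num.min d1 d2).
have d0 : 0 < d by rewrite /d !lt_min del0 d10 d20.
have [tau [mu [tau0 taud mud eq0]]] := solve_constraint j0 j1 j2 d0.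
pose t : T := (tau, mu).
have [Wt small] : (W `&` [set t | forall q : {bseq k of 'I_n} * 'I_n * 'I_n, forall x, K x ->
    `|iter_pderiv q.1.1 (fun y => g t y q.1.2 q.2 - ga y q.1.2 q.2) x| <= eps]) t.
  apply: hAB; split => /=.
    apply: hd1; rewrite -ball_normE /= sub0r normrN gtr0_norm//.
    by move: taud; rewrite /d !lt_min => /and3P[].
  apply: hd2; rewrite -ball_normE /= sub0r normrN.
  by move: mud; rewrite /d !lt_min => /and3P[].
have h0 : (\int[leb]_x (hfun t x)%:E = 0)%E.
  rewrite suppO_integral ?hJ ?eq0 ?mulr0//; first exact: (smf_slice sh I).
  by move=> x; exact: hfun_off.
(* Here the constraint pays off: with integral 0, averaging in all directions leaves the density
   1. *)
have m0 := mosers_enum0 ab oW shW sphW Wt h0.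
have m1 : (fun x => 1 + mosers a b hfun E t x) = fun=> 1.
  by apply/funext => x; rewrite m0 addr0.
exists tau, mu, (g t); split.
- split => //; last by move=> x; exact: wb.
  by apply: lt_le_trans mud _; rewrite /d ge_min lexx.
- split.
  + apply: conductivity_C_glue.
    * by move=> i j; exact: (smf_slice (c_sm cg i j) Wt).
    * by move=> x; exact: (c_off cg).
    * by move=> x; exact: (c_pos cg).
  + apply: ge_ereal_sup => _ [s [i [j [x [sk Ox ->]]]]]; rewrite lee_fin.
    have -> : (fun y => (g t y - ga y) i j) = (fun y => g t y i j - ga y i j).
      by apply/funext => y; rewrite !mxE.
    have [Kx|nK] := pselect (K x); first exact: (small (Bseq sk, i, j) x Kx).
    rewrite (@iter_pderiv_congr R n (~` K) _ (fun=> 0) s x)//.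
    * by rewrite iter_pderiv0 normr0 ltW.
    * exact: closed_openC.
    * by move=> y nKy; rewrite (c_off cg)// subrr.
  + by have := c_gauge cg Wt; rewrite m1.
(* For m = n no direction is left in [drop n E], and the bound is about [hfun] itself. *)
- move=> x; have := mb n t x Wt; rewrite /E drop_oversize ?size_enum_ord//= ler_norml => /andP[h1 _]; lra.
- move=> y Oy; have [x Ox] := c_range cg Wt Oy; exists x => //.
  by move: q; rewrite {1}/iota m0 addr0 expr1n divr1.
- move=> F mF F0; rewrite -(c_int cg Wt mF F0); apply: eq_integral => x _.
  by rewrite m0 addr0 /iota expr1n divr1 mulr1.
Qed.

End init.

(** * Volume of linear images *)

Section linear_volume.
Variable R : realType.
Notation mu := (@lebesgue_measure R).

Lemma ge0_integral_opp (f : R -> \bar R) :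
  measurable_fun setT f -> (forall s, 0 <= f s)%E ->
  (\int[mu]_s f (- s)%R = \int[mu]_s f s)%E.
Proof.
move=> mf f0.
have mN : measurable_fun setT (-%R : measurableTypeR R -> measurableTypeR R).
  exact: oppr_measurable.
have E A : measurable A -> mu A = pushforward mu (-%R : measurableTypeR R -> measurableTypeR R) A.
  move=> mA.
  apply: (@lebesgue_measure_unique R (pushforward mu (-%R : measurableTypeR R -> measurableTypeR R))) => //.
  move=> _ [[a b] _ <-] /=; rewrite /pushforward.
  have -> : -%R @^-1` `]a, b] = `[- b, - a[%classic.
    by apply/seteqP; split => s /=; rewrite !in_itv/= ltrNr lerNl andbC.
  rewrite !lebesgue_measure_itv/= !lte_fin ltrN2.
  by case: ifP => //; rewrite opprK -!EFinD => _; rewrite addrC.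
rewrite -(ge0_integral_pushforward mN mu (D := setT) (f := f))//.
by apply: eq_measure_integral => A mA _; exact/esym/E.
Qed.

Lemma ge0_integral_affine (c d : R) (f : R -> \bar R) : c != 0 ->
  measurable_fun setT f -> (forall s, 0 <= f s)%E ->
  (`|c|%:E * \int[mu]_s f (c * s + d)%R = \int[mu]_s f s)%E.
Proof.
have pos (e : R) (g : R -> \bar R) : 0 < e -> measurable_fun setT g -> (forall s, 0 <= g s)%E ->
    (e%:E * \int[mu]_s g (e * s + d)%R = \int[mu]_s g s)%E.
  move=> e0 mg g0.
  have dd (s : R) : is_derive s 1 (fun s => e * s + d) e.
    have h1 := is_deriveZ e (is_derive_id s (1 : R)).
    have := is_deriveD h1 (is_derive_cst d s (1 : R)).
    by rewrite addr0 /GRing.scale/= mulr1.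
  have K : cancel (fun s => e * s + d) (fun s => (s - d) / e).
    by move=> s; rewrite addrK mulrAC divff ?mul1r// gt_eqF.
  have K' : cancel (fun s => (s - d) / e) (fun s => e * s + d).
    by move=> s; rewrite mulrCA divff ?gt_eqF// mulr1 subrK.
  rewrite -(@ge0_integral_subst R (fun s => e * s + d) (fun=> e) _ g dd _ _ K K')//.
    rewrite -ge0_integralZl//; first by apply: eq_integral => s _; rewrite muleC.
    - apply: measurableT_comp => //; apply: measurable_funD => //; exact: measurable_funM.
    - by rewrite lee_fin ltW.
  by move=> s; exact: cst_continuous.
move=> c0 mf f0; have [cp|cn|/eqP] := ltgtP 0 c; last by rewrite eq_sym (negbTE c0).
  by rewrite gtr0_norm//; exact: pos.
rewrite -[RHS]ge0_integral_opp// ltr0_norm//.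
have mg : measurable_fun setT (fun s : R => f (- s)%R).
  by apply: (measurableT_comp mf); exact: oppr_measurable.
rewrite -(ge0_integral_opp (f := fun s => f (c * s + d)))//; last first.
  apply: measurableT_comp => //; apply: measurable_funD => //; exact: measurable_funM.
under eq_integral do rewrite mulrN -mulNr.
have := @pos (- c) f; rewrite oppr_gt0 => /(_ cn mf f0) ->.
by rewrite ge0_integral_opp.
Qed.

Variable n : nat.
Implicit Types (A B : 'M[R]_n) (x : 'rV[R]_n).

Lemma measurable_mulmxr A : measurable_fun setT (fun x : 'rV[R]_n => x *m A).
Proof.
apply: measurable_fun_rV => // i.
under eq_fun do rewrite mxE.
by apply: measurable_sum => k; apply: measurable_funM => //; exact: measurable_coord.
Qed.

Definition scales_volume A := forall f : 'rV[R]_n -> \bar R,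
  measurable_fun setT f -> (forall x, 0 <= f x)%E ->
  (`|\det A|%:E * \int[lebesgue_rV R n]_x f (x *m A)%R =
   \int[lebesgue_rV R n]_x f x)%E.

(** A cancellation rule, as elimination multiplies by elementary operations on the left until the
    identity is reached. *)
Lemma scales_volumeM A B : scales_volume A -> scales_volume (A *m B) -> \det A != 0 ->
  scales_volume B.
Proof.
move=> sA sAB dA f mf f0.
rewrite -(sAB f)// -(sA (fun x => f (x *m B)))//; last first.
  by apply: (measurableT_comp mf); exact: measurable_mulmxr.
rewrite det_mulmx normrM muleA -EFinM mulrC.
by under [in RHS]eq_integral do rewrite mulmxA.
Qed.

(* The identity matrix with its j-th column replaced by c. *)
Definition row_op (j : 'I_n) (c : 'cV[R]_n) : 'M[R]_n :=
  1%:M + (c - delta_mx j 0) *m delta_mx 0 j.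

Lemma mul_row_op j c x : x *m row_op j c = upd j x ((x *m c) 0 0).
Proof.
rewrite /row_op mulmxDr mulmx1 mulmxA mulmxBr.
apply/rowP => i; rewrite updE !mxE big_ord1 !mxE.
congr (_ + _ * _); congr (_ - _).
rewrite (bigD1 j)//= !mxE !eqxx mulr1 big1 ?addr0// => k kj.
by rewrite !mxE (negbTE kj) mulr0.
Qed.

Lemma det_row_op j c : \det (row_op j c) = c j 0.
Proof.
rewrite /row_op det_rank1 mxE (bigD1 j)//= !mxE !eqxx mul1r big1 ?addr0 => [|k kj].
  by rewrite subrKC.
by rewrite !mxE (negbTE kj) andbF mul0r.
Qed.

Lemma row_op_mul j c A i k : (row_op j c *m A) i k =
  A i k + (c i 0 - (i == j)%:R) * A j k.
Proof.
rewrite /row_op mulmxDl mul1mx -mulmxA mxE; congr (_ + _).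
rewrite mxE big_ord1 !mxE andbT; congr (_ * _).
rewrite (bigD1 j)//= !mxE !eqxx mul1r big1 ?addr0// => l lj.
by rewrite !mxE (negbTE lj) andbF mul0r.
Qed.

(** Only the j-th coordinate is changed, and it is affine in x_j with slope c_j: an affine
    substitution on each line. *)
Lemma scales_volume_row_op j (c : 'cV[R]_n) : c j 0 != 0 -> scales_volume (row_op j c).
Proof.
move=> cj f mf f0; rewrite det_row_op.
rewrite -ge0_integralZl//; last first.
  by apply: (measurableT_comp mf); exact: measurable_mulmxr.
apply: (@ge0_integral_line R n j) => //.
- apply: emeasurable_funM => //; apply: (measurableT_comp mf); exact: measurable_mulmxr.
- by move=> x; rewrite mule_ge0// lee_fin.
move=> x; rewrite ge0_integralZl//; last first.
  apply: (measurableT_comp mf); apply: (measurableT_comp (@measurable_mulmxr (row_op j c))); exact: measurable_upd.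
pose d := \sum_(k | k != j) x 0 k * c k 0.
rewrite -(@ge0_integral_affine (c j 0) d (fun s => f (upd j x s)))//; last first.
  by apply: (measurableT_comp mf); exact: measurable_upd.
congr (_ * _)%E; apply: eq_integral => s _; congr f.
rewrite mul_row_op; apply/rowP => i; rewrite !mxE; case: eqP => // _.
rewrite (bigD1 j)//= mxE eqxx mulrC; congr (_ + _).
by apply: eq_bigr => k kj; rewrite mxE (negbTE kj).
Qed.

(** Gaussian elimination, column by column: [P k B] says that the first k columns are those of the
    identity. *)
Lemma scales_volume_unit A : A \in unitmx -> scales_volume A.
Proof.
have step (B : 'M[R]_n) j (c : 'cV[R]_n) : c j 0 != 0 -> scales_volume (row_op j c *m B) -> scales_volume B.
  move=> cj sB; apply: scales_volumeM sB _; first exact: scales_volume_row_op.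
  by rewrite det_row_op.
have uop (B : 'M[R]_n) j (c : 'cV[R]_n) : c j 0 != 0 -> B \in unitmx -> row_op j c *m B \in unitmx.
  by move=> cj uB; rewrite unitmx_mul uB andbT unitmxE det_row_op unitfE.
pose P (k : nat) (B : 'M[R]_n) := forall i j : 'I_n, (j < k)%N -> B i j = (i == j)%:R.
suff H m k B : (k + m)%N = n -> P k B -> B \in unitmx -> scales_volume B.
  by move=> uA; apply: (H n 0%N A) => // i j; rewrite ltn0.
elim: m k B => [|m IH] k B; first rewrite addn0 => kn PB _.
  have -> : B = 1%:M by apply/matrixP => i j; rewrite PB ?kn// mxE.
  move=> f mf f0; rewrite det1 normr1 mul1e.
  by apply: eq_integral => x _; rewrite mulmx1.
move=> kmn PB uB.
have kn : (k < n)%N by rewrite -kmn addnS ltnS leq_addr.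
pose kk := Ordinal kn.
have red C : P k C -> C kk kk != 0 -> C \in unitmx -> scales_volume C.
  move=> PC Ckk uC.
  (* Normalises the pivot to 1 and clears the rest of its column. *)
  pose c := \col_i (if i == kk then (C kk kk)^-1 else - C i kk / C kk kk).
  have ck : c kk 0 != 0 by rewrite mxE eqxx invr_eq0.
  apply: (step C kk c ck); apply: (IH k.+1); [by rewrite addSnnS| |exact: uop].
  move=> i j; rewrite ltnS leq_eqVlt => /orP[/eqP jk|jk].
    have -> : j = kk by exact: val_inj.
    rewrite row_op_mul mxE; case: eqP => [->|_].
      by rewrite mulrBl mulVf// mul1r addrC subrK.
    by rewrite subr0 mulfVK// subrr.
  rewrite row_op_mul !PC//.
  by rewrite (_ : kk == j = false) ?mulr0 ?addr0// eq_sym -val_eqE/= ltn_eqF.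
have [Bk|Bk] := eqVneq (B kk kk) 0; last exact: red.
have [l kl Bl] : exists2 l : 'I_n, (k < l)%N & B l kk != 0.
  apply: contrapT => no.
  have z (l : 'I_n) : (k <= l)%N -> B l kk = 0.
    rewrite leq_eqVlt => /orP[/eqP E|kl]; first by rewrite (_ : l = kk)//; exact: val_inj.
    by apply/eqP; apply: contrapT => /negP h; apply: no; exists l.
  (* If the column vanished from row k on, it would be a combination of the earlier columns; v is
     the resulting kernel vector, impossible for an invertible B. *)
  pose v : 'cV[R]_n := \col_i (if i == kk then -1 else if (i < k)%N then B i kk else 0).
  have Bv : B *m v = 0.
    apply/colP => i; rewrite !mxE (bigD1 kk)//= mxE eqxx mulrN1.
    rewrite (eq_bigr (fun j => (i == j)%:R * (if (j < k)%N then B j kk else 0))); last first.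
      move=> j jk; rewrite mxE (negbTE jk); case: ifP => jlt; last by rewrite !mulr0.
      by rewrite PB.
    have [ik|ik] := ltnP i k.
      rewrite (bigD1 i)/=; last by rewrite -val_eqE/= ltn_eqF.
      rewrite eqxx mul1r ik big1 ?addr0 ?addNr// => j /andP[_ ji].
      by rewrite eq_sym (negbTE ji) mul0r.
    rewrite z// oppr0 add0r big1// => j jk; case: eqP => [<-|]; last by rewrite mul0r.
    by rewrite ltnNge ik mulr0.
  have : v kk 0 = 0 by rewrite -[v](mulKmx uB) Bv mulmx0 mxE.
  by rewrite mxE eqxx => /eqP; rewrite oppr_eq0 oner_eq0.
(* Adds row l to row kk, which makes the pivot nonzero. *)
pose c : 'cV[R]_n := delta_mx l 0 + delta_mx kk 0.
have lk : (l == kk) = false by rewrite -val_eqE/= gtn_eqF.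
have cl : c l 0 = 1 by rewrite !mxE !eqxx lk addr0.
have cl0 : c l 0 != 0 by rewrite cl oner_eq0.
apply: (step B l c cl0); apply: red; last exact: uop.
  move=> i j jk; rewrite row_op_mul !PB//.
  by rewrite (_ : l == j = false) ?mulr0 ?addr0// eq_sym -val_eqE/= ltn_eqF// (ltn_trans jk).
by rewrite row_op_mul Bk add0r !mxE !eqxx [kk == l]eq_sym lk add0r subr0 mul1r.
Qed.

Lemma volume_linear_image A (c : 'rV[R]_n) (r : R) : A \in unitmx -> 0 <= r ->
  lebesgue_rV R n [set y | forall i, `|(y *m invmx A) 0 i - c 0 i| <= r] =
  (`|\det A| * (r *+ 2) ^+ n)%:E.
Proof.
move=> uA r0.
pose S := [set x : 'rV[R]_n | forall i, `[c 0 i - r, c 0 i + r]%classic (x 0 i)].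
pose T := [set y : 'rV[R]_n | S (y *m invmx A)].
have mS : measurable S by exact: (@measurable_box R n (fun i => `[c 0 i - r, c 0 i + r]%classic)).
have mT : measurable T.
  by have := @measurable_mulmxr (invmx A) measurableT S mS; rewrite setTI.
rewrite (_ : [set y | _] = T); last first.
  apply/seteqP; split => y /= h i; move: (h i); by rewrite /= in_itv/= distrC ler_distlC.
have ind X : measurable X -> (\int[lebesgue_rV R n]_x (\1_X x)%:E = lebesgue_rV R n X)%E.
  by move=> mX; rewrite integral_indic ?setIT.
rewrite -ind// -(@scales_volume_unit A uA (fun y => (\1_T y)%:E))//; last first.
  by apply/measurable_EFinP; exact: measurable_indic.
have -> : (\int[lebesgue_rV R n]_x (\1_T (x *m A))%:E = \int[lebesgue_rV R n]_x (\1_S x)%:E)%E.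
  apply: eq_integral => x _; congr (_%:E); rewrite !indicE; congr (_%:R).
  by apply: congr1; apply/idP/idP; rewrite !inE /T /= mulmxK.
rewrite ind// (@lebesgue_rV_box R n (fun i => `[c 0 i - r, c 0 i + r]%classic))//.
rewrite EFinM; congr (_ * _)%E.
rewrite (eq_bigr (fun=> (r *+ 2)%:E)) => [|i _].
  by rewrite -(big_morph EFin (@EFinM R) (erefl _)) prodr_const card_ord.
rewrite lebesgue_measure_itv/= lte_fin.
have [_|] := ltP (c 0 i - r) (c 0 i + r).
  by rewrite -EFinB; congr (_%:E); rewrite mulr2n; ring.
move=> h; have -> : r = 0 by lra.
by rewrite mul0rn.
Qed.

End linear_volume.

(** * Volume-preserving maps *)

Section volume_preserving.
Variables (R : realType) (n : nat) (Omega : set 'rV[R]_n).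
Notation leb := (lebesgue_rV R n).
Variables (Phi Theta : 'rV[R]_n -> 'rV[R]_n) (g : 'rV[R]_n -> R).
Hypotheses (oO : open Omega) (bO : bounded_set Omega).
Hypotheses (TO : forall y, Omega y -> Omega (Theta y)).
Hypotheses (PT : forall y, Omega y -> Phi (Theta y) = y).
Hypothesis C1P : forall x i, Omega x -> C1_at (fun y => Phi y 0 i) x.
Hypothesis dP : forall x, Omega x -> `|\det (jac Phi x)| = 1.
Hypothesis cT : forall y i, Omega y -> {for y, continuous (fun y => Theta y 0 i)}.
Hypotheses (cg : forall x, Omega x -> {for x, continuous g}) (g0 : forall x, 0 <= g x).

Definition cube (c : 'rV[R]_n) (r : R) := [set x : 'rV[R]_n | forall i, `|x 0 i - c 0 i| <= r].

(** The volume of the image is measured by that of a measurable set containing it. *)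
Definition nearly_isochoric (eta : R) c r :=
  (exists T, [/\ measurable T, Phi @` cube c r `<=` T &
     (leb T <= ((1 + eta) ^+ n * (r *+ 2) ^+ n)%:E)%E]) /\
  forall x, cube c r x -> `|g x - g c| <= eta.

(** By strict differentiability Phi is close to its linear part at x0 on every small cube nearby, so
    the image of a cube of radius r lies in the linear image of one of radius (1 + eta) r; the
    linear part has determinant 1 or -1. *)
Lemma local_volume x0 (eta : R) : Omega x0 -> 0 < eta -> exists d, [/\ 0 < d, ball x0 d `<=` Omega &
  forall c r, 0 <= r -> cube c r `<=` ball x0 d -> nearly_isochoric eta c r].
Proof.
move=> Ox0 eta0.
pose A := (jac Phi x0)^T.
have dA : `|\det A| = 1 by rewrite det_tr dP.
have uA : A \in unitmx by rewrite unitmxE unitfE -normr_eq0 dA oner_eq0.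
pose B := invmx A.
(* M bounds the inverse linear part in the sup norm, so an error e r in Phi with e = eta/(M+1) is at
   most eta r after applying it. *)
pose M := \sum_i \sum_k `|B k i|.
have M0 : 0 <= M by apply: sumr_ge0 => i _; apply: sumr_ge0.
have MB i : \sum_k `|B k i| <= M.
  by rewrite /M [leRHS](bigD1 i)//= lerDl; apply: sumr_ge0 => j _; apply: sumr_ge0.
have M1 : 0 < M + 1 by rewrite ltr_wpDl.
pose e := eta / (M + 1).
have e0 : 0 < e by rewrite divr_gt0.
have /choice[d1 hd1] (i : 'I_n) : exists d, 0 < d /\ forall y z, ball x0 d y -> ball x0 d z ->
    `|Phi z 0 i - Phi y 0 i - \sum_j (z 0 j - y 0 j) * pderiv j (fun y => Phi y 0 i) x0| <= e * `|z - y|.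
  by have [d d0 hd] := C1_strict e0 (C1P i Ox0); exists d.
have [dO dO0 hdO] : exists2 d, 0 < d & ball x0 d `<=` Omega.
  by have /nbhs_ballP[d /= d0 hd] := open_nbhs_nbhs (conj oO Ox0); exists d.
have [dg dg0 hdg] : exists2 d, 0 < d & forall y, ball x0 d y -> `|g x0 - g y| < eta / 2.
  have e20 : 0 < eta / 2 by rewrite divr_gt0.
  have /cvgrPdist_lt/(_ _ e20)/nbhs_ballP[d /= d0 hd] := cg Ox0.
  by exists d.
pose d := Num.min dO (Num.min dg (\big[Num.min/1]_i d1 i)).
have d0 : 0 < d.
  by rewrite !lt_min dO0 dg0/=; apply: lt_bigmin => // i _; have [] := hd1 i.
have dle1 i : d <= d1 i by rewrite !ge_min bigmin_le !orbT.
have dleO : d <= dO by rewrite ge_min lexx.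
have dleg : d <= dg by rewrite !ge_min lexx orbT.
exists d; split => //; first exact: subset_trans (le_ball dleO) hdO.
move=> c r r0 cb.
have cc : cube c r c by move=> i; rewrite subrr normr0.
split; last first.
  move=> x /cb xb; rewrite (splitr eta) (_ : g x - g c = (g x - g x0) + (g x0 - g c)); last by rewrite addrA subrK.
  rewrite (le_trans (ler_normD _ _))// lerD//.
    by rewrite distrC ltW// hdg//; apply: le_ball xb.
  by rewrite ltW// hdg//; exact: le_ball (cb _ cc).
pose w := Phi c *m B.
exists [set y | forall i, `|(y *m B) 0 i - w 0 i| <= r * (1 + eta)].
have r1 : 0 <= r * (1 + eta) by rewrite mulr_ge0// addr_ge0// ltW.
split.
- rewrite (_ : [set y | _] = (fun y => y *m B) @^-1`
    [set x | forall i, `[w 0 i - r * (1 + eta), w 0 i + r * (1 + eta)]%classic (x 0 i)]); last first.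
    by apply/seteqP; split => y /= h i; move: (h i); rewrite /= in_itv/= distrC ler_distlC.
  rewrite -[X in measurable X]setTI; apply: measurable_mulmxr => //.
  exact: (@measurable_box R n (fun i => `[w 0 i - r * (1 + eta), w 0 i + r * (1 + eta)]%classic)).
- move=> _ [x xc <-] i; rewrite /w.
  pose err := Phi x - Phi c - (x - c) *m A.
  have -> : (Phi x *m B) 0 i - (Phi c *m B) 0 i = (x 0 i - c 0 i) + (err *m B) 0 i.
    rewrite /err (mulmxBl _ _ B) (mulmxBl _ _ B) mulmxK//.
    by move: (Phi x *m B) (Phi c *m B) => p q; rewrite !mxE; ring.
  have xcr : `|x - c| <= r by apply: rV_norm_le => // j; rewrite !mxE; exact: xc.
  rewrite (le_trans (ler_normD _ _))// mulrDr mulr1 lerD//.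
  have he k : `|err 0 k| <= e * r.
    have [_ /(_ c x)] := hd1 k; rewrite /err !mxE.
    move=> /(_ (le_ball (dle1 k) (cb _ cc)) (le_ball (dle1 k) (cb _ xc))).
    rewrite (eq_bigr (fun j => (x - c) 0 j * A j k)); last by move=> j _; rewrite !mxE.
    by move=> /le_trans; apply; rewrite ler_pM2l.
  rewrite mxE (le_trans (ler_norm_sum _ _ _))//.
  apply: (@le_trans _ _ (\sum_k e * r * `|B k i|)).
    by apply: ler_sum => k _; rewrite normrM ler_wpM2r.
  rewrite -mulr_sumr (@le_trans _ _ (e * r * M))//.
    by rewrite ler_wpM2l ?MB// mulr_ge0// ltW.
  rewrite /e mulrAC [leLHS]mulrC mulrA [leLHS]mulrC mulrCA [leRHS]mulrC.
  by rewrite [leRHS]mulrC ler_wpM2l// mulrCA ger_pMr// ler_pdivrMr// mul1r lerDl.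
- rewrite volume_linear_image// dA mul1r lee_fin -mulrnAl exprMn mulrC//.
Qed.

Lemma uniform_volume K (eta : R) : compact K -> K `<=` Omega -> 0 < eta ->
  exists m : nat, forall x0, K x0 -> ball x0 m.+1%:R^-1 `<=` Omega /\
   forall c r, 0 <= r -> cube c r `<=` ball x0 m.+1%:R^-1 -> nearly_isochoric eta c r.
Proof.
move=> cK KO eta0.
have /compact_near_coveringP/(_ _ \oo (fun m x0 => ball x0 m.+1%:R^-1 `<=` Omega /\
   forall c r, 0 <= r -> cube c r `<=` ball x0 m.+1%:R^-1 -> nearly_isochoric eta c r)) := cK.
case=> [x Kx|N _ hN]; last by exists N => x0 Kx; exact: (hN N (leqnn N)).
have [d [d0 dO hd]] := local_volume (KO _ Kx) eta0.
(* Half the radius is for the distance of the two centres, half for the new ball. *)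
have d20 : 0 < d / 2 by rewrite divr_gt0.
have H x' m : ball x (d / 2) x' -> m.+1%:R^-1 < d / 2 -> ball x' m.+1%:R^-1 `<=` ball x d.
  by move=> b1 b2; apply: subset_trans (le_ball (ltW b2)) _ => z h; rewrite (splitr d); exact: ball_triangle b1 h.
exists (ball x (d / 2), [set m | m.+1%:R^-1 < d / 2]); first split => /=.
- exact: nbhsx_ballx.
- exact: (near_infty_natSinv_lt (PosNum d20)).
- move=> [x' m] /= [h1 h2]; split; first exact: subset_trans (H _ _ h1 h2) dO.
  by move=> c r r0 cb; apply: hd => //; exact: subset_trans cb (H _ _ h1 h2).
Qed.

(** Cells of a grid of mesh h; being half-open, they are disjoint. *)
Definition cell (h : R) (o : 'rV[R]_n) (v : 'I_n -> nat) :=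
  [set x : 'rV[R]_n | forall i, `[(v i)%:R * h, (v i).+1%:R * h[%classic (x 0 i - o 0 i)].

Lemma measurable_cell h o v : measurable (cell h o v).
Proof.
rewrite (_ : cell h o v = [set x | forall i,
  `[o 0 i + (v i)%:R * h, o 0 i + (v i).+1%:R * h[%classic (x 0 i)]); last first.
  apply/seteqP; split => x /= + i => /(_ i); rewrite /= !in_itv/= lerBrDl ltrBlDl//.
exact: (@measurable_box R n (fun i => `[o 0 i + (v i)%:R * h, o 0 i + (v i).+1%:R * h[%classic)).
Qed.

Lemma volume_cell h o v : 0 <= h -> leb (cell h o v) = (h ^+ n)%:E.
Proof.
move=> h0; rewrite (_ : cell h o v = [set x | forall i,
  `[o 0 i + (v i)%:R * h, o 0 i + (v i).+1%:R * h[%classic (x 0 i)]); last first.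
  by apply/seteqP; split => x /= + i => /(_ i); rewrite /= !in_itv/= lerBrDl ltrBlDl.
rewrite (@lebesgue_rV_box R n (fun i => `[o 0 i + (v i)%:R * h, o 0 i + (v i).+1%:R * h[%classic))//.
rewrite (eq_bigr (fun=> h%:E)) => [|i _].
  by rewrite -(big_morph EFin (@EFinM R) (erefl _)) prodr_const card_ord.
rewrite lebesgue_measure_itv/= lte_fin ltrD2l -[(v i).+1]addn1 natrD mulrDl mul1r.
have [_|] := ltP ((v i)%:R * h) ((v i)%:R * h + h).
  by rewrite -EFinB; congr (_%:E); ring.
by move=> hh; have -> : h = 0 by lra.
Qed.

Lemma cell_inj h o v w x : 0 < h -> cell h o v x -> cell h o w x -> v =1 w.
Proof.
move=> h0 hv hw i; move: (hv i) (hw i); rewrite /= !in_itv/= => /andP[a1 a2] /andP[b1 b2].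
have := le_lt_trans a1 b2; have := le_lt_trans b1 a2.
rewrite !ltr_pM2r// !ltr_nat !ltnS => p q.
by apply/eqP; rewrite eqn_leq p q.
Qed.

Lemma cell_cube h o v : exists c, cell h o v `<=` cube c (h / 2).
Proof.
exists (\row_i (o 0 i + (v i)%:R * h + h / 2)) => x hx i.
move: (hx i); rewrite /= in_itv/= mxE -natr1 mulrDl mul1r => /andP[h1 h2].
by rewrite ler_norml; apply/andP; split; lra.
Qed.

Lemma cell_cover (M h : R) (x : 'rV[R]_n) : 0 < h -> (forall i, `|x 0 i| <= M) ->
  exists v : {ffun 'I_n -> 'I_(Num.bound ((M *+ 2) / h))}, cell h (const_mx (- M)) (fun i => v i) x.
Proof.
move=> h0 hx.
have a0 (i : 'I_n) : 0 <= (x 0 i + M) / h.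
  by rewrite divr_ge0 ?(ltW h0)//; have := hx i; rewrite ler_norml => /andP[]; lra.
have lt (i : 'I_n) : (Num.truncn ((x 0 i + M) / h)%R < Num.bound ((M *+ 2) / h)%R)%N.
  rewrite -(ltr_nat R); have /andP[h1 _] := truncn_itv (a0 i).
  apply: (le_lt_trans h1).
  apply: (@le_lt_trans _ _ ((M *+ 2) / h)); last first.
    by apply: archi_boundP; rewrite divr_ge0 ?(ltW h0)// mulrn_wge0// (le_trans _ (hx i)).
  by rewrite ler_pM2r ?invr_gt0// mulr2n lerD2r; have := hx i; rewrite ler_norml => /andP[].
exists [ffun i => Ordinal (lt i)] => i; rewrite ffunE /= in_itv/= mxE opprK.
by rewrite -ler_pdivlMr// -ltr_pdivrMr//; exact: truncn_itv.
Qed.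

Let mO : measurable Omega. Proof. exact: open_measurable_rV. Qed.

Let mT : measurable_fun Omega Theta.
Proof.
apply: measurable_fun_rV => // i; apply: continuous_measurable_rV => // y Oy; exact: cT.
Qed.

Let mg : measurable_fun Omega g.
Proof. by apply: continuous_measurable_rV => // y Oy; exact: cg. Qed.

Let mgT : measurable_fun Omega (fun y => g (Theta y)).
Proof.
apply: (measurable_comp mO _ mg mT) => _ [y Oy <-]; exact: TO.
Qed.

(** Keep the grid cells that meet K. The preimage of a cell under Theta lies in its image under Phi,
    whose volume exceeds that of the cell by a factor at most (1 + eta)^n. Comparing g with its
    value at the centre costs eta in each of the two integrals. *)
Lemma transport_compact K (eta : R) : compact K -> K `<=` Omega -> 0 < eta ->
  (\int[leb]_(y in Omega `&` Theta @^-1` K) (g (Theta y))%:E <=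
   ((1 + eta) ^+ n)%:E * \int[leb]_(x in Omega) (g x + eta *+ 2)%:E)%E.
Proof.
move=> cK KO eta0.
have [m hm] := uniform_volume cK KO eta0.
have [M M0 hM] := boundN bO.
(* A cell with this side that contains a point of K lies in the ball of radius 1/(m+1) around it. *)
pose h : R := m.+2%:R^-1.
have h0 : 0 < h by rewrite invr_gt0.
have hm1 : h < m.+1%:R^-1 by rewrite ltf_pV2 ?posrE// ltr_nat.
pose o : 'rV[R]_n := const_mx (- M).
pose I := {ffun 'I_n -> 'I_(Num.bound ((M *+ 2) / h))}.
pose C (v : I) := cell h o (fun i => v i).
pose F v := Omega `&` Theta @^-1` (C v).
have mC v : measurable (C v) by exact: measurable_cell.
have mF v : measurable (F v) by exact: mT.
pose s := [seq v <- enum I | `[< exists x, K x /\ C v x >]].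
have us : uniq s by rewrite filter_uniq// enum_uniq.
have sP v : v \in s -> exists x, K x /\ C v x by rewrite mem_filter => /andP[/asboolP].
have Cinj v w x : C v x -> C w x -> v = w.
  by move=> h1 h2; apply/ffunP => i; apply: val_inj; exact: (cell_inj h0 h1 h2).
have tC : trivIset [set` s] C by move=> v w _ _ [x [h1 h2]]; exact: Cinj h1 h2.
have tF : trivIset [set` s] F by move=> v w _ _ [x [[_ h1] [_ h2]]]; exact: Cinj h1 h2.
have nI v : v \in s -> exists c, C v `<=` cube c (h / 2) /\ nearly_isochoric eta c (h / 2) /\ C v `<=` Omega.
  move=> /sP[p [Kp Cp]]; have [c hc] := cell_cube h o (fun i => v i).
  have [bO' gd] := hm _ Kp.
  have cb : cube c (h / 2) `<=` ball p m.+1%:R^-1.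
    move=> z hz; apply/rV_ballP; split => [|i]; first by rewrite invr_gt0.
    apply: le_lt_trans hm1; rewrite (_ : p 0 i - z 0 i = (p 0 i - c 0 i) - (z 0 i - c 0 i)); last by ring.
    by rewrite (splitr h) (le_trans (ler_normB _ _))// lerD//; exact: hc.
  exists c; split => //; split; first by apply: gd => //; rewrite divr_ge0// ltW.
  by move=> x /hc/cb/bO'.
have e1 : 0 <= (1 + eta) ^+ n by rewrite exprn_ge0// addr_ge0// ltW.
have g2 x : 0 <= g x + eta *+ 2 by rewrite addr_ge0// mulrn_wge0// ltW.
have mg2 : measurable_fun Omega (fun x => g x + eta *+ 2) by apply: measurable_funD.
have FO : \big[setU/set0]_(v <- s) F v `<=` Omega.
  by rewrite big_seq; elim/big_ind: _ => // [A B hA hB x [/hA|/hB]|v _ x []].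
have CO : \big[setU/set0]_(v <- s) C v `<=` Omega.
  by rewrite big_seq; elim/big_ind: _ => // [A B hA hB x [/hA|/hB]|v /nI[c [_ [_ hv]]]].
have mUF : measurable (\big[setU/set0]_(v <- s) F v) by exact: bigsetU_measurable.
have mUC : measurable (\big[setU/set0]_(v <- s) C v) by exact: bigsetU_measurable.
have mK : measurable K by apply: closed_measurable_rV; apply: compact_closed => //; exact: norm_hausdorff.
apply: (@le_trans _ _ (\int[leb]_(y in \big[setU/set0]_(v <- s) F v) (g (Theta y))%:E)%E).
  apply: ge0_subset_integral => //.
  - exact: mT.
  - by apply/measurable_EFinP; exact: measurable_funS mgT.
  - by move=> y _; rewrite lee_fin.
  - move=> y [Oy Ky]; have [|v Cv] := @cell_cover M h (Theta y) h0.
      by move=> i; rewrite (le_trans (rV_coord_norm _ _))// hM//; apply: subset_closure; exact: TO.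
    rewrite -bigcup_seq; exists v => //=.
    by rewrite mem_filter mem_enum andbT; apply/asboolP; exists (Theta y).
rewrite ge0_integral_bigsetU//; last 2 first.
- by apply/measurable_EFinP; exact: measurable_funS mgT.
- by move=> y _; rewrite lee_fin.
apply: (@le_trans _ _ (((1 + eta) ^+ n)%:E * \int[leb]_(x in \big[setU/set0]_(v <- s) C v) (g x + eta *+ 2)%:E)%E); last first.
  rewrite lee_wpmul2l ?lee_fin//; apply: ge0_subset_integral => //; first exact/measurable_EFinP.
  by move=> x _; rewrite lee_fin.
rewrite ge0_integral_bigsetU//; last 2 first.
- by apply/measurable_EFinP; exact: measurable_funS mg2.
- by move=> y _; rewrite lee_fin.
rewrite ge0_sume_distrr; last by move=> v _; apply: integral_ge0 => y _; rewrite lee_fin.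
rewrite big_seq [leRHS]big_seq; apply: lee_sum => v /nI[c [Cc [[[T [mT' PT' lT]] gc] COv]]].
have gc0 : 0 <= g c + eta by rewrite addr_ge0// ltW.
apply: (@le_trans _ _ (\int[leb]_(y in F v) (cst (g c + eta)%:E y))%E).
  apply: ge0_le_integral => //.
  - by move=> y _; rewrite lee_fin.
  - by apply/measurable_EFinP; apply: measurable_funS mgT => // y [].
  - move=> y [Oy /Cc/gc]; rewrite lee_fin ler_norml => /andP[_]; lra.
rewrite integral_cst//.
apply: (@le_trans _ _ ((g c + eta)%:E * ((1 + eta) ^+ n * h ^+ n)%:E)%E).
  rewrite lee_wpmul2l ?lee_fin//.
  have -> : h ^+ n = (h / 2 *+ 2) ^+ n by rewrite -mulr_natr divfK.
  (* If Theta y is in the cell, then y = Phi (Theta y) is in the image of the cube. *)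
  apply: le_trans lT; apply: le_measure; rewrite ?inE// => y [Oy /Cc yc].
  by apply: PT'; exists (Theta y) => //; exact: PT.
rewrite -EFinM mulrCA EFinM lee_wpmul2l ?lee_fin//.
rewrite EFinM -(volume_cell o (fun i => v i) (ltW h0)) -integral_cst//.
apply: ge0_le_integral => //.
- exact: (mC v).
- by apply/measurable_EFinP; apply: measurable_funS mg2.
- move=> y /Cc/gc; rewrite lee_fin ler_norml mulr2n => /andP[]; lra.
- exact: (mC v).
Qed.

Definition depth (m : nat) := [set x : 'rV[R]_n | forall z, ~ Omega z -> m.+1%:R^-1 <= `|x - z|].

Lemma depth_sub m : depth m `<=` Omega.
Proof.
move=> x hx; apply: contrapT => nx; have := hx x nx.
by rewrite subrr normr0 leNgt invr_gt0 ltr0Sn.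
Qed.

Lemma compact_depth m : compact (depth m).
Proof.
apply: bounded_closed_compact.
  have [M [Mr hM]] := bO; exists M; split => // N MN x /depth_sub; exact: hM.
rewrite (_ : depth m = \bigcap_(z in ~` Omega) [set x : 'rV[R]_n | m.+1%:R^-1 <= `|x - z|]); last first.
  by apply/seteqP; split => x h z; exact: h.
apply: closed_bigI => z _.
rewrite (_ : [set x : 'rV[R]_n | _] = ~` ball z m.+1%:R^-1); last first.
  by apply/seteqP; split => x; rewrite /= -ball_normE /= distrC => h; [apply/negP|move/negP: h]; rewrite -leNgt.
by apply: open_closedC; apply: ball_open; rewrite invr_gt0.
Qed.

Lemma bigcup_depth : \bigcup_m depth m = Omega.
Proof.
apply/seteqP; split => [x [m _ /depth_sub]//|x Ox].
have [d /= d0 hd] : exists2 d, 0 < d & ball x d `<=` Omega.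
  by have /nbhs_ballP[d /= d0 hd] := open_nbhs_nbhs (conj oO Ox); exists d.
have [N _ hN] := near_infty_natSinv_lt (PosNum d0).
exists N => // z nz; rewrite leNgt; apply/negP => lt.
apply: nz; apply: hd; rewrite -ball_normE /=; apply: lt_trans lt _.
exact: (hN N (leqnn N)).
Qed.

(** On each compact set [depth m] let eta tend to 0 in [transport_compact]; then exhaust Omega by
    these sets. *)
Lemma transport_le : (\int[leb]_(x in Omega) (g x)%:E < +oo)%E ->
  (\int[leb]_(y in Omega) (g (Theta y))%:E <= \int[leb]_(x in Omega) (g x)%:E)%E.
Proof.
have F (q r s : R) : q <= r -> - (q - s) < s - r -> False by move=> *; lra.
move=> fin.
have I0 : (0 <= \int[leb]_(x in Omega) (g x)%:E)%E by apply: integral_ge0 => x _; rewrite lee_fin.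
have lt : (leb Omega < +oo)%E by exact: leb_finite.
have finO : leb Omega \is a fin_num by rewrite ge0_fin_numE.
have finI : (\int[leb]_(x in Omega) (g x)%:E)%E \is a fin_num by rewrite ge0_fin_numE.
have le m : (\int[leb]_(y in Omega `&` Theta @^-1` (depth m)) (g (Theta y))%:E <= \int[leb]_(x in Omega) (g x)%:E)%E.
  set l := (X in (X <= _)%E).
  pose a := fine (\int[leb]_(x in Omega) (g x)%:E)%E; pose L := fine (leb Omega).
  have H eta : 0 < eta -> (l <= ((1 + eta) ^+ n * (a + eta *+ 2 * L))%:E)%E.
    move=> eta0; apply: (le_trans (transport_compact (@compact_depth m) (@depth_sub m) eta0)).
    under eq_integral do rewrite EFinD.
    rewrite ge0_integralD//; last 3 first.
    - by move=> x _; rewrite lee_fin.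
    - exact/measurable_EFinP.
    - by move=> x _; rewrite lee_fin mulrn_wge0// ltW.
    rewrite (integral_cst leb mO) /= -(fineK finI) -(fineK finO) -/a -/L.
    exact: lexx.
  have l0 : (0 <= l)%E by apply: integral_ge0 => x _; rewrite lee_fin.
  have lf : l \is a fin_num by rewrite ge0_fin_numE//; apply: le_lt_trans (H 1 ltr01) (ltry _).
  rewrite -(fineK finI) -(fineK lf) lee_fin -/a leNgt; apply/negP => al.
  (* The upper bound is a polynomial in eta with value a at 0; its continuity there contradicts a <
     l. *)
  pose p : {poly R} := (1 + 'X) ^+ n * (a%:P + (L *+ 2) *: 'X).
  have pE eta : p.[eta] = (1 + eta) ^+ n * (a + eta *+ 2 * L).
    rewrite /p hornerM horner_exp hornerD hornerX hornerC hornerD hornerC hornerZ hornerX.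
    by rewrite !mulrnAl [L * eta]mulrC.
  have e0 : 0 < fine l - a by rewrite subr_gt0.
  have /cvgrPdist_lt/(_ _ e0)/nbhs_ballP[d /= d0 hd] := @continuous_horner R p 0.
  have d20 : 0 < d / 2 by rewrite divr_gt0.
  have := hd (d / 2); rewrite -ball_normE /= sub0r normrN gtr0_norm// ltr_pdivrMr// ltr_pMr//.
  rewrite ltr1n => /(_ isT); rewrite !pE mul0rn mul0r !addr0 expr1n mul1r.
  have := H _ d20; rewrite -(fineK lf) lee_fin ltr_norml => h1 /andP[h2 _].
  exact: F h1 h2.
have nd : nondecreasing_seq (fun m => Omega `&` Theta @^-1` (depth m)).
  move=> m1 m2 m12; rewrite subsetEset => y [Oy h]; split => // z nz.
  by apply: le_trans (h z nz); rewrite lef_pV2 ?posrE// ler_nat.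
have mD m : measurable (depth m).
  by apply: closed_measurable_rV; apply: compact_closed; [exact: norm_hausdorff|exact: compact_depth].
have := @ge0_nondecreasing_set_cvg_integral _ _ R _ (fun y => (g (Theta y))%:E) leb nd.
have -> : \bigcup_m (Omega `&` Theta @^-1` (depth m)) = Omega.
  apply/seteqP; split => [y [m _ [] //]|y Oy].
  have := TO Oy; rewrite -{1}bigcup_depth => -[m _ h]; by exists m.
move=> C; have {}C := C (fun m => mT mO (mD m)) (fun m => measurable_funS mO (@subIsetl _ _ _) (proj2 (measurable_EFinP _ _) mgT)) (fun m x _ => g0 _).
rewrite -(cvg_lim _ C)//; apply: lime_le; first by apply/cvg_ex; eexists; exact: C.
exact: nearW.
Qed.

End volume_preserving.

(** * Non-isometry *)

Section isometry.
Variables (R : realType) (n : nat) (Omega : set 'rV[R]_n).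
Notation leb := (lebesgue_rV R n).
Hypotheses (oO : open Omega) (bO : bounded_set Omega).

Lemma class_C1_at (f : 'rV[R]_n -> R) x : class_C 1 Omega f -> Omega x -> C1_at f x.
Proof.
move=> [h1 h2] Ox i; split; last exact: (h1 [:: i]).
by apply: filterS (open_nbhs_nbhs (conj oO Ox)) => y Oy; exact: (h2 [::]).
Qed.

Lemma boundaryE : boundary Omega = closure Omega `\` Omega.
Proof. by rewrite /boundary; move/interior_id: oO => ->. Qed.

(** A preimage on the boundary would be fixed by Psi, hence would be y itself, which is in Omega. *)
Lemma SDiff_inverse Psi : SDiff Omega Psi -> forall y, Omega y ->
  Omega (inverse_bar Omega Psi y) /\ Psi (inverse_bar Omega Psi y) = y.
Proof.
move=> [[[P1 P2 P3] _ _] _ Pb] y Oy.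
have cy := subset_closure Oy.
have imy : y \in Psi @` closure Omega by rewrite inE; exact: P3.
have PTy : Psi (inverse_bar Omega Psi y) = y by exact: pinvK.
have Ty : closure Omega (inverse_bar Omega Psi y).
  by apply: (surjpinv_image_sub P3); exists y.
split=> //; apply: contrapT => nT.
have := Pb (inverse_bar Omega Psi y); rewrite boundaryE PTy => /(_ (conj Ty nT)) E.
by apply: nT; rewrite -E.
Qed.

Lemma det_push Psi ga y : SDiff Omega Psi -> Omega y ->
  \det (push_conductivity Omega Psi ga y) = \det (ga (inverse_bar Omega Psi y)).
Proof.
move=> SP Oy; have [OT _] := SDiff_inverse SP Oy; have [_ dP _] := SP.
rewrite /push_conductivity dP// invr1 scale1r !det_mulmx det_tr.
by rewrite mulrAC -expr2 -real_normK ?num_real// dP// expr1n mul1r.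
Qed.

Lemma isometric_integral ga1 ga2 (P : R -> R) : isometric Omega ga1 ga2 ->
  (forall x, Omega x -> {for x, continuous (fun x => P (\det (ga1 x)))}) ->
  (forall r, 0 <= P r) ->
  (\int[leb]_(x in Omega) (P (\det (ga1 x)))%:E < +oo)%E ->
  (\int[leb]_(x in Omega) (P (\det (ga2 x)))%:E <=
   \int[leb]_(x in Omega) (P (\det (ga1 x)))%:E)%E.
Proof.
move=> [Psi [SP E]] cP P0 fin.
have [[_ cPsi cTh] dP _] := SP.
have mO := mO oO.
rewrite (eq_integral (fun x => (P (\det (ga1 (inverse_bar Omega Psi x))))%:E)); last first.
  by move=> x /set_mem Ox; rewrite E// det_push.
apply: (@transport_le R n Omega Psi (inverse_bar Omega Psi) (fun x => P (\det (ga1 x)))) => //.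
- by move=> y /(SDiff_inverse SP)[].
- by move=> y /(SDiff_inverse SP)[].
- by move=> x i; apply: class_C1_at; have [] := cPsi i.
- by move=> y i Oy; have [_ [h _] _] := cTh i; exact: (h [::]).
Qed.

End isometry.

(** The segment from A to the identity consists of definite, hence invertible, matrices. The
    determinant along it is a polynomial without zero and equals 1 at the end. *)
Lemma posdef_det_gt0 (R : realType) n (A : 'M[R]_n) : sym_posdef A -> 0 < \det A.
Proof.
move=> [AT Ap].
have pos t : 0 <= t <= 1 -> \det (t%:M + (1 - t) *: A) != 0.
  move=> /andP[t0 t1]; apply/negP => /eqP d0.
  have : (t%:M + (1 - t) *: A) \notin unitmx by rewrite unitmxE d0 unitr0.
  rewrite -row_free_unit -kermx_eq0 => /rowV0Pn[v /sub_kermxP vA v0].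
  have := Ap v v0; have : (v *m (t%:M + (1 - t) *: A) *m v^T) 0 0 = 0 by rewrite vA mul0mx mxE.
  rewrite mulmxDr mulmxDl mxE mul_mx_scalar -scalemxAl -scalemxAr -scalemxAl [X in X + _]mxE [X in _ + X]mxE.
  have vv : 0 < (v *m v^T) 0 0.
    have [i vi] : exists i, v 0 i != 0.
      apply: contrapT => no; move/negP: v0; apply; apply/eqP/rowP => i; rewrite mxE.
      by apply/eqP; apply: contrapT => /negP h; apply: no; exists i.
    rewrite mxE (bigD1 i)//= mxE ltr_wpDr//; last by rewrite -expr2 exprn_even_gt0.
    by apply: sumr_ge0 => j _; rewrite mxE -expr2 sqr_ge0.
  move=> z q; move: z; have [t1'|t1'] := eqVneq t 1.
    by rewrite t1' subrr mul0r addr0 mul1r => z; rewrite z ltxx in vv.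
  have : 0 < (1 - t) * (v *m A *m v^T) 0 0 by rewrite mulr_gt0// subr_gt0 lt_neqAle t1'.
  have : 0 <= t * (v *m v^T) 0 0 by rewrite mulr_ge0// ltW.
  lra.
rewrite lt_neqAle eq_sym; apply/andP; split.
  by have := pos 0; rewrite lexx ler01 subr0 scale1r raddf0 add0r; exact.
rewrite leNgt; apply/negP => An.
pose p : {poly R} := \det ('X%:M + (1 - 'X) *: map_mx polyC A).
have pE t : p.[t] = \det (t%:M + (1 - t) *: A).
  rewrite -horner_evalE -det_map_mx; congr (\det _); apply/matrixP => i j.
  by rewrite !mxE /= /horner_eval !hornerE hornerMn hornerX.
have [||t /andP[t0 t1] /rootP] := @poly_ivt R p 0 1; first exact: ler01.
  by rewrite !pE subr0 subrr scale1r scale0r raddf0 add0r addr0 det1 (ltW An) ler01.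
by rewrite pE => /eqP; apply/negP/pos; rewrite t0 t1.
Qed.

(** Mean value theorem between 1 and w, on either side of 1, with s^(p-1) nondecreasing. *)
Lemma powR_bernoulli (R : realType) (w p : R) : 0 < w -> 1 <= p -> 1 + p * (w - 1) <= w `^ p.
Proof.
move=> w0 p1; have p0 : 0 < p by apply: lt_le_trans p1.
have D (s : R) : 0 < s -> is_derive s 1 (@powR R ^~ p) (p * s `^ (p - 1)) by exact: is_derive1_powR.
have C a b : 0 < a -> {within `[a, b], continuous (@powR R ^~ p)}.
  move=> a0; apply: derivable_within_continuous => s; rewrite in_itv/= => /andP[as_ _].
  by apply: (@ex_derive _ _ _ _ _ _ _ (D s _)); exact: lt_le_trans as_.
have p1' : 0 <= p - 1 by rewrite subr_ge0.
have p1q : 1 `^ (p - 1) = 1 :> R by rewrite powR1.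
have ge1 c : 1 <= c -> 1 <= c `^ (p - 1) by move=> c1; rewrite -[leLHS]p1q ge0_ler_powR ?nnegrE// (le_trans _ c1).
have le1 c : 0 <= c -> c <= 1 -> c `^ (p - 1) <= 1 by move=> c0 c1; rewrite -[leRHS]p1q ge0_ler_powR ?nnegrE.
have [w1|w1|->] := ltgtP w 1; last by rewrite subrr mulr0 addr0 powR1.
  have D1 (s : R) : s \in `]w, 1[ -> is_derive s 1 (@powR R ^~ p) (p * s `^ (p - 1)).
    by rewrite in_itv/= => /andP[ws _]; apply: D; exact: lt_trans ws.
  have [c] := @MVT R (@powR R ^~ p) (fun s => p * s `^ (p - 1)) w 1 w1 D1 (C w 1 w0).
  rewrite in_itv/= powR1 => /andP[c1 c2] E.
  have : p * c `^ (p - 1) * (1 - w) <= p * (1 - w).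
    by rewrite ler_wpM2r ?subr_ge0 ?(ltW w1)// ler_piMr ?(ltW p0)// le1// ?(ltW c2)// ltW// (lt_trans w0).
  rewrite -E; lra.
have D1 (s : R) : s \in `]1, w[ -> is_derive s 1 (@powR R ^~ p) (p * s `^ (p - 1)).
  by rewrite in_itv/= => /andP[ws _]; apply: D; exact: lt_trans ws.
have [c] := @MVT R (@powR R ^~ p) (fun s => p * s `^ (p - 1)) 1 w w1 D1 (C 1 w ltr01).
rewrite in_itv/= powR1 => /andP[c1 c2] E.
have : p * (w - 1) <= p * c `^ (p - 1) * (w - 1).
  by rewrite ler_wpM2r ?subr_ge0 ?(ltW w1)// ler_peMr ?(ltW p0)// ge1// ltW.
rewrite -E; lra.
Qed.

(** * Plateau functions *)

Section blob.
Variables (R : realType) (n : nat).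
Notation leb := (lebesgue_rV R n).
Implicit Types (p x : 'rV[R]_n) (r : R).

(** Balls are cubes here, so a product over the coordinates works. The two factors are [step] at 2
    (1 + (x_i - p_i)/r) and at 2 (1 - (x_i - p_i)/r): both are 1 for |x_i - p_i| <= r/2, and one is
    0 for |x_i - p_i| >= r. *)
Definition blob p r x : R :=
  \prod_i (step (2 / r * x 0 i + (2 - 2 / r * p 0 i)) * step (- (2 / r) * x 0 i + (2 + 2 / r * p 0 i))).

Lemma blob_ge0 p r x : 0 <= blob p r x.
Proof. by apply: prodr_ge0 => i _; rewrite mulr_ge0// step_ge0. Qed.

Lemma blob_sm p r : sm setT (blob p r).
Proof.
apply: smf_sm; apply: smf_prod => [||i]; [exact: openT|exact: openT|].
by apply: smfM; [exact: openT|exact: openT|apply: smf_step; exact: openT|apply: smf_step; exact: openT].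
Qed.

Lemma blob_off p r x : 0 < r -> ~ ball p r x -> blob p r x = 0.
Proof.
move=> r0 nb; have [i hi] : exists i, r <= `|p 0 i - x 0 i|.
  apply: contrapT => no; apply: nb; apply/rV_ballP; split => // i.
  by rewrite ltNge; apply/negP => h; apply: no; exists i.
rewrite /blob (bigD1 i)//= (_ : step _ * step _ = 0) ?mul0r//.
have k : 2 = 2 / r * r by rewrite divfK// gt_eqF.
have r2 : 0 < 2 / r by rewrite divr_gt0.
move: hi; rewrite ler_normr => /orP[h|h].
  rewrite step_eq0 ?mul0r//; have : 2 / r * (x 0 i - p 0 i + r) <= 0 by rewrite pmulr_rle0//; lra.
  by rewrite mulrDr mulrBr -k; lra.
rewrite [X in _ * X]step_eq0 ?mulr0//; have : 2 / r * (p 0 i - x 0 i + r) <= 0 by rewrite pmulr_rle0//; lra.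
by rewrite mulrDr mulrBr -k mulNr; lra.
Qed.

Lemma blob_one p r x : 0 < r -> ball p (r / 2) x -> blob p r x = 1.
Proof.
move=> r0 /rV_ballP[_ hx]; rewrite /blob big1// => i _.
have k : 1 = 2 / r * (r / 2) by field; rewrite gt_eqF.
have r2 : 0 < 2 / r by rewrite divr_gt0.
have := hx i; rewrite ltr_norml => /andP[/ltW h1 /ltW h2].
have : 2 / r * (p 0 i - x 0 i) <= 1 by rewrite [leRHS]k ler_wpM2l// ltW.
have : 2 / r * (x 0 i - p 0 i) <= 1 by rewrite [leRHS]k; apply: ler_wpM2l; [exact: ltW|lra].
by rewrite !mulrBr => a1 a2; rewrite !step_eq1 ?mulr1// ?mulNr; lra.
Qed.

Lemma blob_integral p r : 0 < r -> (0 < \int[leb]_x (blob p r x)%:E)%E.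
Proof.
move=> r0; apply: (@integral_pos R n _ p).
- by apply: continuousT_measurable_rV => x; exact: (sm_continuous (blob_sm p r)).
- exact: (sm_continuous (blob_sm p r)).
- by move=> x; exact: blob_ge0.
- by rewrite blob_one ?ltr01//; apply: ballxx; rewrite divr_gt0.
Qed.

End blob.

Lemma smB (R : realType) n (U : set 'rV[R]_n) f g : open U -> sm U f -> sm U g -> sm U (fun x => f x - g x).
Proof. by move=> oU /sm_smf hf /sm_smf hg; apply: smf_sm; apply: smfB => //; exact: openT. Qed.

(** * Choice of the perturbation *)

Section nonisometric.
Variables (R : realType) (n : nat) (Omega : set 'rV[R]_n).
Notation leb := (lebesgue_rV R n).
Variables (lambda : R) (ga : 'rV[R]_n -> 'M[R]_n).
Hypotheses (oO : open Omega) (bO : bounded_set Omega).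
Hypotheses (n3 : (3 <= n)%N) (l0 : lambda != 0).
Hypothesis sga : forall i j, smooth_bar Omega (fun x => ga x i j).
Hypothesis pga : forall x, closure Omega x -> sym_posdef (ga x).

Let mO : measurable Omega. Proof. exact: mO. Qed.

Lemma bounded_intg (f : 'rV[R]_n -> R) (M : R) : measurable_fun Omega f -> (forall x, Omega x -> `|f x| <= M) -> intg Omega f.
Proof.
move=> mf fM.
have L1 : L2 leb Omega (fun=> 1 : R) by apply: (bounded_L2 oO bO (M := 1)) => // x _; rewrite normr1.
have := intg_mul oO (bounded_L2 oO bO mf fM) L1.
by rewrite /intg; under eq_fun do rewrite mulr1.
Qed.

Lemma intgZ (f : 'rV[R]_n -> R) (r : R) : intg Omega f -> intg Omega (fun x => r * f x).
Proof. by move=> h; have := integrableZl mO r h. Qed.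

Lemma intgD (f g : 'rV[R]_n -> R) : intg Omega f -> intg Omega g -> intg Omega (fun x => f x + g x).
Proof. by move=> hf hg; have := integrableD mO hf hg. Qed.

Lemma sm_det_ga : sm Omega (fun x => \det (ga x)).
Proof.
apply: smf_sm; apply: (@smf_det R R n setT Omega (fun _ => ga) (@openT _) oO) => i k.
by apply: sm_smf; exact: smooth_bar_sm.
Qed.

Lemma det_ga_gt0 x : Omega x -> 0 < \det (ga x).
Proof. by move=> /subset_closure/pga/posdef_det_gt0. Qed.

Lemma det_ga_bounded : exists2 M, 0 <= M & forall x, Omega x -> `|\det (ga x)| <= M.
Proof.
have /choice[B hB] (ij : 'I_n * 'I_n) : exists B : R, 0 <= B /\ forall x, Omega x -> `|ga x ij.1 ij.2| <= B.
  by have [M M0 hM] := smooth_bar_bounded bO [::] (sga ij.1 ij.2); exists M.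
exists (\sum_(s : 'S_n) \prod_i B (i, s i)).
  by apply: sumr_ge0 => s _; apply: prodr_ge0 => i _; have [] := hB (i, s i).
move=> x Ox; rewrite /determinant (le_trans (ler_norm_sum _ _ _))//.
apply: ler_sum => s _; rewrite normrM normrX normrN1 expr1n mul1r normr_prod.
by apply: ler_prod => i _; rewrite normr_ge0/=; have [_] := hB (i, s i); exact.
Qed.

Let al : R := (n - 2)%:R^-1.
Let n2 : (0 < n - 2)%N. Proof. by rewrite subn_gt0. Qed.
Let al0 : 0 < al. Proof. by rewrite invr_gt0 ltr0n. Qed.
Let G x := \det (ga x) `^ al.

Lemma continuous_detpow x : Omega x -> {for x, continuous G}.
Proof.
move=> Ox; apply: (@continuous_comp _ _ _ (fun x => \det (ga x)) (fun r => r `^ al)).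
  exact: (sm_continuous sm_det_ga).
apply: differentiable_continuous; apply/derivable1_diffP.
by apply: (@ex_derive _ _ _ _ _ _ _ (is_derive1_powR al _)); exact: det_ga_gt0.
Qed.

Let mG : measurable_fun Omega G.
Proof. by apply: continuous_measurable_rV => // x; exact: continuous_detpow. Qed.

Let bG : exists M : R, forall x, Omega x -> `|G x| <= M.
Proof.
have [M M0 hM] := det_ga_bounded; exists (M `^ al) => x Ox.
rewrite ger0_norm ?powR_ge0// ge0_ler_powR ?nnegrE ?(ltW al0)//; first exact/ltW/det_ga_gt0.
exact: le_trans (ler_norm _) (hM x Ox).
Qed.

Let iG : intg Omega G. Proof. by have [M hM] := bG; exact: bounded_intg hM. Qed.

(** The exponent 1/(n-2) turns r^(n-2) into r, so the density cancels and only w and A remain. *)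
Lemma iota_detpow (A : 'M[R]_n) (w r : R) : 0 < w -> 0 < r -> 0 < \det A ->
  iota (w ^+ 2 *: A) r `^ al * r = w `^ ((2 * n)%:R * al) * \det A `^ al.
Proof.
move=> w0 r0 A0; rewrite /iota detZ -exprM.
have rn : 0 <= r ^- (n - 2) by rewrite invr_ge0 exprn_ge0// ltW.
have wn : 0 <= w ^+ (2 * n) by rewrite exprn_ge0// ltW.
rewrite powRM// ?mulr_ge0 ?(ltW A0)// powRM ?(ltW A0)//.
have -> : (w ^+ (2 * n)) `^ al = w `^ ((2 * n)%:R * al) by rewrite powRrM powR_mulrn// ltW.
have -> : (r ^- (n - 2)) `^ al = r^-1.
  have -> : r ^- (n - 2) = r^-1 `^ (n - 2)%:R by rewrite powR_mulrn ?invr_ge0 ?ltW// exprVn.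
  by rewrite -powRrM /al divff ?pnatr_eq0 -?lt0n// powRr1 ?invr_ge0 ?ltW.
by rewrite mulfVK// gt_eqF.
Qed.

Definition admissible k eps g2 := [/\ conductivity_C Omega k g2,
  (C_norm Omega k (fun x => (g2 x - ga x)%R) <= eps%:E)%E,
  gauge Omega lambda ga (fun=> 1) g2 (fun=> 1) & ~ isometric Omega ga g2].

Section boxed.
Variables (a b : 'I_n -> R) (be c : 'rV[R]_n -> R).
Hypothesis ab : forall i, a i < b i.
Hypothesis KO : cbox a b `<=` Omega.
Hypotheses (sbe : sm setT be) (sc : sm setT c).
Hypothesis be0 : forall x, ~ cbox a b x -> be x = 0.
Hypothesis c0 : forall x, ~ cbox a b x -> c x = 0.
Hypothesis ibe : \int[leb]_(x in Omega) be x = 0.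
Hypothesis ic : \int[leb]_(x in Omega) c x = 1.

(* By Bernoulli's inequality the integral of det^(1/(n-2)), an invariant of
   volume-preserving diffeomorphisms, increases. *)
Lemma deform_increasing k eps : 0 < eps -> 0 < \int[leb]_(x in Omega) (be x * G x) ->
  exists g2, admissible k eps g2.
Proof.
move=> eps0 I0.
set I := \int[leb]_(x in Omega) (be x * G x) in I0.
pose C := \int[leb]_(x in Omega) (c x * G x).
(* With |mu| below this bound, |mu C| < I, so the correction by c cannot cancel the gain I. *)
have del0 : 0 < I / (`|C| + 1) by rewrite divr_gt0// ltr_wpDl.
have [tau [mu [g2 [[t0 hmu w0] [h1 h2 h3] hh _ hF]]]] :=
  deform ab oO bO KO (ltnW n3) l0 sga pga sbe sc be0 c0 ibe ic k eps0 del0.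
exists g2; split => // iso.
pose w := wfun be c (tau, mu); pose p := (2 * n)%:R * al.
have w1 x : 0 < w x by apply: lt_le_trans (w0 x); rewrite invr_gt0.
have p1 : 1 <= p.
  rewrite /p /al ler_pdivlMr ?ltr0n// mul1r ler_nat; apply: (leq_trans (leq_subr _ _)); exact: leq_pmull.
have P0 (r : R) : 0 <= r `^ al by exact: powR_ge0.
have fin : (\int[leb]_(x in Omega) (G x)%:E < +oo)%E.
  by have := integrable_fin_num mO iG; rewrite fin_num_abs; apply: le_lt_trans; exact: lee_abs.
have := isometric_integral oO bO iso continuous_detpow P0 fin.
rewrite (hF (fun r => r `^ al) (@measurable_powR R al) P0).
rewrite (eq_integral (fun x => (w x `^ p * G x)%:E)); last first.
  move=> x /set_mem Ox; congr (_%:E); rewrite iota_detpow//; last exact: det_ga_gt0.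
  by apply: lt_le_trans (hh x); rewrite invr_gt0.
move=> le.
have swx : sm setT w.
  exact: (smf_slice (smf_wfun sbe sc setT) (Logic.I : setT (tau, mu))).
have mw : measurable_fun Omega w by apply: (sm_measurable oO); exact: (sm_sub (fun _ _ => Logic.I) swx).
(* Finiteness comes from [le], the inequality about to be contradicted. *)
have iw : intg Omega (fun x => w x `^ p * G x).
  apply/integrableP; split.
    apply/measurable_EFinP; apply: measurable_funM => //.
    exact: (measurableT_comp (@measurable_powR R p) mw).
  under eq_integral => x _ do rewrite /= ger0_norm ?mulr_ge0 ?powR_ge0//.
  exact: le_lt_trans le fin.
have ib : intg Omega (fun x => be x * G x).
  have [M hM] := bG; have [B B0 hB] := sm_bounded bO sbe.
  apply: (@bounded_intg _ (B * M)) => [|x Ox].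
    by apply: measurable_funM => //; apply: (sm_measurable oO); exact: (sm_sub (fun _ _ => Logic.I) sbe).
  by rewrite normrM ler_pM// ?hB ?hM.
have icG : intg Omega (fun x => c x * G x).
  have [M hM] := bG; have [B B0 hB] := sm_bounded bO sc.
  apply: (@bounded_intg _ (B * M)) => [|x Ox].
    by apply: measurable_funM => //; apply: (sm_measurable oO); exact: (sm_sub (fun _ _ => Logic.I) sc).
  by rewrite normrM ler_pM// ?hB ?hM.
have le1 : \int[leb]_(x in Omega) (w x `^ p * G x) <= \int[leb]_(x in Omega) G x.
  apply: fine_le le; exact: integrable_fin_num.
have i3 : intg Omega (fun x => (p * tau) * (be x * G x)) by exact: intgZ.
have i4 : intg Omega (fun x => (p * tau * mu) * (c x * G x)) by exact: intgZ.
have i5 : intg Omega (fun x => G x + (p * tau) * (be x * G x)) by exact: intgD.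
have i6 : intg Omega (fun x => G x + (p * tau) * (be x * G x) + (p * tau * mu) * (c x * G x)) by exact: intgD.
(* Bernoulli's inequality bounds w^p from below by 1 + p tau (be + mu c). *)
have : \int[leb]_(x in Omega) (G x + (p * tau) * (be x * G x) + (p * tau * mu) * (c x * G x)) <=
    \int[leb]_(x in Omega) (w x `^ p * G x).
  apply: le_Rintegral => // x Ox.
  apply: (@le_trans _ _ ((1 + p * (w x - 1)) * G x)); last by rewrite ler_wpM2r ?powR_ge0// powR_bernoulli.
  rewrite le_eqVlt; apply/orP; left; apply/eqP; rewrite /w /wfun /bump_dir /=.
  by move: (G x) (be x) (c x) => u v z; ring.
rewrite (RintegralD mO i5 i4) (RintegralD mO iG i3) (RintegralZl _ mO ib) (RintegralZl _ mO icG) -/I -/C.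
move=> /le_trans/(_ le1).
suff : 0 < p * tau * (I + mu * C) by lra.
rewrite mulr_gt0//; first by rewrite mulr_gt0// (lt_le_trans ltr01).
have : `|mu * C| <= `|mu| * (`|C| + 1) by rewrite normrM ler_wpM2l// lerDl.
have C1 : 0 < `|C| + 1 by rewrite ltr_wpDl.
move: hmu; rewrite ltr_pdivlMr// => h5 h6.
have := le_lt_trans h6 h5; rewrite ltr_norml => /andP[]; lra.
Qed.

(** An isometry would make det g2 equal to the constant f0 throughout Omega, but by [c_range] it
    takes the value of the invariant on the plateau U, where w is a constant w1 > 1. *)
Lemma deform_plateau k eps (f0 kappa : R) (U : set 'rV[R]_n) u : 0 < eps -> 0 < kappa ->
  (forall x, Omega x -> \det (ga x) = f0) -> open U -> U `<=` Omega -> U u ->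
  (forall y, U y -> be y = kappa /\ c y = 0) -> exists g2, admissible k eps g2.
Proof.
move=> eps0 k0 fE oU UO Uu Uf.
have [tau [mu [g2 [[t0 hmu w0] [h1 h2 h3] hh rg _]]]] :=
  deform ab oO bO KO (ltnW n3) l0 sga pga sbe sc be0 c0 ibe ic k eps0 ltr01.
exists g2; split => // -[Psi [SP E]].
pose w1 := 1 + tau * kappa.
have w1p : 1 < w1 by rewrite ltrDl mulr_gt0.
have wE y : U y -> wfun be c (tau, mu) y = w1.
  by move=> /Uf[b1 b2]; rewrite /wfun /bump_dir /= b1 b2 mulr0 addr0.
have Ou := UO _ Uu.
have [x Ox] := rg u Ou.
rewrite E// det_push// (fE (inverse_bar Omega Psi x)); last by have [] := SDiff_inverse oO SP Ox.
(* On U the density is w1^2, so the invariant is w1^(2n) f0 / w1^(2(n-2)) = w1^4 f0. *)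
rewrite (hfun_flat lambda ga oU Uu wE) wE// subrKC /iota detZ fE//.
have f0p : 0 < f0 by rewrite -(fE u Ou); exact: det_ga_gt0.
have w2 : w1 ^+ 2 != 0 by rewrite expf_neq0// gt_eqF// (lt_trans ltr01).
have -> : (w1 ^+ 2) ^+ n * f0 / (w1 ^+ 2) ^+ (n - 2) = (w1 ^+ 2) ^+ 2 * f0.
  have nE : n = ((n - 2) + 2)%N by rewrite subnK// ltnW.
  rewrite {1}nE exprD; move: (expf_neq0 (n - 2) w2).
  by move: ((w1 ^+ 2) ^+ (n - 2)) => A A0; field.
move=> /eqP; rewrite -[eqbLHS]mul1r; apply/negP.
rewrite (inj_eq (mulIf (lt0r_neq0 f0p))) -exprM lt_eqF// exprn_egt1//.
Qed.

End boxed.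

Lemma unit_bump (a b : 'I_n -> R) p r : cbox a b `<=` Omega -> 0 < r -> ball p r `<=` cbox a b ->
  exists (f : 'rV[R]_n -> R) (kappa : R), [/\ 0 < kappa, sm setT f,
    forall x, 0 <= f x, forall x, ~ ball p r x -> f x = 0 &
    [/\ forall x, ball p (r / 2) x -> f x = kappa, intg Omega f & \int[leb]_(y in Omega) f y = 1]].
Proof.
move=> KO r0 bK.
have off x : ~ cbox a b x -> blob p r x = 0 by move=> nx; apply: blob_off => // /bK.
have sb := blob_sm p r.
have i1 : intg Omega (blob p r) by apply: (suppO_intg oO KO) => //; exact: (sm_sub (fun _ _ => Logic.I) sb).
have [J J0 JE] : exists2 J, 0 < J & \int[leb]_(y in Omega) blob p r y = J.
  eexists; last by [].
  by rewrite -lte_fin -(suppO_integral oO KO sb off); exact: blob_integral.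
exists (fun x => J^-1 * blob p r x), J^-1; split.
- by rewrite invr_gt0.
- by apply: (smM (@openT _) _ sb); apply: smf_sm; exact: smf_const.
- by move=> x; rewrite mulr_ge0 ?blob_ge0// invr_ge0 ltW.
- by move=> x nx; rewrite blob_off// mulr0.
- split; [by move=> x xb; rewrite blob_one// mulr1|exact: intgZ|].
  by rewrite (RintegralZl _ mO i1) JE mulVf// gt_eqF.
Qed.

(** Both the level set of f through x and its complement in Omega are open. *)
Lemma locally_constant (f : 'rV[R]_n -> R) : connected Omega ->
  (forall x, Omega x -> \forall y \near x, f y = f x) ->
  forall x y, Omega x -> Omega y -> f x = f y.
Proof.
move=> cO lc x y Ox Oy.
pose A c := [set z | Omega z /\ f z = c]; pose B c := [set z | Omega z /\ f z != c].
have oA c : open (A c).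
  rewrite openE => z [Oz fz]; apply: filterS2 (open_nbhs_nbhs (conj oO Oz)) (lc z Oz).
  by move=> v Ov fv; split => //; rewrite fv.
have oB c : open (B c).
  rewrite openE => z [Oz fz]; apply: filterS2 (open_nbhs_nbhs (conj oO Oz)) (lc z Oz).
  by move=> v Ov fv; split => //; rewrite fv.
suff : A (f x) = Omega by move=> AO; have : A (f x) y by [rewrite AO]; case.
apply: cO; first by exists x.
- exists (A (f x)) => //; apply/seteqP; split => z; [by move=> h; split => //; case: h|by case].
- exists (~` B (f x)); first exact: open_closedC.
  apply/seteqP; split => z; first by move=> [Oz fz]; split => //= -[_]; rewrite fz eqxx.
  by move=> [Oz nB]; split => //; apply/eqP; apply: contrapT => /negP h; exact: nB.
Qed.

Lemma exists_admissible k eps : Omega !=set0 -> connected Omega -> 0 < eps ->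
  exists g2, admissible k eps g2.
Proof.
move=> [p0 Op0] cO eps0.
have n0 : (0 < n)%N by exact: leq_trans n3.
have boxat p : Omega p -> exists r, 0 < r /\ cbox (fun i => p 0 i - r) (fun i => p 0 i + r) `<=` Omega.
  move=> Op; have /nbhs_ballP[d /= d0 hd] := open_nbhs_nbhs (conj oO Op).
  exists (d / 2); split; first by rewrite divr_gt0.
  move=> x hx; apply: hd; apply/rV_ballP; split => // i.
  have := hx i; rewrite distrC => h; apply: (@le_lt_trans _ _ (d / 2)); last by lra.
  by rewrite ler_norml; lra.
have abr (p : 'rV[R]_n) r : 0 < r -> forall i, p 0 i - r < p 0 i + r by move=> r0 i; lra.
have [lc|/existsNP[p /not_implyP[Op nlc]]] := pselect (forall x, Omega x -> \forall y \near x, \det (ga y) = \det (ga x)).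
  have fE x : Omega x -> \det (ga x) = \det (ga p0) by move=> Ox; exact: (locally_constant cO lc).
  have [r [r0 KO]] := boxat _ Op0.
  pose s := r / 2; have s0 : 0 < s by rewrite divr_gt0.
  have s2 : s / 2 <= s by lra.
  pose u : 'rV[R]_n := \row_i (p0 0 i + s); pose v : 'rV[R]_n := \row_i (p0 0 i - s).
  have uK : ball u s `<=` cbox (fun i => p0 0 i - r) (fun i => p0 0 i + r).
    by move=> x /rV_ballP[_ h] i; have := h i; rewrite /u mxE ltr_norml /s => /andP[]; lra.
  have vK : ball v s `<=` cbox (fun i => p0 0 i - r) (fun i => p0 0 i + r).
    by move=> x /rV_ballP[_ h] i; have := h i; rewrite /v mxE ltr_norml /s => /andP[]; lra.
  have disj x : ball u s x -> ~ ball v s x.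
    move=> /rV_ballP[_ /(_ (Ordinal n0)) +] /rV_ballP[_ /(_ (Ordinal n0))].
    by rewrite /u /v !mxE !ltr_norml /s => /andP[? ?] /andP[? ?]; lra.
  have [fu [ku [ku0 su u1 u2 [uk iu u3]]]] := unit_bump KO s0 uK.
  have [fv [kv [kv0 sv v1 v2 [vk iv v3]]]] := unit_bump KO s0 vK.
  have Bu : ball u (s / 2) `<=` ball u s by exact: le_ball s2.
  (* Subtracting [fv] makes the integral 0, and [c] is again [fv]: both corrections live in the ball
     around v, off the plateau of [fu]. *)
  apply: (@deform_plateau _ _ (fun x => fu x - fv x) (fv)
    (abr p0 r r0) KO _ sv _ _ _ v3 k eps (\det (ga p0)) ku (ball u (s / 2)) u eps0 _ fE).
  - exact: (smB (@openT _) su sv).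
  - by move=> x nK; rewrite u2 ?v2 ?subr0// => [/vK|/uK].
  - by move=> x nK; rewrite v2// => /vK.
  - by rewrite (RintegralB mO iu iv) u3 v3 subrr.
  - exact: ku0.
  - exact: ball_open.
  - by move=> x /Bu/uK/KO.
  - by apply: ballxx; rewrite divr_gt0.
  - move=> y yb; rewrite v2; last by apply: disj; exact: Bu.
    by rewrite subr0 uk.
have [r [r0 KO]] := boxat _ Op.
have cd x : Omega x -> {for x, continuous G} by exact: continuous_detpow.
have bK : ball p r `<=` cbox (fun i => p 0 i - r) (fun i => p 0 i + r).
  by move=> x /rV_ballP[_ h] i; have := h i; rewrite ltr_norml => /andP[]; lra.
have [u [v [bu bv Guv]]] : exists u v, [/\ ball p r u, ball p r v & G u < G v].
  have [q [bq Gq]] : exists q, ball p r q /\ \det (ga q) <> \det (ga p).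
    apply: contrapT => no; apply: nlc.
    apply: filterS (nbhsx_ballx p r r0) => y yb; apply: contrapT => h; apply: no; by exists y.
  have Gneq : G q != G p.
    apply/eqP => E; apply: Gq.
    have Oq : Omega q by exact: KO (bK _ bq).
    have inj z : Omega z -> \det (ga z) = G z `^ al^-1.
      by move=> Oz; rewrite /G -powRrM divff ?gt_eqF// powRr1//; exact/ltW/det_ga_gt0.
    by rewrite (inj q Oq) (inj p Op) E.
  have bp : ball p r p by exact: ballxx.
  have [h|h|h] := ltgtP (G q) (G p); [by exists q, p|by exists p, q|by rewrite h eqxx in Gneq].
(* A third of the gap: the average of G against [fu] is at most G(u) + e, that against [fv] at least
   G(v) - e, and these differ by e. *)
pose e := (G v - G u) / 3; have e0 : 0 < e by rewrite divr_gt0// subr_gt0.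
have lr1 (s t : R) : `|s - t| < e -> t <= s + e by rewrite ltr_norml => /andP[]; lra.
have lr2 (s t : R) : `|s - t| < e -> s - e <= t by rewrite ltr_norml => /andP[]; lra.
have lr3 (s t : R) : s <= G u + e -> G v - e <= t -> 0 < t - s.
  by have : e * 3 = G v - G u by [rewrite divfK]; lra.
have near z : ball p r z -> exists s, [/\ 0 < s, ball z s `<=` ball p r & forall x, ball z s x -> `|G z - G x| < e].
  move=> bz; have Oz : Omega z by exact: KO (bK _ bz).
  have oB : open (ball p r) by exact: ball_open.
  have /cvgrPdist_lt/(_ _ e0)/nbhs_ballP[d1 /= d10 hd1] := cd z Oz.
  have /nbhs_ballP[d2 /= d20 hd2] := open_nbhs_nbhs (conj oB bz).
  exists (Num.min d1 d2); split; first by rewrite lt_min d10.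
  - by apply: subset_trans hd2; apply: le_ball; rewrite ge_min lexx orbT.
  - by move=> x xb; apply: hd1; apply: le_ball xb; rewrite ge_min lexx.
have [su [su0 subu Gu]] := near u bu.
have [sv [sv0 subv Gv]] := near v bv.
have uK : ball u su `<=` cbox (fun i => p 0 i - r) (fun i => p 0 i + r) := subset_trans subu bK.
have vK : ball v sv `<=` cbox (fun i => p 0 i - r) (fun i => p 0 i + r) := subset_trans subv bK.
have [fu [ku [ku0 smu u1 u2 [_ iu u3]]]] := unit_bump KO su0 uK.
have [fv [kv [kv0 smv v1 v2 [_ iv v3]]]] := unit_bump KO sv0 vK.
have [M hM] := bG.
have mul f : sm setT f -> intg Omega (fun x => f x * G x).
  move=> sf; have [B B0 hB] := sm_bounded bO sf.
  apply: (@bounded_intg _ (B * M)) => [|x Ox].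
    by apply: measurable_funM => //; apply: (sm_measurable oO); exact: (sm_sub (fun _ _ => Logic.I) sf).
  by rewrite normrM ler_pM// ?hB ?hM.
have le1 : \int[leb]_(x in Omega) (fu x * G x) <= G u + e.
  rewrite -[leRHS]mulr1 -u3 -(RintegralZl _ mO iu); apply: le_Rintegral => //; [exact: mul|exact: intgZ|].
  move=> x Ox; rewrite mulrC; have [xb|/u2 ->] := pselect (ball u su x); last by rewrite !mulr0.
  by rewrite ler_wpM2r// lr1// Gu.
have le2 : G v - e <= \int[leb]_(x in Omega) (fv x * G x).
  rewrite -[leLHS]mulr1 -v3 -(RintegralZl _ mO iv); apply: le_Rintegral => //; [exact: intgZ|exact: mul|].
  move=> x Ox; rewrite [leRHS]mulrC; have [xb|/v2 ->] := pselect (ball v sv x); last by rewrite !mulr0.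
  by rewrite ler_wpM2r// lr2// Gv.
(* The perturbation moves mass from the ball where G is small to the one where it is large, so its
   integral against G is positive. *)
apply: (@deform_increasing _ _ (fun x => fv x - fu x) (fv)
    (abr p r r0) KO _ smv _ _ _ v3 k eps eps0).
- exact: (smB (@openT _) smv smu).
- by move=> x nK; rewrite u2 ?v2 ?subr0// => [/vK|/uK].
- by move=> x nK; rewrite v2// => /vK.
- by rewrite (RintegralB mO iv iu) u3 v3 subrr.
- rewrite (_ : (fun x => _ * _) = (fun x => fv x * G x - fu x * G x)); last first.
    by apply/funext => x; rewrite mulrBl.
  by rewrite (RintegralB mO (mul _ smv) (mul _ smu)); exact: lr3 le1 le2.
Qed.

End nonisometric.

Theorem theorem2p2 (R : realType) (n : nat) (Omega : set 'rV[R]_n)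
    (gamma : 'rV[R]_n -> 'M[R]_n) (lambda0 : R) :
  (3 <= n)%N ->
  smooth_bounded_domain Omega ->
  conductivity_smooth Omega gamma ->
  lambda0 != 0 ->
  ~ dirichlet_spectrum Omega gamma lambda0 ->
  forall (k : nat) (eps : R), (1 <= k)%N -> 0 < eps ->
  exists gamma1 gamma2 : 'rV[R]_n -> 'M[R]_n,
    [/\ conductivity_C Omega k gamma1 /\ conductivity_C Omega k gamma2,
        ~ isometric Omega gamma1 gamma2,
        (C_norm Omega k (fun x => gamma1 x - gamma x)%R <= eps%:E)%E /\
        (C_norm Omega k (fun x => gamma2 x - gamma x)%R <= eps%:E)%E,
        ~ dirichlet_spectrum Omega gamma1 lambda0 /\
        ~ dirichlet_spectrum Omega gamma2 lambda0 &
        eq_DN_map Omega gamma1 gamma2 lambda0].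
Proof.
move=> n3 [ne oO cO bO _] [[pga mga bga] sga] l0 res k eps _ eps0.
have [g2 [cg2 ng2 gg iso]] := exists_admissible oO bO n3 l0 sga pga k ne cO eps0.
exists gamma, g2; split => //.
- by split => //; split => // i j; exact: sga.
- split => //; apply: ge_ereal_sup => _ [s [i [j [x [_ _ ->]]]]].
  under eq_fun do rewrite mxE mxE subrr.
  by rewrite iter_pderiv0 normr0 lee_fin ltW.
- split => // sp; apply: sp; apply: (gauge_resolvent oO gg).
  by apply: contrapT.
- by move=> f g _ _; exact: gauge_DN.
Qed.
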